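(* Let $\Omega$, $H$, $\Sigma_R^\pm$, $\Gamma_D,\Gamma_N,\Gamma_M$, $\nu$, $\mathbb{H}$ and $a$ be as described in the context. Suppose that the boundary conditions imposed contain at least one of the following two groups of relations: (i) $u=0$ on $\Sigma_R^+\cup\Sigma_R^-$ (for all $u\in\mathbb{H}$, in the sense of traces); (ii) $u=\partial_n u=0$ on $\Sigma_R^+$, or $u=\partial_n u=0$ on $\Sigma_R^-$ (for all $u\in\mathbb{H}$, in the sense of traces). Then the spectrum of the Kirchhoff plate problem $\Delta^2u=\lambda u$ in $\Omega$ with these boundary conditions is discrete.
   Context: Write $x=(x_1,x_2)=(y,z)\in\mathbb{R}^2$. Let $R\in\mathbb{R}$ and let $H:[R,\infty)\to(0,\infty)$ be smooth and monotone decreasing, with $H(y)\to0$ and $H'(y)\to 0$ as $y\to+\infty$ and $H''$ bounded. For $\rho\ge R$ put $\Pi_\rho=\{(y,z): y>\rho,\ -H(y)<z<H(y)\}$ and $\Sigma_\rho^\pm=\{(y,z): y>\rho,\ z=\pm H(y)\}$. Let $\Omega\subset\mathbb{R}^2$ be a domain with $C^\infty$ boundary $\Gamma=\partial\Omega$ such that $\Omega\cap\{x_1>R\}=\Pi_R$ and $\Omega\setminus\{x_1>R\}$ is bounded. Let $\Gamma_D,\Gamma_N,\Gamma_M\subset\Gamma$ be pairwise disjoint unions of finite families of open curves with $\Gamma=\overline{\Gamma_D}\cup\overline{\Gamma_N}\cup\overline{\Gamma_M}$ (some of them may be empty), and let $\nu\in[0,1/2)$. With $\partial_n,\partial_s$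 the normal and tangential derivatives and $\varkappa$ the signed curvature of $\Gamma$ (positive on convex parts), the boundary conditions are: - on $\Gamma_D$ (clamped): $u=\partial_nu=0$; - on $\Gamma_N$ (traction-free): $\partial_n\Delta u-(1-\nu)(\partial_s\varkappa\partial_su-\partial_s^2\partial_nu)=0$ and $\Delta u-(1-\nu)(\partial_s^2u+\varkappa\partial_nu)=0$; - on $\Gamma_M$ (hinged): $u=0$ and $\Delta u-(1-\nu)\varkappa\partial_nu=0$. The problem is understood in variational form: $a(u,v)=\lambda(u,v)_{L_2(\Omega)}$ for all $v\in\mathbb{H}$, where $\mathbb{H}$ is the subspace of all $u\in H^2(\Omega)$ with $u=\partial_nu=0$ on $\Gamma_D$ and $u=0$ on $\Gamma_M$ in the sense of traces, and $a$ is the symmetric bilinear form with $$a(u,u)=\int_\Omega\Big(|\partial_{x_1}^2u|^2+|\partial_{x_2}^2u|^2+2(1-\nu)|\partial_{x_1}\partial_{x_2}u|^2+2\nu\,\partial_{x_1}^2u\,\partial_{x_2}^2u\Big)dx .$$ The conditions on $\Gamma_N$ and the second condition on $\Gamma_M$ are the natural boundary conditions of this formulation. The spectrum of the problem is the spectrum of the nonnegative self-adjoint operator $A$ in $L_2(\Omega)$ associated with (the closure of) the form $a$ with form domain $\mathbb{H}$. It is discrete if it consists only of isolated eigenvalues of finite multiplicity (with no finite accumulation point); equivalently, the embedding of the form domain, with norm $(a(u,u)+\|u\|_{L_2(\Omega)}^2)^{1/2}$, into $L_2(\Omega)$ is compact. *)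

(* Defs.v *)
From HB Require Import structures.
From mathcomp Require Import all_boot all_order all_algebra.
From mathcomp Require Import all_classical all_reals all_analysis.

Set Implicit Arguments.
Unset Strict Implicit.
Unset Printing Implicit Defensive.

Import Order.TTheory GRing.Theory Num.Theory.
Import numFieldNormedType.Exports.

Local Open Scope classical_set_scope.
Local Open Scope ring_scope.

(* Function spaces consist of honest functions on the plane, of which only the
   values on Om matter, identified when they agree almost everywhere on Om.
   Scalars are real: the form has real coefficients, so the operator commutes
   with complex conjugation, and its spectrum (which lies in R) and its
   multiplicities are those of its complexification. *)

Section SmoothFunctions.
Variable R : realType.
Implicit Types (phi : R * R -> R) (p : R * R).

Definition enorm p : R := Num.sqrt (p.1 ^+ 2 + p.2 ^+ 2).

Definition pder1 phi : R * R -> R := fun p => 'D_((1, 0) : R * R) phi p.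
Definition pder2 phi : R * R -> R := fun p => 'D_((0, 1) : R * R) phi p.
Definition pder (m n : nat) phi : R * R -> R :=
  iter m pder1 (iter n pder2 phi).

(* C^oo on the whole plane; by the equality of mixed derivatives the fixed
   order of differentiation in pder is no restriction. *)
Definition smooth phi := forall m n p, differentiable (pder m n phi) p.

Definition smooth1 (V : normedModType R) (f : R -> V) :=
  forall n t, derivable (derive1n n f) t 1.

(* Smoothness up to the endpoint. *)
Definition smooth_on_ray (r : R) (f : R -> R) :=
  exists2 g : R -> R, smooth1 g & forall y, r <= y -> f y = g y.

End SmoothFunctions.

Section Domains.
Variable R : realType.
Implicit Types (Om S C : set (R * R)) (p n : R * R) (psi : R * R -> R).

Definition bdry Om : set (R * R) := closure Om `&` closure (~` Om).

Definition local_defining Om p psi :=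
  [/\ smooth psi, psi p = 0, (pder1 psi p, pder2 psi p) != 0 &
      \forall x \near p, Om x <-> psi x < 0].

Definition smooth_boundary Om :=
  forall p, bdry Om p -> exists psi, local_defining Om p psi.

(* Outward unit normal grad psi / |grad psi|; it does not depend on psi. *)
Definition outer_normal Om p : R * R :=
  xget 0 [set n | exists2 psi, local_defining Om p psi &
    n = (enorm (pder1 psi p, pder2 psi p))^-1 *:
        ((pder1 psi p, pder2 psi p) : R * R)].

(* A relatively open connected nonempty subset of the smooth curve bdry Om:
   an open arc or an entire closed component. *)
Definition open_curve Om C :=
  [/\ C !=set0, connected C & exists2 U, open U & C = bdry Om `&` U].

Definition finite_union_of_open_curves Om S :=
  exists (k : nat) (C : 'I_k -> set (R * R)),
    (forall i, open_curve Om (C i)) /\ S = \bigcup_i C i.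

Definition horn (H : R -> R) (rho : R) : set (R * R) :=
  [set p | rho < p.1 /\ - H p.1 < p.2 < H p.1].

Definition horn_side_up (H : R -> R) (rho : R) : set (R * R) :=
  [set p | rho < p.1 /\ p.2 = H p.1].

Definition horn_side_down (H : R -> R) (rho : R) : set (R * R) :=
  [set p | rho < p.1 /\ p.2 = - H p.1].

End Domains.

Section SobolevSpaces.
Variable R : realType.
Implicit Types (Om S : set (R * R)) (u v g phi : R * R -> R).

Definition area :
    {measure set (measurableTypeR R * measurableTypeR R) -> \bar R} :=
  (@lebesgue_measure R \x @lebesgue_measure R)%E.

Definition L2 Om u :=
  (u \_ Om : measurableTypeR R * measurableTypeR R -> R) \in Lfun area 2%:E.

Definition L2norm Om u : \bar R := ('N[area]_2%:E[EFin \o (u \_ Om)])%E.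

Definition L2dot Om u v : R := \int[area]_(x in Om) (u x * v x).

Definition eq_ae_on Om u v := {ae area, forall x, Om x -> u x = v x}.

Definition test_function Om phi :=
  smooth phi /\
  exists K, [/\ compact K, K `<=` Om & forall x, ~ K x -> phi x = 0].

Definition is_wder Om (m n : nat) u g :=
  forall phi, test_function Om phi ->
    L2dot Om u (pder m n phi) = (- 1) ^+ (m + n) * L2dot Om g phi.

(* A representative of the weak derivative, unique almost everywhere on Om;
   the value is irrelevant when there is no weak derivative in L2 Om. *)
Definition wder Om (m n : nat) u : R * R -> R :=
  xget (fun=> 0) [set g | L2 Om g /\ is_wder Om m n u g].

Definition sobolev Om (k : nat) u :=
  L2 Om u /\
  forall m n, (m + n <= k)%N -> exists g, L2 Om g /\ is_wder Om m n u g.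

Definition is_arc_in S (gam : R -> R * R) :=
  [/\ smooth1 gam, forall t, 0 <= t <= 1 -> derive1 gam t != 0 &
      forall t, 0 <= t <= 1 -> S (gam t)].

(* g is the trace on S of v in H^1(Om): restrictions of smooth functions
   converge to v in H^1(Om) and their restrictions to S converge to g in
   L2_loc(S) with respect to arc length. Only local convergence is available,
   since the horn is infinitely long and thin. *)
Definition has_trace Om S v g :=
  [/\ sobolev Om 1 v,
      forall gam, is_arc_in S gam ->
        measurable_fun (`[0, 1]%classic : set R) (g \o gam) &
      exists phi : nat -> R * R -> R,
      [/\ forall k, smooth (phi k),
          forall m n, (m + n <= 1)%N ->
            L2norm Om (pder m n (phi k) \- wder Om m n v) @[k --> \oo] --> 0%E &
          forall gam, is_arc_in S gam ->
            (\int[lebesgue_measure]_(t in (`[0%R, 1%R]%classic : set R))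
              ((phi k (gam t) - g (gam t)) ^+ 2 * enorm (derive1 gam t))%:E)%E
              @[k --> \oo] --> 0%E]].

Definition zero_trace Om S u := has_trace Om S u (fun=> 0).

(* The trace of the normal derivative of u in H^2(Om) is assembled from the
   traces of the first derivatives of u. *)
Definition zero_normal_trace Om S u :=
  exists g1 g2, [/\ has_trace Om S (wder Om 1 0 u) g1,
    has_trace Om S (wder Om 0 1 u) g2 &
    forall gam, is_arc_in S gam ->
      {ae @lebesgue_measure R, forall t : R, 0 <= t <= 1 ->
        (outer_normal Om (gam t)).1 * g1 (gam t)
        + (outer_normal Om (gam t)).2 * g2 (gam t) = 0}].

End SobolevSpaces.

(* With plate_space as form domain, the conditions on the traction-free part of
   the boundary and the second hinge condition are natural and do not appear. *)
Section KirchhoffPlate.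
Variables (R : realType) (Om GD GM : set (R * R)) (nu : R).
Implicit Types (u v f : R * R -> R).

Definition plate_space u :=
  [/\ sobolev Om 2 u,
      zero_trace Om GD u /\ zero_normal_trace Om GD u &
      zero_trace Om GM u].

Definition plate_form u v : R :=
  L2dot Om (wder Om 2 0 u) (wder Om 2 0 v)
  + L2dot Om (wder Om 0 2 u) (wder Om 0 2 v)
  + 2 * (1 - nu) * L2dot Om (wder Om 1 1 u) (wder Om 1 1 v)
  + nu * (L2dot Om (wder Om 2 0 u) (wder Om 0 2 v)
          + L2dot Om (wder Om 0 2 u) (wder Om 2 0 v)).

(* us is Cauchy for the form and converges to u in L2: such u make up the
   domain of the closure of the form, in which us converges to u. *)
Definition form_cvg (us : nat -> R * R -> R) u :=
  [/\ forall k, plate_space (us k),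
      forall e : R, 0 < e -> exists N : nat, forall j k : nat,
        (N <= j)%N -> (N <= k)%N ->
        plate_form (us j \- us k) (us j \- us k) < e,
      L2 Om u &
      L2norm Om (us k \- u) @[k --> \oo] --> 0%E].

(* The graph of the self-adjoint operator A of the closed form abar:
   u lies in D(A) and A u = f iff u is in the domain of abar and
   abar(u, v) = (f, v) for all v in plate_space, a core of abar, where
   abar(u, v) = lim_k a(us k, v) whenever form_cvg us u. *)
Definition plate_op u f :=
  L2 Om f /\
  exists us, form_cvg us u /\
    forall v, plate_space v -> plate_form (us k) v @[k --> \oo] --> L2dot Om f v.

(* A - l : D(A) -> L2 is bijective with bounded inverse; injectivity follows
   from the bound. *)
Definition plate_resolvent_set : set R :=
  [set l | (forall f, L2 Om f -> exists u, plate_op u (f \+ l \*: u)) /\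
           exists c : R, forall u f, L2 Om f -> plate_op u (f \+ l \*: u) ->
             (L2norm Om u <= c%:E * L2norm Om f)%E].

Definition plate_spectrum : set R := ~` plate_resolvent_set.

Definition plate_eigenvalue (l : R) :=
  exists u, plate_op u (l \*: u) /\ ~ eq_ae_on Om u (fun=> 0).

Definition plate_finite_multiplicity (l : R) :=
  exists (k : nat) (e : 'I_k -> R * R -> R),
    forall u, plate_op u (l \*: u) ->
      exists c : 'I_k -> R, eq_ae_on Om u (fun x => \sum_i c i * e i x).

Definition plate_spectrum_discrete :=
  (forall l, plate_spectrum l ->
     [/\ isolated plate_spectrum l, plate_eigenvalue l &
         plate_finite_multiplicity l]) /\
  limit_point plate_spectrum = set0.

End KirchhoffPlate.

(* Main.v *)
(* The spectrum is discrete once every eps > 0 admits finitely many e_i in L2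
   with |u|^2 <= sum_i (u, e_i)^2 + eps (a(u, u) + |u|^2) on the form domain.
   Indeed, for eps small the form a - l (., .) + M sum_i (., e_i)^2 is coercive,
   and removing its finite-rank part amounts to solving a square linear system:
   either l is an eigenvalue, or A - l has a bounded inverse. Eigenvectors with
   eigenvalues below a given bound are orthogonal for both forms, so that there
   are no more of them than functionals e_i.

   The bound is proved piecewise. On squares inside Omega it is Poincare's
   inequality on a fine subdivision. Near a boundary point, a layer along the
   boundary is met by segments of a fixed length that stay in Omega, and
   f(x)^2 <= 2/L int f^2 + 2L int f'^2 on such segments makes the contribution
   of the layer proportional to its thickness. In a strip a < y < a + 1 of the
   horn a zero trace on one side gives |u| <= C H(a) |D_2 u|, and it remains to
   bound D_2 u. If u vanishes on both sides, its mean slope across the horn is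
   zero and |D_2 u| <= C H(a) |D_22 u|. If the plate is clamped on one side, the
   outer normal there is proportional to (-+H', 1), so that the vanishing normal
   derivative reads D_2 u = +-H' D_1 u; this bounds D_2 u by D_1 u and second
   derivatives, and D_1 u is bounded by u and D_11 u along horizontal segments,
   which stay in the horn on their left because H decreases. *)

Require Import Defs.
From HB Require Import structures.
From mathcomp Require Import all_boot all_order all_algebra.
From mathcomp Require Import all_classical all_reals all_analysis.
From mathcomp Require Import measurable_realfun.
From mathcomp Require Import ring lra.

Set Implicit Arguments.
Unset Strict Implicit.
Unset Printing Implicit Defensive.

Import Order.TTheory GRing.Theory Num.Theory.
Import numFieldNormedType.Exports.

Local Open Scope classical_set_scope.
Local Open Scope ring_scope.

(** * Quadratic forms *)

(** Line estimates need honest functions, and the only ones at hand are the smooth approximations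
    contained in [has_trace]. Even a trace on an empty set supplies them, and [zero_normal_trace]
    supplies them for both first derivatives; so on the form domain [u], D_1 u and D_2 u are each
    approximated in H^1 by functions smooth on the whole plane. The three approximations are
    unrelated: D_2 of the one for [u] is close in L2 to the one for D_2 u, but not in H^1. Hence the
    one-dimensional inequalities are stated for a pair [w], [q] with an error term in w' - q,
    boundary values enter as integrals along graphs that tend to zero, and every inequality for [u]
    is first obtained up to an arbitrarily small error. In the abstract part functions are
    identified only almost everywhere, so [dot] is merely semidefinite, and the closed form is
    available only through Cauchy sequences. Solutions of the penalized problem are therefore
    produced as limits of minimizing sequences. *)

Record nonneg_form (R : realType) (V : lmodType R) (X : set V)
    (a : V -> V -> R) : Prop := NonnegForm {
  form_dom0 : X 0;
  form_dom_lin : forall c u v, X u -> X v -> X (c *: u + v);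
  form_sym : forall u v, X u -> X v -> a u v = a v u;
  form_lin : forall c u v w, X u -> X v -> X w ->
    a (c *: u + v) w = c * a u w + a v w;
  form_ge0 : forall u, X u -> 0 <= a u u }.

Section QuadraticForms.
Variables (R : realType) (V : lmodType R) (X : set V) (a : V -> V -> R).
Hypothesis ha : nonneg_form X a.

Let X0 := form_dom0 ha.
Let Xlin := form_dom_lin ha.
Let aC := form_sym ha.
Let alin := form_lin ha.
Let a_ge0 := form_ge0 ha.

Lemma subspaceD u v : X u -> X v -> X (u + v).
Proof. by move=> Xu Xv; rewrite -[u]scale1r; apply: Xlin. Qed.

Lemma subspaceZ c u : X u -> X (c *: u).
Proof. by move=> Xu; rewrite -[_ *: _]addr0; apply: Xlin. Qed.

Lemma subspaceB u v : X u -> X v -> X (u - v).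
Proof. by move=> Xu Xv; rewrite addrC -scaleN1r; apply: Xlin. Qed.

Lemma subspace_sum (I : finType) (c : I -> R) (u : I -> V) :
  (forall i, X (u i)) -> X (\sum_i c i *: u i).
Proof.
move=> Xu; apply: (big_ind X) => //; first exact: subspaceD.
by move=> i _; exact: subspaceZ.
Qed.

Lemma form0l w : X w -> a 0 w = 0.
Proof.
move=> Xw; have := alin 1 X0 X0 Xw.
rewrite scale1r addr0 mul1r => /eqP; rewrite -subr_eq0.
by rewrite opprD addrA subrr sub0r oppr_eq0 => /eqP.
Qed.

Lemma formDl u v w : X u -> X v -> X w -> a (u + v) w = a u w + a v w.
Proof. by move=> Xu Xv Xw; rewrite -[u in LHS]scale1r alin // mul1r. Qed.

Lemma formZl c u w : X u -> X w -> a (c *: u) w = c * a u w.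
Proof. by move=> Xu Xw; rewrite -[_ *: _]addr0 alin // form0l // addr0. Qed.

Lemma formBl u v w : X u -> X v -> X w -> a (u - v) w = a u w - a v w.
Proof.
by move=> Xu Xv Xw; rewrite addrC -scaleN1r alin // mulN1r addrC.
Qed.

Lemma form_suml (I : finType) (c : I -> R) (u : I -> V) w :
  (forall i, X (u i)) -> X w ->
  a (\sum_i c i *: u i) w = \sum_i c i * a (u i) w.
Proof.
move=> Xu Xw.
suff [] : X (\sum_i c i *: u i) /\
  a (\sum_i c i *: u i) w = \sum_i c i * a (u i) w by [].
apply: (big_ind2 (fun x y => X x /\ a x w = y)).
- by split => //; rewrite form0l.
- move=> x1 x2 y1 y2 [Xx1 <-] [Xy1 <-].
  by split; [exact: subspaceD|rewrite formDl].
- by move=> i _; split; [exact: subspaceZ|rewrite formZl].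
Qed.

Lemma formDr u v w : X u -> X v -> X w -> a w (u + v) = a w u + a w v.
Proof.
move=> Xu Xv Xw.
by rewrite aC ?formDl ?(aC Xw) //; exact: subspaceD.
Qed.

Lemma formZr c u w : X u -> X w -> a w (c *: u) = c * a w u.
Proof.
by move=> Xu Xw; rewrite aC ?formZl ?(aC Xw) //; exact: subspaceZ.
Qed.

Lemma formBr u v w : X u -> X v -> X w -> a w (u - v) = a w u - a w v.
Proof.
move=> Xu Xv Xw.
by rewrite aC ?formBl ?(aC Xw) //; exact: subspaceB.
Qed.

Lemma formDD u v : X u -> X v -> a (u + v) (u + v) = a u u + a u v *+ 2 + a v v.
Proof.
move=> Xu Xv; have Xuv := subspaceD Xu Xv.
rewrite formDl // !formDr // (aC Xv Xu); ring.
Qed.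

Lemma formBB u v : X u -> X v -> a (u - v) (u - v) = a u u - a u v *+ 2 + a v v.
Proof.
move=> Xu Xv; have Xuv := subspaceB Xu Xv.
rewrite formBl // !formBr // (aC Xv Xu); ring.
Qed.

Lemma formZZ c u : X u -> a (c *: u) (c *: u) = c ^+ 2 * a u u.
Proof.
move=> Xu; have Xcu := subspaceZ c Xu.
by rewrite formZl // formZr // mulrA.
Qed.

(** A quadratic polynomial that is nonnegative on all combinations of [u] and [v] has nonpositive
    discriminant; as [a] may be degenerate, the case a v v = 0 is treated apart. *)
Lemma form_CauchySchwarz u v : X u -> X v -> a u v ^+ 2 <= a u u * a v v.
Proof.
move=> Xu Xv.
have h t s : 0 <= t ^+ 2 * a u u + 2 * (t * s) * a u v + s ^+ 2 * a v v.
  have := a_ge0 (Xlin t Xu (subspaceZ s Xv)).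
  have Xt := subspaceZ t Xu; have Xs := subspaceZ s Xv.
  rewrite formDD // !formZZ // formZl // formZr //.
  by congr (0 <= _); ring.
have au := a_ge0 Xu; have av := a_ge0 Xv.
have [v0|v0] := eqVneq (a v v) 0.
  rewrite v0 mulr0.
  have [->|uv0] := eqVneq (a u v) 0; first by rewrite expr0n.
  (* With a v v = 0 the polynomial is affine in the second coefficient; this choice gives it the
     value -1. *)
  have := h 1 (- (a u u + 1) / (2 * a u v)); rewrite v0 mulr0 addr0.
  have -> : 1 ^+ 2 * a u u + 2 * (1 * (- (a u u + 1) / (2 * a u v))) * a u v
    = -1 by field.
  lra.
have v_gt0 : 0 < a v v by rewrite lt_def v0.
have := h (a v v) (- a u v).
have -> : a v v ^+ 2 * a u u + 2 * (a v v * - a u v) * a u v +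
  (- a u v) ^+ 2 * a v v = a v v * (a u u * a v v - a u v ^+ 2) by ring.
by rewrite pmulr_rge0 // subr_ge0.
Qed.

Definition form_norm u := Num.sqrt (a u u).

Lemma form_norm_ge0 u : 0 <= form_norm u. Proof. exact: sqrtr_ge0. Qed.

Lemma form_normK u : X u -> form_norm u ^+ 2 = a u u.
Proof. by move=> Xu; rewrite sqr_sqrtr // a_ge0. Qed.

Lemma form_le_norm u v : X u -> X v -> `|a u v| <= form_norm u * form_norm v.
Proof.
move=> Xu Xv; rewrite -(@ler_pXn2r _ 2) ?nnegrE ?mulr_ge0 ?form_norm_ge0 //.
by rewrite exprMn !form_normK // real_normK ?num_real // form_CauchySchwarz.
Qed.

Lemma form_normD u v : X u -> X v ->
  form_norm (u + v) <= form_norm u + form_norm v.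
Proof.
move=> Xu Xv.
rewrite -(@ler_pXn2r _ 2) ?nnegrE ?addr_ge0 ?form_norm_ge0 //.
rewrite sqrrD !form_normK ?formDD //; last exact: subspaceD.
rewrite lerD2r lerD2l lerMn2r /=.
exact: le_trans (ler_norm _) (form_le_norm Xu Xv).
Qed.

Lemma form_normZ c u : X u -> form_norm (c *: u) = `|c| * form_norm u.
Proof.
move=> Xu; rewrite /form_norm formZZ // sqrtrM ?sqr_ge0 //.
by rewrite sqrtr_sqr.
Qed.

Lemma form_norm0 : form_norm 0 = 0.
Proof. by rewrite /form_norm form0l // sqrtr0. Qed.

Lemma form_norm_sum (I : finType) (c : I -> R) (u : I -> V) :
  (forall i, X (u i)) ->
  form_norm (\sum_i c i *: u i) <= \sum_i `|c i| * form_norm (u i).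
Proof.
move=> Xu.
suff [] : X (\sum_i c i *: u i) /\
  form_norm (\sum_i c i *: u i) <= \sum_i `|c i| * form_norm (u i) by [].
apply: (big_ind2 (fun x y => X x /\ form_norm x <= y)).
- by rewrite form_norm0.
- move=> x1 x2 y1 y2 [Xx1 le1] [Xy1 le2].
  split; first exact: subspaceD.
  by rewrite (le_trans (form_normD _ _)) // lerD.
- by move=> i _; split; [exact: subspaceZ|rewrite form_normZ].
Qed.

End QuadraticForms.

(** * Forms controlled by finitely many functionals *)

(** The polynomial is tested at q / (B + 1), close to its minimiser q / B but meaningful for B = 0.
    This turns near minimality of a functional into smallness of its first variation. *)
Lemma small_of_quadratic (R : realFieldType) (s q B d : R) : 0 <= B -> 0 < d ->
  s < d ^+ 2 / (B + 1) -> (forall t, 0 <= s - 2 * t * q + t ^+ 2 * B) ->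
  `|q| < d.
Proof.
move=> B0 d0 hs /(_ (q / (B + 1))).
have B1 : 0 < B + 1 by rewrite ltr_wpDl.
have B1' : B + 1 != 0 by rewrite lt0r_neq0.
have -> : s - 2 * (q / (B + 1)) * q + (q / (B + 1)) ^+ 2 * B =
  s - (q ^+ 2 / (B + 1) + q ^+ 2 / (B + 1) ^+ 2) by field.
have : 0 <= q ^+ 2 / (B + 1) ^+ 2 by rewrite divr_ge0 ?sqr_ge0.
move=> h1 h2; have : q ^+ 2 / (B + 1) < d ^+ 2 / (B + 1) by lra.
rewrite ltr_pM2r ?invr_gt0 // -[q ^+ 2]real_normK ?num_real //.
by rewrite ltr_pXn2r // nnegrE ltW.
Qed.

Lemma cvg_sumr (R : realType) (I : Type) (r : seq I) (f : I -> nat -> R)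
  (l : I -> R) : (forall i, f i k @[k --> \oo] --> l i) ->
  \sum_(i <- r) f i k @[k --> \oo] --> \sum_(i <- r) l i.
Proof.
move=> fl; elim: r => [|i r ih].
  rewrite big_nil (_ : (fun k => _) = (fun=> 0)); first exact: cvg_cst.
  by apply/funext => k; rewrite big_nil.
rewrite big_cons (_ : (fun k => _) = (fun k => f i k + \sum_(i <- r) f i k)).
  exact: cvgD.
by apply/funext => k; rewrite big_cons.
Qed.

(** A matrix of maximal rank among those with rows in [S] spans: adding one more row of [S] cannot
    increase its rank. *)
Lemma finite_spanning_rows (F : fieldType) n (S : set 'rV[F]_n) :
  exists (k : nat) (A : 'I_k -> 'rV[F]_n), (forall i, S (A i)) /\
  forall s, S s -> exists c : 'I_k -> F, s = \sum_i c i *: A i.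
Proof.
pose Q r := `[< exists k (M : 'M[F]_(k, n)), (forall i, S (row i M)) /\ \rank M = r >].
have exQ : exists r, Q r.
  exists 0%N; apply/asboolP; exists 0%N, 0; split; last by rewrite mxrank0.
  by case.
have leQ r : Q r -> (r <= n)%N.
  by move=> /asboolP[k [M [_ <-]]]; exact: rank_leq_col.
case: (ex_maxnP exQ leQ) => r /asboolP[k [M [SM rM]]] rmax.
exists k, (fun i => row i M); split => // s Ss.
have le1 : (M <= col_mx M s)%MS by apply/submxP; exists (row_mx 1%:M 0); rewrite mul_row_col mul1mx mul0mx addr0.
have le2 : (s <= col_mx M s)%MS by apply/submxP; exists (row_mx 0 1%:M); rewrite mul_row_col mul1mx mul0mx add0r.
have : (\rank (col_mx M s) <= \rank M)%N.
  rewrite rM; apply: rmax; apply/asboolP; exists (k + 1)%N, (col_mx M s).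
  split => // i; case: (splitP i) => j ij.
    have -> : i = lshift 1 j by apply: val_inj.
    by rewrite rowKu.
  have -> : i = rshift k j by apply: val_inj.
  by rewrite rowKd ord1 row_id.
rewrite (geq_leqif (mxrank_leqif_sup le1)).
move=> /(submx_trans le2) /submxP[D ->].
by exists (D 0); rewrite mulmx_sum_row.
Qed.

Section CompactForms.
Variables (R : realType) (V : lmodType R) (P X : set V) (dot a : V -> V -> R).
Hypothesis hd : nonneg_form P dot.
Hypothesis complete : forall us : nat -> V, (forall k, P (us k)) ->
  (forall e, 0 < e -> exists N : nat, forall j k, (N <= j)%N -> (N <= k)%N ->
    dot (us j - us k) (us j - us k) < e) ->
  exists2 u, P u & dot (us k - u) (us k - u) @[k --> \oo] --> 0.
Hypothesis XP : X `<=` P.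
Hypothesis ha : nonneg_form X a.

Let P0 := form_dom0 hd.
Let Plin := form_dom_lin hd.
Let dotC := form_sym hd.
Let dotlin := form_lin hd.
Let dot_ge0 := form_ge0 hd.
Let X0 := form_dom0 ha.
Let Xlin := form_dom_lin ha.
Let aC := form_sym ha.
Let alin := form_lin ha.
Let a_ge0 := form_ge0 ha.

Local Notation nrm := (form_norm dot).

Definition cauchy_form (us : nat -> V) := forall e : R, 0 < e ->
  exists N : nat, forall j k : nat, (N <= j)%N -> (N <= k)%N ->
    a (us j - us k) (us j - us k) < e.

Definition aform_cvg (us : nat -> V) u :=
  [/\ forall k, X (us k), cauchy_form us, P u &
      dot (us k - u) (us k - u) @[k --> \oo] --> 0].

(** Abstract form of [plate_op]; [u] and [f] matter only up to null vectors of [dot]. *)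
Definition aform_op u f := P f /\ exists us, aform_cvg us u /\
  forall v, X v -> a (us k) v @[k --> \oo] --> dot f v.

Lemma cvg0_sqrt (x : nat -> R) : (x k @[k --> \oo] --> 0) ->
  Num.sqrt (x k) @[k --> \oo] --> 0.
Proof. by move=> x0; rewrite -[0 in X in _ --> X]sqrtr0; exact: (cvg_comp _ _ x0 (@sqrt_continuous R 0)). Qed.

Lemma dot_cvgl us u w : (forall k, P (us k)) -> P u -> P w ->
  dot (us k - u) (us k - u) @[k --> \oo] --> 0 ->
  dot (us k) w @[k --> \oo] --> dot u w.
Proof.
move=> Pus Pu Pw h; apply/subr_cvg0.
apply/norm_cvg0P.
have h0 : nrm (us k - u) * nrm w @[k --> \oo] --> 0.
  by rewrite -[0](mul0r (nrm w)); apply: cvgMl; exact: cvg0_sqrt.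
apply: (squeeze_cvgr _ (cvg_cst 0) h0); apply: nearW => k.
rewrite normr_ge0 /= -(formBl hd) //.
by apply: (form_le_norm hd) => //; exact: (subspaceB hd).
Qed.

Lemma nrm_cvg us u : (forall k, P (us k)) -> P u ->
  dot (us k - u) (us k - u) @[k --> \oo] --> 0 ->
  nrm (us k) @[k --> \oo] --> nrm u.
Proof.
move=> Pus Pu h; apply/subr_cvg0/norm_cvg0P.
apply: (squeeze_cvgr _ (cvg_cst 0) (cvg0_sqrt h)); apply: nearW => k.
have Pd := subspaceB hd (Pus k) Pu.
have nD := form_normD hd.
rewrite normr_ge0 /= ler_norml; apply/andP; split.
  have := nD _ _ (Pus k) (subspaceB hd Pu (Pus k)).
  rewrite addrC subrK.
  have -> : nrm (u - us k) = nrm (us k - u).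
    by rewrite -[u - us k]opprB -[- (us k - u)]scaleN1r (form_normZ hd) // normrN1 mul1r.
  rewrite -/(nrm _); lra.
have := nD _ _ Pd Pu; rewrite subrK -/(nrm (us k - u)); lra.
Qed.

Lemma dot_cvg_self us u : (forall k, P (us k)) -> P u ->
  dot (us k - u) (us k - u) @[k --> \oo] --> 0 ->
  dot (us k) (us k) @[k --> \oo] --> dot u u.
Proof.
move=> Pus Pu h.
have hn := nrm_cvg Pus Pu h.
rewrite -(form_normK hd Pu) (_ : (fun k => _) = (fun k => nrm (us k) ^+ 2)).
  exact: (cvg_comp _ _ hn (@exprn_continuous R 2 _)).
by apply/funext => k; rewrite (form_normK hd).
Qed.

Lemma aform_cvg_lin c us vs u v : aform_cvg us u -> aform_cvg vs v ->
  aform_cvg (fun k => c *: us k + vs k) (c *: u + v).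
Proof.
move=> [Xus Cus Pu du] [Xvs Cvs Pv dv].
have E j k : c *: us j + vs j - (c *: us k + vs k) =
   c *: (us j - us k) + (vs j - vs k).
  by rewrite scalerBr opprD !addrA; congr (_ + _); rewrite -!addrA; congr (_ + _); rewrite addrC.
split => //.
- by move=> k; exact: Xlin.
- move=> e e0; pose d := e / (4 * (c ^+ 2 + 1)).
  have c2 := sqr_ge0 c.
  have d0 : 0 < d by rewrite divr_gt0 //; lra.
  have [N1 h1] := Cus _ d0; have [N2 h2] := Cvs _ d0.
  exists (maxn N1 N2) => j k; rewrite !geq_max => /andP[j1 j2] /andP[k1 k2].
  rewrite E.
  have XA := subspaceB ha (Xus j) (Xus k).
  have XB := subspaceB ha (Xvs j) (Xvs k).
  have := h1 _ _ j1 k1; have := h2 _ _ j2 k2; move: XA XB.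
  set A := us j - us k; set B := vs j - vs k => XA XB hB hA.
  have XcA := subspaceZ ha c XA.
  have := a_ge0 (subspaceB ha XcA XB).
  rewrite (formBB ha XcA XB) (formDD ha XcA XB).
  rewrite (formZZ ha) //.
  have : c ^+ 2 * a A A <= c ^+ 2 * d by rewrite ler_wpM2l // ltW.
  have : 4 * (c ^+ 2 * d + d) = e by rewrite /d; field; lra.
  have := mulr_ge0 c2 (ltW d0).
  lra.
- exact: Plin.
- have e0 : 2 * c ^+ 2 * 0 + 2 * 0 = 0 :> R by ring.
  have h0 : 2 * c ^+ 2 * dot (us k - u) (us k - u) + 2 * dot (vs k - v) (vs k - v)
      @[k --> \oo] --> 0.
    rewrite -[X in _ --> X]e0.
    by apply: cvgD; apply: cvgM => //; exact: cvg_cst.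
  apply: (squeeze_cvgr _ (cvg_cst 0) h0); apply: nearW => k.
  have -> : c *: us k + vs k - (c *: u + v) = c *: (us k - u) + (vs k - v).
    by rewrite scalerBr opprD !addrA; congr (_ + _); rewrite -!addrA; congr (_ + _); rewrite addrC.
  have PA := subspaceB hd (XP (Xus k)) Pu.
  have PB := subspaceB hd (XP (Xvs k)) Pv.
  have PcA := subspaceZ hd c PA.
  rewrite dot_ge0 /=; last exact: Plin.
  have := dot_ge0 (subspaceB hd PcA PB).
  rewrite (formBB hd PcA PB) (formDD hd PcA PB).
  rewrite (formZZ hd) //; lra.
Qed.

Lemma aform_op_lin c u v f g : aform_op u f -> aform_op v g ->
  aform_op (c *: u + v) (c *: f + g).
Proof.
move=> [Pf [us [cu hu]]] [Pg [vs [cv hv]]]; split; first exact: Plin.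
exists (fun k => c *: us k + vs k); split; first exact: aform_cvg_lin.
move=> w Xw; rewrite dotlin //; last exact: XP.
rewrite (_ : (fun k => _) = (fun k => c * a (us k) w + a (vs k) w)).
  by apply: cvgD; [exact: cvgMr (hu _ Xw)|exact: hv].
by apply/funext => k; case: cu => Xus _ _ _; case: cv => Xvs _ _ _; rewrite alin.
Qed.

Lemma aform_op0 : aform_op 0 0.
Proof.
split => //; exists (fun=> 0); split.
  split => //; first by move=> e e0; exists 0%N => j k _ _; rewrite subrr (form0l ha).
  by rewrite subrr (form0l hd) //; exact: cvg_cst.
move=> v Xv; rewrite (form0l ha) // (form0l hd); last exact: XP.
exact: cvg_cst.
Qed.

Lemma aform_opB u v f g : aform_op u f -> aform_op v g -> aform_op (u - v) (f - g).
Proof.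
by move=> uf vg; have := aform_op_lin (-1) vg uf; rewrite !scaleN1r ![- _ + _]addrC.
Qed.

Lemma aform_op_sum (I : finType) (c : I -> R) (u f : I -> V) :
  (forall i, aform_op (u i) (f i)) ->
  aform_op (\sum_i c i *: u i) (\sum_i c i *: f i).
Proof.
move=> uf; apply: (big_ind2 aform_op) => [||i _].
- exact: aform_op0.
- by move=> x1 x2 y1 y2 h1 h2; have := aform_op_lin 1 h1 h2; rewrite !scale1r.
- by have := aform_op_lin (c i) (uf i) aform_op0; rewrite !addr0.
Qed.

Lemma cauchy_form_bounded us : (forall k, X (us k)) -> cauchy_form us ->
  exists2 B, 0 <= B & \forall k \near \oo, a (us k) (us k) <= B.
Proof.
move=> Xus /(_ _ ltr01)[N hN].
(* From a(x + y) <= 2 a(x) + 2 a(y), where us k - us N has energy below 1. *)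
exists (2 * a (us N) (us N) + 2); first by rewrite addr_ge0 // mulr_ge0 // a_ge0.
exists N => // k /= Nk.
have h := hN _ _ Nk (leqnn N).
have XA := subspaceB ha (Xus k) (Xus N).
have := a_ge0 (subspaceB ha XA (Xus N)).
have := formDD ha XA (Xus N); rewrite subrK => ->.
rewrite (formBB ha) //; lra.
Qed.

(** The weak equation is known against fixed vectors of [X] only. For fixed k, a (us j) (vs k) tends
    to dot f (vs k) as j grows, and Cauchy-Schwarz makes its distance from a (us k) (vs k) small
    uniformly in k because the energies of [vs] are bounded. So both arguments may vary together. *)
Lemma aform_energy us u f vs v : aform_cvg us u -> P f ->
  (forall w, X w -> a (us k) w @[k --> \oo] --> dot f w) ->
  aform_cvg vs v -> a (us k) (vs k) @[k --> \oo] --> dot f v.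
Proof.
move=> [Xus Cus Pu du] Pf hus [Xvs Cvs Pv dv].
have [B B0 hB] := cauchy_form_bounded Xvs Cvs.
have dfv : dot f (vs k) @[k --> \oo] --> dot f v.
  rewrite dotC // (_ : (fun k => _) = (fun k => dot (vs k) f)).
    by apply: dot_cvgl => // k; exact: XP.
  by apply/funext => k; rewrite dotC //; exact: XP.
apply/cvgrPdist_lt => e e0.
(* [d] satisfies d (B + 1) = (e / 4)^2, the square of the error allowed in Cauchy-Schwarz. *)
pose d := e ^+ 2 / (16 * (B + 1)).
have d0 : 0 < d by rewrite divr_gt0 ?exprn_gt0 //; lra.
have [N hN] := Cus _ d0.
have key k : (N <= k)%N -> a (vs k) (vs k) <= B ->
    `|a (us k) (vs k) - dot f (vs k)| <= e / 4.
  move=> Nk Bk.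
  have h : `|a (us k) (vs k) - a (us j) (vs k)| @[j --> \oo] -->
      `|a (us k) (vs k) - dot f (vs k)|.
    apply: cvg_norm; apply: cvgB; first exact: cvg_cst.
    exact: hus.
  rewrite -(cvg_lim _ h) //; apply: limr_le; first by apply/cvg_ex; eexists; exact: h.
  exists N => // j /= Nj.
  rewrite -(formBl ha) //.
  have XA := subspaceB ha (Xus k) (Xus j).
  rewrite -(@ler_pXn2r _ 2) ?nnegrE //; last by lra.
  rewrite real_normK ?num_real //.
  apply: le_trans (form_CauchySchwarz ha XA (Xvs k)) _.
  have -> : (e / 4) ^+ 2 = d * (B + 1) by rewrite /d; field; lra.
  have XA0 := a_ge0 XA; have V0 := a_ge0 (Xvs k).
  apply: ler_pM => //; first by rewrite ltW // hN.
  by lra.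
have hdf : \forall k \near \oo, `|dot f v - dot f (vs k)| < e / 2.
  by move/cvgrPdist_lt : dfv; apply; rewrite divr_gt0.
near=> k.
have h1 : `|a (us k) (vs k) - dot f (vs k)| <= e / 4.
  by apply: key; [near: k; exact: nbhs_infty_ge|near: k].
have h2 : `|dot f v - dot f (vs k)| < e / 2 by near: k.
have := ler_distD (dot f (vs k)) (dot f v) (a (us k) (vs k)).
rewrite [`|dot f (vs k) - _|]distrC; lra.
Unshelve. all: end_near. Qed.

Lemma aform_op_sym u f v g : aform_op u f -> aform_op v g -> dot f v = dot g u.
Proof.
move=> [Pf [us [cu hu]]] [Pg [vs [cv hv]]].
have h1 := aform_energy cu Pf hu cv.
have h2 := aform_energy cv Pg hv cu.
apply: (cvg_unique _ h1) => //.
rewrite (_ : (fun k => _) = (fun k => a (vs k) (us k))) //.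
by apply/funext => k; case: cu => Xus _ _ _; case: cv => Xvs _ _ _; rewrite aC.
Qed.

Lemma aform_op_ge0 u f : aform_op u f -> 0 <= dot f u.
Proof.
move=> [Pf [us [cu hu]]]; have h := aform_energy cu Pf hu cu.
rewrite -(cvg_lim _ h) //; apply: limr_ge; first by apply/cvg_ex; eexists; exact: h.
by apply: nearW => k; apply: a_ge0; case: cu.
Qed.

Lemma aform_opP u f : aform_op u f -> P u.
Proof. by move=> [_ [us [[]]]]. Qed.

Definition controls (eps : R) n (e : 'I_n -> V) := forall u, X u ->
  dot u u <= \sum_i dot u (e i) ^+ 2 + eps * (a u u + dot u u).

(** Along an approximating sequence the energy tends to dot f u, so the inequality passes from [X]
    to the domain of the operator. *)
Lemma aform_op_controls eps n (e : 'I_n -> V) u f :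
  (forall i, P (e i)) -> controls eps e -> aform_op u f ->
  dot u u <= \sum_i dot u (e i) ^+ 2 + eps * (dot f u + dot u u).
Proof.
move=> Pe ce [Pf [us [cu hu]]]; have hen := aform_energy cu Pf hu cu.
case: (cu) => Xus _ Pu du.
have Pus k : P (us k) by exact: XP.
have h1 := dot_cvg_self Pus Pu du.
have h2 : \sum_i dot (us k) (e i) ^+ 2 + eps * (a (us k) (us k) + dot (us k) (us k))
    @[k --> \oo] --> \sum_i dot u (e i) ^+ 2 + eps * (dot f u + dot u u).
  apply: cvgD; last by apply: cvgMr; exact: cvgD.
  apply: cvg_sumr => i.
  have h3 := dot_cvgl Pus Pu (Pe i) du.
  exact: (cvg_comp _ _ h3 (@exprn_continuous R 2 _)).
apply: (ler_cvg_to h1 h2).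
by apply: nearW => k; exact: ce.
Qed.


Hypothesis compactly_controlled : forall eps, 0 < eps ->
  exists (n : nat) (e : 'I_n -> V), (forall i, P (e i)) /\ controls eps e.

(** With eps = 1 / (2 (|L| + 1)), an element of energy at most L dot u u on which all functionals
    vanish satisfies dot u u <= dot u u / 2. *)
Lemma control_below L : exists (n : nat) (e : 'I_n -> V), (forall i, P (e i)) /\
  forall u f, aform_op u f -> dot f u <= L * dot u u ->
    (forall i, dot u (e i) = 0) -> dot u u = 0.
Proof.
pose M := `|L| + 1; have M0 : 0 < M by rewrite ltr_wpDl.
have eps0 : 0 < (2 * M)^-1 by rewrite invr_gt0 mulr_gt0.
have [n [e [Pe ce]]] := compactly_controlled eps0.
exists n, e; split => // u f uf le_fu u0.
have u_ge0 := dot_ge0 (aform_opP uf).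
have := aform_op_controls Pe ce uf.
rewrite big1 ?add0r => [h|i _]; last by rewrite u0 expr0n.
have h2 : (2 * M)^-1 * (dot f u + dot u u) <= (2 * M)^-1 * (M * dot u u).
  rewrite ler_pM2l // /M mulrDl mul1r lerD2r (le_trans le_fu) //.
  by rewrite ler_wpM2r // ler_norm.
have h3 : (2 * M)^-1 * (M * dot u u) = dot u u / 2 by field; lra.
by apply/eqP; rewrite eq_le u_ge0 andbT; lra.
Qed.

Lemma eigen_energy l u : aform_op u (l *: u) -> dot (l *: u) u = l * dot u u.
Proof. by move=> /aform_opP Pu; rewrite (formZl hd). Qed.

Lemma aform_eigen_sum l (I : finType) (c : I -> R) (u : I -> V) :
  (forall i, aform_op (u i) (l *: u i)) ->
  aform_op (\sum_i c i *: u i) (l *: \sum_i c i *: u i).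
Proof.
move=> h; have := aform_op_sum c h.
have -> // : l *: \sum_i c i *: u i = \sum_i c i *: (l *: u i).
by rewrite scaler_sumr; apply: eq_bigr => i _; rewrite !scalerA mulrC.
Qed.

(** By [control_below] an eigenvector is determined, up to null vectors, by the row of its products
    with the [e i]; so eigenvectors whose rows span all such rows span the eigenspace. *)
Lemma aform_finite_multiplicity l : exists (k : nat) (e : 'I_k -> V),
  forall u, aform_op u (l *: u) -> exists c : 'I_k -> R,
    P (u - \sum_i c i *: e i) /\
    dot (u - \sum_i c i *: e i) (u - \sum_i c i *: e i) = 0.
Proof.
have [n [e [Pe he]]] := control_below l.
pose s u : 'rV[R]_n := \row_i dot u (e i).
pose S : set 'rV[R]_n := [set s u | u in [set u | aform_op u (l *: u)]].
have [k [A [SA spanA]]] := finite_spanning_rows S.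
have /choice[v hv] i : exists v, aform_op v (l *: v) /\ s v = A i.
  by have [v ? ?] := SA i; exists v.
exists k, v => u hu.
have [c hc] := spanA (s u) (ex_intro2 _ _ u hu erefl); exists c.
have hs := aform_eigen_sum c (fun i => (hv i).1).
have hw : aform_op (u - \sum_i c i *: v i) (l *: (u - \sum_i c i *: v i)).
  by rewrite scalerBr; exact: aform_opB.
split; first exact: aform_opP hw.
apply: (he _ _ hw); first by rewrite eigen_energy.
move=> j; have Pv i := aform_opP (hv i).1.
rewrite (formBl hd (aform_opP hu) (aform_opP hs) (Pe j)) (form_suml hd) //.
apply/eqP; rewrite subr_eq0; apply/eqP.
have := congr1 (fun M : 'rV[R]_n => M 0 j) hc; rewrite !mxE => ->.
rewrite summxE; apply: eq_bigr => i _.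
by rewrite !mxE -(hv i).2 mxE.
Qed.

Lemma aform_eigen_orthogonal l l' u v : l != l' -> aform_op u (l *: u) ->
  aform_op v (l' *: v) -> dot u v = 0.
Proof.
move=> ll' hu hv; have Pu := aform_opP hu; have Pv := aform_opP hv.
have := aform_op_sym hu hv; rewrite !(formZl hd) // (dotC Pv Pu) => /eqP.
by rewrite -subr_eq0 -mulrBl mulf_eq0 subr_eq0 (negPf ll') => /eqP.
Qed.

(** For n + 1 distinct eigenvalues at most L, some nontrivial combination of eigenvectors is
    annihilated by all n functionals. Orthogonality keeps its energy at most L dot w w, so it is
    null, and orthogonality again makes its coefficients vanish. *)
Lemma aform_eigen_below L : exists n : nat, forall l : 'I_n -> R,
  injective l -> (forall i, l i <= L) ->
  (forall i, exists2 u, aform_op u (l i *: u) & dot u u != 0) -> False.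
Proof.
have [n [e [Pe he]]] := control_below L.
exists n.+1 => l linj lL hl.
have /choice[u huu] i : exists u, aform_op u (l i *: u) /\ dot u u != 0.
  by have [u ? ?] := hl i; exists u.
have hu i := (huu i).1; have u0 i := (huu i).2.
have Pu i := aform_opP (hu i).
pose M : 'M[R]_(n.+1, n) := \matrix_(i, j) dot (u i) (e j).
have : kermx M != 0.
  rewrite -mxrank_eq0 mxrank_ker -lt0n subn_gt0 ltnS.
  exact: rank_leq_col.
move=> /rowV0Pn[c /sub_kermxP cM c0].
pose w := \sum_i c 0 i *: u i.
have hw := aform_op_sum (c 0) hu; rewrite -/w in hw.
have we j : dot w (e j) = 0.
  rewrite (form_suml hd) //; have := congr1 (fun N : 'rV[R]_n => N 0 j) cM.
  by rewrite !mxE => h; rewrite -[RHS]h; apply: eq_bigr => i _; rewrite mxE.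
have dotS (g : 'I_n.+1 -> R) : dot (\sum_i g i *: u i) w = \sum_i g i * c 0 i * dot (u i) (u i).
  rewrite (form_suml hd) //; last exact: aform_opP hw.
  apply: eq_bigr => i _; rewrite dotC //; last exact: aform_opP hw.
  rewrite (form_suml hd) // (bigD1 i) //= big1 ?addr0 ?mulrA // => j ji.
  by rewrite (aform_eigen_orthogonal _ (hu j) (hu i)) ?mulr0 // (inj_eq linj).
have w0 : dot w w = 0.
  apply: (he _ _ hw) => //.
  have -> : \sum_i c 0 i *: (l i *: u i) = \sum_i (c 0 i * l i) *: u i.
    by apply: eq_bigr => i _; rewrite scalerA.
  rewrite {1}/w !dotS mulr_sumr; apply: ler_sum => i _.
  rewrite [c 0 i * l i]mulrC -!mulrA ler_wpM2r //.
  by rewrite mulrA -expr2 mulr_ge0 ?sqr_ge0 ?dot_ge0.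
move/eqP: c0; apply; apply/rowP => i; rewrite mxE.
have := dotS (c 0); rewrite -/w w0 => /esym/eqP.
rewrite psumr_eq0 => [/allP/(_ i (mem_index_enum i))|j _] /=; last first.
  by rewrite -expr2 mulr_ge0 ?sqr_ge0 ?dot_ge0.
by rewrite mulf_eq0 (negPf (u0 i)) orbF -expr2 sqrf_eq0 => /eqP.
Qed.


(** * The penalized problem and the Fredholm alternative *)

Section Coercive.
Variables (l M eps : R) (n : nat) (e : 'I_n -> V).
Hypothesis Pe : forall i, P (e i).
Hypothesis ce : controls eps e.
Hypothesis leM : l + 1 <= M.
Hypothesis M0 : 0 <= M.
Hypothesis Meps : M * eps <= 1 / 2.

(** The form a - l dot plus a penalty of finite rank. Multiplying [controls] by M, with M >= l + 1
    and M eps <= 1/2, gives a u u + dot u u <= 2 b u u. *)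
Let b u v := a u v - l * dot u v + M * \sum_i dot u (e i) * dot v (e i).

Let bform : nonneg_form X b.
Proof.
split => //.
- move=> u v Xu Xv; rewrite /b aC // (dotC (XP Xu) (XP Xv)).
  by congr (_ + _ * _); apply: eq_bigr => i _; rewrite mulrC.
- move=> c u v w Xu Xv Xw; rewrite /b alin // dotlin; [|exact: XP..].
  under eq_bigr => i _.
    by rewrite dotlin //; [rewrite mulrDl -mulrA; over|exact: XP..].
  rewrite big_split /= -mulr_sumr; ring.
- move=> u Xu; have := ce Xu; have Pu := XP Xu; have u_ge0 := dot_ge0 Pu.
  have au := a_ge0 Xu.
  rewrite /b (_ : \sum_i _ = \sum_i dot u (e i) ^+ 2); last by apply: eq_bigr => i _; rewrite expr2.
  set S := \sum_i _ => h.
  have : M * dot u u <= M * (S + eps * (a u u + dot u u)) by rewrite ler_wpM2l.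
  have : (l + 1) * dot u u <= M * dot u u by rewrite ler_wpM2r.
  have : M * eps * (a u u + dot u u) <= 1 / 2 * (a u u + dot u u).
    by rewrite ler_wpM2r // addr_ge0.
  rewrite [M * (S + _)]mulrDr [M * (eps * _)]mulrA; lra.
Qed.

Let b_coercive u : X u -> a u u + dot u u <= 2 * b u u.
Proof.
move=> Xu; have := ce Xu; have Pu := XP Xu; have u_ge0 := dot_ge0 Pu.
have au := a_ge0 Xu.
rewrite /b (_ : \sum_i _ = \sum_i dot u (e i) ^+ 2); last by apply: eq_bigr => i _; rewrite expr2.
set S := \sum_i _ => h.
have : M * dot u u <= M * (S + eps * (a u u + dot u u)) by rewrite ler_wpM2l.
have : (l + 1) * dot u u <= M * dot u u by rewrite ler_wpM2r.
have : M * eps * (a u u + dot u u) <= 1 / 2 * (a u u + dot u u).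
  by rewrite ler_wpM2r // addr_ge0.
rewrite [M * (S + _)]mulrDr [M * (eps * _)]mulrA; lra.
Qed.

(** The equation (A - l) u + M sum_i (u, e i) e i = f solved for A u, that is, the operator of
    [b]. *)
Definition penalized_op u f :=
  aform_op u (f + l *: u - M *: \sum_i dot u (e i) *: e i).

Let J f u := b u u - 2 * dot f u.

Let J_bounded f u : P f -> X u -> - (2 * dot f f) <= J f u.
Proof.
move=> Pf Xu; have Pu := XP Xu; have h := b_coercive Xu; have au := a_ge0 Xu.
have := dot_ge0 (form_dom_lin hd (-2) Pf Pu).
have P2 := subspaceZ hd (-2) Pf.
rewrite (formDD hd) // (formZZ hd) // (formZl hd) // /J; lra.
Qed.

(** Dirichlet's principle. A minimizing sequence of [J f] is Cauchy for [b] by the parallelogram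
    identity, hence for [a] and for [dot] by coercivity; its limit for [dot] solves the equation
    because the first variation tends to zero. *)
Lemma penalized_solution f : P f -> exists u, penalized_op u f.
Proof.
move=> Pf.
pose E : set R := [set J f u | u in X].
have infE : has_inf E.
  split; first by exists (J f 0), 0.
  by exists (- (2 * dot f f)) => _ [u Xu <-]; exact: J_bounded.
have leJ u : X u -> inf E <= J f u.
  by move=> Xu; apply: ge_inf; [case: infE|exists u].
have /choice[us hus] k : exists u, X u /\ J f u < inf E + k.+1%:R^-1.
  have k0 : 0 < k.+1%:R^-1 :> R by rewrite invr_gt0.
  by have [_ [u Xu <-] ?] := inf_adherent k0 infE; exists u.
have Xus k := (hus k).1; have Jus k := (hus k).2.
have small (d : R) : 0 < d -> exists N : nat, forall k, (N <= k)%N -> k.+1%:R^-1 < d.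
  move=> d0; have [N _ hN] := @near_infty_natSinv_lt R (PosNum d0).
  by exists N => k Nk; exact: hN.
(* The value of [J f] at the midpoint of two near minimisers is not below the infimum, which bounds
   their distance. *)
have parallelogram u v (du dv : R) : X u -> X v -> J f u < inf E + du ->
    J f v < inf E + dv -> b (u - v) (u - v) < 2 * (du + dv).
  move=> Xu Xv hu hv.
  have Xm := subspaceZ bform (2^-1) (subspaceD bform Xu Xv).
  have := leJ _ Xm; rewrite /J (formZZ bform) ?(formDD bform Xu Xv) //; last exact: (subspaceD bform).
  have Pu := XP Xu; have Pv := XP Xv; have PD := subspaceD hd Pu Pv.
  rewrite (formZr hd) // (formDr hd) //.
  rewrite (formBB bform Xu Xv); move: hu hv; rewrite /J; lra.
have bcauchy (d : R) : 0 < d -> exists N : nat, forall j k, (N <= j)%N -> (N <= k)%N ->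
    b (us j - us k) (us j - us k) < d.
  move=> d0; have [|N hN] := small (d / 4); first by rewrite divr_gt0.
  exists N => j k Nj Nk.
  apply: lt_le_trans (parallelogram _ _ _ _ (Xus j) (Xus k) (Jus j) (Jus k)) _.
  have -> : d = 2 * (d / 4 + d / 4) by field.
  by rewrite ler_pM2l // lerD // ltW // hN.
have cus : cauchy_form us.
  move=> d d0; have [|N hN] := bcauchy (d / 2); first by rewrite divr_gt0.
  exists N => j k Nj Nk; have := hN _ _ Nj Nk.
  have Xjk := subspaceB bform (Xus j) (Xus k).
  have := b_coercive Xjk; have := dot_ge0 (XP Xjk); lra.
have [u Pu du] : exists2 u, P u & dot (us k - u) (us k - u) @[k --> \oo] --> 0.
  apply: complete => [k|d d0]; first exact: XP.
  have [|N hN] := bcauchy (d / 2); first by rewrite divr_gt0.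
  exists N => j k Nj Nk; have := hN _ _ Nj Nk.
  have Xjk := subspaceB bform (Xus j) (Xus k).
  have := b_coercive Xjk; have := a_ge0 Xjk; lra.
have PS : P (\sum_i dot u (e i) *: e i) by apply: (subspace_sum hd).
have PlS := subspaceZ hd M PS; have Plu := subspaceZ hd l Pu.
have Pfu := subspaceD hd Pf Plu.
exists u; split; first exact: (subspaceB hd).
exists us; split => // v Xv; have Pv := XP Xv.
have Pus k : P (us k) by exact: XP.
have bv : b (us k) v @[k --> \oo] --> dot f v.
  apply/cvgrPdist_lt => d d0.
  have bvv := form_ge0 bform Xv.
  have [|N hN] := small (d ^+ 2 / (b v v + 1)).
    by rewrite divr_gt0 ?exprn_gt0 //; lra.
  exists N => // k /= Nk.
  (* Moving from us k along t v lowers [J f] by at most 1 / (k + 1), for every t. *)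
  set q := dot f v - b (us k) v.
  have hq t : 0 <= k.+1%:R^-1 - 2 * t * q + t ^+ 2 * b v v.
    have Xt := subspaceZ bform t Xv.
    have := leJ _ (subspaceD bform (Xus k) Xt).
    rewrite /J (formDD bform) // (formZZ bform) // (formZr bform) //.
    rewrite (formDr hd) ?(formZr hd) //; last exact: XP.
    move: (Jus k); rewrite /J /q; move: (k.+1%:R^-1) => s Jk leE.
    suff : 0 <= s - 2 * t * (dot f v - b (us k) v) + t ^+ 2 * b v v by [].
    move: Jk leE; move: (inf E) (b _ _) (b _ _) (b _ _) (dot _ _) (dot _ _) => *; lra.
  exact: (small_of_quadratic bvv d0 (hN _ Nk) hq).
have dv w : P w -> dot (us k) w @[k --> \oo] --> dot u w by move=> Pw; exact: dot_cvgl.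
rewrite (formBl hd) // (formDl hd) // !(formZl hd) // (form_suml hd) //.
have -> : (fun k => a (us k) v) = (fun k => b (us k) v + l * dot (us k) v -
    M * \sum_i dot (us k) (e i) * dot v (e i)).
  by apply/funext => k; rewrite /b; ring.
have -> : \sum_i dot u (e i) * dot (e i) v = \sum_i dot u (e i) * dot v (e i).
  by apply: eq_bigr => i _; rewrite (dotC Pv).
apply: cvgB; first by apply: cvgD => //; apply: cvgM; [exact: cvg_cst|exact: dv].
apply: cvgM; first exact: cvg_cst.
apply: cvg_sumr => i; apply: cvgM; [exact: dv|exact: cvg_cst].
Qed.

(** Testing the equation with [u] and using coercivity gives dot u u <= 2 dot f u. *)
Lemma penalized_bound u f : P f -> penalized_op u f -> nrm u <= 2 * nrm f.
Proof.
move=> Pf uf; have Pu := aform_opP uf; have h := aform_op_controls Pe ce uf.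
have u_ge0 := dot_ge0 Pu; have g_ge0 := aform_op_ge0 uf.
have PS : P (\sum_i dot u (e i) *: e i) by apply: (subspace_sum hd).
have PlS := subspaceZ hd M PS; have Plu := subspaceZ hd l Pu.
have Pfu := subspaceD hd Pf Plu.
move: h g_ge0.
rewrite (formBl hd) // (formDl hd) // !(formZl hd) // (form_suml hd) //.
have -> : \sum_i dot u (e i) * dot (e i) u = \sum_i dot u (e i) ^+ 2.
  by apply: eq_bigr => i _; rewrite (dotC (Pe i)) // expr2.
set S := \sum_i _; set A := _ - M * S => h A0.
have h1 : M * dot u u <= M * (S + eps * (A + dot u u)) by rewrite ler_wpM2l.
have h2 : (l + 1) * dot u u <= M * dot u u by rewrite ler_wpM2r.
have h3 : M * eps * (A + dot u u) <= 1 / 2 * (A + dot u u).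
  by rewrite ler_wpM2r // addr_ge0.
have h4 : dot u u <= 2 * dot f u.
  move: h1; rewrite mulrDr mulrA => h1.
  have : A = dot f u + l * dot u u - M * S by []. lra.
have h5 : dot u u <= 2 * nrm f * nrm u.
  apply: le_trans h4 _; rewrite -mulrA ler_pM2l //.
  exact: le_trans (ler_norm _) (form_le_norm hd Pf Pu).
have [->|nu0] := eqVneq (nrm u) 0; first by rewrite mulr_ge0 ?form_norm_ge0.
have nu_gt0 : 0 < nrm u by rewrite lt_def nu0 form_norm_ge0.
by rewrite -(ler_pM2r nu_gt0) -expr2 (form_normK hd).
Qed.

Lemma penalized_lin c u v f g : penalized_op u f -> penalized_op v g ->
  P f -> P g -> penalized_op (c *: u + v) (c *: f + g).
Proof.
move=> uf vg Pf Pg; have := aform_op_lin c uf vg; rewrite /penalized_op.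
have Pu := aform_opP uf; have Pv := aform_opP vg.
suff -> : c *: f + g + l *: (c *: u + v) - M *: \sum_i dot (c *: u + v) (e i) *: e i =
  c *: (f + l *: u - M *: \sum_i dot u (e i) *: e i) +
  (g + l *: v - M *: \sum_i dot v (e i) *: e i) by [].
have -> : \sum_i dot (c *: u + v) (e i) *: e i =
    c *: (\sum_i dot u (e i) *: e i) + \sum_i dot v (e i) *: e i.
  rewrite scaler_sumr -big_split; apply: eq_bigr => i _ /=.
  by rewrite dotlin // scalerDl scalerA.
set A := \sum_i _; set B := \sum_i _.
rewrite !scalerDr scalerN !scalerA [l * c]mulrC [M * c]mulrC opprD !addrA.
congr (_ + _); rewrite -!addrA; congr (_ + _).
by rewrite addrCA; congr (_ + _); rewrite addrA addrC.
Qed.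

Lemma penalized_sum (I : finType) (c : I -> R) (u f : I -> V) :
  (forall i, P (f i)) -> (forall i, penalized_op (u i) (f i)) ->
  penalized_op (\sum_i c i *: u i) (\sum_i c i *: f i).
Proof.
move=> Pf uf.
have p0 : penalized_op 0 0.
  rewrite /penalized_op scaler0 addr0 big1 ?scaler0 ?subrr; first exact: aform_op0.
  by move=> i _; rewrite (form0l hd) ?scale0r.
suff [] : P (\sum_i c i *: f i) /\ penalized_op (\sum_i c i *: u i) (\sum_i c i *: f i) by [].
apply: (big_ind2 (fun u f => P f /\ penalized_op u f)) => [//||i _].
- move=> x1 x2 y1 y2 [Px h1] [Py h2]; split; first exact: (subspaceD hd).
  by have := penalized_lin 1 h1 h2; rewrite !scale1r; exact.
- split; first exact: (subspaceZ hd).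
  by have := penalized_lin (c i) (uf i) p0; rewrite !addr0; exact.
Qed.

(* Removing the penalty amounts to solving a square linear system for the
   coordinates of the solution along the e i. *)
Lemma penalized_fredholm :
  (forall u, aform_op u (l *: u) -> dot u u = 0) ->
  (forall f, P f -> exists u, aform_op u (f + l *: u)) /\
  exists c, forall u f, P f -> aform_op u (f + l *: u) -> nrm u <= c * nrm f.
Proof.
move=> noeig.
(* [T] is a solution map picked by choice; it is used only through the equation it satisfies, never
   as a linear map. *)
have /choice[T hT] f : exists u, P f -> penalized_op u f.
  by have [/penalized_solution[u]|] := pselect (P f); [exists u|exists 0].
have PT f : P f -> P (T f) by move=> /hT /aform_opP.
pose B : 'M[R]_n := \matrix_(i, j) dot (T (e i)) (e j).
pose w (c : 'rV[R]_n) := \sum_i (M * c 0 i) *: T (e i).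
have hw c : penalized_op (w c) (\sum_i (M * c 0 i) *: e i).
  by apply: penalized_sum => // i; exact: hT.
have dw c j : dot (w c) (e j) = M * (c *m B) 0 j.
  rewrite /w (form_suml hd) // => [|i]; last exact: PT.
  rewrite !mxE mulr_sumr; apply: eq_bigr => i _; rewrite mxE; ring.
have sumM (c : 'I_n -> R) : \sum_i (M * c i) *: e i = M *: \sum_i c i *: e i.
  by rewrite scaler_sumr; apply: eq_bigr => i _; rewrite scalerA.
(* If c = M c B, then [w c] has coordinates [c] along the [e i], so that its penalty cancels its
   right-hand side and A (w c) = l (w c). The absence of eigenvectors makes [w c] null, hence c =
   0. *)
have unitB : 1%:M - M *: B \in unitmx.
  rewrite -row_free_unit -kermx_eq0; apply/negPn/negP => /rowV0Pn[c /sub_kermxP].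
  rewrite mulmxBr mulmx1 -scalemxAr => /eqP; rewrite subr_eq0 => /eqP cB c0.
  have dwc j : dot (w c) (e j) = c 0 j.
    have cBj : c 0 j = M * (c *m B) 0 j by rewrite [in LHS]cB mxE.
    by rewrite dw cBj.
  have : aform_op (w c) (l *: w c).
    have := hw c; rewrite /penalized_op sumM.
    under [in X in _ - _ *: X]eq_bigr do rewrite dwc.
    by rewrite [_ + l *: _]addrC addrK.
  move=> /[dup] /aform_opP Pw /noeig w0.
  move/eqP: c0; apply; apply/rowP => j; rewrite mxE -dwc.
  apply/eqP; rewrite -sqrf_eq0; apply/eqP/le_anti; rewrite sqr_ge0 andbT.
  have := form_CauchySchwarz hd Pw (Pe j); by rewrite w0 mul0r.
pose N := invmx (1%:M - M *: B).
pose d f : 'rV[R]_n := \row_j dot (T f) (e j).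
(* The right-hand side is corrected by the combination of the [e i] with coefficients M c, where c =
   d f N is chosen so that [u0 f] has exactly the coordinates [c]; the penalty then drops out. *)
pose u0 f := T f + w (d f *m N).
have hu0 f : P f -> penalized_op (u0 f) (f + \sum_i (M * (d f *m N) 0 i) *: e i).
  move=> Pf; have := penalized_lin 1 (hT f Pf) (hw (d f *m N)) Pf.
  by rewrite !scale1r; apply; apply: (subspace_sum hd).
have du0 f j : P f -> dot (u0 f) (e j) = (d f *m N) 0 j.
  move=> Pf; rewrite (formDl hd) ?dw //; [|exact: PT|exact: aform_opP (hw _)].
  have : d f *m N *m (1%:M - M *: B) = d f by rewrite -mulmxA mulVmx // mulmx1.
  rewrite mulmxBr mulmx1 -scalemxAr => /eqP; rewrite subr_eq => /eqP h.
  have -> : (d f *m N) 0 j = d f 0 j + M * (d f *m N *m B) 0 j.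
    have addE (A C : 'rV[R]_n) : (A + M *: C) 0 j = A 0 j + M * C 0 j by rewrite !mxE.
    by rewrite [in LHS]h addE.
  by rewrite [d f 0 j]mxE.
have su0 f : P f -> aform_op (u0 f) (f + l *: u0 f).
  move=> Pf; have := hu0 f Pf; rewrite /penalized_op sumM.
  under [in X in _ - _ *: X]eq_bigr do rewrite du0 //.
  by rewrite addrAC addrK.
split; first by move=> f Pf; exists (u0 f); exact: su0.
(* The sum bounds the correction, with |dot (T f) (e j)| <= 2 |f| |e j| from [penalized_bound]; the
   outer 2 is that bound applied to [u0 f]. *)
exists (2 * (1 + \sum_i M * (\sum_j 2 * nrm (e j) * `|N j i|) * nrm (e i))) => u f Pf uf.
have Pu := aform_opP uf; have Pu0 := aform_opP (su0 f Pf).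
(* Two solutions differ by a solution of the homogeneous equation, which is null by assumption. *)
have -> : nrm u = nrm (u0 f).
  have diff0 : nrm (u - u0 f) = 0.
    rewrite /form_norm noeig ?sqrtr0 //.
    have := aform_opB uf (su0 f Pf).
    by rewrite [- (f + _)]opprD addrACA subrr add0r -scalerBr.
  apply/eqP; rewrite eq_le; apply/andP; split.
    have := form_normD hd (subspaceB hd Pu Pu0) Pu0.
    by rewrite subrK diff0 add0r.
  have := form_normD hd (subspaceB hd Pu0 Pu) Pu; rewrite subrK.
  by rewrite -[u0 f - u]opprB -scaleN1r (form_normZ hd) ?diff0 ?mulr0 ?add0r //; exact: (subspaceB hd).
have PS : P (\sum_i (M * (d f *m N) 0 i) *: e i) by apply: (subspace_sum hd).
apply: le_trans (penalized_bound (subspaceD hd Pf PS) (hu0 f Pf)) _.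
rewrite -mulrA ler_pM2l // mulrDl mul1r.
apply: le_trans (form_normD hd Pf PS) _; rewrite lerD2l.
apply: le_trans (form_norm_sum hd _ Pe) _; rewrite mulr_suml; apply: ler_sum => i _.
rewrite normrM (ger0_norm M0) -!mulrA ler_wpM2l // [nrm (e i) * _]mulrC mulrA.
rewrite ler_wpM2r ?form_norm_ge0 // mxE mulr_suml.
apply: le_trans (ler_norm_sum _ _ _) _; apply: ler_sum => j _.
rewrite normrM mxE [leRHS]mulrAC ler_wpM2r //.
apply: le_trans (form_le_norm hd (PT f Pf) (Pe j)) _.
rewrite [leRHS]mulrAC ler_wpM2r ?form_norm_ge0 //.
exact: penalized_bound (hT f Pf).
Qed.

End Coercive.

Lemma aform_fredholm l :
  (forall u, aform_op u (l *: u) -> dot u u = 0) ->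
  (forall f, P f -> exists u, aform_op u (f + l *: u)) /\
  exists c, forall u f, P f -> aform_op u (f + l *: u) -> nrm u <= c * nrm f.
Proof.
pose M := `|l| + 1; have M0 : 0 < M by rewrite ltr_wpDl.
have eps0 : 0 < (2 * M)^-1 by rewrite invr_gt0 mulr_gt0.
have [n [e [Pe ce]]] := compactly_controlled eps0.
apply: (penalized_fredholm Pe ce (M := M)); last 2 first.
- exact: ltW.
- by rewrite le_eqVlt; apply/orP; left; apply/eqP; field; rewrite lt0r_neq0.
- by rewrite lerD2r ler_norm.
Qed.

End CompactForms.

(** * Square integrable functions on the plane *)

Section PlaneMeasure.
Variable R : realType.
Local Notation mR := (measurableTypeR R).
Local Notation plane := (mR * mR)%type.
Implicit Types (A E Om : set (R * R)) (u v w f : R * R -> R).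

Definition open_box (a b c d : R) : set (R * R) := `]a, b[ `*` `]c, d[.

Lemma measurable_box (I J : interval R) :
  measurable (([set` I] `*` [set` J]) : set plane).
Proof. by apply: measurableX; exact: measurable_itv. Qed.

Lemma ball_pairE (p q : R * R) (e : R) :
  ball p e q <-> `|p.1 - q.1| < e /\ `|p.2 - q.2| < e.
Proof. by []. Qed.

Lemma open_planeP A : open A <-> forall p, A p -> exists2 e, 0 < e &
  forall q, `|p.1 - q.1| < e -> `|p.2 - q.2| < e -> A q.
Proof.
rewrite openE; split=> h p Ap.
  have /nbhs_ballP[e /= e0 he] := h p Ap.
  by exists e => // q q1 q2; apply: he.
have [e e0 he] := h p Ap; apply/nbhs_ballP; exists e => //= q [q1 q2]; exact: he.
Qed.

Lemma area_ae_filter : Filter (nbhs (almost_everywhere (area R))).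
Proof. exact: ae_filter_ringOfSetsType. Qed.
Existing Instance area_ae_filter.

(** Measurability is meant in the product sigma-algebra that carries [area]: an open set is the
    countable union of the squares with rational centre and radius that it contains. *)
Lemma open_measurable_plane A : open A -> measurable (A : set plane).
Proof.
move=> /open_planeP oA.
pose box (q : rat * rat * rat) : set plane := open_box
  (ratr q.1.1 - ratr q.2) (ratr q.1.1 + ratr q.2)
  (ratr q.1.2 - ratr q.2) (ratr q.1.2 + ratr q.2).
pose F q : set plane := if `[< box q `<=` A >] then box q else set0.
have -> : A = \bigcup_q F q.
  apply/seteqP; split => [p Ap|p [q _]]; last first.
    by rewrite /F; case: asboolP => // + ?; exact.
  have [e e0 he] := oA _ Ap.
  have [c] : exists c : rat, ratr c \in `](e / 4), (e / 2)[ by apply: rat_in_itvoo; lra.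
  have [a] : exists a : rat, ratr a \in `](p.1 - e / 4), (p.1 + e / 4)[ by apply: rat_in_itvoo; lra.
  have [b] : exists b : rat, ratr b \in `](p.2 - e / 4), (p.2 + e / 4)[ by apply: rat_in_itvoo; lra.
  rewrite !in_itv /= => /andP[b1 b2] /andP[a1 a2] /andP[c1 c2].
  exists (a, b, c) => //; rewrite /F; case: asboolP => [_|].
    by split => /=; rewrite in_itv /=; lra.
  case=> x [/=]; rewrite !in_itv /= => x1 x2; apply: he; rewrite ltr_norml; lra.
apply: countable_bigcupT_measurable => [|q]; first exact: countableP.
rewrite /F; case: asboolP => _ //; exact: measurable_box.
Qed.

Lemma closed_measurable_plane A : closed A -> measurable (A : set plane).
Proof.
by move=> cA; rewrite -[A]setCK; apply: measurableC; apply: open_measurable_plane; exact: closed_openC.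
Qed.

Lemma continuous_measurable_plane f : continuous f ->
  measurable_fun [set: plane] (f : plane -> R).
Proof.
move=> cf; apply: (measurability (@measurable_realfun.RGenOInfty.G R)); first exact: measurable_realfun.RGenOInfty.measurableE.
move=> _ [_ [x ->] <-]; rewrite setTI; apply: open_measurable_plane.
by apply: open_comp => // p _; exact: cf.
Qed.

Lemma tonelli_xy (F : plane -> \bar R) : @measurable_fun _ _ plane (\bar R) setT F ->
  (forall p, 0 <= F p)%E ->
  (\int[area R]_p F p =
   \int[lebesgue_measure]_(x in [set: mR]) \int[lebesgue_measure]_(y in [set: mR]) F (x, y))%E.
Proof. by move=> mF F0; rewrite /area fubini_tonelli1. Qed.

Lemma tonelli_yx (F : plane -> \bar R) : @measurable_fun _ _ plane (\bar R) setT F ->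
  (forall p, 0 <= F p)%E ->
  (\int[area R]_p F p =
   \int[lebesgue_measure]_(y in [set: mR]) \int[lebesgue_measure]_(x in [set: mR]) F (x, y))%E.
Proof. by move=> mF F0; rewrite /area fubini_tonelli2. Qed.

Definition energy E f : \bar R := (\int[area R]_(p in E) (f p ^+ 2)%:E)%E.

Lemma energy_ge0 E f : (0 <= energy E f)%E.
Proof. by apply: integral_ge0 => x _; rewrite lee_fin sqr_ge0. Qed.

Lemma measurable_sqrE E f : measurable_fun (E : set plane) (f : plane -> R) ->
  measurable_fun (E : set plane) (fun p : plane => (f p ^+ 2)%:E).
Proof. by move=> mf; apply/measurable_EFinP; exact: measurable_funX. Qed.

Lemma energy_subset A E f : measurable (A : set plane) -> measurable (E : set plane) ->
  measurable_fun (E : set plane) (f : plane -> R) -> A `<=` E ->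
  (energy A f <= energy E f)%E.
Proof.
move=> mA mE mf AE; apply: ge0_subset_integral => //; first exact: measurable_sqrE.
by move=> x _; rewrite lee_fin sqr_ge0.
Qed.

Lemma eq_energy E f g : (forall p, E p -> f p = g p) -> energy E f = energy E g.
Proof. by move=> fg; apply: eq_integral => x /[!inE] Ex; rewrite fg. Qed.

Lemma ae_eq_energy E f g : measurable (E : set plane) ->
  measurable_fun (E : set plane) (f : plane -> R) ->
  measurable_fun (E : set plane) (g : plane -> R) ->
  eq_ae_on E f g -> energy E f = energy E g.
Proof.
move=> mE mf mg fg; apply: ae_eq_integral => //; [exact: measurable_sqrE..|].
by apply: filterS fg => x fgx Ex; rewrite fgx.
Qed.

Lemma Lnorm2_energy E f : (L2norm E f `^ 2)%E = energy E f.
Proof.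
rewrite /L2norm poweR_Lnorm // /energy [RHS]integral_mkcond; apply: eq_integral => p _.
rewrite /= !patchE; case: ifPn => pE.
  by rewrite powR_mulrn // real_normK ?num_real.
by rewrite normr0 powR0.
Qed.

Lemma L2normE E f : L2norm E f = (energy E f `^ 2^-1)%E.
Proof. by rewrite -Lnorm2_energy -poweRrM divff // poweRe1 // Lnorm_ge0. Qed.

Variable Om : set (R * R).
Hypothesis mOm : measurable (Om : set plane).

Lemma L2P u : L2 Om u <->
  measurable_fun (Om : set plane) (u : plane -> R) /\ (energy Om u < +oo)%E.
Proof.
rewrite /L2 inE /=; split.
  move=> /andP[]; rewrite !inE /= => mu fu.
  have {}mu : measurable_fun (Om : set plane) (u : plane -> R).
    by apply/(measurable_restrictT _ mOm).
  split => //; rewrite -Lnorm2_energy; apply: poweR_lty; exact: fu.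
move=> [mu fu]; apply/andP; rewrite !inE /=; split.
  by apply/(measurable_restrictT _ mOm).
by rewrite /finite_norm -/(L2norm Om u) L2normE poweR_lty.
Qed.

Lemma L2_measurable u : L2 Om u -> measurable_fun (Om : set plane) (u : plane -> R).
Proof. by move=> /L2P[]. Qed.

Lemma energy_fin u : L2 Om u -> energy Om u \is a fin_num.
Proof. by move=> /L2P[_ ?]; rewrite ge0_fin_numE // energy_ge0. Qed.

Lemma integrable_sqr u : L2 Om u -> (area R).-integrable Om (fun p => (u p ^+ 2)%:E).
Proof.
move=> /L2P[mu fu]; apply/integrableP; split; first exact: measurable_sqrE.
by under eq_integral do rewrite gee0_abs ?lee_fin ?sqr_ge0 //.
Qed.

Lemma L2_integrableM u v : L2 Om u -> L2 Om v ->
  (area R).-integrable Om (EFin \o (fun p => u p * v p)).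
Proof.
move=> u2 v2.
have iD : (area R).-integrable Om (fun p => (u p ^+ 2 + v p ^+ 2)%:E).
  apply: (@eq_integrable _ _ _ _ _ mOm ((fun p => (u p ^+ 2)%:E) \+ (fun p => (v p ^+ 2)%:E))%E).
    by move=> p _ /=; rewrite -EFinD.
  by apply: integrableD => //; exact: integrable_sqr.
apply: (le_integrable mOm _ _ iD).
- by apply/measurable_EFinP; apply: measurable_funM; exact: L2_measurable.
- move=> p _ /=; rewrite lee_fin [leRHS]ger0_norm ?addr_ge0 ?sqr_ge0 //.
  rewrite ler_norml; have := sqr_ge0 (u p - v p); have := sqr_ge0 (u p + v p); nra.
Qed.

Lemma L2dot_energy u : L2 Om u -> (L2dot Om u u)%:E = energy Om u.
Proof.
by move=> u2; rewrite /L2dot /Rintegral fineK; [|exact: energy_fin].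
Qed.

Lemma L2_lin c u v : L2 Om u -> L2 Om v -> L2 Om (c *: u + v).
Proof.
move=> u2 v2; have mu := L2_measurable u2; have mv := L2_measurable v2.
have mcuv : measurable_fun (Om : set plane) ((c *: u + v) : plane -> R).
  by apply: measurable_funD => //; apply: measurable_funM.
apply/L2P; split => //.
have : (area R).-integrable Om (fun p => ((2 * c ^+ 2) * u p ^+ 2 + 2 * v p ^+ 2)%:E).
  apply: (@eq_integrable _ _ _ _ _ mOm ((fun p => (2 * c ^+ 2)%:E * (u p ^+ 2)%:E) \+ (fun p => 2%:E * (v p ^+ 2)%:E))%E).
    by move=> p _ /=; rewrite -!EFinM -EFinD.
  by apply: integrableD => //; apply: integrableZl => //; exact: integrable_sqr.
move=> /integrableP[m /(le_lt_trans _)]; apply; apply: ge0_le_integral => //.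
- by move=> p _; rewrite lee_fin sqr_ge0.
- exact: measurable_sqrE.
- exact: measurableT_comp.
move=> p _ /=; rewrite lee_fin ger0_norm; first last.
  by rewrite addr_ge0 // mulr_ge0 ?sqr_ge0 // mulr_ge0 ?sqr_ge0.
rewrite -[(c *: u + v) p]/(c * u p + v p).
have := sqr_ge0 (c * u p - v p); nra.
Qed.

Lemma L2_0 : L2 Om 0.
Proof.
apply/L2P; split; first exact: measurable_cst.
rewrite /energy (eq_integral (cst 0%E)) ?integral0 // => p _.
by rewrite -[(0 : R * R -> R) p]/(0 : R) expr0n.
Qed.

Lemma L2dot_nonneg_form : nonneg_form (L2 Om) (@L2dot R Om).
Proof.
split.
- exact: L2_0.
- exact: L2_lin.
- by move=> u v _ _; apply: eq_Rintegral => p _; rewrite mulrC.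
- move=> c u v w u2 v2 w2; rewrite /L2dot -RintegralZl //; last exact: L2_integrableM.
  rewrite -RintegralD //; last 2 first.
  + have := integrableZl mOm c (L2_integrableM u2 w2).
    by apply: eq_integrable => // p _ /=; rewrite EFinM.
  + exact: L2_integrableM.
  apply: eq_Rintegral => p _; rewrite -[(c *: u + v) p]/(c * u p + v p); ring.
- by move=> u _; apply: Rintegral_ge0 => p _; rewrite -expr2 sqr_ge0.
Qed.

Lemma L2norm_dot u : L2 Om u -> L2norm Om u = (form_norm (@L2dot R Om) u)%:E.
Proof.
move=> u2; rewrite L2normE -L2dot_energy // poweR_EFin /form_norm powR12_sqrt //.
exact: (form_ge0 L2dot_nonneg_form).
Qed.

Lemma ae_eq_L2dot u v w : L2 Om u -> L2 Om v -> L2 Om w -> eq_ae_on Om u v ->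
  L2dot Om u w = L2dot Om v w.
Proof.
move=> u2 v2 w2 uv; rewrite /L2dot /Rintegral; congr fine.
apply: ae_eq_integral => //.
- by apply/measurable_EFinP; apply: measurable_funM; exact: L2_measurable.
- by apply/measurable_EFinP; apply: measurable_funM; exact: L2_measurable.
- by apply: filterS uv => p uvp Op; rewrite uvp.
Qed.

Lemma L2dot_eq0 u : L2 Om u -> L2dot Om u u = 0 -> eq_ae_on Om u (fun=> 0).
Proof.
move=> u2 u0; have mu := L2_measurable u2.
have : (\int[area R]_(p in Om) `|(u p ^+ 2)%:E| = 0)%E.
  under eq_integral do rewrite gee0_abs ?lee_fin ?sqr_ge0 //.
  by rewrite -/(energy Om u) -L2dot_energy // u0.
move/(ae_eq_integral_abs _ mOm (measurable_sqrE mu)).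
apply: filterS => p h Op; have := h Op => /= -[] /eqP.
by rewrite sqrf_eq0 => /eqP.
Qed.

End PlaneMeasure.
#[global] Existing Instance area_ae_filter.

(** * Completeness of L2 *)

Section L2Complete.
Variable R : realType.
Local Notation mR := (measurableTypeR R).
Local Notation plane := (mR * mR)%type.
Variable Om : set (R * R).
Hypothesis mOm : measurable (Om : set plane).

(** The steps are at most sqrt C / 2^k, hence summable. *)
Lemma cvg_of_geometric_steps (x : nat -> R) (C : R) : 0 <= C ->
  (forall k, 4 ^+ k * (x k.+1 - x k) ^+ 2 <= C) -> cvgn x.
Proof.
move=> C0 hx.
have step k : `|telescope x k| <= Num.sqrt C * 2^-1 ^+ k.
  rewrite -(@ler_pXn2r _ 2) ?nnegrE ?mulr_ge0 ?sqrtr_ge0 ?exprn_ge0 //.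
  rewrite real_normK ?num_real // exprMn sqr_sqrtr // exprAC.
  have -> : (2^-1 ^+ 2 : R) = 4^-1 by field.
  by rewrite exprVn ler_pdivlMr ?exprn_gt0 // mulrC /telescope.
have : cvgn (series (telescope x)).
  apply: normed_cvg; apply: (@series_le_cvg _ _ (geometric (Num.sqrt C) 2^-1)).
  - by move=> n; exact: normr_ge0.
  - by move=> n; rewrite /= mulr_ge0 ?sqrtr_ge0 ?exprn_ge0.
  - exact: step.
  - by apply: is_cvg_geometric_series; rewrite ger0_norm ?invf_lt1 ?ltr1n.
rewrite telescopeK => /cvg_ex[l hl].
apply/cvg_ex; exists (l + x 0%N).
suff : (x n - x 0%N) + x 0%N @[n --> \oo] --> l + x 0%N.
  by under eq_fun do rewrite subrK.
by apply: cvgD; [exact: hl|exact: cvg_cst].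
Qed.

Lemma measurable_L2B u v : L2 Om u -> L2 Om v ->
  measurable_fun (Om : set plane) ((fun p => u p - v p) : plane -> R).
Proof. by move=> u2 v2; apply: measurable_funB; exact: L2_measurable. Qed.

Lemma L2B u v : L2 Om u -> L2 Om v -> L2 Om (u - v).
Proof. exact: (subspaceB (L2dot_nonneg_form mOm)). Qed.

(** The sum of 4^k |g (k + 1) - g k|^2 has integral at most sum_k 4^k 8^-k = 2, so it is finite
    almost everywhere, and there the steps decay geometrically. *)
Lemma L2_ae_limit (g : nat -> R * R -> R) : (forall k, L2 Om (g k)) ->
  (forall k, (energy Om (g k.+1 - g k)%R <= (8^-1 ^+ k)%:E)%E) ->
  exists2 u : R * R -> R, measurable_fun (Om : set plane) (u : plane -> R) &
    {ae area R, forall p, Om p -> g k p @[k --> \oo] --> u p}.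
Proof.
move=> g2 hg.
pose S (p : plane) : \bar R := (\sum_(k <oo) (4 ^+ k * (g k.+1 p - g k p) ^+ 2)%:E)%E.
have t0 k (p : plane) : (0 <= (4 ^+ k * (g k.+1 p - g k p) ^+ 2)%:E)%E.
  by rewrite lee_fin mulr_ge0 ?sqr_ge0 // exprn_ge0.
have mt k : measurable_fun (Om : set plane) (fun p : plane => (4 ^+ k * (g k.+1 p - g k p) ^+ 2)%:E).
  apply/measurable_EFinP; apply: measurable_funM; first exact: measurable_cst.
  by apply: measurable_funX; exact: measurable_L2B.
have iS : (\int[area R]_(p in Om) S p <= (2 : R)%:E)%E.
  rewrite integral_nneseries //.
  apply: (@le_trans _ _ (\sum_(k <oo) (1 * 2^-1 ^+ k)%:E)%E).
    apply: lee_nneseries => [k _|k _]; first by move=> ?; apply: integral_ge0 => p _; exact: t0.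
    under eq_integral do rewrite EFinM.
    rewrite ge0_integralZl_EFin ?exprn_ge0 //; first last.
    - by apply: measurable_sqrE; exact: measurable_L2B.
    - by move=> p _; rewrite lee_fin sqr_ge0.
    have -> : (1 * 2^-1 ^+ k : R)%:E = ((4 ^+ k)%:E * (8^-1 ^+ k)%:E)%E.
      by rewrite -EFinM -exprMn mul1r; congr (_ ^+ _)%:E; field.
    by rewrite lee_pmul2l ?lte_fin ?exprn_gt0 //; exact: hg.
  have := @cvg_geometric_series R 1 2^-1; rewrite ger0_norm ?invf_lt1 ?ltr1n // => /(_ isT) h.
  move: h; have -> : 1 / (1 - 2^-1) = 2 :> R by field.
  move=> h; rewrite le_eqVlt; apply/orP; left; apply/eqP.
  apply/cvg_lim => //; rewrite (_ : (fun n => _) = EFin \o (series (geometric 1 2^-1))).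
    by apply: cvg_EFin => //; exact: nearW.
  by apply/funext => n /=; rewrite /series /= -sumEFin.
have intS : (area R).-integrable Om S.
  apply/integrableP; split.
    by apply: ge0_emeasurable_sum => // k x _ _; exact: t0.
  under eq_integral do rewrite gee0_abs ?nneseries_ge0 //.
  by apply: le_lt_trans iS _; rewrite ltry.
(* An upper limit is measurable without any knowledge of where the sequence converges. *)
pose u (p : plane) := fine (limn_esup (fun k => (g k p)%:E)).
exists u.
  apply: (measurableT_comp (@fine_measurable R setT measurableT)) => //.
  by apply: measurable_fun_limn_esup => k; apply/measurable_EFinP; exact: L2_measurable.
have := integrable_ae mOm intS; apply: filterS => p + Op => /(_ Op) Sfin.
have : cvgn (g^~ p).
  apply: (@cvg_of_geometric_steps _ (fine (S p))).
    by apply: fine_ge0; apply: nneseries_ge0.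
  move=> k; rewrite -lee_fin fineK //.
  apply: le_trans (nneseries_lim_ge k.+1 _) => [|i _ _]; last exact: t0.
  rewrite big_nat_recr //= leeDr //.
  by apply: sume_ge0 => i _; exact: t0.
move=> /cvg_ex[l hl]; rewrite /u.
have hle : (g k p)%:E @[k --> \oo] --> l%:E by apply: cvg_EFin => //; exact: nearW.
by rewrite (cvg_limn_einf_sup hle).2.
Qed.

(** A fast subsequence converges almost everywhere; Fatou's lemma along it bounds the distance from
    us j to the limit by the Cauchy error of the whole sequence. *)
Lemma L2_complete (us : nat -> R * R -> R) : (forall k, L2 Om (us k)) ->
  (forall e, 0 < e -> exists N : nat, forall j k, (N <= j)%N -> (N <= k)%N ->
    L2dot Om (us j - us k) (us j - us k) < e) ->
  exists2 u, L2 Om u & L2dot Om (us k - u) (us k - u) @[k --> \oo] --> 0.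
Proof.
move=> us2 hus.
have mus k : measurable_fun (Om : set plane) (us k : plane -> R) by exact: L2_measurable.
have /choice[N hN] k : exists N : nat, forall i j, (N <= i)%N -> (N <= j)%N ->
    (energy Om (us i - us j)%R <= (8^-1 ^+ k)%:E)%E.
  have [|N hN] := hus (8^-1 ^+ k); first by rewrite exprn_gt0.
  exists N => i j Ni Nj; rewrite -L2dot_energy //; last exact: L2B.
  by rewrite lee_fin ltW // hN.
(* This index is nondecreasing in k, at least k, and at least N i for every i <= k. *)
pose n k := (k + \sum_(i < k.+1) N i)%N.
have leNn k : (N k <= n k)%N by rewrite /n big_ord_recr /= addnA leq_addl.
have nS k : (n k <= n k.+1)%N by rewrite /n leq_add // [leqRHS]big_ord_recr /= leq_addr.
have [||u mu hu] := @L2_ae_limit (us \o n).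
- by move=> k; exact: us2.
- move=> k; apply: hN => //=; exact: leq_trans (leNn k) (nS k).
have key (e : R) : 0 < e -> \forall k \near \oo, (energy Om (us k - u)%R <= e%:E)%E.
  move=> e0; have [M hM] := hus _ e0; exists M => // j /= Mj.
  have -> : energy Om (us j - u) = (\int[area R]_(p in Om)
      limn_einf (fun k => ((us j p - us (n k) p) ^+ 2)%:E))%E.
    apply: ae_eq_integral => //.
    - by apply: measurable_sqrE; apply: measurable_funB.
    - apply: measurableT_comp => //; apply: measurable_fun_limn_esup => k.
      apply: measurableT_comp => //; apply: measurable_sqrE.
      by apply: measurable_funB; exact: mus.
    apply: filterS hu => p hp Op; apply/esym.
    apply: (cvg_limn_einf_sup _).1; apply: cvg_EFin; first exact: nearW.
    have h : us j p - us (n k) p @[k --> \oo] --> us j p - u p.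
      by apply: cvgB; [exact: cvg_cst|exact: hp].
    exact: (cvg_comp _ _ h (@exprn_continuous R 2 _)).
  apply: (le_trans (fatou _ _ _ _)) => //.
  - by move=> k; apply: measurable_sqrE; apply: measurable_funB; exact: mus.
  - by move=> k p _; rewrite lee_fin sqr_ge0.
  rewrite limn_einf_lim; apply: lime_le; first exact: is_cvg_einfs.
  exists M => // k /= Mk.
  apply: (@le_trans _ _ (energy Om (us j - us (n k))%R)).
    by apply: ereal_inf_lbound; exists k => //=.
  rewrite -L2dot_energy //; last exact: L2B.
  rewrite lee_fin ltW //; apply: hM => //.
  by apply: leq_trans Mk _; rewrite /n leq_addr.
have u2 : L2 Om u.
  have [M _ hM] := key _ ltr01; have := hM M (leqnn M) => /= h.
  have d2 : L2 Om (us M - u).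
    apply/(L2P mOm); split; first exact: measurable_funB.
    by apply: le_lt_trans h _; rewrite ltry.
  have := L2B (us2 M) d2; rewrite (_ : us M - (us M - u) = u) //.
  by rewrite opprB addrCA subrr addr0.
exists u => //; apply/cvgrPdist_le => e e0; have := key _ e0; apply: filterS => k.
have d2 := L2B (us2 k) u2.
rewrite -L2dot_energy // lee_fin sub0r normrN ger0_norm //.
exact: (form_ge0 (L2dot_nonneg_form mOm)).
Qed.

End L2Complete.

(** * Smooth functions on the plane *)

Section SmoothCalculus.
Variable R : realType.
Implicit Types (phi psi : R * R -> R) (p : R * R).

Lemma is_derive_line2 phi x t : differentiable phi (x, t) ->
  is_derive t 1 (fun s => phi (x, s)) (pder2 phi (x, t)).
Proof.
move=> /(@diff_derivable _ _ _ phi (x, t) ((0, 1) : R * R)) d.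
have E : (fun h : R => h^-1 *: ((fun s => phi (x, s)) (h *: 1 + t) - phi (x, t))) =
  (fun h : R => h^-1 *: (phi (h *: ((0, 1) : R * R) + (x, t)) - phi (x, t))).
  apply/funext => h; congr (_ *: (phi _ - _)).
  by rewrite [RHS]/GRing.add /= /add_pair /= /GRing.scale /= mulr0 add0r.
split; first by rewrite /derivable /= E.
by rewrite /derive /pder2 /derive /= E.
Qed.

Lemma is_derive_line1 phi x t : differentiable phi (x, t) ->
  is_derive x 1 (fun s => phi (s, t)) (pder1 phi (x, t)).
Proof.
move=> /(@diff_derivable _ _ _ phi (x, t) ((1, 0) : R * R)) d.
have E : (fun h : R => h^-1 *: ((fun s => phi (s, t)) (h *: 1 + x) - phi (x, t))) =
  (fun h : R => h^-1 *: (phi (h *: ((1, 0) : R * R) + (x, t)) - phi (x, t))).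
  apply/funext => h; congr (_ *: (phi _ - _)).
  by rewrite [RHS]/GRing.add /= /add_pair /= /GRing.scale /= mulr0 add0r.
split; first by rewrite /derivable /= E.
by rewrite /derive /pder1 /derive /= E.
Qed.

Lemma smooth_diff phi : smooth phi -> forall p, differentiable phi p.
Proof. by move=> h p; exact: (h 0%N 0%N p). Qed.

Lemma smooth_continuous phi : smooth phi -> continuous phi.
Proof. by move=> h p; apply: differentiable_continuous; exact: smooth_diff. Qed.

Lemma smooth_pder2 phi : smooth phi -> smooth (pder2 phi).
Proof. by move=> h m n p; have := h m n.+1 p; rewrite /pder iterSr. Qed.

Lemma smooth_pder1_diff phi : smooth phi -> forall p, differentiable (pder1 phi) p.
Proof. by move=> h p; exact: (h 1%N 0%N p). Qed.

Lemma mean_value (f df : R -> R) (a b : R) : (forall x, is_derive x (1 : R) f (df x)) ->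
  exists2 c, `|c - a| <= `|b - a| & f b - f a = df c * (b - a).
Proof.
move=> fd.
have cf : continuous f.
  by move=> x; apply: differentiable_continuous; apply/derivable1_diffP; case: (fd x).
have cw (u v : R) : {within `[u, v], continuous f} by exact: continuous_subspaceT.
case: (ltgtP a b) => ab; last by exists a; rewrite ?subrr ?normr0 ?ab ?subrr ?mulr0.
- have [c cab E] := MVT ab (fun x _ => fd x) (cw a b).
  exists c => //; move: cab; rewrite in_itv /= => /andP[ac cb].
  by rewrite !gtr0_norm ?subr_gt0 //; lra.
- have [c cab E] := MVT ab (fun x _ => fd x) (cw b a).
  exists c; last by rewrite -opprB E; ring.
  move: cab; rewrite in_itv /= => /andP[bc ca].
  by rewrite !ltr0_norm ?subr_lt0 //; lra.
Qed.

Lemma is_derive_eps (f : R -> R) (x d e : R) : is_derive x (1 : R) f d -> 0 < e ->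
  exists2 delta, 0 < delta & forall h, h != 0 -> `|h| < delta ->
    `|f (x + h) - f x - d * h| < e * `|h|.
Proof.
case=> dv dE e0.
have : h^-1 *: (f (h *: 1 + x) - f x) @[h --> 0^'] --> d.
  by rewrite -dE; exact: dv.
move/cvgrPdist_lt => /(_ _ e0); rewrite near_withinE => /nbhs_ballP[delta /= d0 hd].
exists delta => // h hn0 hlt; have := hd h; rewrite /ball /= sub0r normrN => /(_ hlt hn0).
rewrite -(@ltr_pM2r _ `|h|) ?normr_gt0 // -normrM mulrBl.
have -> : h^-1 *: (f (h *: 1 + x) - f x) * h = f (x + h) - f x.
  rewrite [h *: 1]mulr1 [h + x]addrC [_ *: _ * _]mulrAC mulVf ?mul1r //.
by rewrite distrC.
Qed.

Lemma continuous_plane_eps phi p (e : R) : continuous phi -> 0 < e ->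
  exists2 delta, 0 < delta & forall q, `|p.1 - q.1| < delta ->
    `|p.2 - q.2| < delta -> `|phi p - phi q| < e.
Proof.
move=> /(_ p) /cvgrPdist_lt cp e0; have := cp _ e0.
move=> /nbhs_ballP[delta /= d0 hd]; exists delta => // q q1 q2; exact: hd.
Qed.

(** Schwarz's theorem. By the mean value theorem applied twice, the second difference over a
    rectangle of sides h and k is h k times a value of D_1 D_2 phi nearby; up to a small error it is
    also h times an increment of D_1 phi in the second variable. *)
Lemma smooth_pder_comm phi : smooth phi -> pder2 (pder1 phi) = pder1 (pder2 phi).
Proof.
move=> sphi; apply/funext => -[x z].
have [A EA] : exists A, A = pder1 (pder2 phi) by eexists.
rewrite -EA.
have cA : continuous A.
  by rewrite EA => p; apply: differentiable_continuous; exact: (sphi 1%N 1%N p).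
have dphi := smooth_diff sphi.
have d1 := smooth_pder1_diff sphi.
have d2 := smooth_diff (smooth_pder2 sphi).
have quotient (h k : R) : exists2 q : R * R, `|x - q.1| <= `|h| /\ `|z - q.2| <= `|k| &
    phi (x + h, z + k) - phi (x, z + k) - (phi (x + h, z) - phi (x, z)) = A q * k * h.
  have D s : is_derive s (1 : R) (fun s => phi (x + h, s) - phi (x, s))
      (pder2 phi (x + h, s) - pder2 phi (x, s)).
    exact: (is_deriveB (is_derive_line2 (dphi (x + h, s))) (is_derive_line2 (dphi (x, s)))).
  have [c cz E] := mean_value z (z + k) D.
  have D2 s : is_derive s (1 : R) (fun s => pder2 phi (s, c)) (A (s, c)).
    by rewrite EA; apply: is_derive_line1.
  have [d dx E2] := mean_value x (x + h) D2.
  exists (d, c) => /=.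
    by move: cz dx; rewrite !(addrC _ h, addrC _ k) !addrK distrC (distrC d).
  have -> : phi (x + h, z + k) - phi (x, z + k) - (phi (x + h, z) - phi (x, z)) =
     (pder2 phi (x + h, c) - pder2 phi (x, c)) * (z + k - z) by rewrite -E.
  by rewrite E2; ring.
have line1 t : is_derive x (1 : R) (fun s => phi (s, t)) (pder1 phi (x, t)).
  exact: is_derive_line1.
have line2 : is_derive z (1 : R) (fun s => pder1 phi (x, s)) (pder2 (pder1 phi) (x, z)).
  exact: is_derive_line2.
have [//|] := eqVneq (pder2 (pder1 phi) (x, z)) (A (x, z)).
rewrite -subr_eq0 -normr_gt0 => a0; exfalso.
move: line2 a0; move: (pder2 (pder1 phi) (x, z)) => L line2 a0.
have [a Ea] : exists a, a = `|L - A (x, z)| by eexists.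
rewrite -Ea in a0.
have e0 : 0 < a / 4 by rewrite divr_gt0.
have [d d0 hd] := continuous_plane_eps (x, z) cA e0.
have [d' d'0 hd'] := is_derive_eps line2 e0.
pose k := Num.min d d' / 2.
have m0 : 0 < Num.min d d' by rewrite lt_min d0.
have k0 : 0 < k by rewrite divr_gt0.
have km : k < Num.min d d' by rewrite /k; lra.
have := km; rewrite lt_min => /andP[kd kd'].
(* The tolerance is proportional to k because the comparison is divided by k at the end; so h has to
   be chosen after k. *)
have ek0 : 0 < a / 4 * k by rewrite mulr_gt0.
have [d1' d10 hd1] := is_derive_eps (line1 (z + k)) ek0.
have [d2' d20 hd2] := is_derive_eps (line1 z) ek0.
pose h := Num.min d (Num.min d1' d2') / 2.
have m1 : 0 < Num.min d (Num.min d1' d2') by rewrite !lt_min d0 d10.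
have h0 : 0 < h by rewrite divr_gt0.
have hm : h < Num.min d (Num.min d1' d2') by rewrite /h; lra.
have := hm; rewrite !lt_min => /and3P[hdd hd1' hd2'].
have [q [q1 q2] E] := quotient h k.
move: q1 q2; rewrite (gtr0_norm h0) (gtr0_norm k0) => q1 q2.
have Aq : `|A (x, z) - A q| < a / 4 by apply: hd => /=; [exact: le_lt_trans q1 hdd|exact: le_lt_trans q2 kd].
have hL := hd' k (lt0r_neq0 k0); rewrite (gtr0_norm k0) in hL; have {}hL := hL kd'.
have hz1 := hd1 h (lt0r_neq0 h0); rewrite (gtr0_norm h0) in hz1; have {}hz1 := hz1 hd1'.
have hz2 := hd2 h (lt0r_neq0 h0); rewrite (gtr0_norm h0) in hz2; have {}hz2 := hz2 hd2'.
move: hL; set P1 := pder1 phi (x, z + k) in hz1 *; set P0 := pder1 phi (x, z) in hz2 *.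
have : `|A q * k * h - (P1 - P0) * h| < a / 2 * k * h.
  rewrite -E; move: hz1 hz2; rewrite !ltr_norml; clear; lra.
rewrite -mulrBl normrM (gtr0_norm h0) ltr_pM2r // => hA hL.
have : `|(A q - L) * k| < 3 / 4 * a * k.
  move: hA hL; rewrite mulrBl !ltr_norml; clear; lra.
rewrite normrM (gtr0_norm k0) ltr_pM2r // => hB.
have tri : a <= `|L - A q| + `|A q - A (x, z)| by rewrite Ea; exact: ler_distD.
rewrite (distrC (A q)) (distrC L) in tri.
move: tri Aq hB; clear; lra.
Qed.

Lemma pder_comm m n phi : smooth phi -> pder m n (pder1 phi) = pder m.+1 n phi.
Proof.
move=> sphi; rewrite /pder iterSr; congr (iter m _ _).
elim: n => // n ih; rewrite iterS ih smooth_pder_comm //.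
by move=> i j; have := sphi i (j + n)%N; rewrite /pder iterD.
Qed.

Lemma smooth_pder1 phi : smooth phi -> smooth (pder1 phi).
Proof. by move=> sphi m n p; rewrite pder_comm //; exact: sphi. Qed.

Lemma pder1_lin (c : R) phi psi : (forall p, differentiable phi p) ->
  (forall p, differentiable psi p) ->
  pder1 (c *: phi + psi) = c *: pder1 phi + pder1 psi.
Proof.
move=> d1 d2; apply/funext => p; rewrite /pder1 deriveD; last 2 first.
- by apply: derivableZ; exact: diff_derivable.
- exact: diff_derivable.
by rewrite deriveZ //; exact: diff_derivable.
Qed.

Lemma pder2_lin (c : R) phi psi : (forall p, differentiable phi p) ->
  (forall p, differentiable psi p) ->
  pder2 (c *: phi + psi) = c *: pder2 phi + pder2 psi.
Proof.
move=> d1 d2; apply/funext => p; rewrite /pder2 deriveD; last 2 first.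
- by apply: derivableZ; exact: diff_derivable.
- exact: diff_derivable.
by rewrite deriveZ //; exact: diff_derivable.
Qed.

Lemma pder_lin m n (c : R) phi psi : smooth phi -> smooth psi ->
  pder m n (c *: phi + psi) = c *: pder m n phi + pder m n psi.
Proof.
move=> s1 s2; rewrite /pder.
have -> : iter n (@pder2 R) (c *: phi + psi) =
    c *: iter n (@pder2 R) phi + iter n (@pder2 R) psi.
  elim: n => // n ih; rewrite !iterS ih pder2_lin // => p.
    exact: (s1 0%N n p).
  exact: (s2 0%N n p).
elim: m => // m ih; rewrite !iterS ih pder1_lin // => p.
  exact: (s1 m n p).
exact: (s2 m n p).
Qed.

Lemma smooth_lin (c : R) phi psi : smooth phi -> smooth psi ->
  smooth (c *: phi + psi).
Proof.
move=> s1 s2 m n p; rewrite pder_lin //; apply: differentiableD; last exact: s2.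
by apply: differentiableZ; exact: s1.
Qed.

Lemma pder1_eq0 phi (U : set (R * R)) : open U -> (forall p, U p -> phi p = 0) ->
  forall p, U p -> pder1 phi p = 0.
Proof.
move=> oU h p Up; rewrite /pder1 (@near_eq_derive _ _ _ phi (cst 0)) ?derive_cst //.
by apply: filterS (open_nbhs_nbhs (conj oU Up)) => q /h.
Qed.

Lemma pder2_eq0 phi (U : set (R * R)) : open U -> (forall p, U p -> phi p = 0) ->
  forall p, U p -> pder2 phi p = 0.
Proof.
move=> oU h p Up; rewrite /pder2 (@near_eq_derive _ _ _ phi (cst 0)) ?derive_cst //.
by apply: filterS (open_nbhs_nbhs (conj oU Up)) => q /h.
Qed.

Lemma test_function_pder1 Om phi : test_function Om phi -> test_function Om (pder1 phi).
Proof.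
move=> [sphi [K [cK KO K0]]]; split; first exact: smooth_pder1.
exists K; split => //; apply: pder1_eq0 K0; apply: closed_openC.
by apply: compact_closed => //; exact: norm_hausdorff.
Qed.

Lemma test_function_pder2 Om phi : test_function Om phi -> test_function Om (pder2 phi).
Proof.
move=> [sphi [K [cK KO K0]]]; split; first exact: smooth_pder2.
exists K; split => //; apply: pder2_eq0 K0; apply: closed_openC.
by apply: compact_closed => //; exact: norm_hausdorff.
Qed.

End SmoothCalculus.

(** * Smooth bump functions *)

Section Bump.
Variable R : realType.

(** This serves at the zeros of [flat], in particular at the endpoints of its support, where its
    formula is not valid on both sides. *)
Lemma is_derive_quadratic (f : R -> R) (t K r : R) : 0 < r -> f t = 0 ->
  (forall h, `|h| < r -> `|f (t + h)| <= K * h ^+ 2) -> is_derive t (1 : R) f 0.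
Proof.
move=> r0 ft0 hf.
have h0 : h^-1 *: (f (h *: 1 + t) - f t) @[h --> 0^'] --> (0 : R).
  apply/cvgrPdist_lt => e e0; rewrite near_withinE; apply/nbhs_ballP.
  have K1 : 0 < `|K| + 1 by rewrite ltr_wpDl.
  exists (Num.min r (e / (`|K| + 1))) => /=; first by rewrite lt_min r0 divr_gt0.
  move=> h; rewrite /ball /= sub0r normrN lt_min => /andP[hr he] hn0.
  rewrite ft0 subr0 sub0r normrN [h *: 1]mulr1 [h + t]addrC normrM normfV.
  have hp : 0 < `|h| by rewrite normr_gt0.
  rewrite mulrC ltr_pdivrMr //; apply: le_lt_trans (hf _ hr) _.
  rewrite -[h ^+ 2]real_normK ?num_real // expr2 mulrA ltr_pM2r //.
  apply: (@le_lt_trans _ _ (`|K| * `|h|)); first by rewrite ler_wpM2r // ler_norm.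
  apply: (@le_lt_trans _ _ ((`|K| + 1) * `|h|)); first by rewrite ler_wpM2r // lerDl.
  by rewrite mulrC -ltr_pdivlMr.
by split; [apply/cvg_ex; exists 0|exact: cvg_lim h0].
Qed.

(** The inequality e^x >= 1 + x >= x at x = c s / n is raised to the power n. *)
Lemma exprn_le_expR (c s : R) n : 0 < c -> 0 <= s ->
  s ^+ n <= (n%:R / c) ^+ n * expR (c * s).
Proof.
move=> c0 s0; have cs0 : 0 <= c * s by rewrite mulr_ge0 // ltW.
case: n => [|n]; first by rewrite !expr0 mul1r -expR0 ler_expR.
have [m Em] : exists m : R, m = n.+1%:R by eexists.
have m0 : 0 < m by rewrite Em ltr0n.
rewrite -Em; have Es : s = m / c * (c * s / m) by field; rewrite !lt0r_neq0.
rewrite {1}Es exprMn ler_wpM2l ?exprn_ge0 ?divr_ge0 ?(ltW c0) ?(ltW m0) //.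
have -> : c * s = n.+1%:R * (c * s / m) by rewrite -Em; field; rewrite lt0r_neq0.
have -> : n.+1%:R * (c * s / m) / m = c * s / m by rewrite -Em; field; rewrite lt0r_neq0.
rewrite expRM_natl lerXn2r ?nnegrE ?expR_ge0 ?divr_ge0 ?(ltW m0) //.
by apply: le_trans (expR_ge1Dx _); rewrite lerDr.
Qed.

Variables (a b c : R).
Hypotheses (ab : a < b) (c0 : 0 < c).

Let W : {poly R} := ('X - a%:P) * (b%:P - 'X).

Let WE t : W.[t] = (t - a) * (b - t).
Proof. by rewrite /W !hornerE. Qed.

Let W_gt0 t : a < t -> t < b -> 0 < W.[t].
Proof. by move=> at0 tb; rewrite WE mulr_gt0 // subr_gt0. Qed.

(* This family is closed under differentiation. *)
Definition flat (P : {poly R}) (k : nat) (t : R) : R :=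
  if (a < t) && (t < b) then P.[t] * W.[t]^-1 ^+ k * expR (- (c * W.[t]^-1)) else 0.

(** The exponential beats every power of 1 / W: [exprn_le_expR] with exponent k + 2 leaves a factor
    W^2, hence a zero of second order at the endpoints. *)
Lemma flat_bound P k : exists2 M, 0 <= M & forall t,
  a < t -> t < b -> `|flat P k t| <= M * W.[t] ^+ 2.
Proof.
have [M hM] := poly_itv_bound P a b.
exists (`|M| * (k.+2%:R / c) ^+ k.+2).
  by rewrite mulr_ge0 // exprn_ge0 // divr_ge0 // ltW.
move=> t at0 tb; rewrite /flat at0 tb /=.
have w0 := W_gt0 at0 tb; set w := W.[t] in w0 *.
have wi : 0 <= w^-1 by rewrite invr_ge0 ltW.
rewrite !normrM (ger0_norm (expR_ge0 _)) (ger0_norm (exprn_ge0 _ wi)) -mulrA.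
have hP : `|P.[t]| <= `|M|.
  by apply: le_trans (ler_norm M); apply: hM; rewrite !ltW.
rewrite -mulrA; apply: ler_pM => //; first by rewrite mulr_ge0 ?expR_ge0 ?exprn_ge0.
have z0 : 0 <= expR (- (c * w^-1)) * w ^+ 2 by rewrite mulr_ge0 ?expR_ge0 ?sqr_ge0.
have := ler_wpM2r z0 (exprn_le_expR k.+2 c0 wi).
have -> : w^-1 ^+ k.+2 * (expR (- (c * w^-1)) * w ^+ 2) = w^-1 ^+ k * expR (- (c * w^-1)).
  rewrite -addn2 exprD; move: (w^-1 ^+ k) (expR _) => V E.
  by field; rewrite lt0r_neq0.
have X0 : 0 <= (k.+2%:R / c) ^+ k.+2 by rewrite exprn_ge0 // divr_ge0 // ltW.
move=> /le_trans; apply; move: (_ ^+ k.+2) X0 => X X0.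
rewrite -!mulrA ler_wpM2l //.
by rewrite mulrA -expRD subrr expR0 mul1r.
Qed.

(** The numerator of the derivative of P W^-k exp(-c / W) over the common denominator W^(k + 2). *)
Definition dflat (P : {poly R}) k : {poly R} :=
  P^`() * W ^+ 2 - k%:R *: (P * W * W^`()) + c *: (P * W^`()).

Lemma flat_derive P k t : is_derive t (1 : R) (flat P k) (flat (dflat P k) k.+2 t).
Proof.
have out s : ~~ ((a < s) && (s < b)) -> forall Q j, flat Q j s = 0.
  by move=> hs Q j; rewrite /flat (negPf hs).
have [M M0 hM] := flat_bound P k.
have [/andP[at0 tb]|tab] := boolP ((a < t) && (t < b)).
  have w0 := W_gt0 at0 tb; have wn0 := lt0r_neq0 w0.
  pose g s := P.[s] * W.[s]^-1 ^+ k * expR (- (c * W.[s]^-1)).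
  apply: (@near_eq_is_derive _ _ _ g).
    have : \forall s \near t, s \in `]a, b[.
      by apply: near_in_itvoo; rewrite in_itv /= at0.
    by apply: filterS => s; rewrite in_itv /= => /andP[h1 h2]; rewrite /flat h1 h2.
  have dW : is_derive t (1 : R) (fun s => W.[s]) W^`().[t] by exact: is_derive_poly.
  have dV : is_derive t (1 : R) (fun s => W.[s]^-1) (- W.[t] ^- 2 * W^`().[t]).
    case: dW => d e; split; first exact: derivableV.
    by rewrite deriveV // e.
  have dP : is_derive t (1 : R) (fun s => P.[s]) P^`().[t] by exact: is_derive_poly.
  have dVk := is_deriveX k dV.
  have dE : is_derive t (1 : R) (fun s => expR (- (c * W.[s]^-1)))
      (expR (- (c * W.[t]^-1)) * (- (c * (- W.[t] ^- 2 * W^`().[t])))).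
    have dN := is_deriveN (is_deriveZ c dV).
    exact: (is_derive1_comp (is_derive_expR _) dN).
  have := is_deriveM (is_deriveM dP dVk) dE.
  have -> : g = horner P * (fun s => W.[s]^-1) ^+ k * (fun s => expR (- (c * W.[s]^-1))).
    by apply/funext => s; rewrite !mulrfctE exprfctE.
  move=> /is_derive_eq; apply.
  have hornerE3 (p p' w w' : {poly R}) (kk : R) :
      (p' * w ^+ 2 - kk *: (p * w * w') + c *: (p * w')).[t] =
      p'.[t] * w.[t] ^+ 2 - kk * (p.[t] * w.[t] * w'.[t]) + c * (p.[t] * w'.[t]).
    by rewrite !(hornerD, hornerN, hornerM, hornerZ, horner_exp).
  have -> : flat (dflat P k) k.+2 t = (P^`().[t] * W.[t] ^+ 2 -
      k%:R * (P.[t] * W.[t] * W^`().[t]) + c * (P.[t] * W^`().[t])) *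
      W.[t]^-1 ^+ k.+2 * expR (- (c * W.[t]^-1)).
    by rewrite /flat at0 tb /dflat hornerE3.
  rewrite !mulrfctE exprfctE /GRing.scale.
  have hk : k%:R * W.[t]^-1 ^+ k.-1 = k%:R * W.[t]^-1 ^+ k * W.[t].
    by case: (k) => [|j]; rewrite ?mul0r // exprS; move: (_ ^+ j) => V; field.
  rewrite [LHS](_ : _ = P.[t] * W.[t]^-1 ^+ k * (expR (- (c * W.[t]^-1)) *
      - (c * (- W.[t] ^- 2 * W^`().[t]))) + expR (- (c * W.[t]^-1)) *
      (P.[t] * ((k%:R * W.[t]^-1 ^+ k.-1) * (- W.[t] ^- 2 * W^`().[t])) +
       W.[t]^-1 ^+ k * P^`().[t])); last by [].
  rewrite hk.
  have -> : W.[t]^-1 ^+ k.+2 = W.[t]^-1 ^+ k * W.[t]^-1 ^+ 2 by rewrite -exprD addn2.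
  move: (W.[t]^-1 ^+ k) (expR _) (W^`().[t]) (P.[t]) (P^`().[t]) (k%:R) => V E w' p p' kk.
  by field.
have ft0 := out _ tab; rewrite ft0.
have [ta|] := ltP t a.
  apply: (@is_derive_quadratic _ _ 0 (a - t)); rewrite ?subr_gt0 ?ft0 // => h hh.
  rewrite out ?normr0 ?mul0r //; apply/negP => /andP[]; move: hh; rewrite ltr_norml; lra.
have [tb|] := ltP b t.
  move=> _; apply: (@is_derive_quadratic _ _ 0 (t - b)); rewrite ?subr_gt0 ?ft0 // => h hh.
  rewrite out ?normr0 ?mul0r //; apply/negP => /andP[]; move: hh; rewrite ltr_norml; lra.
move=> tb at0.
have teq : t = a \/ t = b.
  move: tab; rewrite negb_and -!leNgt => /orP[h|h]; [left|right]; lra.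
(* At an endpoint t, for |h| < 1 with t + h in the support, W (t + h) <= |h| (b - a + 1); so
   [flat_bound] gives quadratic vanishing. *)
apply: (@is_derive_quadratic _ _ (M * (b - a + 1) ^+ 2) 1); rewrite ?ft0 // => h hh.
have [/andP[h1 h2]|/out ->] := boolP ((a < t + h) && (t + h < b)); last first.
  by rewrite normr0 mulr_ge0 ?sqr_ge0 // mulr_ge0 ?sqr_ge0.
apply: le_trans (hM _ h1 h2) _; rewrite -mulrA ler_wpM2l // -exprMn WE.
rewrite -[leRHS]real_normK ?num_real // -[leLHS]real_normK ?num_real //.
rewrite lerXn2r ?nnegrE // !normrM mulrC.
case: teq h1 h2 => -> h1 h2.
  have -> : a + h - a = h by ring.
  rewrite ler_wpM2r // ger0_norm; last by lra.
  by rewrite ger0_norm; move: hh; rewrite ?ltr_norml; lra.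
have -> : b - (b + h) = - h by ring.
rewrite normrN mulrC ler_wpM2r // ger0_norm; last by lra.
by rewrite ger0_norm; move: hh; rewrite ?ltr_norml; lra.
Qed.

Lemma flat_smooth P k : smooth1 (flat P k).
Proof.
move=> n; have [Q [j ->]] : exists Q j, derive1n n (flat P k) = flat Q j.
  elim: n => [|n [Q [j ih]]]; first by exists P, k.
  exists (dflat Q j), j.+2; rewrite derive1nS ih; apply/funext => t.
  by rewrite derive1E; case: (flat_derive Q j t).
by move=> t; case: (flat_derive Q j t).
Qed.

End Bump.

(** * Tensor products of bump functions *)

Section Tensor.
Variable R : realType.
Local Notation mR := (measurableTypeR R).
Local Notation plane := (mR * mR)%type.

Lemma differentiable_fst (p : R * R) : differentiable (fst : R * R -> R) p.
Proof. by apply: linear_differentiable => q; exact: cvg_fst. Qed.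

Lemma differentiable_snd (p : R * R) : differentiable (snd : R * R -> R) p.
Proof. by apply: linear_differentiable => q; exact: cvg_snd. Qed.

Lemma tensor_differentiable (f g : R -> R) p : derivable f p.1 1 ->
  derivable g p.2 1 -> differentiable (fun q : R * R => f q.1 * g q.2) p.
Proof.
move=> /derivable1_diffP df /derivable1_diffP dg.
have := differentiableM (differentiable_comp (differentiable_fst p) df)
  (differentiable_comp (differentiable_snd p) dg).
exact.
Qed.

Lemma tensor_pder (f g : R -> R) m n : smooth1 f -> smooth1 g ->
  pder m n (fun q : R * R => f q.1 * g q.2) =
  (fun q : R * R => derive1n m f q.1 * derive1n n g q.2).
Proof.
move=> sf sg; rewrite /pder.
have -> : iter n (@pder2 R) (fun q => f q.1 * g q.2) = (fun q => f q.1 * derive1n n g q.2).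
  elim: n => // n ih; rewrite iterS ih; apply/funext => -[x z] /=.
  have [_ <-] := is_derive_line2 (tensor_differentiable (p := (x, z)) (sf 0%N x) (sg n z)).
  have [_] := is_deriveZ (f x) (DeriveDef (sg n z) erefl).
  by move=> E; rewrite derive1E; exact: E.
elim: m => // m ih; rewrite iterS ih; apply/funext => -[x z] /=.
have [_ <-] := is_derive_line1 (tensor_differentiable (p := (x, z)) (sf m x) (sg n z)).
have [_] := is_deriveZ (derive1n n g z) (DeriveDef (sf m x) erefl).
move=> E; rewrite derive1E [RHS]mulrC -[RHS]E.
by congr ('D_1 _ x); apply/funext => s; rewrite /= mulrC.
Qed.

Lemma tensor_smooth (f g : R -> R) : smooth1 f -> smooth1 g ->
  smooth (fun q : R * R => f q.1 * g q.2).
Proof. by move=> sf sg m n p; rewrite tensor_pder //; exact: tensor_differentiable. Qed.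

(** The rate 1 / (n + 1) in the exponential tends to zero, so that these bumps, bounded by 1, tend
    to the indicator of the open interval. *)
Definition bump (a b : R) (n : nat) : R -> R := flat a b n.+1%:R^-1 1 0.

Lemma bump_smooth a b n : a < b -> smooth1 (bump a b n).
Proof. by move=> ab; apply: flat_smooth. Qed.

Lemma bump_out a b n t : ~~ ((a < t) && (t < b)) -> bump a b n t = 0.
Proof. by move=> h; rewrite /bump /flat (negPf h). Qed.

Lemma bump_ge0 a b n t : 0 <= bump a b n t.
Proof.
rewrite /bump /flat; case: ifP => // _.
by rewrite hornerC expr0 !mul1r expR_ge0.
Qed.

Lemma bump_le1 a b n t : bump a b n t <= 1.
Proof.
rewrite /bump /flat; case: ifP => // /andP[h1 h2].
rewrite hornerC expr0 !mul1r -[leRHS]expR0 ler_expR oppr_le0 mulr_ge0 //.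
by rewrite invr_ge0 !hornerE mulr_ge0 // subr_ge0 ltW.
Qed.

Lemma bump_cvg a b t : a < t -> t < b -> bump a b n t @[n --> \oo] --> (1 : R).
Proof.
move=> h1 h2; rewrite /bump /flat h1 h2 /=.
under eq_fun do rewrite hornerC expr0 !mul1r.
set s := _^-1.
have h : - (n.+1%:R^-1 * s) @[n --> \oo] --> (0 : R).
  rewrite -oppr0 -(mul0r s); apply: cvgN; apply: cvgM; last exact: cvg_cst.
  exact: cvg_harmonic.
have := cvg_comp _ _ h (@continuous_expR R 0); rewrite expR0; exact.
Qed.

Definition bump2 (a b c d : R) n : R * R -> R := fun q => bump a b n q.1 * bump c d n q.2.

Lemma bump2_test Om a b c d n : a < b -> c < d ->
  (`[a, b]%classic `*` `[c, d]%classic) `<=` Om -> test_function Om (bump2 a b c d n).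
Proof.
move=> ab cd sub; split.
  by apply: tensor_smooth; apply: bump_smooth.
exists (`[a, b]%classic `*` `[c, d]%classic); split => //.
  by apply: compact_setX; exact: segment_compact.
move=> [x z] /= /not_andP[]; rewrite /bump2 /= => h.
  rewrite bump_out ?mul0r //; apply/negP => /andP[h1 h2]; apply: h.
  by rewrite /= in_itv /= !ltW.
rewrite [X in _ * X]bump_out ?mulr0 //; apply/negP => /andP[h1 h2]; apply: h.
by rewrite /= in_itv /= !ltW.
Qed.

Lemma box_finite (a b c d : R) : (area R (open_box a b c d) < +oo)%E.
Proof.
have -> : area R (open_box a b c d) = (lebesgue_measure (`]a, b[%classic : set mR) *
    lebesgue_measure (`]c, d[%classic : set mR))%E.
  by apply: product_measure1E; exact: measurable_itv.
have fin (u v : R) : lebesgue_measure (`]u, v[%classic : set mR) \is a fin_num.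
  by rewrite lebesgue_measure_itv /=; case: ifP.
by rewrite -ge0_fin_numE ?fin_numM ?fin // mule_ge0.
Qed.

(** * The fundamental lemma of the calculus of variations *)

Section DuBoisReymond.
Variable Om : set (R * R).
Hypothesis mOm : measurable (Om : set plane).
Variable f : R * R -> R.
Hypothesis f2 : L2 Om f.
Hypothesis ftest : forall phi, test_function Om phi -> L2dot Om f phi = 0.

Let box_integrable a b c d : open_box a b c d `<=` Om ->
  (area R).-integrable (open_box a b c d) (EFin \o f).
Proof.
move=> BO; have mB := measurable_box (R := R) `]a, b[ `]c, d[.
have mf : measurable_fun (open_box a b c d : set plane) (f : plane -> R).
  by apply: measurable_funS (L2_measurable mOm f2).
apply: (@le_integrable _ _ _ _ _ mB _ ((fun p => (f p ^+ 2)%:E) \+ (fun p => 1%:E))%E).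
- exact/measurable_EFinP.
- move=> p _ /=; rewrite lee_fin [leRHS]ger0_norm; last by rewrite addr_ge0 ?sqr_ge0.
  rewrite ler_norml; have := sqr_ge0 (f p - 1); have := sqr_ge0 (f p + 1); nra.
- apply: integrableD => //.
    apply: (integrableS mOm mB BO); exact: integrable_sqr.
  apply/integrableP; split; first exact: measurable_cst.
  under eq_integral do rewrite /= normr1.
  by rewrite integral_cst // mul1e box_finite.
Qed.

(** The functions [bump2] vanish off a closed box inside [Om], so they are test functions, and they
    tend to the indicator of the open box; dominated convergence applies. *)
Lemma box_integral0 a b c d : (`[a, b]%classic `*` `[c, d]%classic) `<=` Om ->
  (\int[area R]_(p in open_box a b c d) (f p)%:E = 0)%E.
Proof.
move=> sub.
have [ab|ab] := leP b a.
  rewrite (_ : open_box a b c d = set0) ?integral_set0 //.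
  by apply/seteqP; split => // p [/=]; rewrite in_itv /=; lra.
have [cd|cd] := leP d c.
  rewrite (_ : open_box a b c d = set0) ?integral_set0 //.
  by apply/seteqP; split => // p [/=]; rewrite !in_itv /=; lra.
have BO : open_box a b c d `<=` Om.
  by move=> p [/= h1 h2]; apply: sub; split; rewrite /= in_itv /=; move: h1 h2; rewrite !in_itv /= => /andP[? ?] /andP[? ?]; rewrite !ltW.
have mB := measurable_box (R := R) `]a, b[ `]c, d[.
have iB := box_integrable BO.
have mf : measurable_fun (open_box a b c d : set plane) (f : plane -> R).
  by apply: measurable_funS (L2_measurable mOm f2).
have cb n : continuous (bump2 a b c d n).
  by apply: smooth_continuous; apply: tensor_smooth; apply: bump_smooth.
have lim1 p : open_box a b c d p -> (f p * bump2 a b c d n p)%:E @[n --> \oo] --> (f p)%:E.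
  move=> [/=]; rewrite !in_itv /= => /andP[h1 h2] /andP[h3 h4].
  apply: cvg_EFin; first exact: nearW.
  suff : f p * bump2 a b c d n p @[n --> \oo] --> f p * (1 * 1) by rewrite !mulr1.
  by apply: cvgM; [exact: cvg_cst|apply: cvgM; exact: bump_cvg].
have [] := @dominated_convergence _ _ _ (area R) _ mB
  (fun n p => (f p * bump2 a b c d n p)%:E) (EFin \o f) (abse \o (EFin \o f)).
- move=> n; apply/measurable_EFinP; apply: measurable_funM => //.
  by apply: measurable_funTS; exact: continuous_measurable_plane.
- exact/measurable_EFinP.
- by apply: aeW => p; exact: lim1.
- exact: integrable_abse.
- apply: aeW => p n _ /=; rewrite lee_fin normrM ler_piMr // /bump2 normrM.
  by rewrite !ger0_norm ?bump_ge0 // mulr_ile1 ?bump_ge0 ?bump_le1.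
move=> _ _; set F := (X in X @ \oo --> _) => hF.
have EF : F = fun=> 0%E.
  apply/funext => n; have tst := bump2_test n ab cd sub.
  have out p : p \notin open_box a b c d -> bump2 a b c d n p = 0.
    move=> pB; rewrite /bump2.
    have [h1|/(bump_out n) ->] := boolP ((a < p.1) && (p.1 < b)); last by rewrite mul0r.
    have [h2|/(bump_out n) ->] := boolP ((c < p.2) && (p.2 < d)); last by rewrite mulr0.
    by case/negP: pB; rewrite inE; split; rewrite /= in_itv.
  have E : ((fun p => (f p * bump2 a b c d n p)%:E) \_ (open_box a b c d) =
      (fun p => (f p * bump2 a b c d n p)%:E) \_ Om)%E.
    apply/funext => p; rewrite !patchE.
    case: ifPn => pB; first by rewrite ifT // inE; apply: BO; move: pB; rewrite inE.
    by case: ifPn => // _; rewrite out // mulr0.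
  rewrite /F /= integral_mkcond E -integral_mkcond.
  have := ftest tst; rewrite /L2dot /Rintegral => h0.
  rewrite -[LHS]fineK ?h0 //; apply: integrable_fin_num => //.
  have : (area R).-integrable Om ((EFin \o (fun p => f p * bump2 a b c d n p))).
    apply: L2_integrableM => //; apply/(L2P mOm); split.
      by apply: measurable_funTS; exact: continuous_measurable_plane.
    rewrite /energy integral_mkcond.
    rewrite (_ : _ \_ _ = (fun p => (bump2 a b c d n p ^+ 2)%:E) \_ (open_box a b c d)); last first.
      apply/funext => p; rewrite !patchE.
      case: ifPn => [pO|pO]; first by case: ifPn => // /out ->; rewrite expr0n.
      by rewrite ifN //; apply: contra pO; rewrite !inE; exact: BO.
    rewrite -integral_mkcond.
    apply: (@le_lt_trans _ _ (\int[area R]_(p in open_box a b c d) 1)%E).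
      apply: ge0_le_integral => //.
      - by move=> p _; rewrite lee_fin sqr_ge0.
      - apply: measurable_sqrE; apply: measurable_funTS; exact: continuous_measurable_plane.
      move=> p _; rewrite lee_fin expr_le1 // /bump2 ?mulr_ge0 ?bump_ge0 //.
      by rewrite mulr_ile1 ?bump_ge0 ?bump_le1.
    by rewrite integral_cst // mul1e box_finite.
  exact.
by move: hF; rewrite EF => /cvg_lim h; rewrite -(h _) // lim_cst.
Qed.

(** Dynkin's argument along a map [pi]. It is used with the first coordinate, the second coordinate
    and the identity, to pass from boxes to measurable strips, to measurable rectangles and to all
    measurable sets. *)
Lemma integral0_induction d (T : measurableType d) (pi : plane -> T) (C : set plane)
    (G : set (set T)) (g : plane -> \bar R) :
  measurable_fun [set: plane] pi -> measurable C ->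
  (area R).-integrable C g ->
  @measurable _ T = <<s G >> -> setI_closed G ->
  (\int[area R]_(p in C) g p = 0)%E ->
  (forall A, G A -> \int[area R]_(p in pi @^-1` A `&` C) g p = 0)%E ->
  (forall A, measurable A -> \int[area R]_(p in pi @^-1` A `&` C) g p = 0)%E.
Proof.
move=> mpi mC ig GE GI gC0 gG0.
have mpre A : measurable A -> measurable (pi @^-1` A `&` C).
  by move=> mA; apply: measurableI => //; rewrite -[_ @^-1` _]setTI; exact: mpi.
have igA A : measurable A -> (area R).-integrable (pi @^-1` A `&` C) g.
  by move=> mA; apply: (integrableS mC (mpre _ mA) _ ig) => p [].
have mg := measurable_int _ ig.
suff : forall A, <<s G >> A -> (\int[area R]_(p in pi @^-1` A `&` C) g p = 0)%E.
  by rewrite -GE.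
apply: dynkin_induction => //.
- by rewrite preimage_setT setTI.
- move=> S mS hS.
  have EC : C = (pi @^-1` S `&` C) `|` (pi @^-1` (~` S) `&` C).
    by rewrite -setIUl -preimage_setU setUv preimage_setT setTI.
  have mS' : measurable (~` S) by exact: measurableC.
  have := gC0; rewrite {1}EC integral_setU ?hS ?add0e; [exact|exact: mpre|exact: mpre|by rewrite -EC|].
  by apply/disj_setPS => p [[/= h1 _] [/= h2 _]].
- move=> F mF tF hF.
  rewrite preimage_bigcup setI_bigcupl integral_bigcup //.
  + by rewrite eseries0 // => i _ _; exact: hF.
  + apply/trivIsetP => i j _ _ ij; move/trivIsetP : tF => /(_ i j I I ij) h.
    apply/seteqP; split => // p [[/= p1 _] [/= p2 _]].
    have : (F i `&` F j) (pi p) by split.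
    by rewrite h.
  + by move=> k; exact: mpre.
  + by rewrite -setI_bigcupl -preimage_bigcup; apply: igA; exact: bigcupT_measurable.
Qed.


Lemma ray_generators_setI : setI_closed (@measurable_realfun.RGenOInfty.G R).
Proof.
move=> _ _ [x ->] [y ->]; exists (Num.max x y); apply/seteqP; split => t /=.
  by rewrite !in_itv /= !andbT gt_max => -[-> ->].
by rewrite !in_itv /= !andbT gt_max => /andP[].
Qed.

Let mfst : measurable_fun [set: plane] (fst : plane -> mR).
Proof. exact: measurable_fst. Qed.

Let msnd : measurable_fun [set: plane] (snd : plane -> mR).
Proof. exact: measurable_snd. Qed.

Let mbox a b c d : measurable (open_box a b c d : set plane).
Proof. exact: measurable_box. Qed.

Let box_sub a b c d : (`[a, b]%classic `*` `[c, d]%classic) `<=` Om ->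
  open_box a b c d `<=` Om.
Proof.
move=> sub p [/= h1 h2]; apply: sub; split; rewrite /= in_itv /=.
  by move: h1; rewrite in_itv /= => /andP[? ?]; rewrite !ltW.
by move: h2; rewrite in_itv /= => /andP[? ?]; rewrite !ltW.
Qed.

Let strip_integral0 a b c d (A : set mR) :
  (`[a, b]%classic `*` `[c, d]%classic) `<=` Om -> measurable A ->
  (\int[area R]_(p in (fst : plane -> mR) @^-1` A `&` open_box a b c d) (EFin \o f) p = 0)%E.
Proof.
move=> sub; move: A; apply: (integral0_induction mfst (mbox a b c d)
    (box_integrable (box_sub sub)) _ ray_generators_setI).
- exact: measurable_realfun.RGenOInfty.measurableE.
- exact: box_integral0.
move=> _ [x ->].
rewrite (_ : _ `&` _ = open_box (Num.max x a) b c d).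
  apply: box_integral0 => p [/= h1 h2]; apply: sub; split => //=.
  by move: h1; rewrite !in_itv /= ge_max => /andP[/andP[_ ->] ->].
apply/seteqP; split => p; rewrite /open_box /= !in_itv /= !andbT gt_max.
  by move=> [-> [/andP[-> ->] /andP[-> ->]]].
by move=> [/andP[/andP[-> ->] ->] /andP[-> ->]].
Qed.

Let rectangle_integral0 a b c d (A B : set mR) :
  (`[a, b]%classic `*` `[c, d]%classic) `<=` Om -> measurable A -> measurable B ->
  (\int[area R]_(p in (snd : plane -> mR) @^-1` B `&`
     ((fst : plane -> mR) @^-1` A `&` open_box a b c d)) (EFin \o f) p = 0)%E.
Proof.
move=> sub mA; move: B.
have mC : measurable ((fst : plane -> mR) @^-1` A `&` open_box a b c d).
  by apply: measurableI => //; rewrite -[_ @^-1` _]setTI; exact: mfst.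
apply: (integral0_induction msnd mC _ _ ray_generators_setI).
- by apply: (integrableS (mbox a b c d) mC _ (box_integrable (box_sub sub))) => p [].
- exact: measurable_realfun.RGenOInfty.measurableE.
- exact: strip_integral0.
move=> _ [x ->].
rewrite (_ : _ `&` _ = (fst : plane -> mR) @^-1` A `&` open_box a b (Num.max x c) d).
  apply: strip_integral0 => // p [/= h1 h2]; apply: sub; split => //=.
  by move: h2; rewrite !in_itv /= ge_max => /andP[/andP[_ ->] ->].
apply/seteqP; split => p; rewrite /open_box /= !in_itv /= !andbT gt_max.
  by move=> [-> [? [/andP[-> ->] /andP[-> ->]]]].
by move=> [? [/andP[-> ->] /andP[/andP[-> ->] ->]]].
Qed.

Let box_ae0 a b c d : (`[a, b]%classic `*` `[c, d]%classic) `<=` Om ->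
  {ae area R, forall p, open_box a b c d p -> f p = 0}.
Proof.
move=> sub; have iB := box_integrable (box_sub sub).
have hE (E : set plane) : measurable E ->
    (\int[area R]_(p in E `&` open_box a b c d) (EFin \o f) p = 0)%E.
  have H := @integral0_induction _ (mR * mR)%type id (open_box a b c d) _ (EFin \o f)
    (@measurable_id _ _ _) (mbox a b c d) iB (measurable_prod_measurableType mR mR).
  move: E; refine (H _ _ _).
  - move=> _ _ [A1 mA1 [B1 mB1 <-]] [A2 mA2 [B2 mB2 <-]].
    exists (A1 `&` A2); first exact: measurableI.
    exists (B1 `&` B2); first exact: measurableI.
    by rewrite setXI.
  - exact: box_integral0.
  move=> _ [A mA [B mB <-]].
  rewrite (_ : _ `&` _ = (snd : plane -> mR) @^-1` B `&`
     ((fst : plane -> mR) @^-1` A `&` open_box a b c d)); first exact: rectangle_integral0.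
  by apply/seteqP; split => p; [move=> [[? ?] ?]|move=> [? [? ?]]].
have := @integral_ae_eq _ _ _ (area R) _ (mbox a b c d) (cst 0%E) _ iB.
case=> [|E EB mE|].
- exact: measurable_cst.
- by rewrite integral0 -(setIidl EB); exact: hE.
move=> N [mN N0 hN]; exists N; split => // p h; apply: hN => h'; apply: h => Bp.
by have := h' Bp => /= -[].
Qed.

Hypothesis oOm : open Om.

(** [Om] is covered by countably many rational boxes whose closures lie in it, and [f] vanishes
    almost everywhere on each. *)
Lemma test_function_ae0 : eq_ae_on Om f (fun=> 0).
Proof.
pose box (q : rat * rat * rat) := open_box
  (ratr q.1.1 - ratr q.2) (ratr q.1.1 + ratr q.2)
  (ratr q.1.2 - ratr q.2) (ratr q.1.2 + ratr q.2 : R).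
pose cbox (q : rat * rat * rat) : set (R * R) :=
  `[ratr q.1.1 - ratr q.2, ratr q.1.1 + ratr q.2]%classic `*`
  `[ratr q.1.2 - ratr q.2, (ratr q.1.2 + ratr q.2 : R)]%classic.
(* The boxes are numbered through [unpickle], so that their exceptional null sets can be merged into
   one. *)
pose Q n p := forall q : rat * rat * rat, unpickle n = Some q ->
  cbox q `<=` Om -> box q p -> f p = 0.
have : {ae area R, forall p, forall n, Q n p}.
  apply/ae_foralln => n; rewrite /Q; case: (unpickle n) => [q|]; last exact: aeW.
  have [sub|nsub] := pselect (cbox q `<=` Om); last first.
    by apply: aeW => p _ [<-].
  have := box_ae0 sub; apply: filterS => p h _ [<-] _; exact: h.
apply: filterS => p hQ Op.
have [e e0 he] := (open_planeP Om).1 oOm _ Op.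
have [r] : exists r : rat, ratr r \in `](e / 4), (e / 2)[ by apply: rat_in_itvoo; lra.
have [x] : exists x : rat, ratr x \in `](p.1 - e / 4), (p.1 + e / 4)[ by apply: rat_in_itvoo; lra.
have [y] : exists y : rat, ratr y \in `](p.2 - e / 4), (p.2 + e / 4)[ by apply: rat_in_itvoo; lra.
rewrite !in_itv /= => /andP[b1 b2] /andP[a1 a2] /andP[c1 c2].
apply: (hQ (pickle (x, y, r)) (x, y, r)); first exact: pickleK.
  by move=> q [/=]; rewrite !in_itv /= => x1 x2; apply: he; rewrite ltr_norml; lra.
by split => /=; rewrite in_itv /=; lra.
Qed.

End DuBoisReymond.
End Tensor.

(** * Weak derivatives and the plate form *)

Section WeakDerivatives.
Variable R : realType.
Local Notation mR := (measurableTypeR R).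
Local Notation plane := (mR * mR)%type.
Variable Om : set (R * R).
Hypothesis oOm : open Om.

Let mOm : measurable (Om : set plane). Proof. exact: open_measurable_plane. Qed.
Let L2form := L2dot_nonneg_form mOm.

Lemma compact_area_fin (K : set (R * R)) : compact K -> (area R K < +oo)%E.
Proof.
move=> cK; have [M [_ hM]] := compact_bounded cK.
have clK : closed K by apply: compact_closed => //; exact: norm_hausdorff.
apply: le_lt_trans (box_finite (- (`|M| + 2)) (`|M| + 2) (- (`|M| + 2)) (`|M| + 2)).
apply: le_measure; rewrite ?inE.
- exact: closed_measurable_plane.
- exact: measurable_box.
move=> p /(hM (`|M| + 1)) h.
have {}h : `|p| <= `|M| + 1 by apply: h; rewrite (le_lt_trans (ler_norm M)) // ltrDl.
have E : `|p : R * R| = Num.max `|p.1| `|p.2| :> R by [].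
move: h; rewrite E ge_max => /andP[h1 h2].
by split; rewrite /= in_itv /= -ltr_norml; [apply: le_lt_trans h1 _|apply: le_lt_trans h2 _]; lra.
Qed.

Lemma test_function_L2 phi : test_function Om phi -> L2 Om phi.
Proof.
move=> [sphi [K [cK KO K0]]]; have cphi := smooth_continuous sphi.
have mphi : measurable_fun (Om : set plane) (phi : plane -> R).
  by apply: measurable_funTS; exact: continuous_measurable_plane.
apply/(L2P mOm); split => //.
have [M [_ hM]] : bounded_set (phi @` K).
  by apply: compact_bounded; apply: continuous_compact => //; exact: continuous_subspaceT.
have clK : closed K by apply: compact_closed => //; exact: norm_hausdorff.
have mK : measurable (K : set plane) by exact: closed_measurable_plane.
rewrite /energy integral_mkcond.
rewrite (_ : _ \_ _ = (fun p => (phi p ^+ 2)%:E) \_ K); last first.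
  apply/funext => p; rewrite !patchE; case: ifPn => [pO|pO]; case: ifPn => // pK.
    by rewrite K0 ?expr0n // -notin_setE.
  by move/negP: pO; case; rewrite inE; apply: KO; rewrite -in_setE.
rewrite -integral_mkcond.
apply: (@le_lt_trans _ _ (\int[area R]_(p in K) cst (((`|M| + 1) ^+ 2)%:E) p)%E).
  apply: ge0_le_integral => //.
  - by move=> p _; rewrite lee_fin sqr_ge0.
  - by apply: measurable_sqrE; apply: measurable_funTS; exact: continuous_measurable_plane.
  move=> p Kp; rewrite lee_fin -[leLHS]real_normK ?num_real //.
  rewrite lerXn2r ?nnegrE //.
  by apply: hM; [rewrite (le_lt_trans (ler_norm M)) // ltrDl|exists p].
rewrite integral_cst // lte_mul_pinfty ?lee_fin ?sqr_ge0 //.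
exact: compact_area_fin.
Qed.

Lemma test_function_pder m n phi : test_function Om phi -> test_function Om (pder m n phi).
Proof.
move=> tphi; rewrite /pder; elim: m => [|m ih]; last by rewrite iterS; exact: test_function_pder1.
by elim: n => // n ih; rewrite iterS; exact: test_function_pder2.
Qed.

Lemma is_wder_lin m n c u v g h : L2 Om u -> L2 Om v -> L2 Om g -> L2 Om h ->
  is_wder Om m n u g -> is_wder Om m n v h ->
  is_wder Om m n (c *: u + v) (c *: g + h).
Proof.
move=> u2 v2 g2 h2 ug vh phi tphi.
have p2 := test_function_L2 tphi; have dp2 := test_function_L2 (test_function_pder m n tphi).
rewrite !(form_lin L2form) // ug // vh //; ring.
Qed.

Lemma is_wder0 m n : is_wder Om m n 0 0.
Proof.
move=> phi tphi; have p2 := test_function_L2 tphi.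
have dp2 := test_function_L2 (test_function_pder m n tphi).
by rewrite !(form0l L2form) // mulr0.
Qed.

Lemma wder_unique m n u g h : L2 Om g -> L2 Om h -> is_wder Om m n u g ->
  is_wder Om m n u h -> eq_ae_on Om g h.
Proof.
move=> g2 h2 ug uh; have gh2 := subspaceB L2form g2 h2.
have : eq_ae_on Om (g - h) (fun=> 0).
  apply: test_function_ae0 => // phi tphi; have p2 := test_function_L2 tphi.
  rewrite (formBl L2form) //; have := ug _ tphi; rewrite uh //.
  move/(congr1 (fun x => (- 1) ^+ (m + n) * x)).
  by rewrite !mulrA -expr2 sqrr_sign !mul1r => ->; rewrite subrr.
by apply: filterS => p hp Op; have := hp Op => /eqP; rewrite subr_eq0 => /eqP.
Qed.

Lemma eq_ae_is_wder m n u v g : L2 Om u -> L2 Om v -> eq_ae_on Om u v ->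
  is_wder Om m n u g -> is_wder Om m n v g.
Proof.
move=> u2 v2 uv ug phi tphi; rewrite -ug //.
have dp2 := test_function_L2 (test_function_pder m n tphi).
apply: ae_eq_L2dot => //; apply: filterS uv => p h Op; by rewrite h.
Qed.

Lemma eq_ae_sym u v : eq_ae_on Om u v -> eq_ae_on Om v u.
Proof. by apply: filterS => p h Op; rewrite h. Qed.

Lemma eq_ae_wder m n u v : L2 Om u -> L2 Om v -> eq_ae_on Om u v ->
  wder Om m n u = wder Om m n v.
Proof.
move=> u2 v2 uv; congr xget; apply/seteqP; split => g [g2 hg]; split => //.
  exact: (eq_ae_is_wder u2 v2).
exact: (eq_ae_is_wder v2 u2 (eq_ae_sym uv)).
Qed.

Lemma wderP m n k u : sobolev Om k u -> (m + n <= k)%N ->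
  L2 Om (wder Om m n u) /\ is_wder Om m n u (wder Om m n u).
Proof.
move=> [u2 hu] mnk; have [g hg] := hu m n mnk.
exact: (@xgetPex _ (fun=> 0) [set g | L2 Om g /\ is_wder Om m n u g] (ex_intro _ g hg)).
Qed.

Lemma wder_eq m n u g : L2 Om g -> is_wder Om m n u g -> eq_ae_on Om (wder Om m n u) g.
Proof.
move=> g2 ug.
have [w2 uw] := @xgetPex _ (fun=> 0) [set g | L2 Om g /\ is_wder Om m n u g]
  (ex_intro _ g (conj g2 ug)).
exact: wder_unique w2 g2 uw ug.
Qed.

Lemma sobolev_L2 k u : sobolev Om k u -> L2 Om u. Proof. by case. Qed.

Lemma sobolev_lin k c u v : sobolev Om k u -> sobolev Om k v -> sobolev Om k (c *: u + v).
Proof.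
move=> su sv; have u2 := sobolev_L2 su; have v2 := sobolev_L2 sv.
split; first exact: form_dom_lin L2form _ _ _ u2 v2.
move=> m n mnk; have [du2 hu] := wderP su mnk; have [dv2 hv] := wderP sv mnk.
exists (c *: wder Om m n u + wder Om m n v); split.
  exact: form_dom_lin L2form _ _ _ du2 dv2.
exact: is_wder_lin.
Qed.

Lemma wder_lin k m n c u v : sobolev Om k u -> sobolev Om k v -> (m + n <= k)%N ->
  eq_ae_on Om (wder Om m n (c *: u + v)) (c *: wder Om m n u + wder Om m n v).
Proof.
move=> su sv mnk; have u2 := sobolev_L2 su; have v2 := sobolev_L2 sv.
have [du2 hu] := wderP su mnk; have [dv2 hv] := wderP sv mnk.
apply: wder_eq; first exact: form_dom_lin L2form _ _ _ du2 dv2.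
exact: is_wder_lin.
Qed.

Lemma sobolev0 k : sobolev Om k 0.
Proof.
have z2 := form_dom0 L2form; split => // m n _; exists 0; split => //; exact: is_wder0.
Qed.

Lemma eq_ae_sobolev k u v : L2 Om u -> L2 Om v -> eq_ae_on Om u v ->
  sobolev Om k u -> sobolev Om k v.
Proof.
move=> u2 v2 uv [_ hu]; split => // m n mnk; have [g [g2 ug]] := hu m n mnk.
exists g; split => //; exact: (eq_ae_is_wder u2 v2).
Qed.

Lemma wder00 k u : sobolev Om k u -> eq_ae_on Om (wder Om 0 0 u) u.
Proof.
move=> su; apply: wder_eq; first exact: sobolev_L2 su.
by move=> phi _; rewrite expr0 mul1r.
Qed.

(** In [pder] the derivatives in the first variable are outermost, so one D_1 can be moved from the
    test function to [u] without exchanging derivatives. *)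
Lemma wder_comp10 m n u k : sobolev Om k u -> (1 <= k)%N ->
  sobolev Om (m + n) (wder Om 1 0 u) ->
  eq_ae_on Om (wder Om m.+1 n u) (wder Om m n (wder Om 1 0 u)).
Proof.
move=> su k1 sdu; have [du2 hu] := wderP su (k1 : (1 + 0 <= k)%N).
have [g2 hg] := wderP sdu (leqnn _).
apply: wder_eq => // phi tphi.
have sphi := tphi.1.
have -> : pder m.+1 n phi = pder 1 0 (pder m n phi) by [].
rewrite hu; last exact: test_function_pder.
rewrite hg // mulrA -exprD addn0 addnA //.
Qed.

Lemma wder_comp01 n u k : sobolev Om k u -> (1 <= k)%N ->
  sobolev Om n (wder Om 0 1 u) ->
  eq_ae_on Om (wder Om 0 n.+1 u) (wder Om 0 n (wder Om 0 1 u)).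
Proof.
move=> su k1 sdu; have [du2 hu] := wderP su (k1 : (0 + 1 <= k)%N).
have [g2 hg] := wderP sdu (leqnn (0 + n)%N).
apply: wder_eq => // phi tphi.
have -> : pder 0 n.+1 phi = pder 0 1 (pder 0 n phi) by [].
rewrite hu; last exact: test_function_pder.
by rewrite hg // mulrA -exprD.
Qed.

Lemma wder_comp11 u k : sobolev Om k u -> (1 <= k)%N ->
  sobolev Om 1 (wder Om 1 0 u) ->
  eq_ae_on Om (wder Om 1 1 u) (wder Om 0 1 (wder Om 1 0 u)).
Proof.
move=> su k1 sdu; exact: (@wder_comp10 0 1 u k).
Qed.

End WeakDerivatives.

(** * The plate space and the plate form *)

Section Plate.
Variable R : realType.
Local Notation mR := (measurableTypeR R).
Local Notation plane := (mR * mR)%type.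
Variable Om : set (R * R).
Hypothesis oOm : open Om.

Let mOm : measurable (Om : set plane). Proof. exact: open_measurable_plane. Qed.
Let L2form := L2dot_nonneg_form mOm.

Lemma ge0_cvg0P (x : nat -> \bar R) : (forall k, 0 <= x k)%E ->
  ((x k @[k --> \oo] --> 0%E) <->
   (forall e : R, 0 < e -> \forall k \near \oo, (x k <= e%:E)%E)).
Proof.
move=> x0; split => [/fine_cvgP[xfin /cvgrPdist_le h] e e0|h].
  have := h _ e0; apply: filterS2 xfin => k xk.
  rewrite sub0r normrN /= ger0_norm ?fine_ge0 // => hk.
  by rewrite -(fineK xk) lee_fin.
apply/fine_cvgP; split.
  have := h _ ltr01; apply: filterS => k hk.
  by rewrite ge0_fin_numE //; apply: le_lt_trans hk _; rewrite ltry.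
apply/cvgrPdist_le => e e0; have := h _ e0; apply: filterS => k hk.
rewrite sub0r normrN /= ger0_norm ?fine_ge0 // -lee_fin fineK //.
by rewrite ge0_fin_numE //; apply: le_lt_trans hk _; rewrite ltry.
Qed.

Lemma L2norm_energy_cvg0 (f : nat -> R * R -> R) :
  (L2norm Om (f k) @[k --> \oo] --> 0%E) <->
  (energy Om (f k) @[k --> \oo] --> 0%E).
Proof.
rewrite !ge0_cvg0P; [|by move=> k; exact: energy_ge0|by move=> k; exact: Lnorm_ge0].
split => h e e0.
  have s0 : 0 < Num.sqrt e by rewrite sqrtr_gt0.
  have := h _ s0; apply: filterS => k hk; rewrite -Lnorm2_energy.
  have -> : e%:E = ((Num.sqrt e)%:E `^ 2)%E.
    by rewrite poweR_EFin powR_mulrn ?sqrtr_ge0 // sqr_sqrtr // ltW.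
  by apply: gt0_ler_poweR => //; rewrite in_itv /= leey andbT ?Lnorm_ge0 ?lee_fin ?sqrtr_ge0.
have e2 : 0 < e ^+ 2 by rewrite exprn_gt0.
have := h _ e2; apply: filterS => k hk; rewrite L2normE.
have -> : e%:E = ((e ^+ 2)%:E `^ 2^-1)%E.
  by rewrite poweR_EFin powR12_sqrt ?sqr_ge0 // sqrtr_sqr ger0_norm // ltW.
by apply: gt0_ler_poweR => //; rewrite in_itv /= leey andbT ?energy_ge0 ?lee_fin ?sqr_ge0.
Qed.

Lemma ge0_integral_comb d (T : measurableType d) (mu : {measure set T -> \bar R})
    (E : set T) (a b : R) (f g : T -> R) : measurable E -> 0 <= a -> 0 <= b ->
  measurable_fun E f -> measurable_fun E g -> (forall t, E t -> 0 <= f t) ->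
  (forall t, E t -> 0 <= g t) ->
  (\int[mu]_(t in E) (a * f t + b * g t)%:E =
   a%:E * \int[mu]_(t in E) (f t)%:E + b%:E * \int[mu]_(t in E) (g t)%:E)%E.
Proof.
move=> mE a0 b0 mf mg f0 g0.
have Z (c : R) (h : T -> R) : 0 <= c -> measurable_fun E h -> (forall t, E t -> 0 <= h t) ->
    (c%:E * \int[mu]_(t in E) (h t)%:E = \int[mu]_(t in E) (c * h t)%:E)%E.
  move=> c0 mh h0; under [RHS]eq_integral do rewrite EFinM.
  rewrite ge0_integralZl_EFin //; first by apply/measurable_EFinP.
rewrite !Z // -ge0_integralD //.
- by move=> t Et; rewrite lee_fin mulr_ge0 ?f0.
- by apply/measurable_EFinP; exact: measurable_funM.
- by move=> t Et; rewrite lee_fin mulr_ge0 ?g0.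
- by apply/measurable_EFinP; exact: measurable_funM.
Qed.

Lemma energy_lin (E : set (R * R)) c f g : measurable (E : set plane) ->
  measurable_fun (E : set plane) (f : plane -> R) ->
  measurable_fun (E : set plane) (g : plane -> R) ->
  (energy E (c *: f + g)%R <= (2 * c ^+ 2)%:E * energy E f + 2%:E * energy E g)%E.
Proof.
move=> mE mf mg; have c2 : 0 <= 2 * c ^+ 2 by rewrite mulr_ge0 ?sqr_ge0.
rewrite /energy -(@ge0_integral_comb _ _ _ _ _ _ (fun p => f p ^+ 2) (fun p => g p ^+ 2)) //;
  [|exact: measurable_funX|exact: measurable_funX|by move=> p _; exact: sqr_ge0..].
apply: ge0_le_integral => //.
- by move=> p _; rewrite lee_fin sqr_ge0.
- by apply: measurable_sqrE; apply: measurable_funD => //; exact: measurable_funM.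
- apply/measurable_EFinP; apply: measurable_funD; apply: measurable_funM => //; exact: measurable_funX.
move=> p _; rewrite lee_fin -[(c *: f + g) p]/(c * f p + g p).
have := sqr_ge0 (c * f p - g p); nra.
Qed.

Lemma smooth_measurable (E : set (R * R)) phi : smooth phi ->
  measurable_fun (E : set plane) (phi : plane -> R).
Proof.
move=> /smooth_continuous cphi; apply: measurable_funTS.
exact: continuous_measurable_plane.
Qed.

Lemma smooth_pder m n (phi : R * R -> R) : smooth phi -> smooth (pder m n phi).
Proof.
move=> sphi; rewrite /pder; elim: m => [|m ih]; last by rewrite iterS; exact: smooth_pder1.
by elim: n => // n ih; rewrite iterS; exact: smooth_pder2.
Qed.

Lemma cvg0_lin c (x y z : nat -> \bar R) : (forall k, 0 <= z k)%E ->
  (forall k, z k <= (2 * c ^+ 2)%:E * x k + 2%:E * y k)%E ->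
  x k @[k --> \oo] --> 0%E -> y k @[k --> \oo] --> 0%E -> z k @[k --> \oo] --> 0%E.
Proof.
move=> z0 hz hx hy.
have h : ((2 * c ^+ 2)%:E * x k + 2%:E * y k)%E @[k --> \oo] --> 0%E.
  rewrite -[X in _ --> X]adde0 -[X in _ --> (X + _)%E](mule0 (2 * c ^+ 2)%:E) -[X in _ --> (_ + X)%E](mule0 2%:E).
  apply: cvgeD; first by rewrite !mule0.
    exact: cvgeMl.
  exact: cvgeMl.
apply: (squeeze_cvge _ (cvg_cst 0%E) h).
by apply: nearW => k; rewrite z0 hz.
Qed.

(** Approximations are combined linearly; the measurability along arcs contained in [has_trace] lets
    the integrals along arcs be added and compared. *)
Lemma has_trace_lin (S : set (R * R)) c v w g h : has_trace Om S v g -> has_trace Om S w h ->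
  has_trace Om S (c *: v + w) (c *: g + h).
Proof.
move=> [sv mg [phi [sphi cphi tphi]]] [sw mh [psi [spsi cpsi tpsi]]]; split.
- exact: (sobolev_lin oOm).
- move=> gam hgam; apply: measurable_funD; last exact: mh.
  by apply: measurable_funM => //; exact: mg.
exists (fun k => c *: phi k + psi k); split.
- by move=> k; exact: smooth_lin.
- move=> m n mn; apply/L2norm_energy_cvg0.
  have [dv2 _] := wderP sv mn; have [dw2 _] := wderP sw mn.
  have svw := sobolev_lin oOm c sv sw; have [dvw2 _] := wderP svw mn.
  have mv := L2_measurable mOm dv2; have mw := L2_measurable mOm dw2.
  have mvw := L2_measurable mOm dvw2.
  have mp k : measurable_fun (Om : set plane) (pder m n (phi k) : plane -> R).
    by apply: smooth_measurable; exact: smooth_pder.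
  have mq k : measurable_fun (Om : set plane) (pder m n (psi k) : plane -> R).
    by apply: smooth_measurable; exact: smooth_pder.
  have h1 := (L2norm_energy_cvg0 _).1 (cphi _ _ mn).
  have h2 := (L2norm_energy_cvg0 _).1 (cpsi _ _ mn).
  apply: (cvg0_lin (c := c) _ _ h1 h2) => k; first exact: energy_ge0.
  have -> : energy Om (pder m n (c *: phi k + psi k) \- wder Om m n (c *: v + w)) =
     energy Om (c *: (pder m n (phi k) \- wder Om m n v) + (pder m n (psi k) \- wder Om m n w)).
    apply: ae_eq_energy => //.
    + apply: measurable_funB => //; apply: smooth_measurable.
      by apply: smooth_pder; exact: smooth_lin.
    + apply: measurable_funD; last exact: measurable_funB.
      by apply: measurable_funM => //; exact: measurable_funB.
    have := wder_lin oOm c sv sw mn; apply: filterS => p hp Op.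
    rewrite pder_lin // -[LHS]/((c * pder m n (phi k) p + pder m n (psi k) p) - wder Om m n (c *: v + w) p).
    rewrite hp // -[RHS]/(c * (pder m n (phi k) p - wder Om m n v p) + (pder m n (psi k) p - wder Om m n w p)).
    rewrite -[(c *: wder Om m n v + wder Om m n w) p]/(c * wder Om m n v p + wder Om m n w p); ring.
  by apply: energy_lin => //; exact: measurable_funB.
- move=> gam hgam; have h1 := tphi _ hgam; have h2 := tpsi _ hgam.
  have [sgam _ _] := hgam.
  have cgam : continuous gam.
    by move=> t; apply: differentiable_continuous; apply/derivable1_diffP; exact: (sgam 0%N t).
  have cdgam : continuous (derive1 gam).
    by move=> t; apply: differentiable_continuous; apply/derivable1_diffP; exact: (sgam 1%N t).
  have mI : measurable (`[0, 1]%classic : set mR) by exact: measurable_itv.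
  have menorm : measurable_fun (`[0, 1]%classic : set mR) (fun t : mR => enorm (derive1 gam t)).
    apply: measurable_funTS; apply: measurable_realfun.continuous_measurable_fun => t.
    have c1 : {for t, continuous (fun s => (derive1 gam s).1)}.
      by apply: continuous_comp; [exact: cdgam|exact: cvg_fst].
    have c2 : {for t, continuous (fun s => (derive1 gam s).2)}.
      by apply: continuous_comp; [exact: cdgam|exact: cvg_snd].
    apply: (@continuous_comp _ _ _ (fun s => (derive1 gam s).1 ^+ 2 + (derive1 gam s).2 ^+ 2)).
      apply: cvgD; [exact: (cvg_comp _ _ c1 (@exprn_continuous R 2 _))|
                    exact: (cvg_comp _ _ c2 (@exprn_continuous R 2 _))].
    exact: sqrt_continuous.
  have mcomp (f : R * R -> R) : smooth f ->
      measurable_fun (`[0, 1]%classic : set mR) ((fun t => f (gam t)) : mR -> R).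
    move=> /smooth_continuous cf; apply: measurable_funTS; apply: measurable_realfun.continuous_measurable_fun.
    by move=> t; apply: continuous_comp; [exact: cgam|exact: cf].
  have mint (f g' : R * R -> R) : smooth f -> measurable_fun (`[0, 1]%classic : set mR) (g' \o gam) ->
      measurable_fun (`[0, 1]%classic : set mR)
        (fun t : mR => ((f (gam t) - g' (gam t)) ^+ 2 * enorm (derive1 gam t))%:E).
    move=> sf mg'; apply/measurable_EFinP; apply: measurable_funM => //.
    by apply: measurable_funX; apply: measurable_funB => //; exact: mcomp.
  have pos (f g' : R * R -> R) (t : mR) : (`[0, 1]%classic : set mR) t ->
      (0 <= ((f (gam t) - g' (gam t)) ^+ 2 * enorm (derive1 gam t))%:E)%E.
    by move=> _; rewrite lee_fin mulr_ge0 ?sqr_ge0 // /enorm sqrtr_ge0.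
  apply: (cvg0_lin (c := c) _ _ h1 h2) => k; first by apply: integral_ge0; exact: pos.
  have c2 : 0 <= 2 * c ^+ 2 by rewrite mulr_ge0 ?sqr_ge0.
  have mp := mint _ _ (sphi k) (mg _ hgam); have mq := mint _ _ (spsi k) (mh _ hgam).
  rewrite -ge0_integral_comb //; [|exact/measurable_EFinP|exact/measurable_EFinP|
    by move=> t /pos h0; rewrite -lee_fin; exact: h0..].
  apply: ge0_le_integral => //.
  - exact: pos.
  - apply: mint; first exact: smooth_lin.
    apply: measurable_funD; last exact: mh.
    by apply: measurable_funM => //; exact: mg.
  - apply/measurable_EFinP; apply: measurable_funD; apply: measurable_funM => //; exact/measurable_EFinP.
  move=> t _; rewrite lee_fin !mulrA -mulrDl ler_wpM2r ?sqrtr_ge0 //.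
  rewrite -[(c *: phi k + psi k) (gam t)]/(c * phi k (gam t) + psi k (gam t)).
  rewrite -[(c *: g + h) (gam t)]/(c * g (gam t) + h (gam t)).
  have := sqr_ge0 (c * (phi k (gam t) - g (gam t)) - (psi k (gam t) - h (gam t))); nra.
Qed.

Lemma eq_ae_has_trace (S : set (R * R)) v w g : L2 Om v -> L2 Om w -> eq_ae_on Om v w ->
  has_trace Om S v g -> has_trace Om S w g.
Proof.
move=> v2 w2 vw [sv mg [phi [sphi cphi tphi]]]; split => //.
  exact: (eq_ae_sobolev oOm v2 w2 vw).
exists phi; split; [exact: sphi| |exact: tphi] => m n mn.
by rewrite -(eq_ae_wder oOm m n v2 w2 vw); exact: cphi.
Qed.

Lemma pder_cst0 m n : pder m n (0 : R * R -> R) = 0.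
Proof.
have e1 : pder1 (0 : R * R -> R) = 0 by apply/funext => p; exact: derive_cst.
have e2 : pder2 (0 : R * R -> R) = 0 by apply/funext => p; exact: derive_cst.
rewrite /pder (_ : iter n _ _ = 0); last by elim: n => // n ih; rewrite iterS ih.
by elim: m => // m ih; rewrite iterS ih.
Qed.

Lemma has_trace0 (S : set (R * R)) : has_trace Om S 0 (fun=> 0).
Proof.
have z2 := form_dom0 L2form; split.
- exact: sobolev0.
- by move=> gam _; exact: measurable_cst.
have s0 : smooth (0 : R * R -> R).
  by move=> m n p; rewrite pder_cst0; exact: differentiable_cst.
exists (fun=> 0); split => //.
- move=> m n mn; apply/L2norm_energy_cvg0.
  have -> : (fun k : nat => energy Om (pder m n (0 : R * R -> R) \- wder Om m n 0)) = fun=> 0%E.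
    have e0 : energy Om 0 = 0%E by rewrite -(L2dot_energy mOm z2) (form0l L2form).
    apply/funext => k; rewrite -[RHS]e0; apply: ae_eq_energy => //.
    + apply: measurable_funB; first by apply: smooth_measurable; exact: smooth_pder.
      exact: L2_measurable (wderP (sobolev0 oOm 1) mn).1.
    + exact: measurable_cst.
    have := wder_eq oOm z2 (is_wder0 oOm m n); apply: filterS => p hp Op.
    by rewrite /= hp // pder_cst0 subrr.
  exact: cvg_cst.
- move=> gam _; under eq_fun do under eq_integral do rewrite subrr expr0n mul0r.
  by under eq_fun do rewrite integral0; exact: cvg_cst.
Qed.


Lemma lebesgue_ae_filter : Filter (nbhs (almost_everywhere (@lebesgue_measure R))).
Proof. exact: ae_filter_ringOfSetsType. Qed.
Existing Instance lebesgue_ae_filter.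

Lemma zero_normal_trace_lin (S : set (R * R)) c u v : sobolev Om 2 u -> sobolev Om 2 v ->
  zero_normal_trace Om S u -> zero_normal_trace Om S v ->
  zero_normal_trace Om S (c *: u + v).
Proof.
move=> su sv [g1 [g2 [t1 t2 hn]]] [h1 [h2 [s1 s2 hm]]].
exists (c *: g1 + h1), (c *: g2 + h2); split.
- have [a2 _] := wderP su (isT : (1 + 0 <= 2)%N); have [b2 _] := wderP sv (isT : (1 + 0 <= 2)%N).
  have [ab2 _] := wderP (sobolev_lin oOm c su sv) (isT : (1 + 0 <= 2)%N).
  apply: eq_ae_has_trace (has_trace_lin c t1 s1) => //.
    exact: (form_dom_lin L2form).
  exact/eq_ae_sym/(wder_lin oOm c su sv).
- have [a2 _] := wderP su (isT : (0 + 1 <= 2)%N); have [b2 _] := wderP sv (isT : (0 + 1 <= 2)%N).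
  have [ab2 _] := wderP (sobolev_lin oOm c su sv) (isT : (0 + 1 <= 2)%N).
  apply: eq_ae_has_trace (has_trace_lin c t2 s2) => //.
    exact: (form_dom_lin L2form).
  exact/eq_ae_sym/(wder_lin oOm c su sv).
move=> gam hgam; have := hm _ hgam; apply: filterS2 (hn _ hgam) => t e1 e2 t01.
rewrite -[(c *: g1 + h1) (gam t)]/(c * g1 (gam t) + h1 (gam t)).
rewrite -[(c *: g2 + h2) (gam t)]/(c * g2 (gam t) + h2 (gam t)).
have := congr1 ( *%R c) (e1 t01); have := e2 t01; rewrite mulr0; lra.
Qed.

Lemma zero_normal_trace0 (S : set (R * R)) : zero_normal_trace Om S 0.
Proof.
have z2 := form_dom0 L2form.
have w0 m n : (m + n <= 1)%N -> has_trace Om S (wder Om m n 0) (fun=> 0).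
  move=> mn; have [d2 _] := wderP (sobolev0 oOm 1) mn.
  apply: eq_ae_has_trace (has_trace0 S) => //.
  exact/eq_ae_sym/(wder_eq oOm z2 (is_wder0 oOm m n)).
exists (fun=> 0), (fun=> 0); split; [exact: w0|exact: w0|].
by move=> gam _; apply: aeW => t _; rewrite !mulr0 addr0.
Qed.

Variables (GD GM : set (R * R)).

Lemma zero_trace_lin (S : set (R * R)) c u v : zero_trace Om S u -> zero_trace Om S v ->
  zero_trace Om S (c *: u + v).
Proof.
move=> zu zv; have := has_trace_lin c zu zv.
have -> // : c *: (fun=> 0) + (fun=> 0) = (fun=> 0) :> (R * R -> R).
by apply/funext => p; rewrite -[LHS]/(c * 0 + 0) mulr0 addr0.
Qed.

Lemma plate_space_lin c u v : plate_space Om GD GM u -> plate_space Om GD GM v ->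
  plate_space Om GD GM (c *: u + v).
Proof.
move=> [su [zu nu'] mu] [sv [zv nv] mv]; split; [exact: (sobolev_lin oOm)| |exact: zero_trace_lin].
by split; [exact: zero_trace_lin|exact: zero_normal_trace_lin].
Qed.

Lemma plate_space0 : plate_space Om GD GM 0.
Proof.
split; first exact: sobolev0.
  by split; [exact: has_trace0|exact: zero_normal_trace0].
exact: has_trace0.
Qed.

Lemma plate_space_L2 u : plate_space Om GD GM u -> L2 Om u.
Proof. by move=> [[]]. Qed.

Variable nu : R.
Hypothesis nu_range : 0 <= nu < 1 / 2.

Lemma plate_space_wder u m n : plate_space Om GD GM u -> (m + n <= 2)%N ->
  L2 Om (wder Om m n u).
Proof. by move=> [su _ _] mn; have [] := wderP su mn. Qed.

(** The plate form with the second derivatives as free arguments: it is exactly bilinear in these,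
    whereas [wder] is linear only almost everywhere. *)
Definition hessian_form (A B C A' B' C' : R * R -> R) : R :=
  L2dot Om A A' + L2dot Om B B' + 2 * (1 - nu) * L2dot Om C C' +
  nu * (L2dot Om A B' + L2dot Om B A').

(** Twice the form is 2 (1 - nu) (|A|^2 + |B|^2) + 2 nu |A + B|^2 + 4 (1 - nu) |C|^2, and 1 - nu >
    1/2. *)
Lemma hessian_form_ge A B C : L2 Om A -> L2 Om B -> L2 Om C ->
  L2dot Om A A + L2dot Om B B + L2dot Om C C <= 2 * hessian_form A B C A B C.
Proof.
move=> a2 b2 c2; rewrite /hessian_form (form_sym L2form b2 a2).
have := form_ge0 L2form (subspaceD L2form a2 b2).
rewrite (formDD L2form a2 b2).
have := form_ge0 L2form a2; have := form_ge0 L2form b2; have := form_ge0 L2form c2.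
move: (L2dot _ _ _) (L2dot _ _ _) (L2dot _ _ _) (L2dot _ _ _) => X Y Z W.
case/andP: nu_range; nra.
Qed.

Lemma hessian_form_ge0 A B C : L2 Om A -> L2 Om B -> L2 Om C ->
  0 <= hessian_form A B C A B C.
Proof.
move=> a2 b2 c2; have := hessian_form_ge a2 b2 c2.
have := form_ge0 L2form a2; have := form_ge0 L2form b2; have := form_ge0 L2form c2.
lra.
Qed.

Lemma hessian_form_sym A B C A' B' C' : L2 Om A -> L2 Om B -> L2 Om C ->
  L2 Om A' -> L2 Om B' -> L2 Om C' ->
  hessian_form A B C A' B' C' = hessian_form A' B' C' A B C.
Proof.
move=> a2 b2 c2 a2' b2' c2'; rewrite /hessian_form.
rewrite (form_sym L2form a2 a2') (form_sym L2form b2 b2') (form_sym L2form c2 c2').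
by rewrite (form_sym L2form a2 b2') (form_sym L2form b2 a2') [X in nu * X]addrC.
Qed.

Lemma hessian_form_lin c A B C U V W A' B' C' : L2 Om A -> L2 Om B -> L2 Om C ->
  L2 Om U -> L2 Om V -> L2 Om W -> L2 Om A' -> L2 Om B' -> L2 Om C' ->
  hessian_form (c *: A + U) (c *: B + V) (c *: C + W) A' B' C' =
  c * hessian_form A B C A' B' C' + hessian_form U V W A' B' C'.
Proof.
move=> *; rewrite /hessian_form !(form_lin L2form) //; ring.
Qed.

Lemma eq_ae_hessian_form A B C U V W A' B' C' : L2 Om A -> L2 Om B -> L2 Om C ->
  L2 Om U -> L2 Om V -> L2 Om W -> L2 Om A' -> L2 Om B' -> L2 Om C' ->
  eq_ae_on Om A U -> eq_ae_on Om B V -> eq_ae_on Om C W ->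
  hessian_form A B C A' B' C' = hessian_form U V W A' B' C'.
Proof.
move=> A2 B2 C2 U2 V2 W2 A2' B2' C2' AU BV CW; rewrite /hessian_form.
rewrite (ae_eq_L2dot mOm A2 U2 A2' AU) (ae_eq_L2dot mOm B2 V2 B2' BV).
rewrite (ae_eq_L2dot mOm C2 W2 C2' CW).
by rewrite (ae_eq_L2dot mOm A2 U2 B2' AU) (ae_eq_L2dot mOm B2 V2 A2' BV).
Qed.

Lemma plate_form_coercive u : plate_space Om GD GM u ->
  L2dot Om (wder Om 2 0 u) (wder Om 2 0 u) + L2dot Om (wder Om 0 2 u) (wder Om 0 2 u) +
  L2dot Om (wder Om 1 1 u) (wder Om 1 1 u) <= 2 * plate_form Om nu u u.
Proof. by move=> pu; apply: hessian_form_ge; exact: plate_space_wder pu _. Qed.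

Lemma plate_form_nonneg : nonneg_form (plate_space Om GD GM) (plate_form Om nu).
Proof.
split.
- exact: plate_space0.
- exact: plate_space_lin.
- by move=> u v pu pv; apply: hessian_form_sym; [exact: plate_space_wder pu _|exact: plate_space_wder pu _|
    exact: plate_space_wder pu _|exact: plate_space_wder pv _|exact: plate_space_wder pv _|
    exact: plate_space_wder pv _].
- move=> c u v w pu pv pw.
  have puv := plate_space_lin c pu pv.
  have u2 m n := plate_space_wder (m := m) (n := n) pu.
  have v2 m n := plate_space_wder (m := m) (n := n) pv.
  have w2 m n := plate_space_wder (m := m) (n := n) pw.
  have uv2 m n := plate_space_wder (m := m) (n := n) puv.
  have l2 m n : (m + n <= 2)%N -> L2 Om (c *: wder Om m n u + wder Om m n v).
    by move=> mn; apply: (form_dom_lin L2form); [exact: u2|exact: v2].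
  have ae m n : (m + n <= 2)%N ->
      eq_ae_on Om (wder Om m n (c *: u + v)) (c *: wder Om m n u + wder Om m n v).
    by case: pu pv => su _ _ [sv _ _] mn; exact: (wder_lin oOm c su sv mn).
  have E := eq_ae_hessian_form (uv2 2%N 0%N isT) (uv2 0%N 2%N isT) (uv2 1%N 1%N isT)
    (l2 2%N 0%N isT) (l2 0%N 2%N isT) (l2 1%N 1%N isT)
    (w2 2%N 0%N isT) (w2 0%N 2%N isT) (w2 1%N 1%N isT)
    (ae 2%N 0%N isT) (ae 0%N 2%N isT) (ae 1%N 1%N isT).
  have F := hessian_form_lin c (u2 2%N 0%N isT) (u2 0%N 2%N isT) (u2 1%N 1%N isT)
    (v2 2%N 0%N isT) (v2 0%N 2%N isT) (v2 1%N 1%N isT)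
    (w2 2%N 0%N isT) (w2 0%N 2%N isT) (w2 1%N 1%N isT).
  exact: etrans E F.
- by move=> u pu; apply: hessian_form_ge0; exact: plate_space_wder pu _.
Qed.

Definition arc_defect phi g (gam : R -> R * R) : \bar R :=
  (\int[lebesgue_measure]_(t in (`[0%R, 1%R]%classic : set R))
    ((phi (gam t) - g (gam t)) ^+ 2 * enorm (derive1 gam t))%:E)%E.

(** One index of the approximating sequence meets all requirements at once. Two arcs are allowed
    because the hinged case evaluates the same approximant on both sides of the horn. *)
Lemma has_trace_approx (S : set (R * R)) v g (gam1 gam2 : R -> R * R) (eta : R) :
  has_trace Om S v g -> 0 < eta ->
  exists phi, [/\ smooth phi, (energy Om (phi - v)%R <= eta%:E)%E,
    (energy Om (pder1 phi - wder Om 1 0 v)%R <= eta%:E)%E,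
    (energy Om (pder2 phi - wder Om 0 1 v)%R <= eta%:E)%E &
    (is_arc_in S gam1 -> (arc_defect phi g gam1 <= eta%:E)%E) /\
    (is_arc_in S gam2 -> (arc_defect phi g gam2 <= eta%:E)%E)].
Proof.
move=> [sv mg [phi [sphi cphi tphi]]] eta0.
have E (x : nat -> \bar R) : (forall k, 0 <= x k)%E -> (x k @[k --> \oo] --> 0%E) ->
    \forall k \near \oo, (x k <= eta%:E)%E.
  by move=> x0 /(ge0_cvg0P x0); apply.
have A m n : (m + n <= 1)%N -> \forall k \near \oo,
    (energy Om (pder m n (phi k) - wder Om m n v)%R <= eta%:E)%E.
  move=> mn; apply: E => [k|]; first exact: energy_ge0.
  by apply/L2norm_energy_cvg0; exact: cphi.
have T gam : \forall k \near \oo, is_arc_in S gam -> (arc_defect (phi k) g gam <= eta%:E)%E.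
  have [hgam|nS] := pselect (is_arc_in S gam); last by apply: nearW.
  suff : \forall k \near \oo, (arc_defect (phi k) g gam <= eta%:E)%E by apply: filterS.
  apply: E => [k|]; last exact: tphi.
  by apply: integral_ge0 => t _; rewrite lee_fin mulr_ge0 ?sqr_ge0 // sqrtr_ge0.
have [N0 _ H0] := A 0%N 0%N isT; have [N1 _ H1] := A 1%N 0%N isT.
have [N2 _ H2] := A 0%N 1%N isT; have [N3 _ H3] := T gam1; have [N4 _ H4] := T gam2.
pose k := (N0 + N1 + N2 + N3 + N4)%N.
have k0 : (N0 <= k)%N by rewrite /k -!addnA leq_addr.
have k1 : (N1 <= k)%N by rewrite /k -!addnA addnCA leq_addr.
have k2 : (N2 <= k)%N by rewrite /k -!addnA addnA addnCA leq_addr.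
have k3 : (N3 <= k)%N by rewrite /k -!addnA 2!addnA addnCA leq_addr.
have k4 : (N4 <= k)%N by rewrite /k leq_addl.
exists (phi k); split; [exact: sphi| |exact: H1 k k1|exact: H2 k k2|split; [exact: H3 k k3|exact: H4 k k4]].
apply: le_trans (H0 k k0).
rewrite le_eqVlt; apply/orP; left; apply/eqP.
have v2 := sobolev_L2 sv; have [d2 _] := wderP sv (isT : (0 + 0 <= 1)%N).
apply: (ae_eq_energy mOm).
- exact: (measurable_funB (smooth_measurable (sphi k)) (L2_measurable mOm v2)).
- exact: (measurable_funB (smooth_measurable (sphi k)) (L2_measurable mOm d2)).
have := wder00 oOm sv; apply: filterS => p hp Op.
by rewrite -[RHS]/(phi k p - wder Om 0 0 v p) hp.
Qed.

End Plate.
#[global] Existing Instance lebesgue_ae_filter.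

(** * Estimates along lines *)

Section IntervalEstimates.
Variable R : realType.
Local Notation mR := (measurableTypeR R).

Definition itv_integral (a b : R) (g : R -> R) : R :=
  (\int[lebesgue_measure]_(t in (`[a, b]%classic : set mR)) g t)%R.

Lemma continuous_itv_integrable (a b : R) (g : R -> R) : continuous g ->
  lebesgue_measure.-integrable (`[a, b]%classic : set mR) (EFin \o g).
Proof.
move=> cg; apply: continuous_compact_integrable; first exact: segment_compact.
exact: continuous_subspaceT.
Qed.

Lemma itv_integralE (a b : R) (g : R -> R) : continuous g ->
  ((itv_integral a b g)%:E = \int[lebesgue_measure]_(t in (`[a, b]%classic : set mR)) (g t)%:E)%E.
Proof.
move=> cg; rewrite /itv_integral /Rintegral fineK //.
by apply: integrable_fin_num => //; exact: continuous_itv_integrable.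
Qed.

Lemma itv_integral_comb (a b c d : R) (f g : R -> R) : continuous f -> continuous g ->
  itv_integral a b (fun t => c * f t + d * g t) =
  c * itv_integral a b f + d * itv_integral a b g.
Proof.
move=> cf cg; have i1 := @continuous_itv_integrable a b _ cf.
have i2 := @continuous_itv_integrable a b _ cg.
have mI : measurable (`[a, b]%classic : set mR) by exact: measurable_itv.
rewrite /itv_integral RintegralD //; last 2 first.
- have := integrableZl mI c i1; by apply: eq_integrable => // t _ /=; rewrite EFinM.
- have := integrableZl mI d i2; by apply: eq_integrable => // t _ /=; rewrite EFinM.
by rewrite !RintegralZl.
Qed.

Lemma le_itv_integral (a b : R) (f g : R -> R) : continuous f -> continuous g ->
  (forall t, a <= t <= b -> f t <= g t) -> itv_integral a b f <= itv_integral a b g.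
Proof.
move=> cf cg fg; apply: le_Rintegral; [exact: measurable_itv|exact: continuous_itv_integrable|
  exact: continuous_itv_integrable|].
by move=> t; rewrite /= in_itv /=; exact: fg.
Qed.

Lemma itv_integral_cst (a b c : R) : a <= b -> itv_integral a b (fun=> c) = c * (b - a).
Proof.
move=> ab; rewrite /itv_integral Rintegral_cst; last exact: measurable_itv.
congr (_ * _); have E := @lebesgue_measure_itv R `[a, b].
apply: (etrans (congr1 fine E)); rewrite /= lte_fin; case: ltP => // ba.
have -> : b = a by apply/eqP; rewrite eq_le ab ba.
by rewrite subrr.
Qed.

Lemma itv_integral_ge0 (a b : R) (g : R -> R) : (forall t, 0 <= g t) -> 0 <= itv_integral a b g.
Proof. by move=> g0; apply: Rintegral_ge0 => t _; exact: g0. Qed.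

Lemma itv_integral_sub (a b c d : R) (g : R -> R) : continuous g -> (forall t, 0 <= g t) ->
  c <= a -> b <= d -> itv_integral a b g <= itv_integral c d g.
Proof.
move=> cg g0 ca bd; rewrite -lee_fin !itv_integralE //.
apply: ge0_subset_integral; [exact: measurable_itv|exact: measurable_itv| | |].
- by apply/measurable_EFinP; apply: measurable_funTS; exact: measurable_realfun.continuous_measurable_fun.
- by move=> t _; rewrite lee_fin.
by move=> t; rewrite /= !in_itv /= => /andP[h1 h2]; rewrite (le_trans ca) // (le_trans h2).
Qed.

Lemma continuous_sqr (g : R -> R) : continuous g -> continuous (fun t => g t ^+ 2).
Proof. by move=> cg t; exact: (cvg_comp _ _ (cg t) (@exprn_continuous R 2 _)). Qed.

Lemma mean_bound (a b : R) (g : R -> R) : a <= b -> continuous g ->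
  exists2 s, a <= s <= b & (b - a) * g s <= itv_integral a b g.
Proof.
move=> ab cg; have cw : {within `[a, b], continuous g} by exact: continuous_subspaceT.
have [s sab hs] := EVT_min ab cw; exists s; first by move: sab; rewrite in_itv.
rewrite mulrC -itv_integral_cst //; apply: le_itv_integral; [by move=> t; exact: cvg_cst|exact: cg|].
by move=> t tab; apply: hs; rewrite in_itv.
Qed.

Section Derivative.
Variables (f df : R -> R).
Hypothesis fdf : forall x, is_derive x (1 : R) f (df x).
Hypothesis cdf : continuous df.

Lemma is_derive_continuous : continuous f.
Proof.
by move=> x; apply: differentiable_continuous; apply/derivable1_diffP; case: (fdf x).
Qed.

Lemma increment_itv_integral (a b : R) : a <= b -> f b - f a = itv_integral a b df.
Proof.
rewrite le_eqVlt => /predU1P[<-|ab].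
  by rewrite subrr /itv_integral set_itv1 Rintegral_set1.
apply: EFin_inj; rewrite itv_integralE // EFinB.
apply/esym; apply: continuous_FTC2 => //.
- exact: continuous_subspaceT.
- split => [x _||]; first by case: (fdf x).
    by apply: cvg_at_right_filter; exact: is_derive_continuous.
  by apply: cvg_at_left_filter; exact: is_derive_continuous.
- by move=> x _; rewrite derive1E; case: (fdf x).
Qed.

(** Cauchy-Schwarz for the integral of df from y to x, obtained by expanding the integral of (df -
    m)^2 with the mean slope m. *)
Let increment_le (a b x y : R) : a <= y -> y <= x -> x <= b ->
  (f x - f y) ^+ 2 <= (b - a) * itv_integral a b (fun t => df t ^+ 2).
Proof.
move=> ay yx xb; have cd2 := continuous_sqr cdf.
have sq0 t : 0 <= df t ^+ 2 by exact: sqr_ge0.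
apply: (@le_trans _ _ ((x - y) * itv_integral y x (fun t => df t ^+ 2))); last first.
  apply: ler_pM; rewrite ?subr_ge0 ?itv_integral_ge0 //; first by lra.
  exact: itv_integral_sub.
have [yx0|yx0] := eqVneq y x; first by rewrite yx0 !subrr expr0n mul0r.
have xy : 0 < x - y by rewrite subr_gt0 lt_def eq_sym yx0.
pose m := (f x - f y) / (x - y).
have : 0 <= itv_integral y x (fun t => (df t - m) ^+ 2).
  by apply: itv_integral_ge0 => t; exact: sqr_ge0.
have -> : (fun t => (df t - m) ^+ 2) =
    (fun t => 1 * df t ^+ 2 + (- (2 * m)) * (1 * df t + (- (m / 2)) * cst 1 t)).
  by apply/funext => t /=; field.
have cc : continuous (cst 1 : R -> R) by move=> t; exact: cvg_cst.
have cl : continuous (fun t => 1 * df t + (- (m / 2)) * cst 1 t).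
  move=> t; apply: cvgD; apply: cvgM; [exact: cvg_cst|exact: cdf|exact: cvg_cst|exact: cvg_cst].
rewrite itv_integral_comb // itv_integral_comb // itv_integral_cst // -increment_itv_integral //.
set I := itv_integral _ _ _; rewrite /m => h.
have : 0 <= (x - y) * I - (f x - f y) ^+ 2.
  rewrite -(pmulr_rge0 _ (x := (x - y)^-1)) ?invr_gt0 //.
  have -> // : (x - y)^-1 * ((x - y) * I - (f x - f y) ^+ 2) = 1 * I + - (2 * ((f x - f y) / (x - y))) *
    (1 * (f x - f y) + - ((f x - f y) / (x - y) / 2) * (1 * (x - y))).
  by move: (f x - f y) => d; field; rewrite lt0r_neq0.
lra.
Qed.

Lemma increment_sqr_le (a b x y : R) : a <= x <= b -> a <= y <= b ->
  (f x - f y) ^+ 2 <= (b - a) * itv_integral a b (fun t => df t ^+ 2).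
Proof.
move=> /andP[ax xb] /andP[ay yb]; have [xy|yx] := leP x y; last exact: increment_le (ltW yx) _.
by rewrite -sqrrN opprB; exact: increment_le.
Qed.

(** f x is compared with f s at a point s where f^2 is at most its average. *)
Lemma sup_bound (a b x : R) : a < b -> a <= x <= b ->
  f x ^+ 2 <= itv_integral a b
    (fun t => 2 / (b - a) * f t ^+ 2 + 2 * (b - a) * df t ^+ 2).
Proof.
move=> ab xab; have cf := is_derive_continuous.
have c1 := continuous_sqr cf; have c2 := continuous_sqr cdf.
rewrite itv_integral_comb //.
have [s sab hs] := mean_bound (ltW ab) c1.
have := increment_sqr_le xab sab.
have l0 : 0 < b - a by rewrite subr_gt0.
set I1 := itv_integral _ _ (fun t => f t ^+ 2) in hs *; set I2 := itv_integral _ _ _.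
have h1 : f s ^+ 2 <= I1 / (b - a) by rewrite ler_pdivlMr // mulrC.
have -> : 2 / (b - a) * I1 = 2 * (I1 / (b - a)) by ring.
have := sqr_ge0 (f x - 2 * f s); lra.
Qed.

End Derivative.

Section DerivativePair.
Variables (w dw q dq : R -> R).
Hypotheses (wd : forall x, is_derive x (1 : R) w (dw x)) (cdw : continuous dw).
Hypotheses (qd : forall x, is_derive x (1 : R) q (dq x)) (cdq : continuous dq).

(** [w] and [q] will come from independent approximations, so [q] is only close to the derivative of
    [w]. The function w y - (q x) y has derivative (dw - q) + (q - q x); bounding its increment from
    s to t by Cauchy-Schwarz compares the slope q x with the increment of [w]. *)
Lemma pair_bound (a b x s t : R) : a <= x <= b -> a <= s <= b -> a <= t <= b ->
  ((t - s) * q x) ^+ 2 <= 2 * (w t - w s) ^+ 2 +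
    4 * (b - a) * itv_integral a b (fun y => (dw y - q y) ^+ 2) +
    4 * (b - a) ^+ 3 * itv_integral a b (fun y => dq y ^+ 2).
Proof.
move=> xab sab tab; have cq := is_derive_continuous qd.
have ab : a <= b by case/andP: xab => h1 h2; exact: le_trans h2.
pose phi y := w y - q x * y.
have dphi y : is_derive y (1 : R) phi (dw y - q x).
  have h := is_deriveB (wd y) (is_deriveZ (q x) (is_derive_id y (1 : R))).
  by apply: is_derive_eq h _; rewrite /GRing.scale /= mulr1.
have cdphi : continuous (fun y => dw y - q x).
  by move=> y; apply: cvgB; [exact: cdw|exact: cvg_cst].
have := increment_sqr_le dphi cdphi tab sab.
set I := itv_integral _ _ _.
have c1 : continuous (fun y => (dw y - q y) ^+ 2).
  by apply: continuous_sqr => y; apply: cvgB; [exact: cdw|exact: cq].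
pose D := itv_integral a b (fun y => dq y ^+ 2).
have cc : continuous (cst 1 : R -> R) by move=> y; exact: cvg_cst.
have : I <= itv_integral a b (fun y => 2 * (dw y - q y) ^+ 2 + 2 * ((b - a) * D) * cst 1 y).
  apply: le_itv_integral.
  - exact: continuous_sqr.
  - by move=> y; apply: cvgD; apply: cvgM; [exact: cvg_cst|exact: c1|exact: cvg_cst|exact: cvg_cst].
  move=> y yab; have := increment_sqr_le qd cdq yab xab; rewrite -/D.
  rewrite /= mulr1; have := sqr_ge0 ((dw y - q y) - (q y - q x)); lra.
rewrite itv_integral_comb // itv_integral_cst // mul1r -/D.
set I1 := itv_integral _ _ _ => hI hphi.
have l0 : 0 <= b - a by rewrite subr_ge0.
have := ler_wpM2l l0 hI.
have -> : (t - s) * q x = (w t - w s) - (phi t - phi s) by rewrite /phi; ring.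
have := sqr_ge0 ((w t - w s) + (phi t - phi s)).
move: hphi; move: (phi t - phi s) (w t - w s) => P W'.
have -> : (b - a) * (2 * I1 + 2 * ((b - a) * D) * (b - a)) =
  2 * ((b - a) * I1) + 2 * ((b - a) ^+ 3 * D) by ring.
rewrite -!mulrA; lra.
Qed.

(* w is compared at two points of the outer thirds of the interval at which w^2
   is at most its average there. *)
Lemma derivative_bound (a b x : R) : a < b -> a <= x <= b ->
  q x ^+ 2 <= itv_integral a b (fun y => 216 / (b - a) ^+ 3 * w y ^+ 2 +
    (36 / (b - a)) * (1 * (dw y - q y) ^+ 2 + (b - a) ^+ 2 * dq y ^+ 2)).
Proof.
move=> ab xab; have cq := is_derive_continuous qd; have cw := is_derive_continuous wd.
have c1 : continuous (fun y => (dw y - q y) ^+ 2).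
  by apply: continuous_sqr => y; apply: cvgB; [exact: cdw|exact: cq].
have c2 := continuous_sqr cdq; have c3 := continuous_sqr cw.
have c4 : continuous (fun y => 1 * (dw y - q y) ^+ 2 + (b - a) ^+ 2 * dq y ^+ 2).
  by move=> y; apply: cvgD; apply: cvgM; [exact: cvg_cst|exact: c1|exact: cvg_cst|exact: c2].
rewrite itv_integral_comb // itv_integral_comb //.
pose L := b - a; have L0 : 0 < L by rewrite subr_gt0.
have hb : b = a + L by rewrite /L; ring.
have w0 y : 0 <= w y ^+ 2 by exact: sqr_ge0.
have [s sab hs] : exists2 s, a <= s <= a + L / 3 & L / 3 * w s ^+ 2 <= itv_integral a b (fun y => w y ^+ 2).
  have [|s sab hs] := @mean_bound a (a + L / 3) _ _ c3; first by lra.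
  exists s => //; have -> : L / 3 = a + L / 3 - a by ring.
  apply: le_trans hs _; apply: itv_integral_sub => //; lra.
have [t tab ht] : exists2 t, b - L / 3 <= t <= b & L / 3 * w t ^+ 2 <= itv_integral a b (fun y => w y ^+ 2).
  have [|t tab ht] := @mean_bound (b - L / 3) b _ _ c3; first by lra.
  exists t => //; have -> : L / 3 = b - (b - L / 3) by ring.
  apply: le_trans ht _; apply: itv_integral_sub => //; lra.
have sab' : a <= s <= b by lra.
have tab' : a <= t <= b by lra.
have := pair_bound xab sab' tab'.
rewrite -/L; move: hs ht.
set I1 := itv_integral _ _ _; set I2 := itv_integral _ _ _; set I3 := itv_integral _ _ _ => hs ht h.
have h1 : w s ^+ 2 <= 3 / L * I1.
  have -> : 3 / L * I1 = I1 / (L / 3) by field; rewrite lt0r_neq0.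
  by rewrite ler_pdivlMr ?divr_gt0 // mulrC.
have h2 : w t ^+ 2 <= 3 / L * I1.
  have -> : 3 / L * I1 = I1 / (L / 3) by field; rewrite lt0r_neq0.
  by rewrite ler_pdivlMr ?divr_gt0 // mulrC.
have h3 : (L / 3) ^+ 2 * q x ^+ 2 <= ((t - s) * q x) ^+ 2.
  rewrite [leRHS]exprMn ler_wpM2r ?sqr_ge0 // lerXn2r ?nnegrE; lra.
have h4 : (w t - w s) ^+ 2 <= 12 / L * I1.
  have := sqr_ge0 (w t + w s).
  have -> : 12 / L * I1 = 4 * (3 / L * I1) by ring.
  lra.
have h5 : (L / 3) ^+ 2 * q x ^+ 2 <= 24 / L * I1 + 4 * L * I2 + 4 * L ^+ 3 * I3.
  have -> : 24 / L * I1 = 2 * (12 / L * I1) by ring.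
  lra.
have LL : 0 < (L / 3) ^+ 2 by rewrite exprn_gt0 // divr_gt0.
rewrite -(ler_pM2l LL); apply: le_trans h5 _; rewrite le_eqVlt; apply/orP; left; apply/eqP.
by field; rewrite lt0r_neq0.
Qed.

End DerivativePair.
End IntervalEstimates.

(** * From vertical lines to plane regions *)

Section LineEstimates.
Variable R : realType.
Local Notation mR := (measurableTypeR R).
Local Notation plane := (mR * mR)%type.
Implicit Types (A E Om : set (R * R)) (f w dw u v : R * R -> R).

(** Only the second variable is recorded; the first one is reached by exchanging the coordinates. *)
Definition line_C1 w dw := [/\ continuous w, continuous dw &
  forall x t, is_derive t (1 : R) (fun s => w (x, s)) (dw (x, t))].

Lemma continuous_section w x : continuous w -> continuous (fun t : R => w (x, t)).
Proof.
move=> cw t; apply: continuous_comp; last exact: cw.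
move=> B [[B1 B2] [/= h1 h2] hB]; apply: filterS h2 => s hs.
by apply: hB; split => //=; exact: nbhs_singleton h1.
Qed.

Lemma measurable_section (F : plane -> R) (x : R) : measurable_fun [set: plane] F ->
  measurable_fun [set: mR] (fun t : mR => F (x, t)).
Proof. by move=> mF; exact: (measurable_fun_pair2 x mF). Qed.

Lemma integral_sectionE E (F : R * R -> R) : measurable (E : set plane) ->
  measurable_fun [set: plane] (F : plane -> R) -> (forall p, 0 <= F p) ->
  (\int[area R]_(p in E) (F p)%:E =
   \int[lebesgue_measure]_(x in [set: mR])
     \int[lebesgue_measure]_(t in [set: mR]) (((F \_ E) (x, t))%:E))%E.
Proof.
move=> mE mF F0; rewrite integral_mkcond.
have -> : ((fun p => (F p)%:E) \_ E = (fun p => ((F \_ E) p)%:E))%E.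
  by apply/funext => p; rewrite !patchE; case: ifPn.
rewrite tonelli_xy //.
- apply/measurable_EFinP; apply/(measurable_restrictT _ mE).
  exact: measurable_funS mF.
- by move=> p; rewrite lee_fin patchE; case: ifPn.
Qed.

(** The endpoints may lie on the boundary of the domain, as they do for the cross-sections of the
    horn. *)
Lemma itv_integral_le_section E (G : R * R -> R) (x a b : R) : measurable (E : set plane) ->
  continuous G -> (forall p, 0 <= G p) -> (forall s, a < s < b -> E (x, s)) ->
  ((itv_integral a b (fun s => G (x, s)))%:E <=
   \int[lebesgue_measure]_(t in [set: mR]) ((G \_ E) (x, t))%:E)%E.
Proof.
move=> mE cG G0 abE; have cGx : continuous (fun s => G (x, s)) by exact: continuous_section.
have mG := continuous_measurable_plane cG.
have mGx : measurable_fun [set: mR] (fun s : mR => (G (x, s))%:E).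
  by apply/measurable_EFinP; exact: measurable_section.
have mGE : measurable_fun [set: plane] ((G \_ E) : plane -> R).
  by apply/(measurable_restrictT _ mE); exact: measurable_funS mG.
rewrite itv_integralE //.
rewrite -integral_itv_obnd_cbnd; last exact: measurable_funTS.
rewrite -integral_itv_bndo_bndc; last exact: measurable_funTS.
have mI : measurable (`]a, b[%classic : set mR) by exact: measurable_itv.
rewrite [leLHS]integral_mkcond; apply: ge0_le_integral => //.
- by move=> s _; rewrite patchE; case: ifPn => // _; rewrite lee_fin.
- by apply/(measurable_restrictT _ mI); exact: measurable_funTS.
- by apply/measurable_EFinP; exact: measurable_section.
move=> s _; rewrite patchE; case: ifPn => [|_].
  by rewrite inE /= in_itv /= => /abE Exs; rewrite patchE ifT //; exact/mem_set.
by rewrite lee_fin patchE; case: ifPn.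
Qed.

(** By Tonelli's theorem, the pointwise bound is integrated over a section of [A], which lies in
    [c, d]. The width d - c is part of the bound so that it may vary from line to line, as it does
    in the horn. *)
Lemma line_energy_width A E f (G : R * R -> R) :
  measurable (A : set plane) -> measurable (E : set plane) ->
  continuous f -> continuous G -> (forall p, 0 <= G p) ->
  (forall x, exists c d, c <= d /\ forall t, A (x, t) -> c <= t <= d /\
    exists a b, (forall s, a < s < b -> E (x, s)) /\
      (d - c) * f (x, t) ^+ 2 <= itv_integral a b (fun s => G (x, s))) ->
  (energy A f <= \int[area R]_(p in E) (G p)%:E)%E.
Proof.
move=> mA mE cf cG G0 hA.
have mf := continuous_measurable_plane cf; have mG := continuous_measurable_plane cG.
have mf2 : measurable_fun [set: plane] ((fun p => f p ^+ 2) : plane -> R).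
  exact: measurable_funX.
rewrite /energy (integral_sectionE mA mf2) => [|p]; last exact: sqr_ge0.
rewrite (integral_sectionE mE mG) //.
have mfA : measurable_fun [set: plane] (((fun p => f p ^+ 2) \_ A) : plane -> R).
  by apply/(measurable_restrictT _ mA); exact: measurable_funS mf2.
have mGE : measurable_fun [set: plane] ((G \_ E) : plane -> R).
  by apply/(measurable_restrictT _ mE); exact: measurable_funS mG.
have fA0 p : 0 <= ((fun p => f p ^+ 2) \_ A) p by rewrite patchE; case: ifPn => // _; exact: sqr_ge0.
have GE0 p : 0 <= (G \_ E) p by rewrite patchE; case: ifPn.
have K0 (x : mR) : (0 <= \int[lebesgue_measure]_(t in [set: mR]) ((G \_ E) (x, t))%:E)%E.
  by apply: integral_ge0 => t _; rewrite lee_fin.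
apply: ge0_le_integral => //.
- by move=> x _; apply: integral_ge0 => t _; rewrite lee_fin.
- apply: (@measurable_fun_fubini_tonelli_F _ _ _ _ _ (@lebesgue_measure R)
    (fun p : plane => (((fun p => f p ^+ 2) \_ A) p)%:E)).
    exact/measurable_EFinP.
  by move=> p; rewrite lee_fin.
- apply: (@measurable_fun_fubini_tonelli_F _ _ _ _ _ (@lebesgue_measure R) (fun p : plane => ((G \_ E) p)%:E)).
    exact/measurable_EFinP.
  by move=> p; rewrite lee_fin.
move=> x _; have [c [d [cd hc]]] := hA x.
set K := (\int[lebesgue_measure]_(t in _) ((G \_ E) (x, t))%:E)%E.
have KJ t : A (x, t) -> ((d - c)%:E * (f (x, t) ^+ 2)%:E <= K)%E.
  move=> /hc[_ [a [b [abE hab]]]]; rewrite -EFinM.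
  by apply: le_trans (itv_integral_le_section mE cG G0 abE); rewrite lee_fin.
have mI : measurable (`[c, d]%classic : set mR) by exact: measurable_itv.
have muI : lebesgue_measure (`[c, d]%classic : set mR) = (d - c)%:E.
  have E1 := @lebesgue_measure_itv R `[c, d]; apply: (etrans E1); rewrite /= lte_fin.
  case: ltP => // dc; have -> : d = c by apply/eqP; rewrite eq_le dc cd.
  by rewrite subrr.
have sec : (\int[lebesgue_measure]_(t in [set: mR]) (((fun p => f p ^+ 2) \_ A) (x, t))%:E =
    \int[lebesgue_measure]_(t in (`[c, d]%classic : set mR)) (((fun p => f p ^+ 2) \_ A) (x, t))%:E)%E.
  rewrite [RHS]integral_mkcond; apply: eq_integral => t _; rewrite [RHS]patchE.
  case: ifPn => // tI; rewrite patchE ifN //; apply: contraNN tI; rewrite !inE /=.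
  by move=> /hc[]; rewrite in_itv.
rewrite sec.
(* A section of width zero is null; otherwise the pointwise bound may be divided by the width. *)
have [cd0|cd0] := eqVneq c d.
  rewrite cd0 set_itv1 integral_set1; exact: K0.
have cdp : 0 < d - c by rewrite subr_gt0 lt_neqAle cd0.
have bound : forall t, ((((fun p => f p ^+ 2) \_ A) (x, t))%:E <= ((d - c)^-1)%:E * K)%E.
  move=> t; rewrite [X in (X%:E <= _)%E]patchE; case: ifPn => [|_]; last first.
    by apply: mule_ge0; [rewrite lee_fin invr_ge0 ltW|exact: K0].
  rewrite inE => /KJ h.
  have -> : ((f (x, t) ^+ 2)%:E = ((d - c)^-1)%:E * ((d - c)%:E * (f (x, t) ^+ 2)%:E))%E.
    by rewrite -!EFinM mulrA mulVf ?mul1r // lt0r_neq0.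
  by apply: lee_wpmul2l => //; rewrite lee_fin invr_ge0 ltW.
apply: (@le_trans _ _ (\int[lebesgue_measure]_(t in (`[c, d]%classic : set mR)) (cst (((d - c)^-1)%:E * K) t))%E).
  apply: ge0_le_integral => //.
  - by move=> t _; rewrite lee_fin.
  - by apply/measurable_EFinP; apply: measurable_funTS; exact: measurable_section.
by rewrite integral_cst // [X in (_ * X <= _)%E]muI muleAC -EFinM mulVf ?mul1e // lt0r_neq0.
Qed.

(** The width of the sections is uniformly bounded here and comes out as the factor that makes thin
    layers negligible. *)
Lemma line_energy A E f (G : R * R -> R) (delta : R) :
  measurable (A : set plane) -> measurable (E : set plane) ->
  continuous f -> continuous G -> (forall p, 0 <= G p) -> 0 <= delta ->
  (forall x, exists c, forall t, A (x, t) -> c <= t <= c + delta) ->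
  (forall x t, A (x, t) -> exists a b, (forall s, a <= s <= b -> E (x, s)) /\
    f (x, t) ^+ 2 <= itv_integral a b (fun s => G (x, s))) ->
  (energy A f <= delta%:E * \int[area R]_(p in E) (G p)%:E)%E.
Proof.
move=> mA mE cf cG G0 d0 hA hJ.
have -> : (delta%:E * \int[area R]_(p in E) (G p)%:E = \int[area R]_(p in E) (delta * G p)%:E)%E.
  rewrite -ge0_integralZl_EFin //; last 2 first.
  - by move=> p _; rewrite lee_fin.
  - by apply/measurable_EFinP; apply: measurable_funTS; exact: continuous_measurable_plane.
apply: (@line_energy_width A E f (fun p => delta * G p)) => //.
- by move=> p; apply: cvgM; [exact: cvg_cst|exact: cG].
- by move=> p; rewrite mulr_ge0.
move=> x; have [c hc] := hA x; exists c, (c + delta); split; first by rewrite lerDl.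
move=> t Axt; split; first exact: hc.
have [a [b [abE hab]]] := hJ _ _ Axt; exists a, b; split.
  by move=> s /andP[as_ sb]; apply: abE; rewrite !ltW.
have -> : c + delta - c = delta by rewrite addrAC subrr add0r.
have cGx : continuous (fun s => G (x, s)) by exact: continuous_section.
have := itv_integral_comb a b delta 0 cGx cGx; under eq_fun do rewrite mul0r addr0.
move=> ->; rewrite mul0r addr0; exact: ler_wpM2l.
Qed.

End LineEstimates.

(** * Square norms of sets met by segments of fixed length *)

Section SquareNorm.
Variable R : realType.
Local Notation mR := (measurableTypeR R).
Local Notation plane := (mR * mR)%type.
Implicit Types (A B E Om : set (R * R)) (f w dw u v q dq : R * R -> R).

Definition sqnorm E u : R := locked (L2dot E u u).

Lemma sqnormE E u : sqnorm E u = L2dot E u u.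
Proof. by rewrite /sqnorm -lock. Qed.

Lemma sqnorm_ge0 E u : 0 <= sqnorm E u.
Proof. by rewrite sqnormE; apply: Rintegral_ge0 => p _; rewrite -expr2 sqr_ge0. Qed.

Lemma sqnorm_energy E u : measurable (E : set plane) -> L2 E u ->
  (sqnorm E u)%:E = energy E u.
Proof. by move=> mE u2; rewrite sqnormE -L2dot_energy. Qed.

Lemma L2_subset A E u : measurable (A : set plane) -> measurable (E : set plane) ->
  A `<=` E -> L2 E u -> L2 A u.
Proof.
move=> mA mE AE /(L2P mE)[mu fu]; apply/(L2P mA); split; first exact: measurable_funS mu.
by apply: le_lt_trans fu; exact: energy_subset.
Qed.

Lemma sqnorm_subset A E u : measurable (A : set plane) -> measurable (E : set plane) ->
  A `<=` E -> L2 E u -> sqnorm A u <= sqnorm E u.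
Proof.
move=> mA mE AE u2; have u2A := L2_subset mA mE AE u2.
rewrite -lee_fin !sqnorm_energy //; apply: energy_subset => //; exact: L2_measurable u2.
Qed.

Lemma sqnormU A B u : measurable (A : set plane) -> measurable (B : set plane) ->
  A `&` B = set0 -> L2 (A `|` B) u -> sqnorm (A `|` B) u = sqnorm A u + sqnorm B u.
Proof.
move=> mA mB AB u2; have mAB := measurableU A B mA mB.
have u2A : L2 A u by apply: L2_subset u2 => // p; left.
have u2B : L2 B u by apply: L2_subset u2 => // p; right.
apply: EFin_inj; rewrite EFinD !sqnorm_energy // /energy ge0_integral_setU //.
- by apply: measurable_sqrE; exact: L2_measurable u2.
- by move=> p _; rewrite lee_fin sqr_ge0.
by apply/eqP.
Qed.

Lemma sqnormU_le A B u : measurable (A : set plane) -> measurable (B : set plane) ->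
  L2 (A `|` B) u -> sqnorm (A `|` B) u <= sqnorm A u + sqnorm B u.
Proof.
move=> mA mB u2; have mAB := measurableU A B mA mB.
have e : A `|` B = A `|` (B `\` A) by apply/seteqP; split => p /=; case: (pselect (A p)); tauto.
have mBA : measurable (B `\` A : set plane) by exact: measurableD.
have u2B : L2 B u by apply: L2_subset u2 => // p; right.
rewrite e sqnormU //; last by rewrite -e.
  by rewrite lerD2l; apply: sqnorm_subset => // p [].
by rewrite setDE setIA setIAC setICr set0I.
Qed.

Lemma sqnorm_approx E u w : measurable (E : set plane) -> L2 E u -> L2 E w ->
  sqnorm E u <= 2 * sqnorm E w + 2 * sqnorm E (w - u) /\
  sqnorm E w <= 2 * sqnorm E u + 2 * sqnorm E (w - u).
Proof.
move=> mE u2 w2; rewrite !sqnormE; have h := L2dot_nonneg_form mE.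
have d2 := subspaceB h w2 u2.
rewrite (formBB h w2 u2); split.
  have := form_ge0 h (subspaceB h (subspaceZ h 2 w2) u2).
  rewrite (formBB h (subspaceZ h 2 w2) u2) (formZZ h) // (formZl h) //; move: (L2dot E w w) (L2dot E w u) (L2dot E u u) => a b c; lra.
have := form_ge0 h (subspaceB h w2 (subspaceZ h 2 u2)).
rewrite (formBB h w2 (subspaceZ h 2 u2)) (formZZ h) // (formZr h) //; move: (L2dot E w w) (L2dot E w u) (L2dot E u u) => a b c; lra.
Qed.

Lemma sqnormD_le E u w : measurable (E : set plane) -> L2 E u -> L2 E w ->
  sqnorm E (u + w) <= 2 * sqnorm E u + 2 * sqnorm E w.
Proof.
move=> mE u2 w2; rewrite !sqnormE; have h := L2dot_nonneg_form mE.
rewrite (formDD h u2 w2).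
have := form_ge0 h (subspaceB h u2 w2); rewrite (formBB h u2 w2); lra.
Qed.

Lemma sqnormB_le E u w : measurable (E : set plane) -> L2 E u -> L2 E w ->
  sqnorm E (u - w) <= 2 * sqnorm E u + 2 * sqnorm E w.
Proof.
move=> mE u2 w2; rewrite !sqnormE; have h := L2dot_nonneg_form mE.
rewrite (formBB h u2 w2).
have := form_ge0 h (subspaceD h u2 w2); rewrite (formDD h u2 w2); lra.
Qed.

Lemma energy_approx_L2 E u w (e : R) : measurable (E : set plane) -> L2 E u ->
  measurable_fun (E : set plane) (w : plane -> R) -> (energy E (w - u)%R <= e%:E)%E ->
  [/\ L2 E w, L2 E (w - u) & sqnorm E (w - u) <= e].
Proof.
move=> mE u2 mw he; have h := L2dot_nonneg_form mE.
have d2 : L2 E (w - u).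
  apply/(L2P mE); split; last by apply: le_lt_trans he _; rewrite ltry.
  by apply: measurable_funB => //; exact: L2_measurable u2.
split => //; last by rewrite -lee_fin sqnorm_energy.
by rewrite -[w](subrK u); exact: (subspaceD h d2 u2).
Qed.

(** This is the passage to the limit in the accuracy of the approximations. *)
Lemma le_of_small_error (x y c : R) : 0 <= c ->
  (forall e, 0 < e -> x <= y + c * e) -> x <= y.
Proof.
move=> c0 h; rewrite leNgt; apply/negP => yx.
have e0 : 0 < (x - y) / (2 * (c + 1)) by rewrite divr_gt0 ?subr_gt0 // mulr_gt0 // ltr_wpDl.
have := h _ e0; have -> : c * ((x - y) / (2 * (c + 1))) = (x - y) / 2 * (c / (c + 1)).
  by field; rewrite lt0r_neq0 // ltr_wpDl.
have : c / (c + 1) <= 1 by rewrite ler_pdivrMr ?ltr_wpDl // mul1r lerDl.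
have d0 : 0 <= (x - y) / 2 by rewrite divr_ge0 // subr_ge0 ltW.
move=> /(ler_wpM2l d0); lra.
Qed.

(** [v] is D_2 u in the strong sense: an L2 limit of derivatives of functions that are C^1 on
    vertical lines and tend to [u]. *)
Definition line_approx Om u v := forall eta : R, 0 < eta -> exists w dw,
  [/\ line_C1 w dw, L2 Om w /\ L2 Om dw, sqnorm Om (w - u) <= eta & sqnorm Om (dw - v) <= eta].

Definition thin A (delta : R) := forall x, exists c, forall t, A (x, t) -> c <= t <= c + delta.

(** Near a boundary a segment can extend to the inner side only, hence the freedom in the position
    of the point on it. *)
Definition fibred A E (L : R) := forall x t, A (x, t) ->
  exists a, a <= t <= a + L /\ forall s, a <= s <= a + L -> E (x, s).

Lemma line_sqnorm3 A E f (delta a b c : R) g h k :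
  measurable (A : set plane) -> measurable (E : set plane) ->
  continuous f -> continuous g -> continuous h -> continuous k -> 0 <= a -> 0 <= b -> 0 <= c ->
  L2 A f -> L2 E g -> L2 E h -> L2 E k -> 0 <= delta -> thin A delta ->
  (forall x t, A (x, t) -> exists d e, (forall s, d <= s <= e -> E (x, s)) /\
    f (x, t) ^+ 2 <= itv_integral d e
      (fun s => a * g (x, s) ^+ 2 + (b * h (x, s) ^+ 2 + c * k (x, s) ^+ 2))) ->
  sqnorm A f <= delta * (a * sqnorm E g + (b * sqnorm E h + c * sqnorm E k)).
Proof.
move=> mA mE cf cg ch ck a0 b0 c0 f2 g2 h2 k2 d0 tA hf.
have csq (l : R * R -> R) : continuous l -> continuous (fun p : R * R => l p ^+ 2).
  by move=> cl p; exact: (cvg_comp _ _ (cl p) (@exprn_continuous R 2 _)).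
have msq (l : R * R -> R) : continuous l ->
    measurable_fun (E : set plane) (fun p : plane => l p ^+ 2).
  by move=> cl; apply: measurable_funTS; exact: continuous_measurable_plane (csq _ cl).
have cG : continuous (fun p : R * R => b * h p ^+ 2 + c * k p ^+ 2).
  by move=> p; apply: cvgD; apply: cvgM; [exact: cvg_cst|exact: csq|exact: cvg_cst|exact: csq].
have G0 p : 0 <= b * h p ^+ 2 + c * k p ^+ 2 by rewrite addr_ge0 // mulr_ge0 ?sqr_ge0.
have I1 := @ge0_integral_comb _ _ _ (area R) E b c (fun p : plane => h p ^+ 2) (fun p : plane => k p ^+ 2).
have I2 := @ge0_integral_comb _ _ _ (area R) E a 1 (fun p : plane => g p ^+ 2)
  (fun p : plane => b * h p ^+ 2 + c * k p ^+ 2).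
rewrite -lee_fin sqnorm_energy //.
have -> : ((delta * (a * sqnorm E g + (b * sqnorm E h + c * sqnorm E k)))%:E =
    delta%:E * \int[area R]_(p in E) (a * g p ^+ 2 + 1 * (b * h p ^+ 2 + c * k p ^+ 2))%:E)%E.
  rewrite I2 //; [|exact: msq| |by move=> p _; exact: sqr_ge0]; last first.
    by apply: measurable_funTS; exact: continuous_measurable_plane.
  rewrite I1 //; [|exact: msq|exact: msq|by move=> p _; exact: sqr_ge0|by move=> p _; exact: sqr_ge0].
  rewrite mul1e -[X in (_ + (_ * X + _))%E]/(energy E h) -[X in (_ + (_ + _ * X))%E]/(energy E k).
  by rewrite -[X in (_ * X + _)%E]/(energy E g) -!sqnorm_energy.
apply: (@line_energy _ A E f (fun p => a * g p ^+ 2 + 1 * (b * h p ^+ 2 + c * k p ^+ 2))) => //.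
- by move=> p; apply: cvgD; apply: cvgM; [exact: cvg_cst|exact: csq|exact: cvg_cst|exact: cG].
- by move=> p; rewrite mul1r addr_ge0 // mulr_ge0 ?sqr_ge0.
move=> x t /hf[d [e [deE hde]]]; exists d, e; split => //.
by under eq_fun do rewrite mul1r.
Qed.

Lemma line_sqnorm2 A E f (delta a b : R) g h : measurable (A : set plane) -> measurable (E : set plane) ->
  continuous f -> continuous g -> continuous h -> 0 <= a -> 0 <= b ->
  L2 A f -> L2 E g -> L2 E h -> 0 <= delta -> thin A delta ->
  (forall x t, A (x, t) -> exists c d, (forall s, c <= s <= d -> E (x, s)) /\
    f (x, t) ^+ 2 <= itv_integral c d (fun s => a * g (x, s) ^+ 2 + b * h (x, s) ^+ 2)) ->
  sqnorm A f <= delta * (a * sqnorm E g + b * sqnorm E h).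
Proof.
move=> mA mE cf cg ch a0 b0 f2 g2 h2 d0 tA hf.
have := @line_sqnorm3 A E f delta a b 0 g h h mA mE cf cg ch ch a0 b0 (lexx _) f2 g2 h2 h2 d0 tA.
rewrite mul0r addr0; apply=> x t /hf[c [d [cdE hcd]]]; exists c, d; split => //.
by under eq_fun do rewrite mul0r addr0.
Qed.

Let scaled_approx (K x y d e : R) : 0 <= K -> x <= 2 * y + 2 * d -> d <= e ->
  K * x <= K * (2 * y + 2 * e).
Proof. by move=> K0 xy de; rewrite ler_wpM2l //; lra. Qed.

Let approx_sum (x y z e : R) : x <= 2 * y + 2 * z -> y <= e -> z <= e -> x <= 4 * e.
Proof. lra. Qed.

Let approx_trans (x y z d e p q : R) : x <= 2 * y + 2 * d -> d <= e -> y <= z -> z <= p + q ->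
  x <= 2 * p + (2 * q + 2 * e).
Proof. lra. Qed.

Section Bounds.
Variables (A E Om : set (R * R)) (delta L : R).
Hypotheses (mA : measurable (A : set plane)) (mE : measurable (E : set plane))
  (mOm : measurable (Om : set plane)) (AO : A `<=` Om) (EO : E `<=` Om).
Hypotheses (d0 : 0 <= delta) (L0 : 0 < L) (tA : thin A delta) (fA : fibred A E L).

(** [sup_bound] on segments of length L is integrated over sections of width delta. The constants 2
    / L and 2 L are doubled twice, in passing from [u] to its approximant and back. *)
Lemma strip_bound u v : L2 Om u -> L2 Om v -> line_approx Om u v ->
  sqnorm A u <= delta * (8 / L * sqnorm E u + 8 * L * sqnorm E v).
Proof.
move=> u2 v2 uv.
have u2A := L2_subset mA mOm AO u2; have u2E := L2_subset mE mOm EO u2.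
have v2E := L2_subset mE mOm EO v2.
have iL : 0 <= L^-1 by rewrite invr_ge0 ltW.
apply: (@le_of_small_error _ _ (8 / L * delta + 8 * L * delta + 2)).
  by rewrite !addr_ge0 // !mulr_ge0 // ltW.
move=> e e0; have [w [dw [[cw cdw wd] [w2 dw2] wu dwv]]] := uv _ e0.
have h := L2dot_nonneg_form mOm.
have w2A := L2_subset mA mOm AO w2; have w2E := L2_subset mE mOm EO w2.
have dw2E := L2_subset mE mOm EO dw2.
have k1 : sqnorm A (w - u) <= e.
  by apply: le_trans wu; apply: sqnorm_subset => //; exact: L2B.
have k2 : sqnorm E (w - u) <= e.
  by apply: le_trans wu; apply: sqnorm_subset => //; exact: L2B.
have k3 : sqnorm E (dw - v) <= e.
  by apply: le_trans dwv; apply: sqnorm_subset => //; exact: L2B.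
have [a1 _] := sqnorm_approx mA u2A w2A; have [_ a2] := sqnorm_approx mE u2E w2E.
have [_ a3] := sqnorm_approx mE v2E dw2E.
have : sqnorm A w <= delta * (2 / L * sqnorm E w + 2 * L * sqnorm E dw).
  apply: line_sqnorm2 => //; [by rewrite mulr_ge0|by rewrite mulr_ge0 // ltW|].
  move=> x t /fA[c [ct cE]]; exists c, (c + L); split => //.
  have cdwx : continuous (fun s => dw (x, s)) by exact: continuous_section.
  have ccL : c < c + L by rewrite ltrDl.
  have := sup_bound (wd x) cdwx ccL ct.
  by have -> : c + L - c = L by ring.
have : 2 / L * sqnorm E w <= 2 / L * (2 * sqnorm E u + 2 * e).
  exact: scaled_approx (mulr_ge0 (ler0n _ 2) iL) a2 k2.
have : 2 * L * sqnorm E dw <= 2 * L * (2 * sqnorm E v + 2 * e).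
  exact: scaled_approx (mulr_ge0 (ler0n _ 2) (ltW L0)) a3 k3.
move=> b1 b2 b3.
have : delta * (2 / L * sqnorm E w + 2 * L * sqnorm E dw) <=
   delta * (2 / L * (2 * sqnorm E u + 2 * e) + 2 * L * (2 * sqnorm E v + 2 * e)).
  by rewrite ler_wpM2l // lerD.
have -> : delta * (2 / L * (2 * sqnorm E u + 2 * e) + 2 * L * (2 * sqnorm E v + 2 * e)) =
  delta * (4 / L * sqnorm E u + 4 * L * sqnorm E v) + (4 / L * delta + 4 * L * delta) * e by ring.
have -> : delta * (8 / L * sqnorm E u + 8 * L * sqnorm E v) =
  2 * (delta * (4 / L * sqnorm E u + 4 * L * sqnorm E v)) by ring.
have -> : (8 / L * delta + 8 * L * delta + 2) * e =
  2 * ((4 / L * delta + 4 * L * delta) * e) + 2 * e by ring.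
exact: approx_trans a1 k1 b3.
Qed.

(** Interpolation between [u] and its second derivative, through [derivative_bound]. The constants
    are four times those found there, again from two passages between functions and approximants. *)
Lemma gradient_bound u v s : L2 Om u -> L2 Om v -> L2 Om s ->
  line_approx Om u v -> line_approx Om v s ->
  sqnorm A v <= delta * (864 / L ^+ 3 * sqnorm E u + 144 * L * sqnorm E s).
Proof.
move=> u2 v2 s2 uv vs.
have u2E := L2_subset mE mOm EO u2; have v2A := L2_subset mA mOm AO v2.
have v2E := L2_subset mE mOm EO v2; have s2E := L2_subset mE mOm EO s2.
have iL : 0 <= L^-1 by rewrite invr_ge0 ltW.
have L0' : 0 <= L by rewrite ltW.
have [K KE] : exists K : R, K = 216 / L ^+ 3 by exists (216 / L ^+ 3).
have K0 : 0 <= K by rewrite KE mulr_ge0 ?ler0n // invr_ge0 exprn_ge0.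
apply: (@le_of_small_error _ _ (delta * (4 * K + 288 / L + 144 * L) + 2)).
  apply: addr_ge0 (ler0n _ 2); apply: mulr_ge0 d0 _.
  apply: addr_ge0 (mulr_ge0 (ler0n _ 144) L0').
  exact: addr_ge0 (mulr_ge0 (ler0n _ 4) K0) (mulr_ge0 (ler0n _ 288) iL).
move=> e e0; have [w [dw [[cw cdw wd] [w2 dw2] wu dwv]]] := uv _ e0.
have [q [dq [[cq cdq qd] [q2 dq2] qv dqs]]] := vs _ e0.
have h := L2dot_nonneg_form mOm; have hE := L2dot_nonneg_form mE.
have w2E := L2_subset mE mOm EO w2; have dw2E := L2_subset mE mOm EO dw2.
have q2A := L2_subset mA mOm AO q2; have q2E := L2_subset mE mOm EO q2.
have dq2E := L2_subset mE mOm EO dq2.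
have sub k l : L2 Om k -> L2 Om l -> sqnorm Om (k - l) <= e ->
    sqnorm E (k - l) <= e /\ sqnorm A (k - l) <= e.
  by move=> k2 l2 kl; split; apply: le_trans kl; apply: sqnorm_subset => //; exact: L2B.
have [k1 _] := sub _ _ w2 u2 wu; have [k2 _] := sub _ _ dw2 v2 dwv.
have [k3 k3A] := sub _ _ q2 v2 qv; have [k4 _] := sub _ _ dq2 s2 dqs.
have [a1 _] := sqnorm_approx mA v2A q2A; have [_ a2] := sqnorm_approx mE u2E w2E.
have [_ a4] := sqnorm_approx mE s2E dq2E.
have dd2 : L2 E (dw - q) by exact: L2B.
(* The derivative of the approximant of [u] and the approximant of [v] are both close to [v], hence
   to each other. *)
have a3 : sqnorm E (dw - q) <= 4 * e.
  have -> : dw - q = (dw - v) - (q - v) by rewrite opprB addrA subrK.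
  exact: approx_sum (sqnormB_le mE (L2B mE dw2E v2E) (L2B mE q2E v2E)) k2 k3.
have cd : continuous (dw - q) by move=> p; apply: cvgB; [exact: cdw|exact: cq].
have : sqnorm A q <= delta * (K * sqnorm E w +
    (36 / L * sqnorm E (dw - q) + 36 * L * sqnorm E dq)).
  have c0 : 0 <= 36 / L by rewrite mulr_ge0.
  have c0' : 0 <= 36 * L by rewrite mulr_ge0.
  apply: line_sqnorm3 => //.
  move=> x t /fA[c [ct cE]]; exists c, (c + L); split => //.
  have cdwx : continuous (fun s => dw (x, s)) by exact: continuous_section.
  have cdqx : continuous (fun s => dq (x, s)) by exact: continuous_section.
  have ccL : c < c + L by rewrite ltrDl.
  have := derivative_bound (wd x) cdwx (qd x) cdqx ccL ct.
  have -> : c + L - c = L by ring.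
  rewrite -KE; set i1 := itv_integral _ _ _; set i2 := itv_integral _ _ _.
  suff -> : i1 = i2 by [].
  congr itv_integral; apply/funext => y.
  have -> : (dw - q) (x, y) = dw (x, y) - q (x, y) by [].
  by field; rewrite lt0r_neq0.
have b1 : K * sqnorm E w <= K * (2 * sqnorm E u + 2 * e).
  exact: scaled_approx K0 a2 k1.
have b2 : 36 / L * sqnorm E (dw - q) <= 36 / L * (4 * e) by rewrite ler_wpM2l // mulr_ge0.
have b3 : 36 * L * sqnorm E dq <= 36 * L * (2 * sqnorm E s + 2 * e).
  exact: scaled_approx (mulr_ge0 (ler0n _ 36) L0') a4 k4.
move=> hq.
have : delta * (K * sqnorm E w + (36 / L * sqnorm E (dw - q) + 36 * L * sqnorm E dq)) <=
   delta * (K * (2 * sqnorm E u + 2 * e) + (36 / L * (4 * e) + 36 * L * (2 * sqnorm E s + 2 * e))).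
  by rewrite ler_wpM2l // !lerD.
have -> : 864 / L ^+ 3 = 4 * K by rewrite KE; ring.
have -> : delta * (K * (2 * sqnorm E u + 2 * e) + (36 / L * (4 * e) + 36 * L * (2 * sqnorm E s + 2 * e)))
  = delta * (2 * K * sqnorm E u + 72 * L * sqnorm E s) + delta * (2 * K + 144 / L + 72 * L) * e by ring.
have -> : delta * (4 * K * sqnorm E u + 144 * L * sqnorm E s) =
  2 * (delta * (2 * K * sqnorm E u + 72 * L * sqnorm E s)) by ring.
have -> : (delta * (4 * K + 288 / L + 144 * L) + 2) * e =
  2 * (delta * (2 * K + 144 / L + 72 * L) * e) + 2 * e by ring.
exact: approx_trans a1 k3A hq.
Qed.

End Bounds.
End SquareNorm.

(** * Exchanging the coordinates *)

Section Flip.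
Variable R : realType.
Local Notation mR := (measurableTypeR R).
Local Notation plane := (mR * mR)%type.
Implicit Types (A E Om : set (R * R)) (f u v phi : R * R -> R).

Definition flip (p : R * R) : R * R := (p.2, p.1).

Lemma flipK p : flip (flip p) = p. Proof. by case: p. Qed.

Lemma continuous_flip : continuous flip.
Proof.
move=> p B [[B1 B2] /= [h1 h2] hB].
by exists (B2, B1) => //= -[q1 q2] /= [k1 k2]; exact: hB.
Qed.

Lemma open_flip A : open A -> open (flip @^-1` A).
Proof. by move=> oA; apply: open_comp => // p _; exact: continuous_flip. Qed.

Lemma measurable_fun_flip : measurable_fun [set: plane] (flip : plane -> plane).
Proof. exact: (@measurable_swap _ _ mR mR). Qed.

Lemma measurable_flip E : measurable (E : set plane) -> measurable (flip @^-1` E : set plane).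
Proof. by move=> mE; rewrite -[_ @^-1` _]setTI; exact: measurable_fun_flip. Qed.

Lemma energy_flip E f : measurable (E : set plane) ->
  measurable_fun (E : set plane) (f : plane -> R) ->
  energy (flip @^-1` E) (f \o flip) = energy E f.
Proof.
move=> mE mf; rewrite /energy integral_mkcond [RHS]integral_mkcond.
have mF : measurable_fun [set: plane] ((fun p : plane => (f p ^+ 2)%:E) \_ E)%E.
  by apply/(measurable_restrictT _ mE); exact: measurable_sqrE.
have F0 p : (0 <= ((fun p : plane => (f p ^+ 2)%:E) \_ E) p)%E.
  by rewrite patchE; case: ifPn => // _; rewrite lee_fin sqr_ge0.
rewrite [RHS]tonelli_yx // -(tonelli_xy (F := fun p => ((fun p : plane => (f p ^+ 2)%:E) \_ E)%E (flip p))) //.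
exact: (measurableT_comp mF measurable_fun_flip).
Qed.

Lemma L2_flip E u : measurable (E : set plane) -> L2 E u -> L2 (flip @^-1` E) (u \o flip).
Proof.
move=> mE u2; have mFE := measurable_flip mE; have /(L2P mE)[mu fu] := u2.
apply/(L2P mFE); rewrite energy_flip //; split => //.
apply: (measurable_comp mE _ mu); first by move=> p [q qE <-].
by apply: measurable_funTS; exact: measurable_fun_flip.
Qed.

Lemma sqnorm_flip E u : measurable (E : set plane) -> L2 E u ->
  sqnorm (flip @^-1` E) (u \o flip) = sqnorm E u.
Proof.
move=> mE u2; apply: EFin_inj; rewrite !sqnorm_energy //; last 2 first.
- exact: measurable_flip.
- exact: L2_flip.
by apply: energy_flip => //; exact: L2_measurable u2.
Qed.

(** ([v1], [v2]) is the gradient of [u] as an L2 limit of gradients of functions smooth on the whole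
    plane. Up to an irregular boundary this is a property to be supplied; here the traces supply
    it. *)
Definition grad_approx Om u (v1 v2 : R * R -> R) := forall eta : R, 0 < eta -> exists phi,
  [/\ smooth phi, [/\ L2 Om phi, L2 Om (pder1 phi) & L2 Om (pder2 phi)],
    sqnorm Om (phi - u) <= eta, sqnorm Om (pder1 phi - v1) <= eta &
    sqnorm Om (pder2 phi - v2) <= eta].

Lemma smooth_line_C1 phi : smooth phi -> line_C1 phi (pder2 phi).
Proof.
move=> sphi; split; [exact: smooth_continuous|exact/smooth_continuous/smooth_pder2|].
by move=> x t; apply: is_derive_line2; exact: smooth_diff.
Qed.

Lemma smooth_line_C1_flip phi : smooth phi -> line_C1 (phi \o flip) (pder1 phi \o flip).
Proof.
move=> sphi; split.
- by move=> p; apply: continuous_comp; [exact: continuous_flip|exact: smooth_continuous].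
- by move=> p; apply: continuous_comp; [exact: continuous_flip|exact/smooth_continuous/smooth_pder1].
by move=> x t; apply: is_derive_line1; exact: smooth_diff.
Qed.

Lemma grad_line_approx Om u v1 v2 : grad_approx Om u v1 v2 -> line_approx Om u v2.
Proof.
move=> h eta /h[phi [sphi [p2 p12 p22] h0 h1 h2]]; exists phi, (pder2 phi); split; [exact: smooth_line_C1|by split|exact: h0|exact: h2].
Qed.

Lemma grad_line_approx_flip Om u v1 v2 : measurable (Om : set plane) ->
  L2 Om u -> L2 Om v1 -> grad_approx Om u v1 v2 ->
  line_approx (flip @^-1` Om) (u \o flip) (v1 \o flip).
Proof.
move=> mOm u2 v2' h eta /h[phi [sphi [p2 p12 p22] h0 h1 h2]].
exists (phi \o flip), (pder1 phi \o flip); split; [exact: smooth_line_C1_flip| | |].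
- by split; exact: L2_flip.
- by have := sqnorm_flip mOm (L2B mOm p2 u2) => ->.
- by have := sqnorm_flip mOm (L2B mOm p12 v2') => ->.
Qed.

End Flip.

(** * Poincare's inequality on squares *)

Section Poincare.
Variable R : realType.
Local Notation mR := (measurableTypeR R).
Local Notation plane := (mR * mR)%type.
Implicit Types (A E Om : set (R * R)) (f u : R * R -> R).

(** Half-open, so that four squares of half the side form an exact partition. *)
Definition square (a b h : R) : set (R * R) := `[a, a + h[%classic `*` `[b, b + h[%classic.

Lemma measurable_square a b h : measurable (square a b h : set plane).
Proof. exact: measurable_box. Qed.

Lemma area_box (I J : interval R) : area R ([set` I] `*` [set` J] : set plane) =
  (lebesgue_measure ([set` I] : set mR) * lebesgue_measure ([set` J] : set mR))%E.
Proof. by apply: product_measure1E; exact: measurable_itv. Qed.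

Lemma area_square a b h : 0 < h -> area R (square a b h) = (h ^+ 2)%:E.
Proof.
move=> h0; rewrite /square area_box.
have E (c : R) : lebesgue_measure (`[c, c + h[%classic : set mR) = h%:E.
  have e := @lebesgue_measure_itv R `[c, c + h[; apply: (etrans e).
  by rewrite /= lte_fin ltrDl h0 -EFinD addrAC subrr add0r.
by rewrite !E -EFinM expr2.
Qed.

Lemma L2_cst_square a b h (c : R) : 0 < h -> L2 (square a b h) (cst c).
Proof.
move=> h0; apply/(L2P (measurable_square a b h)); split; first exact: measurable_cst.
rewrite -[energy _ _]/(\int[area R]_(p in square a b h) cst (c ^+ 2)%:E p)%E integral_cst.
  by rewrite area_square // ltry.
exact: measurable_square.
Qed.

Lemma sqnorm_cst_square a b h (c : R) : 0 < h -> sqnorm (square a b h) (cst c) = c ^+ 2 * h ^+ 2.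
Proof.
move=> h0; have mQ := measurable_square a b h.
apply: EFin_inj; rewrite sqnorm_energy //; last exact: L2_cst_square.
rewrite -[energy _ _]/(\int[area R]_(p in square a b h) cst (c ^+ 2)%:E p)%E integral_cst //.
by rewrite area_square // EFinM.
Qed.

Lemma energy_closed_square a b h f : 0 < h -> measurable_fun [set: plane] (f : plane -> R) ->
  energy (`[a, a + h[%classic `*` `[b, b + h]%classic) f = energy (square a b h) f.
Proof.
move=> h0 mf; rewrite /energy.
rewrite (@ge0_negligible_integral _ _ _ (area R) _ (`[a, a + h[%classic `*` `[b + h, b + h]%classic)).
- congr integral; apply/seteqP; split => -[x t]; rewrite /square /= !in_itv /=.
    move=> [[h1 h2] h3]; split => //; case: (ltP t (b + h)) => h4; first by lra.
    by case: h3; split => //; lra.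
  by move=> [h1 h2]; split; [split => //; lra|move=> [_]; lra].
- exact: measurable_box.
- exact: measurable_box.
- by apply: measurable_sqrE; exact: measurable_funTS.
- by move=> p _; rewrite lee_fin sqr_ge0.
rewrite area_box set_itv1 lebesgue_measure_set1 mule0 //.
Qed.

Section Smooth.
Variables (a b h : R) (phi : R * R -> R).
Hypotheses (h0 : 0 < h) (sphi : smooth phi).
Let Q := square a b h.
Hypotheses (phi2 : L2 Q phi) (d12 : L2 Q (pder1 phi)) (d22 : L2 Q (pder2 phi)).
Let mQ : measurable (Q : set plane) := measurable_square a b h.

(** Some column carries at most the average of (D_2 phi)^2, up to eta. Otherwise V + eta would be
    bounded by h times the integral over each column, and [line_sqnorm2] applied to the constant
    sqrt(V + eta) would give (V + eta) h^2 <= V h^2. *)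
Let column (eta : R) : 0 < eta -> exists2 x, a <= x < a + h &
  h * itv_integral b (b + h) (fun t => pder2 phi (x, t) ^+ 2) <= sqnorm Q (pder2 phi) + eta.
Proof.
move=> eta0; apply: contrapT => /forall2NP hx.
have c2 : continuous (pder2 phi) by exact/smooth_continuous/smooth_pder2.
have m2 := continuous_measurable_plane c2.
set V := sqnorm Q (pder2 phi) in hx.
have V0 : 0 <= V by exact: sqnorm_ge0.
pose C : set (R * R) := `[a, a + h[%classic `*` `[b, b + h]%classic.
have mC : measurable (C : set plane) by exact: measurable_box.
have EC : energy C (pder2 phi) = energy Q (pder2 phi) by exact: energy_closed_square.
have d2C : L2 C (pder2 phi).
  by apply/(L2P mC); rewrite EC; move/(L2P mQ): d22 => -[_ f2]; split => //; exact: measurable_funTS.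
have VC : sqnorm C (pder2 phi) = V by apply: EFin_inj; rewrite !sqnorm_energy.
have cc (c : R) : continuous (cst c : R * R -> R) by move=> p; exact: cvg_cst.
have : sqnorm Q (cst (Num.sqrt (V + eta))) <= h * (0 * sqnorm C (pder2 phi) + h * sqnorm C (pder2 phi)).
  apply: line_sqnorm2 => //; [exact: ltW|exact: L2_cst_square|exact: ltW| |].
    by move=> x; exists b => t [/= _]; rewrite in_itv /=; lra.
  move=> x t [/=]; rewrite !in_itv /= => xa tb; exists b, (b + h); split.
    by move=> s sb; rewrite /C /= !in_itv /=.
  rewrite sqr_sqrtr; last by rewrite addr_ge0 // ltW.
  under eq_fun do rewrite mul0r add0r.
  have := itv_integral_comb b (b + h) h 0 (continuous_sqr (continuous_section (x := x) c2)) (continuous_sqr (continuous_section (x := x) c2)).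
  under eq_fun do rewrite mul0r addr0.
  move=> ->; rewrite mul0r addr0.
  by have [//|] := hx x; move=> /negP; rewrite -ltNge => /ltW.
rewrite sqnorm_cst_square // VC sqr_sqrtr; last by rewrite addr_ge0 // ltW.
have -> : h * (0 * V + h * V) = V * h ^+ 2 by ring.
rewrite ler_pM2r ?exprn_gt0 //; lra.
Qed.

(* phi is compared along rows with its values on a column where the integral of
   (pder2 phi)^2 is at most average, and then along that column. *)
Lemma poincare_smooth (eta : R) : 0 < eta -> exists c,
  sqnorm Q (phi - cst c) <= 2 * h ^+ 2 * (sqnorm Q (pder1 phi) + sqnorm Q (pder2 phi)) + eta.
Proof.
move=> eta0; have e0 : 0 < eta / (2 * h ^+ 2) by rewrite divr_gt0 // mulr_gt0 // exprn_gt0.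
have [x0 x0a hx0] := column e0; set V := sqnorm Q (pder2 phi) in hx0 *.
exists (phi (x0, b)).
have c0 := smooth_continuous sphi.
have c1 : continuous (pder1 phi) by exact/smooth_continuous/smooth_pder1.
have c2 : continuous (pder2 phi) by exact/smooth_continuous/smooth_pder2.
pose g (p : R * R) := phi (x0, p.2) - phi (x0, b).
have cg : continuous g.
  move=> p; apply: cvgB; last exact: cvg_cst.
  apply: (@continuous_comp _ _ _ snd (fun t => phi (x0, t))); first exact: cvg_snd.
  exact: continuous_section.
have g2 p : Q p -> g p ^+ 2 <= V + eta / (2 * h ^+ 2).
  move=> [/= _]; rewrite in_itv /= => pb; apply: le_trans hx0.
  have bb : b <= b <= b + h by lra.
  have pb' : b <= p.2 <= b + h by lra.
  have := increment_sqr_le (fun t => is_derive_line2 (smooth_diff sphi (x0, t)))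
    (continuous_section (x := x0) c2) pb' bb.
  by have -> : b + h - b = h by ring.
have V0 : 0 <= V + eta / (2 * h ^+ 2) by rewrite addr_ge0 ?sqnorm_ge0 // ltW.
have mg := continuous_measurable_plane cg.
have gE : (energy Q g <= ((V + eta / (2 * h ^+ 2)) * h ^+ 2)%:E)%E.
  rewrite EFinM -(@area_square a b) // -integral_cst //.
  apply: ge0_le_integral => //.
  - by move=> p _; rewrite lee_fin sqr_ge0.
  - by apply: measurable_sqrE; exact: measurable_funTS.
have gL2 : L2 Q g.
  by apply/(L2P mQ); split; [exact: measurable_funTS|apply: le_lt_trans gE _; rewrite ltry].
have gS : sqnorm Q g <= (V + eta / (2 * h ^+ 2)) * h ^+ 2 by rewrite -lee_fin sqnorm_energy.
have fL2 : L2 Q (phi - cst (phi (x0, b))) by apply: L2B => //; exact: L2_cst_square.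
pose f := (phi - cst (phi (x0, b))) - g.
have f2 : L2 Q f by exact: L2B.
have fE x t : f (x, t) = phi (x, t) - phi (x0, t).
  by rewrite -[LHS]/(phi (x, t) - phi (x0, b) - (phi (x0, t) - phi (x0, b))) opprB addrA subrK.
have cf : continuous f.
  by move=> p; apply: cvgB; [apply: cvgB; [exact: c0|exact: cvg_cst]|exact: cg].
have fS : sqnorm Q f <= h * (0 * sqnorm Q (pder1 phi) + h * sqnorm Q (pder1 phi)).
  have mQ' := measurable_flip mQ.
  rewrite -(sqnorm_flip mQ f2) -(sqnorm_flip mQ d12).
  have cfl (k : R * R -> R) : continuous k -> continuous (k \o @flip R).
    by move=> ck p; apply: continuous_comp; [exact: continuous_flip|exact: ck].
  apply: (line_sqnorm2 mQ' mQ' (cfl _ cf) (cfl _ c1) (cfl _ c1) (lexx 0) (ltW h0)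
    (L2_flip mQ f2) (L2_flip mQ d12) (L2_flip mQ d12) (ltW h0)).
    by move=> t; exists a => x [/=]; rewrite in_itv /=; lra.
  move=> t x [/=]; rewrite !in_itv /= => xa tb.
  exists (Num.min x0 x), (Num.max x0 x); split.
    move=> s; rewrite ge_min le_max => sx; rewrite /Q /flip /square /= !in_itv /=; split => //.
    by case/andP: sx => /orP[] s1 /orP[] s2; lra.
  under eq_fun do rewrite mul0r add0r.
  have cs : continuous (fun s => pder1 phi (s, t)).
    by have := @continuous_section _ (pder1 phi \o @flip R) t (cfl _ c1).
  have := itv_integral_comb (Num.min x0 x) (Num.max x0 x) h 0 (continuous_sqr cs) (continuous_sqr cs).
  under eq_fun do rewrite mul0r addr0.
  move=> ->; rewrite mul0r addr0 -[f (flip _)]/(f (x, t)) fE.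
  have x1 : Num.min x0 x <= x <= Num.max x0 x by rewrite ge_min le_max !lexx !orbT.
  have x2 : Num.min x0 x <= x0 <= Num.max x0 x by rewrite ge_min le_max !lexx.
  have := increment_sqr_le (fun s => is_derive_line1 (smooth_diff sphi (s, t))) cs x1 x2.
  move=> /le_trans; apply; apply: ler_wpM2r.
    by apply: itv_integral_ge0 => s; exact: sqr_ge0.
  by case: (leP x0 x) => _; lra.
have -> : phi - cst (phi (x0, b)) = f + g by rewrite /f subrK.
have := sqnormD_le mQ f2 gL2.
have e1 : eta / (2 * h ^+ 2) * h ^+ 2 = eta / 2 by field; rewrite lt0r_neq0.
rewrite mulrDl e1 in gS.
rewrite mul0r add0r mulrA -expr2 in fS.
have -> : 2 * h ^+ 2 * (sqnorm Q (pder1 phi) + V) = 2 * (h ^+ 2 * sqnorm Q (pder1 phi)) + 2 * (V * h ^+ 2) by ring.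
lra.
Qed.

End Smooth.

(** The constant 1 / h has unit norm on the square, so the first term on the right is the squared
    projection on the constants; the rest of |u|^2 is the squared distance to them. *)
Lemma sqnorm_projection a b h u (c : R) : 0 < h -> L2 (square a b h) u ->
  sqnorm (square a b h) u <= L2dot (square a b h) u (h^-1 *: cst 1) ^+ 2 +
    sqnorm (square a b h) (u - cst c).
Proof.
move=> h0 u2; have mQ := measurable_square a b h; have hQ := L2dot_nonneg_form mQ.
have one2 := @L2_cst_square a b h 1 h0.
have -> : cst c = c *: cst 1 :> (R * R -> R) by apply/funext => p; rewrite -[RHS]/(c * 1) mulr1.
rewrite (formZr hQ _ one2 u2) !sqnormE (formBB hQ u2 (subspaceZ hQ c one2)) (formZZ hQ) //.
rewrite (formZr hQ _ one2 u2) -[L2dot _ (cst 1) (cst 1)]sqnormE sqnorm_cst_square //.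
move: (L2dot _ u u) (L2dot _ u (cst 1)) => uu y.
have -> : y = h * (h^-1 * y) by rewrite mulrA divff ?mul1r // lt0r_neq0.
rewrite mulrA mulVf ?mul1r ?lt0r_neq0 //; move: (h^-1 * y) => z.
have := sqr_ge0 (z - c * h); lra.
Qed.

Let square_arith (k x p j d1 d2 v1 v2 e : R) : 0 <= k -> x <= 2 * p + 2 * j ->
  p <= 2 * k * (d1 + d2) + e -> d1 <= 2 * v1 + 2 * e -> d2 <= 2 * v2 + 2 * e -> j <= e ->
  x <= 8 * k * (v1 + v2) + (4 + 16 * k) * e.
Proof.
move=> k0 hx hp h1 h2 hj.
have : 2 * k * (d1 + d2) <= 2 * k * (2 * v1 + 2 * e + (2 * v2 + 2 * e)).
  by apply: ler_wpM2l; [rewrite mulr_ge0|lra].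
have -> : 2 * k * (2 * v1 + 2 * e + (2 * v2 + 2 * e)) = 4 * (k * (v1 + v2)) + 8 * (k * e) by ring.
rewrite (_ : 8 * k * (v1 + v2) + (4 + 16 * k) * e = 8 * (k * (v1 + v2)) + 4 * e + 16 * (k * e)); last by ring.
lra.
Qed.

(** The functional is integration against 1 / h on the square, extended by zero to [Om]; the smooth
    inequality passes to [u] by approximation. *)
Lemma square_poincare Om a b h : measurable (Om : set plane) -> 0 < h ->
  square a b h `<=` Om -> exists2 e, L2 Om e & forall u v1 v2,
  L2 Om u -> L2 Om v1 -> L2 Om v2 -> grad_approx Om u v1 v2 ->
  sqnorm (square a b h) u <= L2dot Om u e ^+ 2 +
    8 * h ^+ 2 * (sqnorm (square a b h) v1 + sqnorm (square a b h) v2).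
Proof.
move=> mOm h0 QO; have mQ := measurable_square a b h; have hQ := L2dot_nonneg_form mQ.
set Q := square a b h in QO mQ hQ *.
pose e : R * R -> R := (cst h^-1) \_ Q; exists e.
  apply/(L2P mOm); split.
    by apply: measurable_funTS; apply/(measurable_restrictT _ mQ); exact: measurable_cst.
  have := L2_cst_square a b h^-1 h0 => /(L2P mQ)[_]; apply: le_lt_trans.
  rewrite /energy integral_mkcond [leRHS]integral_mkcond le_eqVlt; apply/orP; left; apply/eqP.
  apply: eq_integral => p _; rewrite !patchE; case: ifPn => pO; case: ifPn => pQ //.
  - by rewrite /e patchE ifT.
  - by rewrite /e patchE ifN // expr0n.
  by move: pO; rewrite inE in pQ; rewrite (mem_set (QO _ pQ)).
move=> u v1 v2 u2 v12 v22 happ.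
have -> : L2dot Om u e = L2dot Q u (h^-1 *: cst 1).
  rewrite /L2dot /Rintegral integral_mkcond [in RHS]integral_mkcond; congr fine.
  apply: eq_integral => p _; rewrite !patchE; case: ifPn => pO; case: ifPn => pQ //.
  - by rewrite /e patchE ifT // -[(h^-1 *: cst 1) p]/(h^-1 * 1) mulr1.
  - by rewrite /e patchE ifN // mulr0.
  by move: pO; rewrite inE in pQ; rewrite (mem_set (QO _ pQ)).
have u2Q := L2_subset mQ mOm QO u2; have v12Q := L2_subset mQ mOm QO v12.
have v22Q := L2_subset mQ mOm QO v22.
apply: (@le_of_small_error _ _ _ (4 + 16 * h ^+ 2)); first by rewrite addr_ge0 // mulr_ge0 // sqr_ge0.
move=> eta eta0; have [phi [sphi [p2 p12 p22] k0 k1 k2]] := happ _ eta0.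
have p2Q := L2_subset mQ mOm QO p2; have p12Q := L2_subset mQ mOm QO p12.
have p22Q := L2_subset mQ mOm QO p22.
have sub k l : L2 Om k -> L2 Om l -> sqnorm Om (k - l) <= eta -> sqnorm Q (k - l) <= eta.
  by move=> k2' l2 kl; apply: le_trans kl; apply: sqnorm_subset => //; exact: L2B.
have j0 := sub _ _ p2 u2 k0; have j1 := sub _ _ p12 v12 k1; have j2 := sub _ _ p22 v22 k2.
have [c hc] := poincare_smooth h0 sphi p2Q p12Q p22Q eta0.
have cQ := L2_cst_square a b c h0.
apply: le_trans (sqnorm_projection c h0 u2Q) _; rewrite -/Q -addrA lerD2l.
have -> : u - cst c = (phi - cst c) - (phi - u).
  apply/funext => p; rewrite -[LHS]/(u p - c) -[RHS]/(phi p - c - (phi p - u p)); ring.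
have [_ a1] := sqnorm_approx mQ v12Q p12Q; have [_ a2] := sqnorm_approx mQ v22Q p22Q.
apply: square_arith (sqr_ge0 h) (sqnormB_le mQ (L2B mQ p2Q cQ) (L2B mQ p2Q u2Q)) hc _ _ j0.
  by apply: le_trans a1 _; rewrite lerD2l ler_pM2l.
by apply: le_trans a2 _; rewrite lerD2l ler_pM2l.
Qed.

Lemma square_split a b h : 0 <= h -> square a b (2 * h) =
  (square a b h `|` square (a + h) b h) `|` (square a (b + h) h `|` square (a + h) (b + h) h).
Proof.
move=> h0; apply/seteqP; split => -[x t] /=; rewrite /square /= !in_itv /=; last lra.
by case: (ltP x (a + h)); case: (ltP t (b + h)); lra.
Qed.

Lemma sqnorm_square_split a b h u : 0 <= h -> L2 (square a b (2 * h)) u ->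
  sqnorm (square a b (2 * h)) u = (sqnorm (square a b h) u + sqnorm (square (a + h) b h) u) +
    (sqnorm (square a (b + h) h) u + sqnorm (square (a + h) (b + h) h) u).
Proof.
move=> h0; rewrite square_split // => u2.
have m c d := measurable_square c d h.
have mL := measurableU _ _ (m a b) (m (a + h) b).
have mU := measurableU _ _ (m a (b + h)) (m (a + h) (b + h)).
have mA := measurableU _ _ mL mU.
rewrite sqnormU //.
- rewrite !sqnormU //.
  + by apply/seteqP; split => // -[x t] /= []; rewrite /square /= !in_itv /=; lra.
  + by apply: L2_subset u2 => // p hp; right.
  + by apply/seteqP; split => // -[x t] /= []; rewrite /square /= !in_itv /=; lra.
  + by apply: L2_subset u2 => // p hp; left.
by apply/seteqP; split => // -[x t] /= []; rewrite /square /= !in_itv /=; lra.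
Qed.

Definition L2_family Om (es : seq (R * R -> R)) : Prop := forall e, e \in es -> L2 Om e.

Let four_bounds (C x1 x2 x3 x4 s1 s2 s3 s4 a1 a2 a3 a4 b1 b2 b3 b4 : R) :
  x1 <= s1 + C * (a1 + b1) -> x2 <= s2 + C * (a2 + b2) ->
  x3 <= s3 + C * (a3 + b3) -> x4 <= s4 + C * (a4 + b4) ->
  x1 + x2 + (x3 + x4) <=
  s1 + s2 + (s3 + s4) + C * (a1 + a2 + (a3 + a4) + (b1 + b2 + (b3 + b4))).
Proof. by rewrite !mulrDr; lra. Qed.

(** Each quartering halves the side and multiplies the number of functionals by four, so the
    constant in front of the gradient decreases like 4^-n. *)
Lemma square_compactness Om n : measurable (Om : set plane) -> forall a b h, 0 < h ->
  square a b h `<=` Om -> exists es, L2_family Om es /\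
  forall u v1 v2, L2 Om u -> L2 Om v1 -> L2 Om v2 -> grad_approx Om u v1 v2 ->
  sqnorm (square a b h) u <= \sum_(e <- es) L2dot Om u e ^+ 2 +
    8 * (h / 2 ^+ n) ^+ 2 * (sqnorm (square a b h) v1 + sqnorm (square a b h) v2).
Proof.
move=> mOm; elim: n => [|n ih] a b h h0 QO.
  have [e e2 he] := square_poincare mOm h0 QO; exists [:: e]; split.
    by move=> e'; rewrite inE => /eqP ->.
  by move=> u v1 v2 u2 v12 v22 hu; rewrite big_seq1 expr0 divr1; exact: he.
pose k := h / 2; have k0 : 0 < k by rewrite divr_gt0.
have hk : h = 2 * k by rewrite /k; field.
rewrite hk in QO *; have Q4 := QO; rewrite square_split ?ltW // in Q4.
have [e1 [e12 he1]] := ih _ _ _ k0 (fun p hp => Q4 p (or_introl (or_introl hp))).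
have [e2 [e22 he2]] := ih _ _ _ k0 (fun p hp => Q4 p (or_introl (or_intror hp))).
have [e3 [e32 he3]] := ih _ _ _ k0 (fun p hp => Q4 p (or_intror (or_introl hp))).
have [e4 [e42 he4]] := ih _ _ _ k0 (fun p hp => Q4 p (or_intror (or_intror hp))).
exists ((e1 ++ e2) ++ (e3 ++ e4)); split.
  by move=> e; rewrite !mem_cat => /orP[/orP[]|/orP[]]; [exact: e12|exact: e22|exact: e32|exact: e42].
move=> u v1 v2 u2 v12 v22 hu; have mQ := measurable_square a b (2 * k).
have sub v : L2 Om v -> L2 (square a b (2 * k)) v by exact: L2_subset.
rewrite !(sqnorm_square_split (ltW k0) (sub _ _)) // !big_cat /=.
have -> : 2 * k / 2 ^+ n.+1 = k / 2 ^+ n.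
  by rewrite exprS; field; rewrite expf_neq0.
exact: four_bounds (he1 _ _ _ u2 v12 v22 hu) (he2 _ _ _ u2 v12 v22 hu)
  (he3 _ _ _ u2 v12 v22 hu) (he4 _ _ _ u2 v12 v22 hu).
Qed.

End Poincare.

(** * Compactness on bounded sets *)

Arguments flip {R} p.

Section LocalCompactness.
Variable R : realType.
Local Notation mR := (measurableTypeR R).
Local Notation plane := (mR * mR)%type.
Variable Om : set (R * R).
Hypothesis oOm : open Om.
Implicit Types (A E K U : set (R * R)) (u : R * R -> R) (p : R * R).
Let mOm : measurable (Om : set plane) := open_measurable_plane oOm.

(** [v1], [v2] are the first derivatives, and [s11], [s12], [s21], [s22] the second ones. [B] bounds
    [u] and the pure second derivatives; bounds for the first derivatives are recovered by
    interpolation wherever segments of fixed length are available. *)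
Definition regular_bound u (B : R) := exists v1 v2 s11 s12 s21 s22,
  [/\ [/\ L2 Om u, L2 Om v1 & L2 Om v2], L2 Om s11 /\ L2 Om s22,
      [/\ grad_approx Om u v1 v2, grad_approx Om v1 s11 s12 & grad_approx Om v2 s21 s22] &
      [/\ sqnorm Om u <= B, sqnorm Om s11 <= B & sqnorm Om s22 <= B]].

(** The control inequality localised to [E]; in this form it passes to subsets and finite unions. *)
Definition compactly_bounded E := forall eps : R, 0 < eps -> exists es, L2_family Om es /\
  forall u B, regular_bound u B ->
    sqnorm E u <= \sum_(e <- es) L2dot Om u e ^+ 2 + eps * B.

Lemma regular_bound_L2 u B : regular_bound u B -> L2 Om u.
Proof. by move=> [v1 [v2 [s11 [s12 [s21 [s22 [[]]]]]]]]. Qed.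

Lemma regular_bound_ge0 u B : regular_bound u B -> 0 <= B.
Proof.
by move=> [v1 [v2 [s11 [s12 [s21 [s22 [_ _ _ [uB _ _]]]]]]]]; apply: le_trans uB; exact: sqnorm_ge0.
Qed.

Lemma compactly_bounded_sub A E : measurable (A : set plane) -> measurable (E : set plane) ->
  A `<=` E -> E `<=` Om -> compactly_bounded E -> compactly_bounded A.
Proof.
move=> mA mE AE EO cE eps /cE[es [es2 hes]]; exists es; split => // u B hu.
apply: le_trans (hes u B hu); apply: sqnorm_subset => //.
exact: L2_subset EO (regular_bound_L2 hu).
Qed.

Lemma compactly_boundedU A E : measurable (A : set plane) -> measurable (E : set plane) ->
  A `<=` Om -> E `<=` Om -> compactly_bounded A -> compactly_bounded E ->
  compactly_bounded (A `|` E).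
Proof.
move=> mA mE AO EO cA cE eps eps0; have e0 : 0 < eps / 2 by rewrite divr_gt0.
have [es1 [h1 k1]] := cA _ e0; have [es2 [h2 k2]] := cE _ e0.
exists (es1 ++ es2); split; first by move=> e; rewrite mem_cat => /orP[/h1|/h2].
move=> u B hu; have mAE := measurableU _ _ mA mE.
have AEO : A `|` E `<=` Om by move=> p [/AO|/EO].
apply: le_trans (sqnormU_le mA mE (L2_subset mAE mOm AEO (regular_bound_L2 hu))) _.
rewrite big_cat /=; have := k1 u B hu; have := k2 u B hu.
have -> : eps * B = eps / 2 * B + eps / 2 * B by rewrite -mulrDl -splitr.
move: (sqnorm A u) (sqnorm E u) (\sum_(e <- es1) _) (\sum_(e <- es2) _) (eps / 2 * B) => *; lra.
Qed.

Lemma compactly_bounded0 : compactly_bounded set0.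
Proof.
move=> eps eps0; exists [::]; split => // u B hu.
rewrite big_nil add0r.
have -> : sqnorm set0 u = 0 by rewrite sqnormE /L2dot /Rintegral integral_set0.
by rewrite mulr_ge0 ?(regular_bound_ge0 hu) // ltW.
Qed.

Definition grad_const (L : R) : R := locked (864 / L ^+ 3 + 144 * L).

Lemma grad_const_ge0 (L : R) : 0 < L -> 0 <= grad_const L.
Proof.
move=> L0; rewrite /grad_const -lock.
have a0 : 0 <= 864 / L ^+ 3 by rewrite divr_ge0 ?ler0n // exprn_ge0 // ltW.
by rewrite addr_ge0 // mulr_ge0 ?ler0n // ltW.
Qed.

Lemma gradient_bound_B A (L delta B : R) (v s u : R * R -> R) (O : set (R * R)) :
  measurable (A : set plane) -> measurable (O : set plane) -> A `<=` O -> 0 <= delta -> 0 < L ->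
  thin A delta -> fibred A O L -> L2 O u -> L2 O v -> L2 O s ->
  line_approx O u v -> line_approx O v s -> sqnorm O u <= B -> sqnorm O s <= B ->
  sqnorm A v <= delta * grad_const L * B.
Proof.
move=> mA mO AO d0 L0 tA fA u2 v2 s2 uv vs uB sB.
apply: le_trans (gradient_bound mA mO mO AO (@subset_refl _ O) d0 L0 tA fA u2 v2 s2 uv vs) _.
rewrite -[leRHS]mulrA; apply: (ler_wpM2l d0); rewrite /grad_const -lock [leRHS]mulrDl.
have a0 : 0 <= 864 / L ^+ 3 by rewrite divr_ge0 ?ler0n // exprn_ge0 // ltW.
have b0 : 0 <= 144 * L by rewrite mulr_ge0 ?ler0n // ltW.
exact: lerD (ler_wpM2l a0 uB) (ler_wpM2l b0 sB).
Qed.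

(** From n <= 2^n <= 4^n. *)
Lemma small_square (h K eps : R) : 0 <= K -> 0 < eps -> exists n, 8 * (h / 2 ^+ n) ^+ 2 * K <= eps.
Proof.
move=> K0 eps0; pose m := 8 * h ^+ 2 * K / eps.
have m0 : 0 <= m by rewrite divr_ge0 ?(ltW eps0) // (mulr_ge0 (mulr_ge0 _ (sqr_ge0 h)) K0).
have [n hn] : exists n : nat, m <= n%:R.
  by exists (Num.truncn m).+1; apply: ltW; exact: truncnS_gt.
exists n; have n2 : n%:R <= (2 ^+ n) ^+ 2 :> R.
  have h1 : n%:R <= 2 ^+ n :> R by rewrite -natrX ler_nat ltnW // ltn_expl.
  by apply: le_trans h1 _; rewrite expr2 ler_peMl ?exprn_ge0 // exprn_ege1 // ler1n.
have p0 : 0 < (2 ^+ n : R) ^+ 2 by rewrite !exprn_gt0.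
have -> : 8 * (h / 2 ^+ n) ^+ 2 * K = (8 * h ^+ 2 * K) / (2 ^+ n) ^+ 2.
  by field; rewrite expf_neq0.
rewrite ler_pdivrMr //; move: (le_trans hn n2).
by rewrite /m ler_pdivrMr // [leRHS]mulrC.
Qed.

(** Segments in [Om] in both directions bound the two gradient norms by a fixed multiple of [B], so
    a fine enough subdivision makes their contribution small. *)
Lemma compactly_bounded_square a b h L : 0 < h -> 0 < L -> square a b h `<=` Om ->
  fibred (square a b h) Om L -> fibred (flip @^-1` square a b h) (flip @^-1` Om) L ->
  compactly_bounded (square a b h).
Proof.
move=> h0 L0 QO f2 f1 eps eps0; have mQ := measurable_square a b h.
pose C := h * grad_const L.
have C0 : 0 <= C by rewrite mulr_ge0 ?(ltW h0) // grad_const_ge0.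
have [n hn] := @small_square h (C + C) eps (addr_ge0 C0 C0) eps0.
have [es [es2 hes]] := square_compactness n mOm h0 QO.
exists es; split => // u B hu; have B0 := regular_bound_ge0 hu.
have [v1 [v2 [s11 [s12 [s21 [s22 [[u2 v12 v22] [s112 s222] [k0 k1 k2] [uB s11B s22B]]]]]]]] := hu.
have mQf := measurable_flip mQ; have mOf := measurable_flip mOm.
have w2 : sqnorm (square a b h) v2 <= C * B.
  apply: (gradient_bound_B mQ mOm QO (ltW h0) L0 _ f2 u2 v22 s222 (grad_line_approx k0) (grad_line_approx k2) uB s22B).
  by move=> x; exists b => t [/= _]; rewrite in_itv /=; lra.
have w1 : sqnorm (square a b h) v1 <= C * B.
  rewrite -(sqnorm_flip mQ (L2_subset mQ mOm QO v12)).
  apply: (gradient_bound_B mQf mOf _ (ltW h0) L0 _ f1 (L2_flip mOm u2) (L2_flip mOm v12) (L2_flip mOm s112)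
    (grad_line_approx_flip mOm u2 v12 k0) (grad_line_approx_flip mOm v12 s112 k1)).
  - by move=> p; exact: QO.
  - by move=> x; exists a => t [/=]; rewrite !in_itv /=; lra.
  - by rewrite sqnorm_flip.
  - by rewrite sqnorm_flip.
apply: le_trans (hes u v1 v2 u2 v12 v22 k0) _; rewrite lerD2l.
apply: le_trans (ler_wpM2r B0 hn); rewrite -[leRHS]mulrA; apply: ler_wpM2l.
  by rewrite mulr_ge0 // sqr_ge0.
by rewrite mulrDl; exact: lerD.
Qed.

Definition open_square p (e : R) : set (R * R) := [set q | `|p.1 - q.1| < e /\ `|p.2 - q.2| < e].

Lemma open_open_square p e : open (open_square p e).
Proof.
apply/open_planeP => q [h1 h2].
exists (Num.min (e - `|p.1 - q.1|) (e - `|p.2 - q.2|)).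
  by rewrite lt_min !subr_gt0 h1 h2.
move=> s; rewrite !lt_min => /andP[k1 _] /andP[_ k2]; split.
  by have := ler_distD q.1 p.1 s.1; lra.
by have := ler_distD q.2 p.2 s.2; lra.
Qed.

Lemma compactly_bounded_interior p : Om p -> exists U, [/\ open U, U p & compactly_bounded (U `&` Om)].
Proof.
move=> Op; have /open_planeP /(_ p Op)[e e0 he] := oOm.
(* Segments of length r that start in the square of half-side r around p stay within 3 r of p, hence
   in [Om]. *)
pose r := e / 4; have r0 : 0 < r by rewrite divr_gt0.
have inO x t : p.1 - 3 * r <= x <= p.1 + 3 * r -> p.2 - 3 * r <= t <= p.2 + 3 * r -> Om (x, t).
  by move=> hx ht; apply: he; rewrite /= ltr_norml; rewrite /r in hx ht r0; lra.
exists (open_square p r); split; first exact: open_open_square.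
  by split; rewrite subrr normr0.
pose Q := square (p.1 - r) (p.2 - r) (2 * r).
have QO : Q `<=` Om by move=> [x t] [/=]; rewrite !in_itv /= => h1 h2; apply: inO; lra.
apply: (@compactly_bounded_sub _ Q) => //.
- by apply: open_measurable_plane; apply: openI => //; exact: open_open_square.
- exact: measurable_square.
- by move=> [x t] [[/=]]; rewrite /Q /square /= !ltr_norml !in_itv /= => h1 h2 _; split; lra.
apply: (@compactly_bounded_square _ _ _ r) => //; first by rewrite mulr_gt0.
- move=> x t [/=]; rewrite !in_itv /= => h1 h2; exists t; split; first by lra.
  by move=> s hs; apply: inO; lra.
- move=> t x [/=]; rewrite !in_itv /= => h1 h2; exists x; split; first by lra.
  by move=> s hs; rewrite /flip /=; apply: inO; lra.
Qed.

(* If K were not compactly bounded, the sets whose complement in K is small would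
   form a proper filter without cluster point. *)
Lemma compactly_bounded_compact K : compact K ->
  (forall p, K p -> exists U, [/\ open U, U p & compactly_bounded (U `&` Om)]) ->
  compactly_bounded (K `&` Om).
Proof.
move=> cK hK; have clK : closed K by apply: compact_closed => //; exact: norm_hausdorff.
apply: contrapT => nK.
pose small (S : set (R * R)) := exists W, [/\ open W, W `<=` Om, S `&` Om `<=` W & compactly_bounded W].
have small0 : small set0.
  exists set0; split; [exact: open0|by []|by move=> p []|exact: compactly_bounded0].
have smallU S T : small S -> small T -> small (S `|` T).
  move=> [W [oW WO SW cW]] [V [oV VO TV cV]]; exists (W `|` V); split.
  - exact: openU.
  - by move=> p [/WO|/VO].
  - by move=> p [[Sp|Tp] Op]; [left; exact: SW|right; exact: TV].
  - by apply: compactly_boundedU => //; exact: open_measurable_plane.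
have smallS S T : S `<=` T -> small T -> small S.
  by move=> ST [W [oW WO TW cW]]; exists W; split => // p [/ST Tp Op]; exact: TW.
pose F := [set B : set (R * R) | small (K `\` B)].
have FF : ProperFilter F.
  split.
    rewrite /F /= setD0 => -[W [oW WO KW cW]]; apply: nK.
    apply: compactly_bounded_sub cW => //; [|exact: open_measurable_plane].
    by apply: measurableI => //; exact: closed_measurable_plane.
  split; first by rewrite /F /= setDT.
    by move=> A B FA FB; rewrite /F /= setDIr; exact: smallU.
  by move=> A B AB; apply: smallS => p [Kp nB]; split => // /AB.
have [|p [Kp cp]] := cK F FF; first by rewrite /F /= setDv.
have [U [oU Up cU]] := hK p Kp.
have FU : F (~` U).
  exists (U `&` Om); split; [exact: openI|by move=> q []| |exact: cU].
  by move=> q [[_ /contrapT Uq] Oq].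
have [q [nUq Uq]] := cp _ U FU (open_nbhs_nbhs (conj oU Up)).
exact: nUq.
Qed.

End LocalCompactness.

(** * Layers along the boundary *)

Section Collar.
Variable R : realType.
Local Notation mR := (measurableTypeR R).
Local Notation plane := (mR * mR)%type.
Implicit Types (A E K U Om : set (R * R)) (u psi : R * R -> R) (p : R * R).

(** Two scales are needed: segments from the thin layer [A] stay in [E], which leaves D_2 u to be
    bounded on [E], and for this segments from [E] stay in [Om]. The part of [U] in [Om] missed by
    [A] is covered by a compact subset of [Om]. *)
Record collar Om U E (L D : R) : Prop := Collar {
  collar_L : 0 < L;
  collar_D : 0 <= D;
  collar_measurable : measurable (E : set plane);
  collar_sub : E `<=` Om;
  collar_thin : thin E D;
  collar_fibred : fibred E Om L;
  collar_split : forall delta, 0 < delta -> exists A K,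
    [/\ measurable (A : set plane) /\ A `<=` E, thin A delta, fibred A E L,
      compact K /\ K `<=` Om & U `&` Om `<=` A `|` K] }.

(** Since D_2 psi does not vanish near p, psi is strictly monotone on vertical lines, at a rate at
    least m. A segment that runs in the direction of decreasing psi keeps psi < 0 and so stays in
    [Om]. *)
Lemma collar_exists Om p psi dpsi : open Om -> line_C1 psi dpsi -> dpsi p != 0 ->
  (\forall x \near p, Om x <-> psi x < 0) ->
  exists e L D, 0 < e /\ exists E, collar Om (open_square p e) E L D.
Proof.
move=> oOm [cpsi cdpsi hd]; case: p => px pt d0 /nbhs_ballP[e1 e10 he1].
pose m := `|dpsi (px, pt)| / 2; have m0 : 0 < m by rewrite divr_gt0 // normr_gt0.
have [e2 e20 he2] := continuous_plane_eps (px, pt) cdpsi m0.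
(* Within 2 b of p the sign of psi decides membership in [Om]. A point given by the mean value
   theorem between two such points is within 2 b + 4 b of p, hence the condition 6 b <= e2. *)
pose b := Num.min (e1 / 2) (e2 / 6).
have b0 : 0 < b by rewrite lt_min !divr_gt0.
have b1 : 2 * b <= e1.
  have : b <= e1 / 2 by rewrite ge_min lexx.
  lra.
have b2 : 6 * b <= e2.
  have : b <= e2 / 6 by rewrite ge_min lexx orbT.
  lra.
have inO x t : `|px - x| < 2 * b -> `|pt - t| < 2 * b -> (Om (x, t) <-> psi (x, t) < 0).
  by move=> h1 h2; apply: he1; apply/ball_pairE; split => /=; lra.
have mono : (forall x t s, `|px - x| < 2 * b -> `|pt - t| < 2 * b -> `|pt - s| < 2 * b -> t <= s ->
      m * (s - t) <= psi (x, s) - psi (x, t)) \/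
    (forall x t s, `|px - x| < 2 * b -> `|pt - t| < 2 * b -> `|pt - s| < 2 * b -> t <= s ->
      psi (x, s) - psi (x, t) <= - (m * (s - t))).
  have near x t s : `|px - x| < 2 * b -> `|pt - t| < 2 * b -> `|pt - s| < 2 * b -> t <= s ->
      exists2 c, `|dpsi (x, c) - dpsi (px, pt)| < m & psi (x, s) - psi (x, t) = dpsi (x, c) * (s - t).
    move=> hx ht hs ts; have [c hc E] := mean_value t s (hd x); exists c => //.
    rewrite distrC; apply: he2 => /=; first by lra.
    have e1' : `|s - t| < 4 * b by have := ler_distD pt s t; rewrite (distrC s pt); lra.
    by have := ler_distD t pt c; rewrite (distrC t c); lra.
  have [dp|dp|] := ltrgt0P (dpsi (px, pt)).
  - left=> x t s hx ht hs ts; have [c hc ->] := near x t s hx ht hs ts.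
    rewrite ler_wpM2r ?subr_ge0 //; move: hc; rewrite ltr_norml /m gtr0_norm //; lra.
  - right=> x t s hx ht hs ts; have [c hc ->] := near x t s hx ht hs ts.
    rewrite -mulNr ler_wpM2r ?subr_ge0 //; move: hc; rewrite ltr_norml /m ltr0_norm //; lra.
  by move=> dp0; rewrite dp0 eqxx in d0.
pose E := open_square (px, pt) b `&` Om.
exists (b / 2), (b / 2), (2 * b); split; first by rewrite divr_gt0.
exists E.
(* One statement serves both fibrations, with segments of length b / 2: from [E], of half-side b,
   into [Om], and from [A], of half-side b / 2, into [E]. *)
have fib c e (S T : set (R * R)) : 0 < c -> c + e <= 2 * b -> e <= b ->
    S `<=` open_square (px, pt) e `&` Om ->
    (forall x s, `|px - x| < e -> `|pt - s| < e + c -> Om (x, s) -> T (x, s)) -> fibred S T c.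
  move=> c0 ce eb SE hT x t /SE[[/= hx ht] Oxt].
  have neg : psi (x, t) < 0 by apply/(inO x t) => //; lra.
  case: mono => mono.
    exists (t - c); rewrite subrK; split; first by lra.
    move=> s hs; have hs' : `|pt - s| < e + c by move: ht; rewrite !ltr_norml; lra.
    apply: hT => //; apply/(inO x s); [lra|lra|].
    have st : s <= t by lra.
    have := mono x s t ltac:(lra) ltac:(lra) ltac:(lra) st.
    have : 0 <= m * (t - s) by rewrite mulr_ge0 ?subr_ge0 // ltW.
    lra.
  exists t; split; first by lra.
  move=> s hs; have hs' : `|pt - s| < e + c by move: ht; rewrite !ltr_norml; lra.
  apply: hT => //; apply/(inO x s); [lra|lra|].
  have st : t <= s by lra.
  have := mono x t s ltac:(lra) ltac:(lra) ltac:(lra) st.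
  have : 0 <= m * (s - t) by rewrite mulr_ge0 ?subr_ge0 // ltW.
  lra.
have oE : open E by apply: openI => //; exact: open_open_square.
split.
- by rewrite divr_gt0.
- lra.
- exact: open_measurable_plane.
- by move=> q [].
- by move=> x; exists (pt - b) => t [[/= _]]; rewrite ltr_norml; lra.
- apply: (fib _ b) => //; lra.
(* On a vertical line psi varies at a rate at least m, so any two points with -eta < psi < 0 are at
   distance at most eta / m = delta / 2. *)
move=> delta delta0; pose eta := m * delta / 2.
have eta0 : 0 < eta by rewrite divr_gt0 // mulr_gt0.
pose A := (open_square (px, pt) (b / 2) `&` Om) `&` [set q | - eta < psi q].
pose K : set (R * R) := (`[px - b / 2, px + b / 2]%classic `*` `[pt - b / 2, pt + b / 2]%classic) `&` [set q | psi q <= - eta].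
exists A, K.
have inE x t : `|px - x| < b / 2 -> `|pt - t| < b / 2 -> `|px - x| < 2 * b /\ `|pt - t| < 2 * b.
  by move=> h1 h2; split; lra.
split.
- split; last by move=> q [[[h1 h2] Oq] _]; split => //; split; lra.
  apply: open_measurable_plane; apply: openI.
    by apply: openI => //; exact: open_open_square.
  rewrite (_ : [set q | _] = psi @^-1` [set y | - eta < y]) //.
  by apply: open_comp => [q _|]; [exact: cpsi|exact: open_gt].
- move=> x; have [[t0 [[[/= hx ht0] Ot0] /= lt0]]|nA] := pselect (exists t, A (x, t)); last first.
    by exists 0 => t At; exfalso; apply: nA; exists t.
  exists (t0 - delta / 2) => t [[[/= _ ht] Ot] /= lt].
  have [hx' ht0'] := inE _ _ hx ht0; have [_ ht'] := inE _ _ hx ht.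
  have n0 : psi (x, t0) < 0 by apply/(inO x t0).
  have n1 : psi (x, t) < 0 by apply/(inO x t).
  suff : `|t - t0| <= delta / 2 by rewrite ler_norml; lra.
  have k (s r : R) : `|pt - s| < 2 * b -> `|pt - r| < 2 * b -> s <= r ->
      m * (r - s) <= `|psi (x, r) - psi (x, s)|.
    move=> hs hr sr; case: mono => [/(_ _ _ _ hx' hs hr sr) h|/(_ _ _ _ hx' hs hr sr) h].
      by apply: le_trans h _; exact: ler_norm.
    by rewrite distrC; apply: le_trans (ler_norm _); lra.
  have : m * `|t - t0| <= eta.
    case: (leP t0 t) => h.
      rewrite (ger0_norm (_ : 0 <= t - t0)); last lra.
      by apply: le_trans (k _ _ ht0' ht' h) _; rewrite ler_norml; lra.
    rewrite distrC (ger0_norm (_ : 0 <= t0 - t)); last lra.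
    by apply: le_trans (k _ _ ht' ht0' (ltW h)) _; rewrite ler_norml; lra.
  by rewrite /eta -mulrA ler_pM2l.
- apply: (fib _ (b / 2)) => //; [lra|lra|lra|by move=> q []|].
  by move=> x s hx hs Oxs; split => //; split => /=; lra.
- split.
    apply: (subclosed_compact _ (compact_setX (@segment_compact R (px - b / 2) (px + b / 2)) (@segment_compact R (pt - b / 2) (pt + b / 2)))).
      apply: closedI; last first.
        rewrite (_ : [set q | _] = psi @^-1` [set y | y <= - eta]) //.
        by apply: closed_comp => [q _|]; [exact: cpsi|exact: closed_le].
      apply: compact_closed; first exact: norm_hausdorff.
      by apply: compact_setX; exact: segment_compact.
    by move=> q [].
  move=> [x t] [[/=]]; rewrite !in_itv /= => hx ht /= lt.
  apply/(inO x t); [by rewrite ltr_norml; lra|by rewrite ltr_norml; lra|lra].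
move=> [x t] [[/= hx ht] Oxt].
case: (ltP (- eta) (psi (x, t))) => h; [left|right] => //.
by split => //=; rewrite !in_itv /=; move: hx ht; rewrite !ltr_norml; lra.
Qed.

End Collar.

(** * Compactness up to the boundary *)

Section BoundaryCompactness.
Variable R : realType.
Local Notation mR := (measurableTypeR R).
Local Notation plane := (mR * mR)%type.
Variable Om : set (R * R).
Hypothesis oOm : open Om.
Implicit Types (A E K U : set (R * R)) (u : R * R -> R) (p : R * R).
Let mOm : measurable (Om : set plane) := open_measurable_plane oOm.

Definition collar_const (L D : R) : R := locked (8 / L + 8 * L * (D * grad_const L)).

Lemma collar_const_ge0 L D : 0 < L -> 0 <= D -> 0 <= collar_const L D.
Proof.
move=> L0 D0; rewrite /collar_const -lock; have g0 := grad_const_ge0 L0.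
by rewrite addr_ge0 ?divr_ge0 ?mulr_ge0 ?ler0n ?(ltW L0).
Qed.

(** [strip_bound] on [A] leaves [u] and D_2 u on [E], and [gradient_bound_B] bounds the latter; the
    thickness delta remains as a small factor. *)
Lemma collar_bound O U E (L D delta B : R) A u (v s : R * R -> R) : open O ->
  collar O U E L D -> measurable (A : set plane) -> A `<=` E -> 0 <= delta -> thin A delta ->
  fibred A E L -> L2 O u -> L2 O v -> L2 O s -> line_approx O u v -> line_approx O v s ->
  sqnorm O u <= B -> sqnorm O s <= B -> sqnorm A u <= delta * collar_const L D * B.
Proof.
move=> oO [L0 D0 mE EO tE fE _] mA AE d0 tA fA u2 v2 s2 uv vs uB sB.
have mO := open_measurable_plane oO.
have AO : A `<=` O by move=> p /AE /EO.
apply: le_trans (strip_bound mA mE mO AO EO d0 L0 tA fA u2 v2 uv) _.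
rewrite -[leRHS]mulrA; apply: (ler_wpM2l d0).
have vB : sqnorm E v <= D * grad_const L * B.
  exact: (gradient_bound_B mE mO EO D0 L0 tE fE u2 v2 s2 uv vs uB sB).
have uE : sqnorm E u <= B by apply: le_trans uB; exact: sqnorm_subset.
rewrite /collar_const -lock [leRHS]mulrDl -[X in _ <= _ + X]mulrA.
have a0 : 0 <= 8 / L by rewrite divr_ge0 ?ler0n // ltW.
have b0 : 0 <= 8 * L by rewrite mulr_ge0 ?ler0n // ltW.
exact: lerD (ler_wpM2l a0 uE) (ler_wpM2l b0 vB).
Qed.

(** Half of eps is spent on the layer, by choosing its thickness; the other half on the compact set
    [K], which is covered by interior squares. *)
Lemma compactly_bounded_of_thin U (C : R) : open U -> 0 <= C ->
  (forall delta, 0 < delta -> exists A K, [/\ measurable (A : set plane), A `<=` Om,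
     compact K /\ K `<=` Om, U `&` Om `<=` A `|` K &
     forall u B, regular_bound Om u B -> sqnorm A u <= delta * C * B]) ->
  compactly_bounded Om (U `&` Om).
Proof.
move=> oU C0 h eps eps0.
have e0 : 0 < eps / 2 by rewrite divr_gt0.
have d0 : 0 < eps / 2 / (C + 1) by rewrite divr_gt0 // ltr_wpDl.
have [A [K [mA AO [cK KO] UAK hA]]] := h _ d0.
have clK : closed K by apply: compact_closed => //; exact: norm_hausdorff.
have mK : measurable (K : set plane) by exact: closed_measurable_plane.
have bK : compactly_bounded Om K.
  rewrite -[K](setIidl KO); apply: compactly_bounded_compact => // p Kp.
  by apply: compactly_bounded_interior => //; exact: KO.
have [es [es2 hes]] := bK _ e0; exists es; split => // u B hu.
have mU : measurable (U `&` Om : set plane) by apply: open_measurable_plane; exact: openI.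
have mAK := measurableU _ _ mA mK; have u2 := regular_bound_L2 hu.
have AKO : A `|` K `<=` Om by move=> p [/AO|/KO].
have u2AK := L2_subset mAK mOm AKO u2.
apply: le_trans (sqnorm_subset mU mAK UAK u2AK) _.
apply: le_trans (sqnormU_le mA mK u2AK) _.
have hAB : sqnorm A u <= eps / 2 * B.
  apply: le_trans (hA u B hu) _; apply: ler_wpM2r; first exact: regular_bound_ge0 hu.
  have -> : eps / 2 / (C + 1) * C = eps / 2 * (C / (C + 1)) by ring.
  by apply: ler_piMr; [exact: ltW|rewrite ler_pdivrMr ?ltr_wpDl // mul1r lerDl].
have := hes u B hu.
have -> : eps * B = eps / 2 * B + eps / 2 * B by rewrite -mulrDl -splitr.
move: hAB; move: (sqnorm A u) (sqnorm K u) (\sum_(e <- es) _) (eps / 2 * B) => *; lra.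
Qed.

Lemma compactly_bounded_collar U E L D : open U -> collar Om U E L D ->
  compactly_bounded Om (U `&` Om).
Proof.
move=> oU c; have [L0 D0 mE EO tE fE split_] := c.
apply: (compactly_bounded_of_thin oU (collar_const_ge0 L0 D0)) => delta d0.
have [A [K [[mA AE] tA fA KO UAK]]] := split_ _ d0; exists A, K; split => //.
  by move=> p /AE /EO.
move=> u B [v1 [v2 [s11 [s12 [s21 [s22 [[u2 v12 v22] [s112 s222] [k0 k1 k2] [uB s11B s22B]]]]]]]].
exact: (collar_bound oOm c mA AE (ltW d0) tA fA u2 v22 s222 (grad_line_approx k0) (grad_line_approx k2) uB s22B).
Qed.

Lemma compact_flip K : compact K -> compact (flip @^-1` K).
Proof.
move=> cK; have -> : flip @^-1` K = flip @` K.
  by apply/seteqP; split => [p Kp|p [q Kq <-]]; [exists (flip p) => //; rewrite flipK|rewrite /= flipK].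
apply: continuous_compact cK; apply: continuous_subspaceT; exact: continuous_flip.
Qed.

Lemma compactly_bounded_collar_flip U E L D : open U ->
  collar (flip @^-1` Om) (flip @^-1` U) E L D -> compactly_bounded Om (U `&` Om).
Proof.
move=> oU c; have [L0 D0 mE EO tE fE split_] := c.
apply: (compactly_bounded_of_thin oU (collar_const_ge0 L0 D0)) => delta d0.
have [A [K [[mA AE] tA fA [cK KO] UAK]]] := split_ _ d0.
have ff (S : set (R * R)) : flip @^-1` (flip @^-1` S) = S.
  by apply/funext => p; rewrite /preimage /= flipK.
have AO : flip @^-1` A `<=` Om by move=> p /AE /EO; rewrite /= flipK.
have mAf := measurable_flip mA.
exists (flip @^-1` A), (flip @^-1` K); split => //.
- by split; [exact: compact_flip|move=> p /KO; rewrite /= flipK].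
- move=> p [Up Op]; apply: (UAK (flip p)); split; rewrite /= flipK //.
move=> u B [v1 [v2 [s11 [s12 [s21 [s22 [[u2 v12 v22] [s112 s222] [k0 k1 k2] [uB s11B s22B]]]]]]]].
rewrite -(sqnorm_flip mAf (L2_subset mAf mOm AO u2)) ff.
apply: (collar_bound (open_flip oOm) c mA AE (ltW d0) tA fA (L2_flip mOm u2) (L2_flip mOm v12) (L2_flip mOm s112)
  (grad_line_approx_flip mOm u2 v12 k0) (grad_line_approx_flip mOm v12 s112 k1)).
- by rewrite sqnorm_flip.
- by rewrite sqnorm_flip.
Qed.

(** The gradient of psi does not vanish at p: if D_2 psi does, the layer is built in the exchanged
    coordinates. *)
Lemma compactly_bounded_boundary p psi : local_defining Om p psi ->
  exists U, [/\ open U, U p & compactly_bounded Om (U `&` Om)].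
Proof.
move=> [spsi _ g0 hp].
have Up e : 0 < e -> open_square p e p by move=> e0; split; rewrite subrr normr0.
have [d0|d0] := eqVneq (pder2 psi p) 0; last first.
  have [e [L [D [e0 [E c]]]]] := collar_exists oOm (smooth_line_C1 spsi) d0 hp.
  exists (open_square p e); split; [exact: open_open_square|exact: Up|].
  exact: compactly_bounded_collar (@open_open_square _ _ _) c.
have d1 : (pder1 psi \o flip) (flip p) != 0.
  by rewrite /= flipK; apply: contraNneq g0 => ->; rewrite d0.
have hpf : \forall x \near flip p, (flip @^-1` Om) x <-> (psi \o flip) x < 0.
  suff : nbhs (flip (flip p)) [set x | Om x <-> psi x < 0] by exact: (@continuous_flip R (flip p)).
  by rewrite flipK.
have [e [L [D [e0 [E c]]]]] := collar_exists (open_flip oOm) (smooth_line_C1_flip spsi) d1 hpf.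
exists (open_square p e); split; [exact: open_open_square|exact: Up|].
apply: (@compactly_bounded_collar_flip _ E L D (@open_open_square _ _ _)).
by have -> : flip @^-1` open_square p e = open_square (flip p) e by apply/seteqP; split => q [].
Qed.

(** The closure is compact, and each of its points is either in [Om] or on the boundary, where a
    good neighbourhood is known. *)
Lemma compactly_bounded_bounded (S : set (R * R)) : smooth_boundary Om -> closed S ->
  bounded_set (S `&` Om) -> compactly_bounded Om (S `&` Om).
Proof.
move=> sb cS bS.
have cK : compact (closure (S `&` Om)).
  have [M [_ hM]] := bS; pose m := `|M| + 1.
  have cB : compact (`[- m, m]%classic `*` `[- m, m]%classic : set (R * R)).
    by apply: compact_setX; exact: segment_compact.
  have clB : closed (`[- m, m]%classic `*` `[- m, m]%classic : set (R * R)).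
    by apply: compact_closed cB; exact: norm_hausdorff.
  apply: (subclosed_compact _ cB); first exact: closed_closure.
  rewrite [X in _ `<=` X](closure_id _).1 //; apply: closureS => p Sp.
  have Mm : M < m by rewrite /m; have := ler_norm M; lra.
  have Ep : `|p : R * R| = Num.max `|p.1| `|p.2| :> R by [].
  have : `|p : R * R| <= m by exact: hM m Mm p Sp.
  rewrite Ep ge_max => /andP[h1 h2].
  by split; rewrite /= in_itv /= -ler_norml.
have hK : compactly_bounded Om (closure (S `&` Om) `&` Om).
  apply: compactly_bounded_compact => // p Kp.
  case: (pselect (Om p)) => [|nOp]; first exact: compactly_bounded_interior.
  have [psi hpsi] : exists psi, local_defining Om p psi.
    apply: sb; split; first by apply: closureS Kp => q [].
    exact: subset_closure.
  exact: compactly_bounded_boundary hpsi.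
rewrite (_ : S `&` Om = closure (S `&` Om) `&` Om) //.
apply/seteqP; split => p.
  by move=> [Sp Op]; split => //; exact: subset_closure.
move=> [Kp Op]; split => //.
have : closure S p by apply: closureS Kp => q [].
by move/closure_id: cS => <-.
Qed.

End BoundaryCompactness.

(** * The horn *)

Section HornStrips.
Variable R : realType.
Local Notation mR := (measurableTypeR R).
Local Notation plane := (mR * mR)%type.
Implicit Types (A E Om : set (R * R)) (f u phi : R * R -> R) (K k : R -> R).
Variables (r : R) (G : R -> R).
Hypotheses (cG : continuous G) (Gpos : forall y, r <= y -> 0 < G y)
  (Gdecr : forall y1 y2, r <= y1 -> y1 <= y2 -> G y2 <= G y1).

(** The part a < y <= b of the horn; half-open, so that consecutive strips are disjoint, and
    measurable as a difference of open sets. *)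
Definition strip (a b : R) : set (R * R) := horn G a `\` horn G b.

Lemma open_horn a : open (horn G a).
Proof.
have c1 : continuous (fun p : R * R => p.1) by move=> p; exact: cvg_fst.
have c2 : continuous (fun p : R * R => p.2) by move=> p; exact: cvg_snd.
have cg : continuous (fun p : R * R => G p.1).
  by move=> p; apply: (@continuous_comp _ _ _ fst G); [exact: c1|exact: cG].
have e : horn G a = ((fun p => p.1) @^-1` [set y | a < y]) `&`
    (((fun p => p.2 - G p.1) @^-1` [set y | y < 0]) `&` ((fun p => p.2 + G p.1) @^-1` [set y | 0 < y])).
  apply/seteqP; split => -[x t]; rewrite /horn /=; first by move=> [h1 h2]; do ?split => //; lra.
  by move=> [h1 [h2 h3]]; split => //; lra.
rewrite e; apply: openI; last apply: openI; apply: open_comp => [p _|].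
- exact: c1.
- exact: open_gt.
- by apply: cvgB; [exact: c2|exact: cg].
- exact: open_lt.
- by apply: cvgD; [exact: c2|exact: cg].
- exact: open_gt.
Qed.

Lemma measurable_strip a b : measurable (strip a b : set plane).
Proof. by apply: measurableD; apply: open_measurable_plane; exact: open_horn. Qed.

Lemma stripP a b x t : strip a b (x, t) <-> a < x <= b /\ - G x < t < G x.
Proof.
split=> [[[/= ax tx] nb]|[/andP[ax xb] tx]].
  by split => //; rewrite ax leNgt; apply/negP => bx; apply: nb.
by split => //= -[/= bx _]; lra.
Qed.

Lemma continuous_graph K phi : continuous K -> continuous phi ->
  continuous (fun x => phi (x, K x)).
Proof.
move=> cK cphi x; apply: continuous_comp; last exact: cphi.
move=> B [[B1 B2] /= [h1 h2] hB]; have h2' := cK x _ h2.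
by apply: filterS2 h1 h2' => s s1 s2; apply: hB.
Qed.

Lemma continuous_fst_comp k : continuous k -> continuous (fun p : R * R => k p.1).
Proof. by move=> ck p; apply: (@continuous_comp _ _ _ fst k); [exact: cvg_fst|exact: ck]. Qed.

(** A function of the first variable is constant on each cross-section, whose length is 2 G x. *)
Lemma energy_strip_fst a b k : r <= a -> continuous k ->
  energy (strip a b) (fun p => k p.1) = (itv_integral a b (fun x => 2 * G x * k x ^+ 2))%:E.
Proof.
move=> ra ck; have mT := measurable_strip a b.
have ck1 := continuous_fst_comp ck; have mk := continuous_measurable_plane ck1.
have cF : continuous (fun x => 2 * G x * k x ^+ 2).
  move=> x; apply: cvgM; last exact: continuous_sqr.
  by apply: cvgM; [exact: cvg_cst|exact: cG].
rewrite /energy (integral_sectionE mT (F := fun p => k p.1 ^+ 2)); last 2 first.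
- exact: measurable_funX.
- by move=> p; exact: sqr_ge0.
have mF : measurable_fun [set: mR] (fun x : mR => (2 * G x * k x ^+ 2)%:E).
  by apply/measurable_EFinP; exact: measurable_realfun.continuous_measurable_fun.
rewrite itv_integralE // -integral_itv_obnd_cbnd; last exact: measurable_funTS.
rewrite [RHS]integral_mkcond; apply: eq_integral => x _; rewrite patchE.
case: ifPn => [|nx]; last first.
  rewrite integral0_eq // => t _; rewrite patchE; case: ifPn => //; rewrite inE => /stripP[hx _].
  by case/negP: nx; rewrite inE /= in_itv.
rewrite inE /= in_itv /= => xab.
have Gx : 0 < G x by apply: Gpos; lra.
pose I : set mR := `](- G x), (G x)[%classic.
have mI : measurable I by exact: measurable_itv.
have -> : (fun t : mR => (((fun p : R * R => k p.1 ^+ 2) \_ (strip a b)) (x, t))%:E) =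
    ((cst (k x ^+ 2)%:E : mR -> \bar R) \_ I)%E.
  apply/funext => t; rewrite !patchE /=.
  case: ifPn => [|nt]; rewrite ?inE.
    by move=> /stripP[_ h]; rewrite ifT // inE /I /= in_itv.
  rewrite ifN //; apply: contraNN nt; rewrite !inE /I /= in_itv /= => h; exact/stripP.
rewrite -integral_mkcond integral_cst //.
have mI2 : lebesgue_measure I = (2 * G x)%:E.
  have e := @lebesgue_measure_itv R `](- G x), (G x)[; apply: (etrans e).
  by rewrite /= lte_fin ifT; [congr EFin; ring|lra].
by rewrite [X in (_ * X)%E]mI2 -EFinM mulrC.
Qed.

Lemma energy_bound_L2 A f (c : R) : measurable (A : set plane) -> continuous f ->
  (energy A f <= c%:E)%E -> L2 A f /\ sqnorm A f <= c.
Proof.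
move=> mA cf fc; have f2 : L2 A f.
  apply/(L2P mA); split; last by apply: le_lt_trans fc _; rewrite ltry.
  by apply: measurable_funTS; exact: continuous_measurable_plane.
by split => //; rewrite -lee_fin sqnorm_energy.
Qed.

Section Graph.
Variables (a b : R) (K : R -> R).
Hypotheses (ra : r <= a) (cK : continuous K) (KG : forall x, r < x -> - G x <= K x <= G x).
Let T := strip a b.
Let mT : measurable (T : set plane) := measurable_strip a b.

Lemma sqnorm_graph k : continuous k -> L2 T (fun p => k p.1) /\
  sqnorm T (fun p => k p.1) = itv_integral a b (fun x => 2 * G x * k x ^+ 2).
Proof.
move=> ck; have e := energy_strip_fst b ra ck.
have [|k2 _] := energy_bound_L2 (c := itv_integral a b (fun x => 2 * G x * k x ^+ 2)) mT (continuous_fst_comp ck).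
  by rewrite -e.
by split => //; apply: EFin_inj; rewrite sqnorm_energy.
Qed.

Let xr x : a < x <= b -> r < x.
Proof. by move=> /andP[h _]; exact: le_lt_trans h. Qed.

(** The factor 2 G x is the length of the cross-section, so integrating the pointwise bound over it
    leaves the right-hand side unchanged, and nothing is lost as the horn becomes thin. *)
Lemma strip_line_bound f (c d e : R) (g h k : R * R -> R) : continuous f ->
  continuous g -> continuous h -> continuous k -> 0 <= c -> 0 <= d -> 0 <= e ->
  L2 T g -> L2 T h -> L2 T k ->
  (forall x t, a < x <= b -> - G x < t < G x -> 2 * G x * f (x, t) ^+ 2 <=
    itv_integral (- G x) (G x)
      (fun s => c * g (x, s) ^+ 2 + (d * h (x, s) ^+ 2 + e * k (x, s) ^+ 2))) ->
  L2 T f /\ sqnorm T f <= c * sqnorm T g + (d * sqnorm T h + e * sqnorm T k).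
Proof.
move=> cf cg ch ck c0 d0 e0 g2 h2 k2 hf; apply: energy_bound_L2 => //.
have csq (l : R * R -> R) : continuous l -> continuous (fun p : R * R => l p ^+ 2).
  by move=> cl p; exact: (cvg_comp _ _ (cl p) (@exprn_continuous R 2 _)).
have msq (l : R * R -> R) : continuous l ->
    measurable_fun (T : set plane) (fun p : plane => l p ^+ 2).
  by move=> cl; apply: measurable_funTS; exact: continuous_measurable_plane (csq _ cl).
have cH : continuous (fun p : R * R => d * h p ^+ 2 + e * k p ^+ 2).
  by move=> p; apply: cvgD; apply: cvgM; [exact: cvg_cst|exact: csq|exact: cvg_cst|exact: csq].
have H0 p : 0 <= d * h p ^+ 2 + e * k p ^+ 2 by rewrite addr_ge0 // mulr_ge0 ?sqr_ge0.
have I1 := @ge0_integral_comb _ _ _ (area R) T d e (fun p : plane => h p ^+ 2) (fun p : plane => k p ^+ 2).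
have I2 := @ge0_integral_comb _ _ _ (area R) T c 1 (fun p : plane => g p ^+ 2)
  (fun p : plane => d * h p ^+ 2 + e * k p ^+ 2).
have -> : ((c * sqnorm T g + (d * sqnorm T h + e * sqnorm T k))%:E =
    \int[area R]_(p in T) (c * g p ^+ 2 + 1 * (d * h p ^+ 2 + e * k p ^+ 2))%:E)%E.
  rewrite I2 //; [|exact: msq| |by move=> p _; exact: sqr_ge0]; last first.
    by apply: measurable_funTS; exact: continuous_measurable_plane.
  rewrite I1 //; [|exact: msq|exact: msq|by move=> p _; exact: sqr_ge0|by move=> p _; exact: sqr_ge0].
  rewrite mul1e -[X in (_ + (_ * X + _))%E]/(energy T h) -[X in (_ + (_ + _ * X))%E]/(energy T k).
  by rewrite -[X in (_ * X + _)%E]/(energy T g) -!sqnorm_energy.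
apply: (@line_energy_width _ T T f (fun p => c * g p ^+ 2 + 1 * (d * h p ^+ 2 + e * k p ^+ 2))) => //.
- by move=> p; apply: cvgD; apply: cvgM; [exact: cvg_cst|exact: csq|exact: cvg_cst|exact: cH].
- by move=> p; rewrite mul1r addr_ge0 // mulr_ge0 ?sqr_ge0.
move=> x; case: (pselect (a < x <= b)) => hx; last first.
  by exists 0, 0; split => // t /stripP[].
have Gx : 0 < G x by exact: Gpos (ltW (xr hx)).
exists (- G x), (G x); split; first lra.
move=> t /stripP[_ ht]; split; first lra.
exists (- G x), (G x); split; first by move=> s hs; apply/stripP.
have -> : G x - - G x = 2 * G x by ring.
under eq_fun do rewrite mul1r.
exact: hf.
Qed.

Let width_bound (f : R * R -> R) (c d : R) (g h : R * R -> R) : continuous f -> continuous g -> continuous h ->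
  0 <= c -> 0 <= d -> L2 T g -> L2 T h ->
  (forall x t, a < x <= b -> - G x < t < G x -> 2 * G x * f (x, t) ^+ 2 <=
    itv_integral (- G x) (G x) (fun s => c * g (x, s) ^+ 2 + d * h (x, s) ^+ 2)) ->
  L2 T f /\ sqnorm T f <= c * sqnorm T g + d * sqnorm T h.
Proof.
move=> cf cg ch c0 d0 g2 h2 hf.
have := @strip_line_bound f c d 0 g h h cf cg ch ch c0 d0 (lexx _) g2 h2 h2.
rewrite mul0r addr0; apply=> x t hx ht; apply: le_trans (hf x t hx ht) _.
by under [X in _ <= itv_integral _ _ X]eq_fun do rewrite mul0r addr0.
Qed.

Let Gle x : a < x <= b -> G x ^+ 2 <= G a ^+ 2.
Proof.
move=> hx; have Gx : 0 < G x by exact: Gpos (ltW (xr hx)).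
have Ga : 0 < G a by exact: Gpos.
rewrite lerXn2r ?nnegrE ?(ltW Gx) ?(ltW Ga) //; apply: Gdecr; first exact: ra.
by case/andP: hx => /ltW.
Qed.

Variable phi : R * R -> R.
Hypotheses (sphi : smooth phi) (phi2 : L2 T phi) (d2 : L2 T (pder2 phi)).
Let cphi : continuous phi := smooth_continuous sphi.
Let cd2 : continuous (pder2 phi) := smooth_continuous (smooth_pder2 sphi).

(** [sup_bound] on a cross-section of length 2 G x, multiplied by that length, has the coefficients
    2 and 8 (G x)^2; on the strip G x <= G a. *)
Lemma graph_value : sqnorm T (fun p => phi (p.1, K p.1)) <=
  2 * sqnorm T phi + 8 * G a ^+ 2 * sqnorm T (pder2 phi).
Proof.
apply: (proj2 (width_bound _ _ _ _ _ _ _ _)) => //.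
- exact: (continuous_fst_comp (continuous_graph cK cphi)).
- by rewrite mulr_ge0 ?sqr_ge0.
move=> x t hx ht; have Gx : 0 < G x by exact: Gpos (ltW (xr hx)).
have cs : continuous (fun s => phi (x, s)) by exact: continuous_section.
have cds : continuous (fun s => pder2 phi (x, s)) by exact: continuous_section.
have rx := xr hx.
have GG : - G x < G x by lra.
have := sup_bound (fun s => is_derive_line2 (smooth_diff sphi (x, s))) cds GG (KG rx).
have G2 : 0 <= 2 * G x by lra.
move=> /(ler_wpM2l G2) h; apply: le_trans h _.
rewrite !itv_integral_comb //; try exact: continuous_sqr.
have I0 : 0 <= itv_integral (- G x) (G x) (fun t => pder2 phi (x, t) ^+ 2).
  by apply: itv_integral_ge0 => s; exact: sqr_ge0.
have := ler_wpM2r I0 (Gle hx).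
have -> : G x - - G x = 2 * G x by ring.
move: (itv_integral _ _ _) (itv_integral _ _ _) => I1 I2.
have -> : 2 * G x * (2 / (2 * G x) * I1 + 2 * (2 * G x) * I2) = 2 * I1 + 8 * (G x ^+ 2 * I2).
  by field; rewrite lt0r_neq0.
rewrite -[8 * _ * _]mulrA; lra.
Qed.

Lemma graph_increment : L2 T (fun p => phi p - phi (p.1, K p.1)) /\
  sqnorm T (fun p => phi p - phi (p.1, K p.1)) <= 4 * G a ^+ 2 * sqnorm T (pder2 phi).
Proof.
have cgr := continuous_fst_comp (continuous_graph cK cphi).
have [] := @width_bound (fun p => phi p - phi (p.1, K p.1)) (4 * G a ^+ 2) 0 (pder2 phi) (pder2 phi) _ cd2 cd2 _ (lexx 0) d2 d2.
- by move=> p; apply: cvgB; [exact: cphi|exact: cgr].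
- by rewrite mulr_ge0 ?sqr_ge0.
- move=> x t hx ht; have Gx : 0 < G x by exact: Gpos (ltW (xr hx)).
  have cds : continuous (fun s => pder2 phi (x, s)) by exact: continuous_section.
  have rx := xr hx.
  have ht' : - G x <= t <= G x by lra.
  have := increment_sqr_le (fun s => is_derive_line2 (smooth_diff sphi (x, s))) cds ht' (KG rx).
  have G2 : 0 <= 2 * G x by lra.
  move=> /(ler_wpM2l G2) h; apply: le_trans h _.
  rewrite !itv_integral_comb //; try exact: continuous_sqr.
  have I0 : 0 <= itv_integral (- G x) (G x) (fun t => pder2 phi (x, t) ^+ 2).
    by apply: itv_integral_ge0 => s; exact: sqr_ge0.
  have := ler_wpM2r I0 (Gle hx).
  have -> : G x - - G x = 2 * G x by ring.
  move: (itv_integral _ _ _) => I2.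
  have -> : 2 * G x * (2 * G x * I2) = 4 * (G x ^+ 2 * I2) by ring.
  rewrite -[4 * _ * _]mulrA mul0r addr0; lra.
by rewrite mul0r addr0.
Qed.

Lemma strip_graph_bound : sqnorm T phi <=
  8 * G a ^+ 2 * sqnorm T (pder2 phi) + 2 * sqnorm T (fun p => phi (p.1, K p.1)).
Proof.
have [f2 fS] := graph_increment.
have [g2 _] := sqnorm_graph (continuous_graph cK cphi).
have e : phi = (fun p => phi p - phi (p.1, K p.1)) + (fun p => phi (p.1, K p.1)).
  by apply/funext => p; rewrite -[RHS]/(phi p - phi (p.1, K p.1) + phi (p.1, K p.1)) subrK.
rewrite {1}e; apply: le_trans (sqnormD_le mT f2 g2) _.
rewrite lerD2r; have := ler_wpM2l (ler0n R 2) fS.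
by rewrite !mulrA -natrM.
Qed.

End Graph.
End HornStrips.

(** * Boundary values in one strip *)

Section StripEstimates.
Variable R : realType.
Local Notation mR := (measurableTypeR R).
Local Notation plane := (mR * mR)%type.
Implicit Types (A E : set (R * R)) (u v phi : R * R -> R) (K k : R -> R).
Variables (r : R) (G : R -> R).
Hypotheses (cG : continuous G) (Gpos : forall y, r <= y -> 0 < G y)
  (Gdecr : forall y1 y2, r <= y1 -> y1 <= y2 -> G y2 <= G y1).
Variables (Om : set (R * R)) (a b : R).
Hypotheses (mOm : measurable (Om : set plane)) (ra : r <= a) (TO : strip G a b `<=` Om).
Let T := strip G a b.
Let mT : measurable (T : set plane) := measurable_strip cG a b.

(* The trace of phi on a graph, extended constantly in the second variable: its
   square norm over a strip is that of the trace with weight 2 G. *)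
Definition on_graph K phi : R * R -> R := fun p => phi (p.1, K p.1).

(** The same approximant has to be small on both graphs: in the hinged case its values on the two
    sides are subtracted. *)
Definition graph_null K1 K2 u v := forall eta : R, 0 < eta -> exists phi,
  [/\ smooth phi, L2 Om phi /\ L2 Om (pder2 phi),
    sqnorm Om (phi - u) <= eta, sqnorm Om (pder2 phi - v) <= eta &
    sqnorm T (on_graph K1 phi) <= eta /\ sqnorm T (on_graph K2 phi) <= eta].

(** An L2 form of |u2| <= |u1| on the graph; the factor 4 leaves room for replacing the traces by
    approximants. *)
Definition graph_related K u1 v1 u2 v2 := forall eta : R, 0 < eta -> exists phi1 phi2,
  [/\ smooth phi1 /\ smooth phi2,
    [/\ L2 Om phi1, L2 Om (pder2 phi1), L2 Om phi2 & L2 Om (pder2 phi2)],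
    sqnorm Om (phi1 - u1) <= eta /\ sqnorm Om (pder2 phi1 - v1) <= eta,
    sqnorm Om (phi2 - u2) <= eta /\ sqnorm Om (pder2 phi2 - v2) <= eta &
    sqnorm T (on_graph K phi2) <= 4 * sqnorm T (on_graph K phi1) + eta].

Let bound_in_strip f w (eta : R) : L2 Om f -> L2 Om w -> sqnorm Om (w - f) <= eta ->
  sqnorm T f <= 2 * sqnorm T w + 2 * eta /\ sqnorm T w <= 2 * sqnorm T f + 2 * eta.
Proof.
move=> f2 w2 hw; have f2T := L2_subset mT mOm TO f2; have w2T := L2_subset mT mOm TO w2.
have h : sqnorm T (w - f) <= eta.
  by apply: le_trans hw; apply: sqnorm_subset => //; exact: L2B.
have [h1 h2] := sqnorm_approx mT f2T w2T.
have hh : 2 * sqnorm T (w - f) <= 2 * eta by rewrite ler_pM2l.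
by split; [apply: le_trans h1 _|apply: le_trans h2 _]; rewrite lerD2l.
Qed.

Let arith_null (g U P D B V e : R) : 0 <= g -> U <= 2 * P + 2 * e -> P <= 8 * g * D + 2 * B ->
  B <= e -> D <= 2 * V + 2 * e -> U <= 32 * g * V + (6 + 32 * g) * e.
Proof.
by move=> g0 hU hP hB hD; have := ler_wpM2l g0 hD; lra.
Qed.

Lemma strip_null_bound K1 K2 u v : continuous K1 -> (forall x, r < x -> - G x <= K1 x <= G x) ->
  L2 Om u -> L2 Om v -> graph_null K1 K2 u v -> sqnorm T u <= 32 * G a ^+ 2 * sqnorm T v.
Proof.
move=> cK KG u2 v2 h; have g0 := sqr_ge0 (G a).
apply: (@le_of_small_error _ _ _ (6 + 32 * G a ^+ 2)); first by move: g0; lra.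
move=> eta eta0; have [phi [sphi [p2 dp2] pu pv [hK _]]] := h _ eta0.
have [hu _] := bound_in_strip u2 p2 pu; have [_ hv] := bound_in_strip v2 dp2 pv.
have hp := strip_graph_bound cG Gpos Gdecr ra cK KG sphi (L2_subset mT mOm TO dp2).
exact: (arith_null g0 hu hp hK hv).
Qed.

Let arith_related (g U2 P2 D2 B2 B1 P1 D1 V1 S1 S2 e : R) : 0 <= g ->
  U2 <= 2 * P2 + 2 * e -> P2 <= 8 * g * D2 + 2 * B2 -> B2 <= 4 * B1 + e ->
  B1 <= 2 * P1 + 8 * g * D1 -> P1 <= 2 * V1 + 2 * e -> D1 <= 2 * S1 + 2 * e -> D2 <= 2 * S2 + 2 * e ->
  U2 <= 64 * V1 + (256 * g * S1 + 32 * g * S2) + (70 + 288 * g) * e.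
Proof.
move=> g0 hU hP hB2 hB1 hP1 hD1 hD2.
have := ler_wpM2l g0 hD1; have := ler_wpM2l g0 hD2; lra.
Qed.

(** [u2] is bounded by its values on the graph, these by the values of [u1] there, and these by [u1]
    over the strip; each passage between graph and strip costs G a^2 times a second derivative. *)
Lemma strip_related_bound K u1 v1 u2 v2 : continuous K -> (forall x, r < x -> - G x <= K x <= G x) ->
  L2 Om u1 -> L2 Om v1 -> L2 Om u2 -> L2 Om v2 -> graph_related K u1 v1 u2 v2 ->
  sqnorm T u2 <= 64 * sqnorm T u1 + (256 * G a ^+ 2 * sqnorm T v1 + 32 * G a ^+ 2 * sqnorm T v2).
Proof.
move=> cK KG u12 v12 u22 v22 h; have g0 := sqr_ge0 (G a).
apply: (@le_of_small_error _ _ _ (70 + 288 * G a ^+ 2)); first by move: g0; lra.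
move=> eta eta0; have [phi1 [phi2 [[s1 s2] [p1 d1 p2 d2] [pu1 pv1] [pu2 pv2] hK]]] := h _ eta0.
have [_ hu1] := bound_in_strip u12 p1 pu1; have [_ hv1] := bound_in_strip v12 d1 pv1.
have [hu2 _] := bound_in_strip u22 p2 pu2; have [_ hv2] := bound_in_strip v22 d2 pv2.
have sub f : L2 Om f -> L2 T f by exact: L2_subset.
have hp2 := strip_graph_bound cG Gpos Gdecr ra cK KG s2 (sub _ d2).
have hb1 := graph_value cG Gpos Gdecr ra cK KG s1 (sub _ p1) (sub _ d1).
exact: (arith_related g0 hu2 hp2 hK hb1 hu1 hv1 hv2).
Qed.

Let arith_pair (g c V Q D W S' S e : R) : 0 <= g -> 0 <= c -> V <= 2 * Q + 2 * e ->
  Q <= c * D + (4 * W + 16 * g * S') -> D <= 4 * e -> W <= 4 * e -> S' <= 2 * S + 2 * e ->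
  V <= 64 * g * S + (8 * c + 34 + 64 * g) * e.
Proof.
move=> g0 c0 hV hQ hD hW hS; have := ler_wpM2l g0 hS; have := ler_wpM2l c0 hD; lra.
Qed.

(** The mean of D_2 w over a cross-section is the difference of the values of [w] on the two sides
    divided by 2 G x, and tends to zero with the error. [pair_bound], with s and t the two ends of
    the cross-section, then leaves only the derivative of [q]. *)
Lemma strip_pair_bound u v s : L2 Om u -> L2 Om v -> L2 Om s -> a < b ->
  graph_null G (fun x => - G x) u v -> line_approx Om v s ->
  sqnorm T v <= 64 * G a ^+ 2 * sqnorm T s.
Proof.
move=> u2 v2 s2 ab h hq; have g0 := sqr_ge0 (G a).
have Gb : 0 < G b by apply: Gpos; exact: le_trans ra (ltW ab).
(* The lower bound G b of G on the strip turns the difference of boundary values into a slope. This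
   constant may blow up for distant strips, since it multiplies only the error eta. *)
pose c := (2 * G b ^+ 2)^-1.
have c0 : 0 <= c by rewrite invr_ge0 mulr_ge0 ?sqr_ge0.
apply: (@le_of_small_error _ _ _ (8 * c + 34 + 64 * G a ^+ 2)).
  by move: c0 g0; lra.
move=> eta eta0; have [w [sw [w2 dw2] wu wv [hK1 hK2]]] := h _ eta0.
have [q [dq [[cq cdq qd] [q2 dq2] qv qs]]] := hq _ eta0.
have sub f : L2 Om f -> L2 T f by exact: L2_subset.
have [hv _] := bound_in_strip v2 q2 qv; have [_ hs] := bound_in_strip s2 dq2 qs.
have cw := smooth_continuous sw.
have cdw : continuous (pder2 w) by exact: smooth_continuous (smooth_pder2 sw).
have cN : continuous (fun x => - G x) by move=> x; apply: cvgN; exact: cG.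
have [k12 _] := sqnorm_graph cG Gpos b ra (continuous_graph cG cw).
have [k22 _] := sqnorm_graph cG Gpos b ra (continuous_graph cN cw).
pose D := on_graph G w - on_graph (fun x => - G x) w.
have D2 : L2 T D by exact: L2B.
have W2 : L2 T (pder2 w - q) by apply: L2B => //; exact: sub.
have hD : sqnorm T D <= 4 * eta.
  apply: le_trans (sqnormB_le mT k12 k22) _.
  have -> : 4 * eta = 2 * eta + 2 * eta by ring.
  by apply: lerD; rewrite ler_pM2l.
have hW : sqnorm T (pder2 w - q) <= 4 * eta.
  have -> : pder2 w - q = (pder2 w - v) - (q - v) by rewrite opprB addrA subrK.
  have sq f f' : L2 Om f -> L2 Om f' -> sqnorm Om (f - f') <= eta -> sqnorm T (f - f') <= eta.
    by move=> f2 f2' hf; apply: le_trans hf; apply: sqnorm_subset => //; exact: L2B.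
  apply: le_trans (sqnormB_le mT (sub _ (L2B mOm dw2 v2)) (sub _ (L2B mOm q2 v2))) _.
  have -> : 4 * eta = 2 * eta + 2 * eta by ring.
  by apply: lerD; rewrite ler_pM2l //; exact: sq.
have [_ hQ] : L2 T q /\ sqnorm T q <= c * sqnorm T D + (4 * sqnorm T (pder2 w - q) + 16 * G a ^+ 2 * sqnorm T dq).
  apply: (strip_line_bound cG Gpos ra (b := b)) => //.
  - by move=> p; apply: cvgB; [exact: (continuous_fst_comp (continuous_graph cG cw))|
      exact: (continuous_fst_comp (continuous_graph cN cw))].
  - by move=> p; apply: cvgB; [exact: cdw|exact: cq].
  - by rewrite mulr_ge0.
  - exact: sub.
  move=> x t hx ht.
  have xr : r < x by case/andP: hx => h1 _; exact: le_lt_trans h1.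
  have Gx : 0 < G x by exact: Gpos (ltW xr).
  have cwx : continuous (fun s => pder2 w (x, s)) by exact: continuous_section.
  have cqx : continuous (fun s => q (x, s)) by exact: continuous_section.
  have cdqx : continuous (fun s => dq (x, s)) by exact: continuous_section.
  have ht' : - G x <= t <= G x by lra.
  have h1 : - G x <= - G x <= G x by lra.
  have h2 : - G x <= G x <= G x by lra.
  have := pair_bound (fun s => is_derive_line2 (smooth_diff sw (x, s))) cwx (qd x) cdqx ht' h1 h2.
  have c1 : continuous (fun s => (pder2 w (x, s) - q (x, s)) ^+ 2).
    by apply: continuous_sqr => y; apply: cvgB; [exact: cwx|exact: cqx].
  have c2 := continuous_sqr cdqx.
  have c3 : continuous (fun s => 4 * (pder2 w (x, s) - q (x, s)) ^+ 2 + 16 * G a ^+ 2 * dq (x, s) ^+ 2).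
    by move=> y; apply: cvgD; apply: cvgM; [exact: cvg_cst|exact: c1|exact: cvg_cst|exact: c2].
  pose d := w (x, G x) - w (x, - G x).
  have -> : (fun y => c * D (x, y) ^+ 2 + (4 * (pder2 w - q) (x, y) ^+ 2 + 16 * G a ^+ 2 * dq (x, y) ^+ 2)) =
    (fun y => (c * d ^+ 2) * cst 1 y + 1 * (4 * (pder2 w (x, y) - q (x, y)) ^+ 2 + 16 * G a ^+ 2 * dq (x, y) ^+ 2)).
    by apply/funext => y; rewrite mulr1 mul1r.
  have cc : continuous (cst 1 : R -> R) by move=> y; exact: cvg_cst.
  rewrite !itv_integral_comb // itv_integral_cst; last lra.
  rewrite -/d.
  have I0 : 0 <= itv_integral (- G x) (G x) (fun t => dq (x, t) ^+ 2).
    by apply: itv_integral_ge0 => y; exact: sqr_ge0.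
  have Ga : G x ^+ 2 <= G a ^+ 2.
    have Ga0 : 0 < G a by exact: Gpos.
    rewrite lerXn2r ?nnegrE ?(ltW Gx) ?(ltW Ga0) //; apply: Gdecr; first exact: ra.
    by case/andP: hx => /ltW.
  have Gxb : G b ^+ 2 <= G x ^+ 2.
    rewrite lerXn2r ?nnegrE ?(ltW Gx) ?(ltW Gb) //; apply: Gdecr; first exact: ltW.
    by case/andP: hx.
  have h3 := ler_wpM2r I0 Ga.
  have -> : G x - - G x = 2 * G x by ring.
  move: h3; move: (itv_integral _ _ _) (itv_integral _ _ _) => I1 I2 h3.
  have -> : (2 * G x * q (x, t)) ^+ 2 = 2 * G x * (2 * G x * q (x, t) ^+ 2) by ring.
  have d2 : d ^+ 2 <= 2 * G x ^+ 2 * (c * d ^+ 2).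
    rewrite mulrA ler_peMl ?sqr_ge0 // /c ler_pdivlMr ?mul1r ?ler_pM2l //.
    by rewrite mulr_gt0 // exprn_gt0.
  have h4 : 2 * d ^+ 2 <= 2 * G x * (2 * G x * (c * d ^+ 2)).
    have -> : 2 * G x * (2 * G x * (c * d ^+ 2)) = 2 * (2 * G x ^+ 2 * (c * d ^+ 2)) by ring.
    by rewrite ler_pM2l.
  have h5 : 4 * (2 * G x) ^+ 3 * I2 <= 2 * G x * (16 * G a ^+ 2 * I2).
    have -> : 4 * (2 * G x) ^+ 3 * I2 = 2 * G x * (16 * (G x ^+ 2 * I2)) by ring.
    by rewrite -[16 * _ * I2]mulrA ler_pM2l ?mulr_gt0 // ler_pM2l.
  move=> hp; rewrite -(ler_pM2l (_ : 0 < 2 * G x)); last by rewrite mulr_gt0.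
  apply: le_trans hp _.
  have -> : 2 * G x * (c * d ^+ 2 * (1 * (2 * G x)) + 1 * (4 * I1 + 16 * G a ^+ 2 * I2)) =
    2 * G x * (2 * G x * (c * d ^+ 2)) + 4 * (2 * G x) * I1 + 2 * G x * (16 * G a ^+ 2 * I2) by ring.
  by apply: lerD => //; apply: lerD.
exact: (arith_pair g0 c0 hv hQ hD hW hs).
Qed.

End StripEstimates.

(** * Arcs lying on graphs *)

Section Arcs.
Variable R : realType.
Local Notation mR := (measurableTypeR R).
Local Notation plane := (mR * mR)%type.
Implicit Types (f g k K : R -> R) (phi psi : R * R -> R).

Lemma is_derive_pair f g (t df dg : R) : is_derive t (1 : R) f df -> is_derive t (1 : R) g dg ->
  is_derive t (1 : R) (fun s => (f s, g s) : R * R) ((df, dg) : R * R).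
Proof.
move=> hf hg.
have cf : (fun h : R => h^-1 *: (f (h *: 1 + t) - f t)) @ 0^' --> df.
  by rewrite -(@derive_val _ _ _ _ _ _ _ hf); exact: (@ex_derive _ _ _ _ _ _ _ hf).
have cg : (fun h : R => h^-1 *: (g (h *: 1 + t) - g t)) @ 0^' --> dg.
  by rewrite -(@derive_val _ _ _ _ _ _ _ hg); exact: (@ex_derive _ _ _ _ _ _ _ hg).
have cp : (fun h : R => h^-1 *: (((f (h *: 1 + t), g (h *: 1 + t)) : R * R) - (f t, g t))) @ 0^'
    --> ((df, dg) : R * R).
  exact: (cvg_pair cf cg).
split; first by apply/cvg_ex; exists (df, dg).
by apply: cvg_lim cp; exact: norm_hausdorff.
Qed.

Lemma derive1_is_derive (V : normedModType R) (f : R -> V) t : derivable f t 1 ->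
  is_derive t (1 : R) f (derive1 f t).
Proof. by move=> df; split => //; rewrite derive1E. Qed.

Lemma derive1n_pair f g n : smooth1 f -> smooth1 g ->
  derive1n n (fun s => (f s, g s) : R * R) = (fun s => (derive1n n f s, derive1n n g s) : R * R).
Proof.
move=> sf sg; elim: n => // n ih; rewrite derive1nS ih; apply/funext => t.
have h := is_derive_pair (derive1_is_derive (sf n t)) (derive1_is_derive (sg n t)).
by rewrite derive1E (@derive_val _ _ _ _ _ _ _ h) !derive1nS.
Qed.

Lemma smooth1_pair f g : smooth1 f -> smooth1 g -> smooth1 (fun s => (f s, g s) : R * R).
Proof.
move=> sf sg n t; rewrite derive1n_pair //.
by have [] := is_derive_pair (derive1_is_derive (sf n t)) (derive1_is_derive (sg n t)).
Qed.

Lemma is_derive_translate f (a t df : R) : is_derive (a + t) (1 : R) f df ->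
  is_derive t (1 : R) (fun s => f (a + s)) df.
Proof.
move=> hf.
have E : (fun h : R => h^-1 *: (f (a + (h *: 1 + t)) - f (a + t))) =
  (fun h : R => h^-1 *: (f (h *: 1 + (a + t)) - f (a + t))).
  by apply/funext => h; rewrite addrCA.
split; first by rewrite /derivable /= E; exact: (@ex_derive _ _ _ _ _ _ _ hf).
by rewrite /derive /= E; exact: (@derive_val _ _ _ _ _ _ _ hf).
Qed.

Lemma derive1n_translate f (a : R) n : smooth1 f ->
  derive1n n (fun s => f (a + s)) = (fun s => derive1n n f (a + s)).
Proof.
move=> sf; elim: n => // n ih; rewrite derive1nS ih; apply/funext => t.
have h := is_derive_translate (derive1_is_derive (sf n (a + t))).
by rewrite derive1E (@derive_val _ _ _ _ _ _ _ h) derive1nS.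
Qed.

Lemma smooth1_translate f (a : R) : smooth1 f -> smooth1 (fun s => f (a + s)).
Proof.
move=> sf n t; rewrite derive1n_translate //.
by have [] := is_derive_translate (derive1_is_derive (sf n (a + t))).
Qed.

Lemma smooth1_id : smooth1 (fun s : R => s).
Proof.
have d1 : derive1 (fun s : R => s) = cst 1.
  by apply/funext => t; rewrite derive1E derive_id.
have d2 n : derive1n n.+2 (fun s : R => s) = cst 0.
  elim: n => [|n ih]; last by rewrite derive1nS ih; apply/funext => t; rewrite derive1E derive_cst.
  by rewrite derive1nS derive1n1 d1; apply/funext => t; rewrite derive1E derive_cst.
move=> [|[|n]] t; rewrite ?derive1n0 ?derive1n1 ?d1 ?d2; [exact: derivable_id|exact: derivable_cst|exact: derivable_cst].
Qed.

Lemma smooth1N f : smooth1 f -> smooth1 (fun s => - f s).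
Proof.
move=> sf; have e n : derive1n n (fun s => - f s) = (fun s => - derive1n n f s).
  elim: n => // n ih; rewrite derive1nS ih; apply/funext => t.
  have h := is_deriveN (derive1_is_derive (sf n t)).
  by rewrite derive1E (@derive_val _ _ _ _ _ _ _ h) derive1nS.
move=> n t; rewrite e; exact: derivableN.
Qed.

Lemma smooth1_continuous f : smooth1 f -> continuous f.
Proof. by move=> sf t; apply: differentiable_continuous; apply/derivable1_diffP; exact: (sf 0%N t). Qed.

Lemma smooth1_derive1 f : smooth1 f -> continuous (derive1 f).
Proof. by move=> sf t; apply: differentiable_continuous; apply/derivable1_diffP; exact: (sf 1%N t). Qed.

Definition graph_set (r : R) K : set (R * R) := [set p | r < p.1 /\ p.2 = K p.1].

Definition graph_arc K (a : R) : R -> R * R := fun t => (a + t, K (a + t)).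

Lemma derive1_graph_arc K a t : smooth1 K -> derive1 (graph_arc K a) t = (1, derive1 K (a + t)).
Proof.
move=> sK; have h1 := is_derive_translate (is_derive_id (a + t) (1 : R)).
have h := is_derive_pair h1 (is_derive_translate (derive1_is_derive (sK 0%N (a + t)))).
by rewrite derive1E (@derive_val _ _ _ _ _ _ _ h).
Qed.

Lemma graph_arc_in r K a (S : set (R * R)) : smooth1 K -> r < a -> graph_set r K `<=` S ->
  is_arc_in S (graph_arc K a).
Proof.
move=> sK ra KS; split.
- exact: (smooth1_pair (@smooth1_translate _ a (@smooth1_id)) (@smooth1_translate _ a sK)).
- move=> t _; rewrite derive1_graph_arc //; apply/negP => /eqP[] /eqP.
  by rewrite oner_eq0.
- by move=> t /andP[t0 _]; apply: KS; split => //=; rewrite ltr_wpDr.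
Qed.

Lemma enorm_graph_arc K a t : smooth1 K -> 1 <= enorm (derive1 (graph_arc K a) t).
Proof.
move=> sK; rewrite derive1_graph_arc // /enorm /= expr1n -[leLHS]sqrtr1 ler_wsqrtr //.
by rewrite lerDl sqr_ge0.
Qed.

Lemma itv_integral_translate k (a : R) : continuous k ->
  itv_integral 0 1 (fun t => k (a + t)) = itv_integral a (a + 1) k.
Proof.
move=> ck.
have cka : continuous (fun t => k (a + t)).
  by move=> t; apply: (@continuous_comp _ _ _ (fun s => a + s) k); [apply: cvgD; [exact: cvg_cst|exact: cvg_id]|exact: ck].
apply: EFin_inj; rewrite !itv_integralE //.
have dF t : is_derive t (1 : R) (fun s : R => a + s) 1 := is_derive_translate (is_derive_id (a + t) (1 : R)).
have dE : derive1 (fun s : R => a + s) = cst 1.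
  by apply/funext => t; rewrite derive1E (@derive_val _ _ _ _ _ _ _ (dF t)).
have := @integration_by_substitution_increasing R (fun s : R => a + s) k 0 1 ler01.
rewrite addr0 dE => ->.
- by apply: eq_integral => t _ /=; rewrite mulr1.
- by move=> s t _ _ st; rewrite ltrD2l.
- by move=> t _; exact: cvg_cst.
- exact: is_cvg_cst.
- exact: is_cvg_cst.
- split.
  + by move=> t _; have [] := dF t.
  + by apply: cvg_at_right_filter; apply: cvgD; [exact: cvg_cst|exact: cvg_id].
  + by apply: cvg_at_left_filter; apply: cvgD; [exact: cvg_cst|exact: cvg_id].
- exact: continuous_subspaceT.
Qed.

(** Along a graph the arc length element is at least that of the parameter, so it may be dropped. *)
Lemma arc_defect_ge phi (tau : R * R -> R) K a : continuous phi -> smooth1 K ->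
  measurable_fun (`[0, 1]%classic : set mR) (tau \o graph_arc K a) ->
  (\int[lebesgue_measure]_(t in (`[0%R, 1%R]%classic : set mR))
     ((phi (graph_arc K a t) - tau (graph_arc K a t)) ^+ 2)%:E <= arc_defect phi tau (graph_arc K a))%E.
Proof.
move=> cphi sK mg; rewrite /arc_defect.
have cK := smooth1_continuous sK; have cdK := smooth1_derive1 sK.
have tr k : continuous k -> continuous (fun t => k (a + t)).
  move=> ck t; apply: (@continuous_comp _ _ _ (fun s => a + s) k); last exact: ck.
  by apply: cvgD; [exact: cvg_cst|exact: cvg_id].
have mphi : measurable_fun (`[0, 1]%classic : set mR) (phi \o graph_arc K a).
  apply: measurable_funTS; apply: measurable_realfun.continuous_measurable_fun.
  exact: (tr (fun x => phi (x, K x)) (continuous_graph cK cphi)).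
have me : measurable_fun (`[0, 1]%classic : set mR) (fun t => enorm (derive1 (graph_arc K a) t)).
  apply: measurable_funTS; apply: measurable_realfun.continuous_measurable_fun.
  have -> : (fun t => enorm (derive1 (graph_arc K a) t)) = (fun t => Num.sqrt (1 + derive1 K (a + t) ^+ 2)).
    by apply/funext => t; rewrite derive1_graph_arc // /enorm /= expr1n.
  have cs : continuous (fun t => 1 + derive1 K (a + t) ^+ 2).
    by move=> t; apply: cvgD; [exact: cvg_cst|exact: (continuous_sqr (tr _ cdK))].
  by move=> t; exact: (cvg_comp _ _ (cs t) (@sqrt_continuous R _)).
have msq : measurable_fun (`[0, 1]%classic : set mR)
    (fun t => (phi (graph_arc K a t) - tau (graph_arc K a t)) ^+ 2).
  by apply: measurable_funX; apply: measurable_funB.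
apply: ge0_le_integral => //.
- by move=> t _; rewrite lee_fin sqr_ge0.
- exact/measurable_EFinP.
- by apply/measurable_EFinP; exact: measurable_funM.
by move=> t _; rewrite lee_fin ler_peMr ?sqr_ge0 // enorm_graph_arc.
Qed.

End Arcs.

(** * Traces on the sides of the horn *)

Section TracesOnGraphs.
Variable R : realType.
Local Notation mR := (measurableTypeR R).
Local Notation plane := (mR * mR)%type.
Implicit Types (k : R -> R) (u v phi psi tau : R * R -> R).
Variables (r : R) (G : R -> R).
Hypotheses (sG : smooth1 G) (Gpos : forall y, r <= y -> 0 < G y)
  (Gdecr : forall y1 y2, r <= y1 -> y1 <= y2 -> G y2 <= G y1).
Variable Om : set (R * R).
Hypotheses (oOm : open Om) (Om_horn : Om `&` [set p | r < p.1] = horn G r).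
Let mOm : measurable (Om : set plane) := open_measurable_plane oOm.
Let cG : continuous G := smooth1_continuous sG.

Lemma Om_hornE x t : r < x -> Om (x, t) <-> - G x < t < G x.
Proof.
move=> rx; split=> [Oxt|h].
  have : (Om `&` [set p | r < p.1]) (x, t) by split.
  by rewrite Om_horn => -[].
have : horn G r (x, t) by split.
by rewrite -Om_horn => -[].
Qed.

Lemma strip_sub a b : r <= a -> strip G a b `<=` Om.
Proof.
move=> ra [x t] /stripP[/andP[ax _] ht]; apply/Om_hornE => //.
exact: le_lt_trans ax.
Qed.

(** [K] stands for either side of the horn. *)
Variable K : R -> R.
Hypotheses (sK : smooth1 K) (KG : forall x, r < x -> `|K x| = G x).
Let cK : continuous K := smooth1_continuous sK.

Lemma graph_notin x : r < x -> ~ Om (x, K x).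
Proof. by move=> rx /(Om_hornE _ rx); rewrite -ltr_norml KG // ltxx. Qed.

(** The points (x, (1 - d) K x) lie in the horn and approach the graph as d tends to zero. *)
Lemma graph_bdry x : r < x -> bdry Om (x, K x).
Proof.
move=> rx; split; last by apply: subset_closure; exact: graph_notin.
have Gx : 0 < G x by apply: Gpos; exact: ltW.
move=> B /nbhs_ballP[e /= e0 he].
pose d := Num.min (1 / 2) (e / (2 * G x)).
have d0 : 0 < d by rewrite lt_min !divr_gt0 // mulr_gt0.
have d1 : d <= 1 / 2 by rewrite ge_min lexx.
have d2 : d * G x <= e / 2.
  have : d <= e / (2 * G x) by rewrite ge_min lexx orbT.
  move=> /(ler_wpM2r (ltW Gx)) h; apply: le_trans h _.
  by rewrite invfM mulrA mulfVK ?lt0r_neq0.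
exists (x, (1 - d) * K x); split.
  apply/Om_hornE => //; rewrite -ltr_norml normrM KG // gtr0_norm; last lra.
  by rewrite gtr_pMl //; lra.
apply: he; apply/ball_pairE => /=; rewrite subrr normr0; split => //.
have -> : K x - (1 - d) * K x = d * K x by ring.
by rewrite normrM KG // gtr0_norm //; lra.
Qed.

Lemma is_derive_graph psi x : smooth psi ->
  is_derive x (1 : R) (fun s => psi (s, K s)) (pder1 psi (x, K x) + derive1 K x * pder2 psi (x, K x)).
Proof.
move=> spsi.
pose c (s : R) : R * R := (s, K s).
have dc : is_derive x (1 : R) c ((1, derive1 K x) : R * R).
  have h := is_derive_pair (is_derive_id x (1 : R)) (derive1_is_derive (@sK 0%N x)).
  by apply: is_derive_eq h _.
have dfc : differentiable c x by apply/derivable1_diffP; have [] := dc.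
have dpsi : differentiable psi (c x) by exact: smooth_diff.
have df : differentiable (psi \o c) x by exact: differentiable_comp.
split; first exact/derivable1_diffP.
have -> : 'D_1 (psi \o c) x = 'd psi (c x) ((1, derive1 K x) : R * R).
  rewrite deriveE // diff_comp //=; congr ('d psi (c x) _).
  by rewrite -deriveE // (@derive_val _ _ _ _ _ _ _ dc).
have -> : ((1, derive1 K x) : R * R) = ((1, 0) : R * R) + derive1 K x *: ((0, 1) : R * R).
  by rewrite [RHS]/GRing.add /= /add_pair /= /GRing.scale /= mulr0 addr0 add0r mulr1.
by rewrite linearD linearZ /= -!deriveE.
Qed.

(** Near x the function s -> psi (s, K s) is nonnegative, because the graph lies outside [Om], and
    it vanishes at x; so it has a minimum there and its derivative is zero. D_2 psi = 0 would then
    make the whole gradient vanish. *)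
Lemma defining_tangent psi x : r < x -> local_defining Om (x, K x) psi ->
  pder1 psi (x, K x) = - (derive1 K x * pder2 psi (x, K x)) /\ pder2 psi (x, K x) != 0.
Proof.
move=> rx [spsi psi0 g0 hO].
have E : pder1 psi (x, K x) = - (derive1 K x * pder2 psi (x, K x)).
  pose f (s : R) := psi (s, K s).
  have df s : is_derive s (1 : R) f (pder1 psi (s, K s) + derive1 K s * pder2 psi (s, K s)).
    exact: is_derive_graph.
  have cc : continuous (fun s : R => (s, K s) : R * R).
    move=> s B [[B1 B2] /= [h1 h2] hB]; have h2' := cK h2.
    by apply: filterS2 h1 h2' => y s1 s2; apply: hB.
  have [e e0 he] : exists2 e, 0 < e & forall s, `|x - s| < e -> 0 <= f s.
    have : \forall s \near x, r < s /\ (Om (s, K s) <-> f s < 0).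
      near=> s; split; first by near: s; apply: open_nbhs_nbhs; split; [exact: open_gt|exact: rx].
      by near: s; exact: (cc x _ hO).
    move=> /nbhs_ballP[e /= e0 he]; exists e => // s /he[rs hs].
    by rewrite leNgt; apply/negP => /hs; exact: graph_notin.
  have xe : x \in `]x - e, x + e[ by rewrite in_itv /=; lra.
  have ee : x - e <= x + e by lra.
  have := derive1_at_min ee _ xe _ => /(_ f) [||_].
  - by move=> t _; have [] := df t.
  - move=> t; rewrite in_itv /= => ht; rewrite {1}/f psi0; apply: he.
    by rewrite ltr_norml; lra.
  have [_ ->] := df x => h; apply/eqP; rewrite -addr_eq0; exact/eqP.
split => //; apply: contraNneq g0 => z; rewrite E z mulr0 oppr0.
by [].
Unshelve. all: by end_near.
Qed.

Lemma normal_trace_relation x (g1 g2 : R) : smooth_boundary Om -> r < x -> `|derive1 K x| <= 1 ->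
  (outer_normal Om (x, K x)).1 * g1 + (outer_normal Om (x, K x)).2 * g2 = 0 -> g2 ^+ 2 <= g1 ^+ 2.
Proof.
move=> sb rx K1; rewrite /outer_normal.
(* [outer_normal] falls back to 0 where no defining function exists; smoothness of the boundary
   excludes this on the graph. *)
case: xgetP => [n -> /= [psi hpsi ->]|/= hn]; last first.
  have [psi hpsi] := sb _ (graph_bdry rx).
  by exfalso; apply: (hn ((enorm (pder1 psi (x, K x), pder2 psi (x, K x)))^-1 *: ((pder1 psi (x, K x), pder2 psi (x, K x)) : R * R))); exists psi.
have [E d0] := defining_tangent rx hpsi.
set c := (enorm _)^-1.
have c0 : c != 0.
  rewrite invr_neq0 // /enorm sqrtr_eq0 -ltNge /= ltr_wpDl ?sqr_ge0 //.
  by rewrite exprn_even_gt0.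
rewrite -[(_ *: _).1]/(c * pder1 psi (x, K x)) -[(_ *: _).2]/(c * pder2 psi (x, K x)) E.
have -> : c * - (derive1 K x * pder2 psi (x, K x)) * g1 + c * pder2 psi (x, K x) * g2 =
  (c * pder2 psi (x, K x)) * (g2 - derive1 K x * g1) by ring.
move/eqP; rewrite mulf_eq0 (negbTE (mulf_neq0 c0 d0)) /= subr_eq0 => /eqP ->.
rewrite exprMn ler_piMl ?sqr_ge0 //.
by rewrite -real_normK ?num_real // exprn_ile1.
Qed.

Section Arc.
Variable a : R.
Hypothesis ra : r < a.
Let T := strip G a (a + 1).
Let Gax t : 0 <= t <= 1 -> 0 <= 2 * G (a + t) <= 2 * G a.
Proof.
move=> ht; have h1 : 0 < G (a + t) by apply: Gpos; move: ra; lra.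
have h2 : G (a + t) <= G a by apply: Gdecr; move: ra; lra.
lra.
Qed.

Let translate k : continuous k -> continuous (fun t => k (a + t)).
Proof.
move=> ck t; apply: (@continuous_comp _ _ _ (fun s => a + s) k); last exact: ck.
by apply: cvgD; [exact: cvg_cst|exact: cvg_id].
Qed.

Lemma sqnorm_on_graph phi : continuous phi -> L2 T (on_graph K phi) /\
  sqnorm T (on_graph K phi) = itv_integral 0 1 (fun t => 2 * G (a + t) * phi (graph_arc K a t) ^+ 2).
Proof.
move=> cphi; have cgr := continuous_graph cK cphi.
have [h1 h2] := sqnorm_graph cG Gpos (a + 1) (ltW ra) cgr.
split => //; apply: (etrans h2); apply/esym.
apply: (itv_integral_translate a (k := fun x => 2 * G x * phi (x, K x) ^+ 2)).
move=> x; apply: cvgM; last exact: (continuous_sqr cgr).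
by apply: cvgM; [exact: cvg_cst|exact: cG].
Qed.

Let carc phi : continuous phi -> continuous (fun t => phi (graph_arc K a t)).
Proof. by move=> cphi; exact: (translate (continuous_graph cK cphi)). Qed.

Let cw : continuous (fun t => 2 * G (a + t)).
Proof. by move=> t; apply: cvgM; [exact: cvg_cst|exact: (translate cG)]. Qed.

Lemma graph_sqnorm_null phi (eta : R) : continuous phi ->
  (arc_defect phi (fun=> 0%R) (graph_arc K a) <= eta%:E)%E ->
  sqnorm T (on_graph K phi) <= 2 * G a * eta.
Proof.
move=> cphi h; have [_ ->] := sqnorm_on_graph cphi.
have m0 : measurable_fun (`[0, 1]%classic : set mR) ((fun=> 0) \o graph_arc K a : R -> R) by exact: measurable_cst.
have := le_trans (arc_defect_ge cphi sK m0) h.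
have e : (fun t => ((phi (graph_arc K a t) - 0) ^+ 2)%:E) = (fun t => ((phi (graph_arc K a t)) ^+ 2)%:E).
  by apply/funext => t; rewrite subr0.
rewrite e -itv_integralE; last exact: (continuous_sqr (carc cphi)).
rewrite lee_fin => h'.
have Ga : 0 <= 2 * G a by rewrite mulr_ge0 // ltW // Gpos // ltW.
apply: le_trans (ler_wpM2l Ga h').
have csq := continuous_sqr (carc cphi).
have := itv_integral_comb 0 1 (2 * G a) 0 csq csq; under eq_fun do rewrite mul0r addr0.
rewrite mul0r addr0 => <-; apply: le_itv_integral.
- by move=> t; apply: cvgM; [exact: cw|exact: csq].
- by move=> t; apply: cvgM; [exact: cvg_cst|exact: csq].
by move=> t /Gax/andP[_ h2]; rewrite ler_wpM2r ?sqr_ge0.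
Qed.

(** The relation tau2^2 <= tau1^2 is known only for the traces, almost everywhere on the arc; each
    approximant is exchanged for its trace at the cost of its arc defect. *)
Lemma graph_sqnorm_related phi1 phi2 tau1 tau2 (eta : R) : continuous phi1 -> continuous phi2 ->
  measurable_fun (`[0, 1]%classic : set mR) (tau1 \o graph_arc K a) ->
  measurable_fun (`[0, 1]%classic : set mR) (tau2 \o graph_arc K a) ->
  {ae @lebesgue_measure R, forall t : R, 0 <= t <= 1 ->
    tau2 (graph_arc K a t) ^+ 2 <= tau1 (graph_arc K a t) ^+ 2} ->
  (arc_defect phi1 tau1 (graph_arc K a) <= eta%:E)%E ->
  (arc_defect phi2 tau2 (graph_arc K a) <= eta%:E)%E ->
  sqnorm T (on_graph K phi2) <= 4 * sqnorm T (on_graph K phi1) + 12 * G a * eta.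
Proof.
move=> c1 c2 m1 m2 hae h1 h2.
have [_ E1] := sqnorm_on_graph c1; have [_ E2] := sqnorm_on_graph c2.
have k1 := le_trans (arc_defect_ge c1 sK m1) h1; have k2 := le_trans (arc_defect_ge c2 sK m2) h2.
have cwf phi : continuous phi -> continuous (fun t => 2 * G (a + t) * phi (graph_arc K a t) ^+ 2).
  by move=> cphi t; apply: cvgM; [exact: cw|exact: (continuous_sqr (carc cphi))].
have Ga : 0 <= G a by rewrite ltW // Gpos // ltW.
pose I : set mR := `[0, 1]%classic.
have mI : measurable I by exact: measurable_itv.
pose d1 t := (phi1 (graph_arc K a t) - tau1 (graph_arc K a t)) ^+ 2.
pose d2 t := (phi2 (graph_arc K a t) - tau2 (graph_arc K a t)) ^+ 2.
have mcont f : continuous f -> measurable_fun I (f : mR -> R).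
  by move=> cf; apply: measurable_funTS; exact: measurable_realfun.continuous_measurable_fun.
have md1 : measurable_fun I (d1 : mR -> R).
  by apply: measurable_funX; apply: measurable_funB => //; exact: mcont (carc c1).
have md2 : measurable_fun I (d2 : mR -> R).
  by apply: measurable_funX; apply: measurable_funB => //; exact: mcont (carc c2).
have mw1 := mcont _ (cwf _ c1); have mw2 := mcont _ (cwf _ c2).
have md t : 4 * G a * d2 t + 8 * G a * d1 t >= 0.
  by apply: addr_ge0; exact: (mulr_ge0 (mulr_ge0 (ler0n R _) Ga) (sqr_ge0 _)).
have mD : measurable_fun I (fun t : mR => 4 * G a * d2 t + 8 * G a * d1 t).
  by apply: measurable_funD; apply: measurable_funM.
have w0 phi t : I t -> 0 <= 2 * G (a + t) * phi (graph_arc K a t) ^+ 2.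
  by rewrite /I /= in_itv /= => /Gax/andP[g0 _]; rewrite mulr_ge0 ?sqr_ge0.
have step : (\int[lebesgue_measure]_(t in I) (2 * G (a + t) * phi2 (graph_arc K a t) ^+ 2)%:E <=
    \int[lebesgue_measure]_(t in I) (4 * (2 * G (a + t) * phi1 (graph_arc K a t) ^+ 2) +
      1 * (4 * G a * d2 t + 8 * G a * d1 t))%:E)%E.
  apply: ae_ge0_le_integral => //.
  - by move=> t It; rewrite lee_fin w0.
  - exact/measurable_EFinP.
  - by move=> t It; rewrite lee_fin mul1r addr_ge0 // mulr_ge0 // w0.
  - apply/measurable_EFinP; apply: measurable_funD; apply: measurable_funM => //.
  apply: filterS hae => t ht; rewrite /I /= in_itv /= => It; rewrite lee_fin mul1r.
  have := ht It; have /andP[g0 g1] := Gax It; rewrite /d1 /d2.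
  move: (phi1 _) (phi2 _) (tau1 _) (tau2 _) => p1 p2 t1 t2 tt.
  (* The chain runs from p2 to t2, from t2 to t1 and from t1 to p1. Weighting by 2 G (a + t) <= 2 G
     a gives the coefficients 4 G a and 8 G a of the defects. *)
  have q1 : p2 ^+ 2 <= 2 * (p2 - t2) ^+ 2 + 4 * (p1 - t1) ^+ 2 + 4 * p1 ^+ 2.
    have := sqr_ge0 (p2 - 2 * t2); have := sqr_ge0 (2 * p1 - t1); lra.
  have q2 := ler_wpM2l g0 q1; apply: le_trans q2 _.
  have s1 := ler_wpM2r (sqr_ge0 (p2 - t2)) g1; have s2 := ler_wpM2r (sqr_ge0 (p1 - t1)) g1.
  move: s1 s2; move: ((p2 - t2) ^+ 2) ((p1 - t1) ^+ 2) (p1 ^+ 2) (G (a + t)) => x y z g; lra.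
have I1 := @ge0_integral_comb _ _ _ (@lebesgue_measure R) I 4 1
  (fun t : mR => 2 * G (a + t) * phi1 (graph_arc K a t) ^+ 2) (fun t : mR => 4 * G a * d2 t + 8 * G a * d1 t).
have I2 := @ge0_integral_comb _ _ _ (@lebesgue_measure R) I (4 * G a) (8 * G a) (d2 : mR -> R) (d1 : mR -> R).
move: step; rewrite I1 //; last by move=> t; exact: w0.
rewrite I2 //; last 4 first.
- by rewrite mulr_ge0 ?ler0n.
- by rewrite mulr_ge0 ?ler0n.
- by move=> t _; exact: sqr_ge0.
- by move=> t _; exact: sqr_ge0.
rewrite -[X in (X <= _)%E](itv_integralE 0 1 (cwf _ c2)).
rewrite -[X in (_ <= _ * X + _)%E](itv_integralE 0 1 (cwf _ c1)) -E1 -E2 mul1e => step.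
rewrite -lee_fin; apply: le_trans step _.
have -> : ((4 * sqnorm T (on_graph K phi1) + 12 * G a * eta)%:E =
    4%:E * (sqnorm T (on_graph K phi1))%:E + ((4 * G a)%:E * eta%:E + (8 * G a)%:E * eta%:E))%E.
  by rewrite -!EFinM -!EFinD; congr EFin; ring.
by apply: leeD => //; apply: leeD; apply: lee_wpmul2l => //; rewrite lee_fin mulr_ge0 ?ler0n.
Qed.

End Arc.
End TracesOnGraphs.

(** * Smooth approximation in the plate space *)

Section PlateTraces.
Variable R : realType.
Local Notation mR := (measurableTypeR R).
Local Notation plane := (mR * mR)%type.
Variables (Om : set (R * R)).
Hypothesis oOm : open Om.
Implicit Types (S : set (R * R)) (u v w g phi : R * R -> R).
Let mOm : measurable (Om : set plane) := open_measurable_plane oOm.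

Lemma ae_eq_sqnorm u v : L2 Om u -> L2 Om v -> eq_ae_on Om u v -> sqnorm Om u = sqnorm Om v.
Proof.
move=> u2 v2 uv; apply: EFin_inj; rewrite (sqnorm_energy mOm u2) (sqnorm_energy mOm v2).
exact: (ae_eq_energy mOm (L2_measurable mOm u2) (L2_measurable mOm v2) uv).
Qed.

Lemma has_trace_smooth_approx S v g (gam1 gam2 : R -> R * R) (eta : R) :
  has_trace Om S v g -> 0 < eta -> exists phi,
  [/\ smooth phi, [/\ L2 Om phi, L2 Om (pder1 phi) & L2 Om (pder2 phi)],
    sqnorm Om (phi - v) <= eta,
    sqnorm Om (pder1 phi - wder Om 1 0 v) <= eta /\ sqnorm Om (pder2 phi - wder Om 0 1 v) <= eta &
    (is_arc_in S gam1 -> (arc_defect phi g gam1 <= eta%:E)%E) /\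
    (is_arc_in S gam2 -> (arc_defect phi g gam2 <= eta%:E)%E)].
Proof.
move=> hv eta0; have [sv _ _] := hv.
have v2 := sobolev_L2 sv.
have [d1 _] := wderP sv (isT : (1 + 0 <= 1)%N); have [d2 _] := wderP sv (isT : (0 + 1 <= 1)%N).
have [phi [sphi h0 h1 h2 harc]] := has_trace_approx oOm gam1 gam2 hv eta0.
have [a0 _ b0] := energy_approx_L2 mOm v2 (smooth_measurable sphi) h0.
have [a1 _ b1] := energy_approx_L2 mOm d1 (smooth_measurable (smooth_pder1 sphi)) h1.
have [a2 _ b2] := energy_approx_L2 mOm d2 (smooth_measurable (smooth_pder2 sphi)) h2.
by exists phi; split; [exact: sphi|split; [exact: a0|exact: a1|exact: a2]|exact: b0|split; [exact: b1|exact: b2]|exact: harc].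
Qed.

(** The approximations in [has_trace] converge on all of [Om], so a trace on any set, even on an
    empty one, provides them. *)
Lemma has_trace_grad_approx S v g : has_trace Om S v g ->
  grad_approx Om v (wder Om 1 0 v) (wder Om 0 1 v).
Proof.
move=> hv eta eta0.
have [phi [s h h0 [h1 h2] _]] := has_trace_smooth_approx (fun=> 0) (fun=> 0) hv eta0.
by exists phi; split; [exact: s|exact: h|exact: h0|exact: h1|exact: h2].
Qed.

Section Form.
Variables (GD GM : set (R * R)) (nu : R).
Hypothesis nu_range : 0 <= nu < 1 / 2.
Let X := plate_space Om GD GM.
Let a := plate_form Om nu.

Let sum_sqnorm_le (f g h f' g' h' : R * R -> R) (b : R) :
  L2dot Om f f + L2dot Om g g + L2dot Om h h <= b -> sqnorm Om f = sqnorm Om f' ->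
  sqnorm Om g = sqnorm Om g' -> sqnorm Om h = sqnorm Om h' ->
  [/\ sqnorm Om f' <= b, sqnorm Om h' <= b & sqnorm Om g' <= b].
Proof.
rewrite -!sqnormE => hb ef eg eh; rewrite ef eg eh in hb.
have := sqnorm_ge0 Om f'; have := sqnorm_ge0 Om g'; have := sqnorm_ge0 Om h'.
move: (sqnorm Om f') (sqnorm Om g') (sqnorm Om h') hb => *; split; lra.
Qed.

(** Second derivatives are taken as derivatives of D_1 u and D_2 u, which lie in H^1 because
    [zero_normal_trace] gives them traces; almost everywhere they agree with the ones in the plate
    form. *)
Lemma plate_second_bounds u : X u ->
  [/\ L2 Om (wder Om 1 0 (wder Om 1 0 u)), L2 Om (wder Om 0 1 (wder Om 1 0 u)) &
      L2 Om (wder Om 0 1 (wder Om 0 1 u))] /\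
  [/\ sqnorm Om (wder Om 1 0 (wder Om 1 0 u)) <= 2 * a u u,
      sqnorm Om (wder Om 0 1 (wder Om 1 0 u)) <= 2 * a u u &
      sqnorm Om (wder Om 0 1 (wder Om 0 1 u)) <= 2 * a u u].
Proof.
move=> Xu; have [su [_ [g1 [g2 [t1 t2 _]]]] _] := Xu.
have [s1 _ _] := t1; have [s2 _ _] := t2.
have [p11 _] := wderP s1 (isT : (1 + 0 <= 1)%N); have [p12 _] := wderP s1 (isT : (0 + 1 <= 1)%N).
have [p22 _] := wderP s2 (isT : (0 + 1 <= 1)%N).
have [q20 _] := wderP su (isT : (2 + 0 <= 2)%N); have [q11 _] := wderP su (isT : (1 + 1 <= 2)%N).
have [q02 _] := wderP su (isT : (0 + 2 <= 2)%N).
split; first by split; [exact: p11|exact: p12|exact: p22].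
have e11 := ae_eq_sqnorm q20 p11 (wder_comp10 oOm su (isT : (1 <= 2)%N) (s1 : sobolev Om (1 + 0) _)).
have e12 := ae_eq_sqnorm q11 p12 (wder_comp11 oOm su (isT : (1 <= 2)%N) s1).
have e22 := ae_eq_sqnorm q02 p22 (wder_comp01 oOm su (isT : (1 <= 2)%N) (s2 : sobolev Om 1 _)).
exact: (sum_sqnorm_le (plate_form_coercive oOm nu_range Xu) e11 e22 e12).
Qed.

Let sqnorm_le_energy (f : R * R -> R) (y : R) : 0 <= y -> sqnorm Om f <= 2 * y + L2dot Om f f.
Proof. by move=> y0; rewrite sqnormE lerDr mulr_ge0. Qed.

Lemma plate_regular_bound u : X u -> regular_bound Om u (2 * a u u + L2dot Om u u).
Proof.
move=> Xu; have [su [_ [g1 [g2 [t1 t2 _]]]] _] := Xu; have [_ [zt _] _] := Xu.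
have [s1 _ _] := t1; have [s2 _ _] := t2; have [z _ _] := zt.
have [v1 _] := wderP z (isT : (1 + 0 <= 1)%N); have [v2 _] := wderP z (isT : (0 + 1 <= 1)%N).
have [[p11 p12 p22] [b11 b12 b22]] := plate_second_bounds Xu.
have u2 := sobolev_L2 su.
have a0 : 0 <= a u u by exact: (form_ge0 (plate_form_nonneg oOm GD GM nu_range) Xu).
have u0 := form_ge0 (L2dot_nonneg_form mOm) u2.
have u2B := sqnorm_le_energy u a0.
exists (wder Om 1 0 u), (wder Om 0 1 u), (wder Om 1 0 (wder Om 1 0 u)), (wder Om 0 1 (wder Om 1 0 u)),
  (wder Om 1 0 (wder Om 0 1 u)), (wder Om 0 1 (wder Om 0 1 u)); split.
- by split; [exact: u2|exact: v1|exact: v2].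
- by split; [exact: p11|exact: p22].
- split; [exact: has_trace_grad_approx zt|exact: has_trace_grad_approx t1|exact: has_trace_grad_approx t2].
- by split; [exact: u2B|exact: (ler_wpDr u0 b11)|exact: (ler_wpDr u0 b22)].
Qed.

End Form.

Section Graphs.
Variables (r : R) (G : R -> R).
Hypotheses (sG : smooth1 G) (Gpos : forall y, r <= y -> 0 < G y)
  (Gdecr : forall y1 y2, r <= y1 -> y1 <= y2 -> G y2 <= G y1).
Hypotheses (Om_horn : Om `&` [set p | r < p.1] = horn G r) (sb : smooth_boundary Om).
Variable a : R.
Hypothesis ra : r < a.
Let Ga0 : 0 < G a. Proof. by apply: Gpos; exact: ltW. Qed.

Lemma zero_trace_graph_null S K1 K2 u : smooth1 K1 -> smooth1 K2 ->
  (forall x, r < x -> `|K1 x| = G x) -> (forall x, r < x -> `|K2 x| = G x) ->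
  graph_set r K1 `<=` S -> graph_set r K2 `<=` S -> zero_trace Om S u ->
  graph_null G Om a (a + 1) K1 K2 u (wder Om 0 1 u).
Proof.
move=> sK1 sK2 KG1 KG2 KS1 KS2 zu eta eta0.
(* The error on an arc is multiplied by 2 G a, the largest width of the strip, when it becomes an
   error on the strip. *)
have e0 : 0 < eta / (1 + 2 * G a) by rewrite divr_gt0 // addr_gt0 // mulr_gt0.
have ele : eta / (1 + 2 * G a) <= eta.
  by rewrite ler_pdivrMr ?addr_gt0 ?mulr_gt0 // ler_peMr ?(ltW eta0) // lerDl mulr_ge0 // ltW.
have gle : 2 * G a * (eta / (1 + 2 * G a)) <= eta.
  rewrite mulrA ler_pdivrMr ?addr_gt0 ?mulr_gt0 // mulrC ler_pM2l // lerDr //.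
have [phi [s [p0 _ p2] h0 [_ h2] [k1 k2]]] := has_trace_smooth_approx (graph_arc K1 a) (graph_arc K2 a) zu e0.
have cphi := smooth_continuous s.
exists phi; split; [exact: s|split; [exact: p0|exact: p2]|exact: le_trans h0 ele|exact: le_trans h2 ele|].
split; apply: le_trans gle; apply: (graph_sqnorm_null sG Gpos Gdecr) => //.
- exact: (k1 (graph_arc_in sK1 ra KS1)).
- exact: (k2 (graph_arc_in sK2 ra KS2)).
Qed.

Lemma zero_normal_trace_graph_related S K u : smooth1 K -> (forall x, r < x -> `|K x| = G x) ->
  (forall x, a <= x -> `|derive1 K x| <= 1) -> graph_set r K `<=` S -> zero_normal_trace Om S u ->
  graph_related G Om a (a + 1) K (wder Om 1 0 u) (wder Om 0 1 (wder Om 1 0 u))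
    (wder Om 0 1 u) (wder Om 0 1 (wder Om 0 1 u)).
Proof.
move=> sK KG K1 KS [g1 [g2 [t1 t2 hn]]] eta eta0.
have arc := graph_arc_in sK ra KS.
(* The factor 12 G a is the one that multiplies the arc defects in [graph_sqnorm_related]. *)
have e0 : 0 < eta / (1 + 12 * G a) by rewrite divr_gt0 // addr_gt0 // mulr_gt0.
have ele : eta / (1 + 12 * G a) <= eta.
  by rewrite ler_pdivrMr ?addr_gt0 ?mulr_gt0 // ler_peMr ?(ltW eta0) // lerDl mulr_ge0 // ltW.
have gle : 12 * G a * (eta / (1 + 12 * G a)) <= eta.
  rewrite mulrA ler_pdivrMr ?addr_gt0 ?mulr_gt0 // mulrC ler_pM2l // lerDr //.
have [phi1 [s1 [p1 _ q1] h1 [_ k1] [d1 _]]] := has_trace_smooth_approx (graph_arc K a) (graph_arc K a) t1 e0.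
have [phi2 [s2 [p2 _ q2] h2 [_ k2] [d2 _]]] := has_trace_smooth_approx (graph_arc K a) (graph_arc K a) t2 e0.
have [_ m1 _] := t1; have [_ m2 _] := t2.
have hr := graph_sqnorm_related sG Gpos Gdecr sK ra (smooth_continuous s1) (smooth_continuous s2)
  (m1 _ arc) (m2 _ arc).
have hae : {ae @lebesgue_measure R, forall t : R, 0 <= t <= 1 ->
    g2 (graph_arc K a t) ^+ 2 <= g1 (graph_arc K a t) ^+ 2}.
  apply: filterS (hn _ arc) => t ht t01.
  have at0 : a <= a + t by case/andP: t01 => t0 _; rewrite lerDl.
  exact: (normal_trace_relation (g1 := g1 (graph_arc K a t)) (g2 := g2 (graph_arc K a t))
    Gpos Om_horn sK KG sb (lt_le_trans ra at0) (K1 _ at0) (ht t01)).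
exists phi1, phi2; split; [by split; [exact: s1|exact: s2]|by split; [exact: p1|exact: q1|exact: p2|exact: q2]| | |].
- by split; [exact: le_trans h1 ele|exact: le_trans k1 ele].
- by split; [exact: le_trans h2 ele|exact: le_trans k2 ele].
apply: le_trans (hr _ hae (d1 arc) (d2 arc)) _; rewrite lerD2l; exact: gle.
Qed.

End Graphs.
End PlateTraces.

(** * Smallness in the tail of the horn *)

Section Tail.
Variable R : realType.
Local Notation mR := (measurableTypeR R).
Local Notation plane := (mR * mR)%type.
Variables (Om : set (R * R)) (r : R) (G : R -> R).
Hypotheses (oOm : open Om) (sG : smooth1 G) (Gpos : forall y, r <= y -> 0 < G y)
  (Gdecr : forall y1 y2, r <= y1 -> y1 <= y2 -> G y2 <= G y1)
  (Om_horn : Om `&` [set p | r < p.1] = horn G r).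
Implicit Types (u v w : R * R -> R).
Let mOm : measurable (Om : set plane) := open_measurable_plane oOm.
Let cG : continuous G := smooth1_continuous sG.
Let mS b c : measurable (strip G b c : set plane) := measurable_strip cG b c.
Let SO b c (rb : r <= b) : strip G b c `<=` Om := strip_sub Om_horn rb.

Lemma sqnorm_strip_split b c d w : r <= b -> b <= c -> c <= d -> L2 Om w ->
  sqnorm (strip G b d) w = sqnorm (strip G b c) w + sqnorm (strip G c d) w.
Proof.
move=> rb bc cd w2.
have e : strip G b d = strip G b c `|` strip G c d.
  apply/seteqP; split => -[x t].
    move=> /stripP[h1 h2]; case: (leP x c) => xc; [left|right]; apply/stripP; split => //; lra.
  by move=> [] /stripP[h1 h2]; apply/stripP; split => //; lra.
rewrite e sqnormU //.
  by apply/seteqP; split => // -[x t] [/stripP[h1 _] /stripP[h2 _]]; lra.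
by rewrite -e; exact: L2_subset (SO rb) w2.
Qed.

Lemma sum_sqnorm_strip b n w : r <= b -> L2 Om w ->
  \sum_(k < n) sqnorm (strip G (b + k%:R) (b + k%:R + 1)) w = sqnorm (strip G b (b + n%:R)) w.
Proof.
move=> rb w2; elim: n => [|n ih].
  rewrite big_ord0 addr0 (_ : strip G b b = set0); last first.
    by apply/seteqP; split => // -[x t] /stripP[h _]; lra.
  by rewrite sqnormE /L2dot /Rintegral integral_set0.
have h1 : b <= b + n%:R by rewrite lerDl.
have h2 : b + n%:R <= b + n%:R + 1 by rewrite lerDl.
by rewrite big_ord_recr /= ih -(sqnorm_strip_split rb h1 h2 w2) -addrA natr1.
Qed.

(** Monotone convergence along the strips that exhaust the horn. *)
Lemma sqnorm_horn_limit b w (B : R) : r <= b -> L2 Om w ->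
  (forall n, sqnorm (strip G b (b + n%:R)) w <= B) -> sqnorm (horn G b) w <= B.
Proof.
move=> rb w2 h.
have E : horn G b = \bigcup_n strip G b (b + n%:R).
  apply/seteqP; split => [[x t] [/= bx xt]|[x t] [n _ /stripP[h1 h2]]]; last by split => //=; lra.
  have [n hn] : exists n : nat, x - b <= n%:R.
    by exists (Num.truncn (x - b)).+1; apply: ltW; exact: truncnS_gt.
  by exists n => //; apply/stripP; split => //; lra.
have HO : horn G b `<=` Om.
  by rewrite E => p [n _]; exact: SO.
have mH : measurable (horn G b : set plane) by apply: open_measurable_plane; exact: open_horn.
have w2H := L2_subset mH mOm HO w2.
rewrite -lee_fin (sqnorm_energy mH w2H) /energy E.
have nd : nondecreasing_seq (fun n : nat => strip G b (b + n%:R)).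
  apply/nondecreasing_seqP => n; rewrite subsetEset => -[x t] /stripP[h1 h2]; apply/stripP; split => //.
  by rewrite -natr1; lra.
have mw := L2_measurable mOm w2.
have cv := @ge0_nondecreasing_set_cvg_integral _ plane R (fun n => strip G b (b + n%:R))
  (fun p => (w p ^+ 2)%:E) (area R) nd (fun n => mS _ _).
have := cv _ _ => /(_ _ _)/cvg_lim <- //; last 2 first.
- by move=> n; apply: measurable_sqrE; exact: (measurable_funS mOm (SO rb) mw).
- by move=> n p _; rewrite lee_fin sqr_ge0.
apply: lime_le.
  apply: ereal_nondecreasing_is_cvgn; apply/nondecreasing_seqP => n; apply: energy_subset => //.
    exact: (measurable_funS mOm (SO rb) mw).
  by move: (nd n n.+1 (leqnSn n)); rewrite subsetEset.
apply: nearW => n; rewrite -[X in (X <= _)%E]/(energy _ w) -sqnorm_energy ?lee_fin //.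
exact: L2_subset (SO rb) w2.
Qed.

(** Each enlarged strip consists of two consecutive unit strips, so every point is counted at most
    twice; hence the factor 2. *)
Lemma sqnorm_horn_bound b u (ws : seq (R * R -> R)) (c : R) : r <= b - 1 -> 0 <= c -> L2 Om u ->
  L2_family Om ws ->
  (forall n : nat, sqnorm (strip G (b + n%:R) (b + n%:R + 1)) u <=
    c * \sum_(w <- ws) sqnorm (strip G (b + n%:R - 1) (b + n%:R + 1)) w) ->
  sqnorm (horn G b) u <= c * (2 * \sum_(w <- ws) sqnorm Om w).
Proof.
move=> rb c0 u2 ws2 h; have rb' : r <= b by lra.
apply: sqnorm_horn_limit => // n; rewrite -sum_sqnorm_strip //.
apply: (@le_trans _ _ (\sum_(k < n) c * \sum_(w <- ws) sqnorm (strip G (b + k%:R - 1) (b + k%:R + 1)) w)).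
  by apply: ler_sum => k _; exact: h.
rewrite -mulr_sumr; apply: ler_wpM2l => //.
rewrite exchange_big /= mulr_sumr !big_seq; apply: ler_sum => w /ws2 w2.
have e (k : 'I_n) : sqnorm (strip G (b + k%:R - 1) (b + k%:R + 1)) w =
    sqnorm (strip G (b - 1 + k%:R) (b - 1 + k%:R + 1)) w + sqnorm (strip G (b + k%:R) (b + k%:R + 1)) w.
  have k0 : 0 <= k%:R :> R by [].
  have -> : b - 1 + k%:R = b + k%:R - 1 by ring.
  rewrite subrK; apply: sqnorm_strip_split => //; move: k0; move: (k%:R) => y; lra.
rewrite (eq_bigr _ (fun k _ => e k)) big_split /= !sum_sqnorm_strip // mulr2n mulrDl mul1r.
by apply: lerD; apply: sqnorm_subset => //; exact: SO.
Qed.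

Let TE a : strip G a (a + 1) `<=` strip G (a - 1) (a + 1).
Proof. by move=> [x t] /stripP[h1 h2]; apply/stripP; split => //; lra. Qed.

Let left_room a : r + 1 <= a -> [/\ r < a, r <= a & r <= a - 1].
Proof. by move=> ra; split; lra. Qed.

Let le_sum4 (x y z t : R) : 0 <= x -> 0 <= y -> 0 <= z -> 0 <= t ->
  [/\ 0 <= x + y + z + t, x <= x + y + z + t, y <= x + y + z + t, z <= x + y + z + t &
    t <= x + y + z + t].
Proof. by move=> *; split; lra. Qed.

Let sum4 (E : set (R * R)) (f1 f2 f3 f4 : R * R -> R) : \sum_(w <- [:: f1; f2; f3; f4]) sqnorm E w =
  sqnorm E f1 + sqnorm E f2 + sqnorm E f3 + sqnorm E f4.
Proof. by rewrite !big_cons big_nil addr0 !addrA. Qed.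

Let le_sum4_last (E : set (R * R)) (f1 f2 f3 f4 : R * R -> R) (x : R) : x <= sqnorm E f4 ->
  x <= \sum_(w <- [:: f1; f2; f3; f4]) sqnorm E w.
Proof.
by move=> h; rewrite sum4; apply: le_trans h _; rewrite lerDr !addr_ge0 // sqnorm_ge0.
Qed.

Lemma line_approx_sub (E O : set (R * R)) u v : measurable (E : set plane) ->
  measurable (O : set plane) -> E `<=` O -> L2 O u -> L2 O v -> line_approx O u v -> line_approx E u v.
Proof.
move=> mE mO EO u2 v2 h eta /h[w [dw [c1 [w2 dw2] h1 h2]]]; exists w, dw; split => //.
- by split; exact: L2_subset EO _.
- by apply: le_trans h1; apply: sqnorm_subset => //; exact: L2B.
- by apply: le_trans h2; apply: sqnorm_subset => //; exact: L2B.
Qed.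

(** In the exchanged coordinates the strip has thickness 1 and the segments have length 1, so the
    constant is the same for all strips, however thin the horn is there. *)
Lemma strip_gradient u v s a (B : R) : r <= a - 1 -> L2 Om u -> L2 Om v -> L2 Om s ->
  line_approx (flip @^-1` Om) (u \o flip) (v \o flip) ->
  line_approx (flip @^-1` Om) (v \o flip) (s \o flip) ->
  sqnorm (strip G (a - 1) (a + 1)) u <= B -> sqnorm (strip G (a - 1) (a + 1)) s <= B ->
  sqnorm (strip G a (a + 1)) v <= grad_const 1 * B.
Proof.
move=> ra u2 v2 s2 uv vs uB sB.
have EO := (@SO _ (a + 1) ra); have mE := mS (a - 1) (a + 1).
have sub w : L2 Om w -> L2 (strip G (a - 1) (a + 1)) w by exact: L2_subset.
have mOf := measurable_flip mOm; have mEf := measurable_flip mE.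
have EOf : flip @^-1` strip G (a - 1) (a + 1) `<=` flip @^-1` Om by move=> p; exact: EO.
have subf w w' : L2 Om w -> L2 Om w' -> line_approx (flip @^-1` Om) (w \o flip) (w' \o flip) ->
    line_approx (flip @^-1` strip G (a - 1) (a + 1)) (w \o flip) (w' \o flip).
  by move=> w2 w2'; apply: line_approx_sub => //; exact: L2_flip.
rewrite -(sqnorm_flip (mS _ _) (L2_subset (mS _ _) mE (@TE a) (sub _ v2))).
rewrite -[X in X * B]mul1r.
apply: (gradient_bound_B (u := u \o flip) (s := s \o flip) (O := flip @^-1` strip G (a - 1) (a + 1))).
- exact: measurable_flip.
- exact: mEf.
- by move=> p; exact: (@TE a).
- exact: ler01.
- exact: ltr01.
- by move=> t; exists a => x /stripP[/= h _]; lra.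
- move=> t x /stripP[/= h1 h2]; exists (x - 1); rewrite subrK; split; first lra.
  move=> y hy; apply/stripP; split=> /=; first lra.
  have : G x <= G y by apply: Gdecr; lra.
  lra.
- exact: L2_flip (sub _ u2).
- exact: L2_flip (sub _ v2).
- exact: L2_flip (sub _ s2).
- exact: subf.
- exact: subf.
- by rewrite sqnorm_flip //; exact: sub.
- by rewrite sqnorm_flip //; exact: sub.
Qed.

Variables (GD GM : set (R * R)) (nu : R).
Hypotheses (nu_range : 0 <= nu < 1 / 2) (sb : smooth_boundary Om).
Let X := plate_space Om GD GM.
Let s11 u := wder Om 1 0 (wder Om 1 0 u).
Let s12 u := wder Om 0 1 (wder Om 1 0 u).
Let s22 u := wder Om 0 1 (wder Om 0 1 u).
Let ws u := [:: u; s11 u; s12 u; s22 u].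

(** The 32 comes from [strip_null_bound]. For D_2 u the clamped case gives 64 [grad_const 1] + 288
    and the hinged case 64; the sum 352 = 288 + 64 covers both. *)
Definition tail_const : R := locked (32 * (64 * grad_const 1 + 352)).

Lemma tail_const_ge0 : 0 <= tail_const.
Proof. by rewrite /tail_const -lock; have := grad_const_ge0 (@ltr01 R); lra. Qed.

Lemma plate_L2_family u : X u -> L2_family Om (ws u).
Proof.
move=> Xu; have [[p11 p12 p22] _] := plate_second_bounds oOm nu_range Xu.
have [[u2 _] _ _] := Xu.
by move=> w; rewrite !inE => /or4P[] /eqP ->; [exact: u2|exact: p11|exact: p12|exact: p22].
Qed.

Let arith_hinged (g c T v s q : R) : 0 <= g -> g <= 1 -> 0 <= c -> 0 <= s -> T <= 32 * g * v ->
  v <= 64 * g * s -> s <= q -> T <= 32 * (64 * c + 352) * g * q.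
Proof.
move=> g0 g1 c0 s0 hT hv sq; have q0 : 0 <= q by exact: le_trans sq.
have gs : g * s <= q by apply: le_trans sq; rewrite ler_piMl.
have h1 := ler_wpM2l g0 hv.
have h2 := ler_wpM2l g0 (ler_wpM2l g0 gs).
have gq : 0 <= g * q by rewrite mulr_ge0.
have h3 : g * (g * s) <= g * q by rewrite ler_wpM2l.
have h4 : 0 <= c * (g * q) by rewrite mulr_ge0.
have e1 : 32 * g * v = 32 * (g * v) by ring.
have e2 : g * (64 * g * s) = 64 * (g * (g * s)) by ring.
have e3 : 32 * (64 * c + 352) * g * q = 2048 * (c * (g * q)) + 11264 * (g * q) by ring.
rewrite e1 in hT; rewrite e2 in h1; rewrite e3.
move: (g * v) (g * (g * s)) (c * (g * q)) (g * q) hT h1 h3 h4 gq => *; lra.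
Qed.

(** [strip_null_bound] followed by [strip_pair_bound] gains G a^4; as G a <= 1, only G a^2 is kept,
    to match the clamped case. *)
Lemma strip_hinged S u a : X u -> r + 1 <= a -> G a <= 1 ->
  graph_set r G `<=` S -> graph_set r (fun x => - G x) `<=` S -> zero_trace Om S u ->
  sqnorm (strip G a (a + 1)) u <= tail_const * G a ^+ 2 *
    \sum_(w <- ws u) sqnorm (strip G (a - 1) (a + 1)) w.
Proof.
move=> Xu ra Ga1 KS1 KS2 zu.
have [[p11 p12 p22] _] := plate_second_bounds oOm nu_range Xu.
have [su [_ [g1 [g2 [t1 t2 _]]]] _] := Xu; have [z _ _] := zu.
have u2 := sobolev_L2 su; have [v2 _] := wderP z (isT : (0 + 1 <= 1)%N).
have [raa raw ra1] := left_room ra.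
have Gx x : r < x -> 0 < G x by move=> rx; apply: Gpos; exact: ltW.
have KG1 x : r < x -> `|G x| = G x by move=> /Gx h; rewrite gtr0_norm.
have KG2 x : r < x -> `|- G x| = G x by move=> /Gx h; rewrite normrN gtr0_norm.
have KB x : r < x -> - G x <= G x <= G x.
  by move=> /Gx h; rewrite lexx andbT (le_trans _ (ltW h)) // oppr_le0 ltW.
have nul := zero_trace_graph_null oOm sG Gpos Gdecr raa sG (smooth1N sG) KG1 KG2 KS1 KS2 zu.
have TO := (@SO _ (a + 1) raw).
have aa : a < a + 1 by rewrite ltrDl.
have b1 := strip_null_bound cG Gpos Gdecr mOm raw TO cG KB u2 v2 nul.
have b2 := strip_pair_bound cG Gpos Gdecr mOm raw TO u2 v2 p22 aa nul
  (grad_line_approx (has_trace_grad_approx oOm t2)).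
have g0 := sqr_ge0 (G a).
have g1' : G a ^+ 2 <= 1 by rewrite exprn_ile1 // ltW // Gx.
rewrite /tail_const -lock.
apply: (arith_hinged g0 g1' (grad_const_ge0 (@ltr01 R)) (sqnorm_ge0 _ _) b1 b2).
apply: le_sum4_last.
exact: (sqnorm_subset (mS _ _) (mS _ _) (@TE a) (L2_subset (mS _ _) mOm (@SO _ (a + 1) ra1) p22)).
Qed.

Let arith_clamped (g c T v1 v2 t12 t22 q : R) : 0 <= g -> g <= 1 -> 0 <= q -> T <= 32 * g * v2 ->
  v2 <= 64 * v1 + (256 * g * t12 + 32 * g * t22) -> v1 <= c * q -> 0 <= t12 -> t12 <= q ->
  0 <= t22 -> t22 <= q -> T <= 32 * (64 * c + 352) * g * q.
Proof.
move=> g0 g1 q0 hT hv hv1 t120 t12q t220 t22q.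
have h1 : g * t12 <= q by apply: le_trans t12q; rewrite ler_piMl.
have h2 : g * t22 <= q by apply: le_trans t22q; rewrite ler_piMl.
have hv' : v2 <= 64 * (c * q) + 288 * q.
  move: h1 h2 hv hv1; rewrite -!(mulrA _ g).
  move: (g * t12) (g * t22) (c * q) => x y z; lra.
have := ler_wpM2l g0 hv'.
have e3 : 32 * (64 * c + 352) * g * q = 32 * (g * (64 * (c * q) + 288 * q)) + 2048 * (g * q) by ring.
have gq : 0 <= g * q by rewrite mulr_ge0.
rewrite e3; move: hT; rewrite -mulrA; move: (g * v2) (g * _) (g * q) gq => *; lra.
Qed.

(** Only one factor G a^2 is gained: D_2 u is bounded but not small, because on the clamped side it
    is controlled by D_1 u. The enlarged strip on the right gives the room on the left that
    [strip_gradient] uses. *)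
Lemma strip_clamped S K u a : X u -> r + 1 <= a -> G a <= 1 -> smooth1 K ->
  (forall x, r < x -> `|K x| = G x) -> (forall x, a <= x -> `|derive1 K x| <= 1) ->
  graph_set r K `<=` S -> zero_trace Om S u -> zero_normal_trace Om S u ->
  sqnorm (strip G a (a + 1)) u <= tail_const * G a ^+ 2 *
    \sum_(w <- ws u) sqnorm (strip G (a - 1) (a + 1)) w.
Proof.
move=> Xu ra Ga1 sK KG K1 KS zu zn.
have [[p11 p12 p22] _] := plate_second_bounds oOm nu_range Xu.
have [su [_ [g1 [g2 [t1 t2 _]]]] _] := Xu; have [z _ _] := zu.
have u2 := sobolev_L2 su; have [v1 _] := wderP z (isT : (1 + 0 <= 1)%N).
have [v2 _] := wderP z (isT : (0 + 1 <= 1)%N).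
have [raa raw ra1] := left_room ra.
have Gx x : r < x -> 0 < G x by move=> rx; apply: Gpos; exact: ltW.
have KB x : r < x -> - G x <= K x <= G x by move=> rx; rewrite -ler_norml KG.
have nul := zero_trace_graph_null oOm sG Gpos Gdecr raa sK sK KG KG KS KS zu.
have rel := zero_normal_trace_graph_related oOm sG Gpos Gdecr Om_horn sb raa sK KG K1 KS zn.
have TO := (@SO _ (a + 1) raw); have EO := (@SO _ (a + 1) ra1).
have cK := smooth1_continuous sK.
have b1 := strip_null_bound cG Gpos Gdecr mOm raw TO cK KB u2 v2 nul.
have b2 := strip_related_bound cG Gpos Gdecr mOm raw TO cK KB v1 p12 v2 p22 rel.
have le w : L2 Om w -> sqnorm (strip G a (a + 1)) w <= sqnorm (strip G (a - 1) (a + 1)) w.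
  by move=> w2; exact: (sqnorm_subset (mS _ _) (mS _ _) (@TE a) (L2_subset (mS _ _) mOm EO w2)).
pose N w := sqnorm (strip G (a - 1) (a + 1)) w.
have N0 w : 0 <= N w by exact: sqnorm_ge0.
have sumE : \sum_(w <- ws u) sqnorm (strip G (a - 1) (a + 1)) w = N u + N (s11 u) + N (s12 u) + N (s22 u).
  exact: sum4.
have [q0 qu q11 q12 q22] := le_sum4 (N0 u) (N0 (s11 u)) (N0 (s12 u)) (N0 (s22 u)).
rewrite sumE.
have ga := has_trace_grad_approx oOm zu; have ga1 := has_trace_grad_approx oOm t1.
have b3 := strip_gradient ra1 u2 v1 p11 (grad_line_approx_flip mOm u2 v1 ga)
  (grad_line_approx_flip mOm v1 p11 ga1) qu q11.
have g0 := sqr_ge0 (G a).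
have g1' : G a ^+ 2 <= 1 by rewrite exprn_ile1 // ltW // Gx.
rewrite /tail_const -lock.
exact: (arith_clamped g0 g1' q0 b1 b2 b3 (sqnorm_ge0 _ _) (le_trans (le _ p12) q12) (sqnorm_ge0 _ _) (le_trans (le _ p22) q22)).
Qed.

Let arith_tail (c eps A B x y z t : R) : y <= 2 * A -> z <= 2 * A -> t <= 2 * A ->
  x <= 2 * A + B -> 0 <= A -> 0 <= B -> 0 <= c -> 8 * c <= eps ->
  c * (2 * (x + y + z + t)) <= eps * (2 * A + B).
Proof.
move=> hy hz ht hx A0 B0 c0 hc.
have N0 : 0 <= 2 * A + B by lra.
have sN : 2 * (x + y + z + t) <= 8 * (2 * A + B) by lra.
apply: le_trans (ler_wpM2l c0 sN) _.
by rewrite mulrCA mulrA; apply: ler_wpM2r.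
Qed.

(** In the second case [K] is the clamped side, whichever it is; only its distance from the axis and
    the size of its slope matter. *)
Definition clamped_or_hinged_ends := (exists S, [/\ graph_set r G `<=` S,
    graph_set r (fun x => - G x) `<=` S & forall u, X u -> zero_trace Om S u]) \/
  (exists S K, [/\ smooth1 K, (forall x, r < x -> `|K x| = G x),
    (forall x, r < x -> `|derive1 K x| = `|derive1 G x|), graph_set r K `<=` S &
    forall u, X u -> zero_trace Om S u /\ zero_normal_trace Om S u]).

Lemma tail_small (eps : R) : clamped_or_hinged_ends -> 0 < eps ->
  (forall e : R, 0 < e -> exists b, forall y, b <= y -> `|G y| <= e) ->
  (forall e : R, 0 < e -> exists b, forall y, b <= y -> `|derive1 G y| <= e) ->
  exists2 b, r <= b & forall u, X u ->
    sqnorm (horn G b) u <= eps * (2 * plate_form Om nu u u + L2dot Om u u).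
Proof.
move=> bc eps0 Glim Glim'.
have C0 := tail_const_ge0.
(* G <= d <= 1 gives G^2 <= d. The factor 8 is the price of four norms, each at most 2 a(u, u) +
   |u|^2, that are counted twice. *)
pose d := Num.min 1 (eps / (8 * tail_const + 1)).
have C1 : 0 < 8 * tail_const + 1 by lra.
have d0 : 0 < d by rewrite lt_min ltr01 divr_gt0.
have [b1 hb1] := Glim _ d0; have [b2 hb2] := Glim' _ ltr01.
(* The margin 1 beyond r makes room for the enlarged strips on the left. *)
pose b := Num.max (r + 1) (Num.max b1 b2).
have br : r + 1 <= b by rewrite le_max lexx.
have bb1 : b1 <= b by rewrite !le_max lexx orbT.
have bb2 : b2 <= b by rewrite !le_max lexx !orbT.
exists b; first lra.
move=> u Xu; have [[u2 _] _ _] := Xu.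
have Gd y : b <= y -> 0 < G y /\ G y <= d.
  move=> by_; have G0 : 0 < G y by apply: Gpos; lra.
  by split => //; have := hb1 y (le_trans bb1 by_); rewrite gtr0_norm.
have d1 : d <= 1 by rewrite ge_min lexx.
have key (n : nat) : sqnorm (strip G (b + n%:R) (b + n%:R + 1)) u <=
    tail_const * d * \sum_(w <- ws u) sqnorm (strip G (b + n%:R - 1) (b + n%:R + 1)) w.
  have bn : b <= b + n%:R by rewrite lerDl.
  have [G0 Gle] := Gd _ bn.
  have rn : r + 1 <= b + n%:R by exact: le_trans br bn.
  have s0 : 0 <= \sum_(w <- ws u) sqnorm (strip G (b + n%:R - 1) (b + n%:R + 1)) w.
    by apply: sumr_ge0 => w _; exact: sqnorm_ge0.
  have G2 : G (b + n%:R) ^+ 2 <= d.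
    by apply: (le_trans _ Gle); rewrite expr2 ler_piMr ?(ltW G0) // (le_trans Gle).
  apply: (@le_trans _ _ (tail_const * G (b + n%:R) ^+ 2 *
      \sum_(w <- ws u) sqnorm (strip G (b + n%:R - 1) (b + n%:R + 1)) w)); last first.
    by apply: ler_wpM2r => //; apply: ler_wpM2l.
  case: bc => [[S [KS1 KS2 hS]]|[S [K [sK KG K1 KS hS]]]].
    exact: (strip_hinged Xu rn (le_trans Gle d1) KS1 KS2 (hS _ Xu)).
  have [zu zn] := hS _ Xu.
  apply: (strip_clamped Xu rn (le_trans Gle d1) sK KG _ KS zu zn).
  move=> x hx; rewrite K1; last by apply: lt_le_trans hx; apply: lt_le_trans rn; rewrite ltrDl.
  by apply: hb2; exact: le_trans bb2 (le_trans bn hx).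
have rb : r <= b - 1 by lra.
have cd0 : 0 <= tail_const * d by rewrite mulr_ge0 // ltW.
have cde : 8 * (tail_const * d) <= eps.
  have h : d <= eps / (8 * tail_const + 1) by rewrite ge_min lexx orbT.
  have h8 : 0 <= 8 * tail_const by rewrite mulr_ge0.
  rewrite mulrA; apply: le_trans (ler_wpM2l h8 h) _.
  by rewrite mulrA ler_pdivrMr // mulrC ler_pM2l // lerDl.
apply: le_trans (sqnorm_horn_bound rb cd0 u2 (plate_L2_family Xu) key) _.
have [_ [h11 h12 h22]] := plate_second_bounds oOm nu_range Xu.
have [_ [_ [_ [_ [_ [_ [_ _ _ [hu _ _]]]]]]]] := plate_regular_bound oOm nu_range Xu.
have a0 := form_ge0 (plate_form_nonneg oOm GD GM nu_range) Xu.
have u0 := form_ge0 (L2dot_nonneg_form mOm) u2.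
have e : \sum_(w <- ws u) sqnorm Om w =
    sqnorm Om u + sqnorm Om (s11 u) + sqnorm Om (s12 u) + sqnorm Om (s22 u) by exact: sum4.
rewrite e; exact: (arith_tail h11 h12 h22 hu a0 u0 cd0 cde).
Qed.

End Tail.

(** * Discreteness *)

Section DiscreteSets.
Variable R : realType.
Implicit Types (S : set R) (t : R) (s : seq R).

Lemma seq_separated t s : (forall y, y \in s -> y != t) ->
  exists2 e : R, 0 < e & forall y, y \in s -> e <= `|t - y|.
Proof.
elim: s => [_|x s ih h]; first by exists 1.
have [|e e0 he] := ih; first by move=> y ys; apply: h; rewrite inE ys orbT.
have xt : x != t by apply: h; rewrite inE eqxx.
exists (Num.min e `|t - x|).
  by rewrite lt_min e0 normr_gt0 subr_eq0 eq_sym.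
move=> y; rewrite inE => /orP[/eqP ->|/he h']; first by rewrite ge_min lexx orbT.
by rewrite ge_min h'.
Qed.

(** Near a limit point t, arbitrarily many distinct points of [S] below t + 1 are found one after
    the other, each closer to t than those before. *)
Lemma limit_point_set0 S : (forall L : R, exists n : nat, forall l : 'I_n -> R,
    injective l -> (forall i, l i <= L) -> (forall i, S (l i)) -> False) ->
  limit_point S = set0.
Proof.
move=> hS; apply/seteqP; split => // t ht.
have key (m : nat) : exists s, [/\ size s = m, uniq s &
    forall y, y \in s -> [/\ y != t, S y & y <= t + 1]].
  elim: m => [|m [s [sz us hs]]]; first by exists [::].
  have [e e0 he] : exists2 e : R, 0 < e & forall y, y \in s -> e <= `|t - y|.
    by apply: seq_separated => y /hs[].
  have e1 : 0 < Num.min e 1 by rewrite lt_min e0 ltr01.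
  have [y [yt Sy]] := ht (ball t (Num.min e 1)) (nbhsx_ballx _ _ e1).
  rewrite /ball /= lt_min => /andP[ye y1]; exists (y :: s); split => /=; first by rewrite sz.
    by rewrite us andbT; apply/negP => /he; rewrite leNgt ye.
  move=> z; rewrite inE => /orP[/eqP ->|/hs //]; split => //.
  by move: y1; rewrite ltr_norml; lra.
have [n hn] := hS (t + 1); have [s [sz us hs]] := key n.
apply: (hn (fun i : 'I_n => nth 0 s i)).
- by move=> i j /eqP; rewrite nth_uniq ?sz // => /eqP ij; apply: val_inj.
- by move=> i; have [] := hs _ (mem_nth 0 (eq_ind_r (fun k => (i < k)%N) (ltn_ord i) sz)).
- by move=> i; have [] := hs _ (mem_nth 0 (eq_ind_r (fun k => (i < k)%N) (ltn_ord i) sz)).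
Qed.

End DiscreteSets.

(** * From the control inequality to the spectrum *)

Section Spectrum.
Variable R : realType.
Local Notation mR := (measurableTypeR R).
Local Notation plane := (mR * mR)%type.
Variables (Om GD GM : set (R * R)) (nu : R).
Hypotheses (oOm : open Om) (nu_range : 0 <= nu < 1 / 2).
Let mOm : measurable (Om : set plane) := open_measurable_plane oOm.
Let X := plate_space Om GD GM.
Let a := plate_form Om nu.
Let dot := @L2dot R Om.
Let hd := L2dot_nonneg_form mOm.
Let ha := plate_form_nonneg oOm GD GM nu_range.
Let XP : X `<=` L2 Om. Proof. by move=> u; exact: plate_space_L2. Qed.

Lemma EFin_cvg0 (x : nat -> R) : ((x k)%:E @[k --> \oo] --> 0%E) <-> (x k @[k --> \oo] --> 0).
Proof.
split => [/fine_cvg //|h]; apply/fine_cvgP; split => //; exact: nearW.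
Qed.

Lemma L2norm_dot_cvg0 (us : nat -> R * R -> R) : (forall k, L2 Om (us k)) ->
  (L2norm Om (us k) @[k --> \oo] --> 0%E) <-> (L2dot Om (us k) (us k) @[k --> \oo] --> 0).
Proof.
move=> us2; rewrite L2norm_energy_cvg0 -EFin_cvg0.
by rewrite (_ : (fun k => energy Om (us k)) = (fun k => (L2dot Om (us k) (us k))%:E)) //;
  apply/funext => k; rewrite L2dot_energy.
Qed.

Lemma form_cvgE us u : form_cvg Om GD GM nu us u <-> aform_cvg (L2 Om) X dot a us u.
Proof.
have subE (f g : R * R -> R) : f \- g = f - g by [].
have nrm : (forall k, X (us k)) -> L2 Om u ->
    (L2norm Om (us k \- u) @[k --> \oo] --> 0%E) <->
    (L2dot Om (us k - u) (us k - u) @[k --> \oo] --> 0).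
  move=> Xus u2; have h := @L2norm_dot_cvg0 (fun k => us k - u).
  by apply: h => k; apply: L2B => //; exact: XP.
split=> [[Xus cus u2 hus]|[Xus cus u2 hus]]; split => //.
- exact/(nrm Xus u2).
- exact/(nrm Xus u2).
Qed.

Lemma plate_opE u f : plate_op Om GD GM nu u f <-> aform_op (L2 Om) X dot a u f.
Proof.
split=> [[f2 [us [/form_cvgE h1 h2]]]|[f2 [us [/form_cvgE h1 h2]]]]; split => //; exists us; split => //.
Qed.

Hypothesis compactly_controlled : forall eps : R, 0 < eps -> exists (n : nat) (e : 'I_n -> R * R -> R),
  (forall i, L2 Om (e i)) /\ controls X dot a eps e.

Let complete := @L2_complete R Om mOm.

(** The Fredholm alternative: without eigenvectors for [l], the resolvent exists and is bounded. *)
Lemma plate_spectrum_eigenvector l : plate_spectrum Om GD GM nu l ->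
  exists2 u, aform_op (L2 Om) X dot a u (l *: u) & dot u u != 0.
Proof.
move=> sl; apply: contrapT => ne; apply: sl.
have h0 u : aform_op (L2 Om) X dot a u (l *: u) -> dot u u = 0.
  by move=> hu; apply/eqP; apply: contrapT => /negP u0; apply: ne; exists u.
have [h1 [c h2]] := aform_fredholm hd complete XP ha compactly_controlled h0.
split; first by move=> f /h1[u hu]; exists u; apply/plate_opE.
exists c => u f f2 /plate_opE hu.
have u2 : L2 Om u by have [_ [us [[_ _ u2 _] _]]] := hu.
rewrite (L2norm_dot mOm u2) (L2norm_dot mOm f2) -EFinM lee_fin.
exact: h2.
Qed.

Lemma plate_spectrum_discrete_of_control : plate_spectrum_discrete Om GD GM nu.
Proof.
have lim0 : limit_point (plate_spectrum Om GD GM nu) = set0.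
  apply: limit_point_set0 => L.
  have [n hn] := aform_eigen_below hd XP ha compactly_controlled L.
  exists n => l linj lL sl; apply: (hn l linj lL) => i.
  exact: plate_spectrum_eigenvector.
split => // l sl; split.
- have : closure (plate_spectrum Om GD GM nu) l by exact: subset_closure.
  by rewrite closure_isolated_limit_point lim0 setU0.
- have [u hu u0] := plate_spectrum_eigenvector sl; exists u; split; first exact/plate_opE.
  move=> uae; move/eqP: u0; apply.
  have u2 : L2 Om u by have [_ [us [[_ _ u2 _] _]]] := hu.
  have z2 := form_dom0 hd.
  by rewrite /dot (ae_eq_L2dot mOm u2 z2 u2 uae) (form0l hd).
- have [k [e he]] := aform_finite_multiplicity hd XP ha compactly_controlled l.
  exists k, e => u /plate_opE /he[c [d2 d0]]; exists c.
  have := L2dot_eq0 mOm d2 d0; apply: filterS => p hp Op.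
  have := hp Op; rewrite -[(u - _) p]/(u p - (\sum_i c i *: e i) p) => /eqP.
  by rewrite subr_eq0 => /eqP ->; rewrite fct_sumE.
Qed.

End Spectrum.

(** * The control inequality for the plate *)

Section Control.
Variable R : realType.
Local Notation mR := (measurableTypeR R).
Local Notation plane := (mR * mR)%type.
Variables (Om GD GM : set (R * R)) (nu r : R) (G : R -> R).
Hypotheses (oOm : open Om) (nu_range : 0 <= nu < 1 / 2) (sb : smooth_boundary Om).
Hypotheses (sG : smooth1 G) (Gpos : forall y, r <= y -> 0 < G y)
  (Gdecr : forall y1 y2, r <= y1 -> y1 <= y2 -> G y2 <= G y1)
  (Om_horn : Om `&` [set p | r < p.1] = horn G r)
  (Om_bounded : bounded_set (Om `\` [set p | r < p.1])).
Let mOm : measurable (Om : set plane) := open_measurable_plane oOm.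

Lemma bounded_body (b : R) : r <= b -> bounded_set ([set p : R * R | p.1 <= b] `&` Om).
Proof.
move=> rb; have [M [_ hM]] := Om_bounded.
pose N := `|M| + 1 + `|b| + `|r| + G r.
have Gr : 0 < G r by apply: Gpos.
exists N; split; first exact: num_real.
move=> x Nx p [/= pb Op].
have [n1 n2 n3] : [/\ 0 <= `|M|, 0 <= `|b| & 0 <= `|r|] by split.
have [pr|pr] := leP p.1 r.
  have Mm : M < `|M| + 1 by have := ler_norm M; lra.
  have Sp : (Om `\` [set p | r < p.1]) p by split => //=; apply/negP; rewrite -leNgt.
  have : `|p| <= `|M| + 1 by exact: (hM _ Mm p Sp).
  by move=> /le_trans; apply; apply: ltW; apply: le_lt_trans Nx; rewrite /N; lra.
have Ep : `|p : R * R| = Num.max `|p.1| `|p.2| :> R by [].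
have : horn G r p by rewrite -Om_horn.
move=> [_ h2]; rewrite Ep ge_max; have Gp : G p.1 <= G r by apply: Gdecr => //; exact: ltW.
apply/andP; split; apply: ltW; apply: le_lt_trans Nx; rewrite /N.
  have : `|p.1| <= `|b| + `|r|.
    by rewrite ler_norml; have := ler_norm b; have := ler_norm (- r); rewrite normrN; lra.
  lra.
have : `|p.2| <= G r by rewrite ler_norml; lra.
lra.
Qed.

Hypothesis ends : clamped_or_hinged_ends Om r G GD GM.
Hypothesis Glim : forall e : R, 0 < e -> exists b, forall y, b <= y -> `|G y| <= e.
Hypothesis Glim' : forall e : R, 0 < e -> exists b, forall y, b <= y -> `|derive1 G y| <= e.

Let arith_control (eps x y z s A B : R) : 0 <= eps -> x <= y + z ->
  y <= s + eps / 4 * (2 * A + B) -> z <= eps / 4 * (2 * A + B) -> 0 <= B ->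
  x <= s + eps * (A + B).
Proof.
move=> eps0 hx hy hz B0; have eB : 0 <= eps * B by rewrite mulr_ge0.
have e : eps / 4 * (2 * A + B) = 1 / 2 * (eps * A) + 1 / 4 * (eps * B) by field.
rewrite e in hy hz; rewrite mulrDr; lra.
Qed.

(** [Om] is cut at y = b. Body and tail each cost eps / 4 times 2 a(u, u) + |u|^2, which together is
    at most eps times a(u, u) + |u|^2; only the bounded body contributes functionals. *)
Lemma plate_compactly_controlled (eps : R) : 0 < eps -> exists (n : nat) (e : 'I_n -> R * R -> R),
  (forall i, L2 Om (e i)) /\ controls (plate_space Om GD GM) (@L2dot R Om) (plate_form Om nu) eps e.
Proof.
move=> eps0; have e4 : 0 < eps / 4 by rewrite divr_gt0.
have [b rb tail] := tail_small oOm sG Gpos Gdecr Om_horn nu_range sb ends e4 Glim Glim'.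
pose S := [set p : R * R | p.1 <= b].
have cS : closed S.
  rewrite (_ : S = fst @^-1` [set y | y <= b]) //.
  by apply: closed_comp => [p _|]; [exact: cvg_fst|exact: closed_le].
have [es [es2 hes]] := compactly_bounded_bounded oOm sb cS (bounded_body rb) e4.
exists (size es), (fun i => nth 0 es i); split.
  by move=> i; apply: es2; exact: mem_nth.
move=> u Xu; have [[u2 _] _ _] := Xu.
have mS : measurable (S `&` Om : set plane).
  by apply: measurableI => //; exact: closed_measurable_plane.
have mH : measurable (horn G b : set plane).
  by apply: open_measurable_plane; exact: (open_horn (smooth1_continuous sG)).
have HO : horn G b `<=` Om.
  by move=> [x t] [/= bx ht]; apply/(Om_hornE Om_horn) => //; exact: le_lt_trans bx.
have OSH : Om = (S `&` Om) `|` horn G b.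
  apply/seteqP; split => [p Op|p [[] //|/HO //]].
  case: (leP p.1 b) => pb; [by left; split|right; split => //].
  case: p pb Op => x t /= pb Op; apply/(Om_hornE Om_horn) => //; exact: le_lt_trans pb.
have hu := plate_regular_bound oOm nu_range Xu.
have h1 := hes u _ hu; have h2 := tail u Xu.
have h3 : sqnorm Om u <= sqnorm (S `&` Om) u + sqnorm (horn G b) u.
  by rewrite {1}OSH; apply: sqnormU_le => //; rewrite -OSH.
have a0 := form_ge0 (plate_form_nonneg oOm GD GM nu_range) Xu.
have u0 := form_ge0 (L2dot_nonneg_form mOm) u2.
rewrite -[X in X <= _]sqnormE.
have -> : \sum_(i < size es) L2dot Om u (nth 0 es i) ^+ 2 = \sum_(e <- es) L2dot Om u e ^+ 2.
  by rewrite (big_nth 0) big_mkord.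
exact: (arith_control (ltW eps0) h3 h1 h2 u0).
Qed.

End Control.

Section RealLimits.
Variable R : realType.

Lemma cvg_pinfty_small (f : R -> R) : f y @[y --> +oo] --> 0 ->
  forall e : R, 0 < e -> exists b, forall y, b <= y -> `|f y| <= e.
Proof.
move=> /cvgrPdist_le h e e0; have := h e e0; move=> [M [_ hM]].
exists (M + 1) => y My; have := hM y; rewrite sub0r normrN; apply.
by apply: lt_le_trans My; rewrite ltrDl.
Qed.

End RealLimits.

Theorem theorem1 (R : realType) (r : R) (H : R -> R)
  (Om GD GN GM : set (R * R)) (nu : R)
  (Hsmooth : smooth_on_ray r H)
  (Hpos : forall y, r <= y -> 0 < H y)
  (Hdecr : forall y1 y2, r <= y1 -> y1 <= y2 -> H y2 <= H y1)
  (Hlim : H y @[y --> +oo] --> 0)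
  (Hlim' : derive1 H y @[y --> +oo] --> 0)
  (Hbnd'' : exists M : R, forall y, r < y -> `|derive1n 2 H y| <= M)
  (Om_open : open Om)
  (Om_connected : connected Om)
  (Om_smooth : smooth_boundary Om)
  (Om_horn : Om `&` [set p | r < p.1] = horn H r)
  (Om_bounded : bounded_set (Om `\` [set p | r < p.1]))
  (GD_curves : finite_union_of_open_curves Om GD)
  (GN_curves : finite_union_of_open_curves Om GN)
  (GM_curves : finite_union_of_open_curves Om GM)
  (GDN : GD `&` GN = set0) (GDM : GD `&` GM = set0) (GNM : GN `&` GM = set0)
  (Gcover : bdry Om = closure GD `|` closure GN `|` closure GM)
  (nu_range : 0 <= nu < 1 / 2)
  (bc : (forall u, plate_space Om GD GM u ->
           zero_trace Om (horn_side_up H r `|` horn_side_down H r) u)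
        \/
        ((forall u, plate_space Om GD GM u ->
            zero_trace Om (horn_side_up H r) u
            /\ zero_normal_trace Om (horn_side_up H r) u)
         \/
         (forall u, plate_space Om GD GM u ->
            zero_trace Om (horn_side_down H r) u
            /\ zero_normal_trace Om (horn_side_down H r) u))) :
  plate_spectrum_discrete Om GD GM nu.
Proof.
(* All estimates use [G], smooth on the whole line. It agrees with [H] on the closed ray, so
   derivatives are compared only for y > r, where the agreement holds in a neighbourhood. *)
have [G sG HG] := Hsmooth.
have Gpos y : r <= y -> 0 < G y by move=> ry; rewrite -HG //; exact: Hpos.
have Gdecr y1 y2 : r <= y1 -> y1 <= y2 -> G y2 <= G y1.
  by move=> ry1 y12; rewrite -!HG ?(le_trans ry1) //; exact: Hdecr.
have Om_hornG : Om `&` [set p | r < p.1] = horn G r.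
  by rewrite Om_horn; apply/seteqP; split => -[x t]; rewrite /horn /= => -[rx]; rewrite HG ?(ltW rx).
have dHG y : r < y -> derive1 H y = derive1 G y.
  move=> ry; rewrite !derive1E; apply: near_eq_derive; near=> z; apply: HG; apply: ltW.
  by near: z; apply: open_nbhs_nbhs; split; [exact: open_gt|exact: ry].
have up : graph_set r G `<=` horn_side_up H r.
  by move=> [x t] [/= rx ->]; split => //=; rewrite HG // ltW.
have down : graph_set r (fun x => - G x) `<=` horn_side_down H r.
  by move=> [x t] [/= rx ->]; split => //=; rewrite HG // ltW.
have ends : clamped_or_hinged_ends Om r G GD GM.
  case: bc => [h|[h|h]].
  - left; exists (horn_side_up H r `|` horn_side_down H r); split; last exact: h.
      by move=> p /up; left.
    by move=> p /down; right.
  - right; exists (horn_side_up H r), G; split; [exact: sG| |by []|exact: up|exact: h].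
    by move=> x rx; rewrite gtr0_norm // Gpos // ltW.
  right; exists (horn_side_down H r), (fun x => - G x); split; [exact: smooth1N| | |exact: down|exact: h].
    by move=> x rx; rewrite normrN gtr0_norm // Gpos // ltW.
  move=> x _; rewrite !derive1E deriveN; first by rewrite normrN.
  exact: (sG 0%N x).
apply: (plate_spectrum_discrete_of_control Om_open nu_range).
apply: (plate_compactly_controlled (r := r) (G := G)) => //.
- move=> e e0; have [b hb] := cvg_pinfty_small Hlim e0.
  exists (Num.max b r) => y; rewrite ge_max => /andP[by_ ry]; rewrite -HG //; exact: hb.
- move=> e e0; have [b hb] := cvg_pinfty_small Hlim' e0.
  exists (Num.max b (r + 1)) => y; rewrite ge_max => /andP[by_ ry]; rewrite -dHG; first exact: hb.
  by apply: lt_le_trans ry; rewrite ltrDl.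
Unshelve. all: by end_near.
Qed.
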